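(* The untwisted figure eight elastic rod is stable if $\beta/\alpha>2$ and unstable if $\beta/\alpha<2$.
   Context: A rod consists of a centerline $\gamma$ in $\mathbb{R}^3$ of length $L$ (arclength parameter $s$, curvature $\kappa$, torsion $\tau$, Frenet frame $T,N,B$) and a material frame $(M_1,M_2,T)$, an oriented orthonormal frame along $\gamma$ with $T$ tangent to $\gamma$; the material strains $u_1,u_2,u_3$ are defined by $T'=-u_2M_1+u_1M_2$, $M_1'=u_2T-u_3M_2$, $M_2'=-u_1T+u_3M_1$, and $u_3$ is the twist rate. The elastic energy of the (uniform, isotropic, linearly elastic) rod is $\mathcal{E}=\int_0^L\big(\alpha(u_1^2+u_2^2)+\beta u_3^2\big)\,ds=\int_0^L(\alpha\kappa^2+\beta u_3^2)\,ds$, where $\alpha$ and $\beta$ are nonnegative constants (with $\alpha\neq0$, so that $\beta/\alpha$ makes sense) depending on the physical characteristics of the rod. Elastic rods are equilibria of $\mathcal{E}$; along them $u_3$ equals a constant $m$. Boundary conditions: the centerline is closed, with fixed length $L$, and the total change $\Delta\psi$ is prescribed, where $\psi$ is the angle with $M_1=N\cos\psi+B\sin\psi$, the frame $T,N,B$ being a generalized Frenet frame (satisfying the usual Frenet equations and extending smoothly across inflection points); one has $\int u_3\,ds=\Delta\psi+\int\tau\,ds$. If the centerline has inflection points, $\Delta\psi$ is prescribed only modulo $\pi$. An elastic rod is stable if it is a local minimum of $\mathcal{E}$ under these boundary conditions, and unstable if it is not. The figure eight centerline is the closed planar curve with signed curvature $\kappa=\kappa_0\operatorname{cn}\big(\tfrac{\kappa_0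 s}{2p},p\big)$, $\kappa_0>0$, of length $L=8pK(p)/\kappa_0$, where $\operatorname{cn}$ is the Jacobi elliptic function and the modulus $p\approx0.9089$ is the one for which the complete elliptic integrals of the first and second kind satisfy $2E(p)=K(p)$. The untwisted figure eight elastic rod is the rod with this centerline and twist rate $m=0$. *)

(* Defs.v *)
From Stdlib Require Import Reals Lra ZArith ClassicalEpsilon.
From Coquelicot Require Import Coquelicot.

Open Scope R_scope.

(** The linear structure and the (Euclidean) norm on [vec] are those that
    Coquelicot puts on products of normed modules. *)

Definition vec : Type := (R * R * R)%type.

Definition mkvec (x y z : R) : vec := (x, y, z).
Definition px (v : vec) : R := fst (fst v).
Definition py (v : vec) : R := snd (fst v).
Definition pz (v : vec) : R := snd v.

Definition dot (v w : vec) : R := px v * px w + py v * py w + pz v * pz w.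

Definition cross (v w : vec) : vec :=
  mkvec (py v * pz w - pz v * py w)
        (pz v * px w - px v * pz w)
        (px v * py w - py v * px w).

Definition smooth (f : R -> R) : Prop := forall (n : nat) (x : R), ex_derive_n f n x.

Definition vsmooth (c : R -> vec) : Prop :=
  smooth (fun s => px (c s)) /\
  smooth (fun s => py (c s)) /\
  smooth (fun s => pz (c s)).

Definition vDerive (c : R -> vec) (s : R) : vec :=
  mkvec (Derive (fun t => px (c t)) s)
        (Derive (fun t => py (c t)) s)
        (Derive (fun t => pz (c t)) s).

Record rod : Type := Rod {
  center : R -> vec;
  mat1 : R -> vec;
  mat2 : R -> vec
}.

Definition tangent (r : rod) : R -> vec := vDerive (center r).

(** A smooth closed centerline of length [L] is an [L]-periodic smooth
    unit-speed curve.  The material frame need not be periodic: the rod is the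
    restriction to [0, L], and being defined on all of R only encodes
    smoothness up to the end points. *)
Definition closed_rod (L : R) (r : rod) : Prop :=
  vsmooth (center r) /\ vsmooth (mat1 r) /\ vsmooth (mat2 r) /\
  (forall s, center r (s + L) = center r s) /\
  (forall s, dot (tangent r s) (tangent r s) = 1) /\
  (forall s, dot (mat1 r s) (mat1 r s) = 1) /\
  (forall s, dot (mat2 r s) (mat2 r s) = 1) /\
  (forall s, dot (mat1 r s) (mat2 r s) = 0) /\
  (forall s, cross (mat1 r s) (mat2 r s) = tangent r s).

(** The material strains are the coefficients in
    T' = - u2 M1 + u1 M2,  M1' = u2 T - u3 M2,  M2' = - u1 T + u3 M1;
    see [strain_equations] below.  With (M1, M2, T) right-handed and the Frenet
    equations of [generalized_frenet], these signs give u3 = - (psi' + tau); the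
    energy does not see the sign of u3. *)
Definition u1 (r : rod) (s : R) : R := dot (vDerive (tangent r) s) (mat2 r s).
Definition u2 (r : rod) (s : R) : R := - dot (vDerive (tangent r) s) (mat1 r s).
Definition u3 (r : rod) (s : R) : R := dot (vDerive (mat2 r) s) (mat1 r s).

Definition energy (alpha beta L : R) (r : rod) : R :=
  RInt (fun s => alpha * (u1 r s ^ 2 + u2 r s ^ 2) + beta * u3 r s ^ 2) 0 L.

(** [kappa] is a signed curvature: it may vanish and change sign. *)
Definition generalized_frenet (r : rod) (N B : R -> vec) (kappa tau : R -> R) : Prop :=
  vsmooth N /\ vsmooth B /\ smooth kappa /\ smooth tau /\
  (forall s, dot (N s) (N s) = 1) /\
  (forall s, dot (tangent r s) (N s) = 0) /\
  (forall s, B s = cross (tangent r s) (N s)) /\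
  (forall s, vDerive (tangent r) s = scal (kappa s) (N s)) /\
  (forall s, vDerive N s =
             plus (scal (- kappa s) (tangent r s)) (scal (tau s) (B s))) /\
  (forall s, vDerive B s = scal (- tau s) (N s)).

Definition has_delta_psi (L : R) (r : rod) (d : R) : Prop :=
  exists (N B : R -> vec) (kappa tau psi : R -> R),
    generalized_frenet r N B kappa tau /\
    smooth psi /\
    (forall s, mat1 r s = plus (scal (cos (psi s)) (N s)) (scal (sin (psi s)) (B s))) /\
    d = psi L - psi 0.

Definition has_inflection (r : rod) : Prop :=
  exists s : R, vDerive (tangent r) s = zero.

(** [r'] satisfies the boundary conditions of [r].  A centerline with inflection
    points has, arbitrarily close to it, centerlines whose Frenet frames gain or
    lose half-turns, so it is the centerline of the given rod [r] that decides
    whether the prescription is modulo PI. *)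
Definition same_boundary_conditions (L : R) (r r' : rod) : Prop :=
  closed_rod L r' /\
  exists d d' : R,
    has_delta_psi L r d /\ has_delta_psi L r' d' /\
    (has_inflection r -> exists k : Z, d' - d = IZR k * PI) /\
    (~ has_inflection r -> d' = d).

(** Closeness in C^2 for the centerline and C^1 for the material frame, the
    highest orders of differentiation on which the energy depends. *)
Definition close_rods (L eps : R) (r r' : rod) : Prop :=
  forall s : R, 0 <= s <= L ->
    norm (minus (center r' s) (center r s)) < eps /\
    norm (minus (tangent r' s) (tangent r s)) < eps /\
    norm (minus (vDerive (tangent r') s) (vDerive (tangent r) s)) < eps /\
    norm (minus (mat1 r' s) (mat1 r s)) < eps /\
    norm (minus (vDerive (mat1 r') s) (vDerive (mat1 r) s)) < eps /\
    norm (minus (mat2 r' s) (mat2 r s)) < eps /\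
    norm (minus (vDerive (mat2 r') s) (vDerive (mat2 r) s)) < eps.

Definition stable (alpha beta L : R) (r : rod) : Prop :=
  exists eps : R, 0 < eps /\
    forall r' : rod,
      same_boundary_conditions L r r' ->
      close_rods L eps r r' ->
      energy alpha beta L r <= energy alpha beta L r'.

Definition unstable (alpha beta L : R) (r : rod) : Prop := ~ stable alpha beta L r.

Definition ellF (phi p : R) : R :=
  RInt (fun t => / sqrt (1 - p ^ 2 * sin t ^ 2)) 0 phi.

Definition ellK (p : R) : R := ellF (PI / 2) p.

Definition ellE (p : R) : R :=
  RInt (fun t => sqrt (1 - p ^ 2 * sin t ^ 2)) 0 (PI / 2).

(** Here [p] is the modulus, not the parameter p^2.  For 0 <= p < 1, [fun phi => ellF phi p] is an increasing bijection of R, and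
    the Jacobi amplitude is its inverse. *)
Definition jacobi_am (u p : R) : R :=
  epsilon (inhabits 0) (fun phi : R => ellF phi p = u).

Definition jacobi_cn (u p : R) : R := cos (jacobi_am u p).

(** The curve lies in a plane with unit normal [e], oriented by [e]. *)
Definition planar_with_signed_curvature (r : rod) (kappa : R -> R) : Prop :=
  exists e : vec,
    dot e e = 1 /\
    (forall s, dot (tangent r s) e = 0) /\
    (forall s, vDerive (tangent r) s = scal (kappa s) (cross e (tangent r s))).

Definition figure_eight_length (kappa0 p : R) : R := 8 * p * ellK p / kappa0.

Definition untwisted_figure_eight (kappa0 p : R) (r : rod) : Prop :=
  closed_rod (figure_eight_length kappa0 p) r /\
  planar_with_signed_curvature r
    (fun s => kappa0 * jacobi_cn (kappa0 * s / (2 * p)) p) /\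
  (forall s, 0 <= s <= figure_eight_length kappa0 p -> u3 r s = 0).

Lemma smooth_ex_derive (f : R -> R) (s : R) : smooth f -> ex_derive f s.
Proof. intros H; exact (H 1%nat s). Qed.

Lemma smooth_Derive (f : R -> R) : smooth f -> smooth (Derive f).
Proof.
intros H [|n] x; [exact I|].
assert (Hs := H (S (S n)) x); simpl in *.
apply ex_derive_ext with (2 := Hs).
intros t; clear; revert t; induction n as [|n IH]; intros t; [reflexivity|].
simpl; apply Derive_ext; intros y; apply IH.
Qed.

Lemma vsmooth_vDerive (c : R -> vec) : vsmooth c -> vsmooth (vDerive c).
Proof. intros [Hx [Hy Hz]]; repeat split; apply smooth_Derive; assumption. Qed.

Lemma dot_vDerive (c d : R -> vec) (k s : R) :
  vsmooth c -> vsmooth d -> (forall t, dot (c t) (d t) = k) ->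
  dot (vDerive c s) (d s) + dot (c s) (vDerive d s) = 0.
Proof.
intros [Cx [Cy Cz]] [Dx [Dy Dz]] H.
assert (P : forall f g : R -> R, smooth f -> smooth g ->
  is_derive (fun t => f t * g t) s (Derive f s * g s + f s * Derive g s)).
{ intros f g Hf Hg; auto_derive; [repeat split; auto using smooth_ex_derive|].
  change (fun x => f x) with f; change (fun x => g x) with g; ring. }
assert (D : is_derive (fun t => dot (c t) (d t)) s
  (dot (vDerive c s) (d s) + dot (c s) (vDerive d s))).
{ unfold dot.
  evar_last.
  - apply @is_derive_plus; [apply @is_derive_plus|].
    + exact (P _ _ Cx Dx).
    + exact (P _ _ Cy Dy).
    + exact (P _ _ Cz Dz).
  - unfold vDerive, mkvec, plus, px, py, pz; simpl; ring. }
apply is_derive_unique in D; rewrite <- D.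
rewrite (Derive_ext _ (fun _ => k)) by exact H; apply Derive_const.
Qed.

Lemma dot_sym (v w : vec) : dot v w = dot w v.
Proof. unfold dot; ring. Qed.

Lemma dot_cross_l (a b : vec) : dot (cross a b) a = 0.
Proof. unfold dot, cross, mkvec, px, py, pz; simpl; ring. Qed.

Lemma dot_cross_r (a b : vec) : dot (cross a b) b = 0.
Proof. unfold dot, cross, mkvec, px, py, pz; simpl; ring. Qed.

Lemma vec_eq (v w : vec) :
  px v - px w = 0 -> py v - py w = 0 -> pz v - pz w = 0 -> v = w.
Proof.
destruct v as [[v1 v2] v3], w as [[w1 w2] w3].
unfold px, py, pz; simpl; intros H1 H2 H3.
apply Rminus_diag_uniq in H1, H2, H3; subst; reflexivity.
Qed.

Lemma frame_expand (a b v : vec) :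
  dot a a = 1 -> dot b b = 1 -> dot a b = 0 ->
  v = plus (plus (scal (dot v a) a) (scal (dot v b) b))
           (scal (dot v (cross a b)) (cross a b)).
Proof.
intros Ha Hb Hab.
set (w := cross a b).
set (rhs := plus _ _).
assert (Hw : dot w w = 1).
{ transitivity (dot a a * dot b b - dot a b ^ 2).
  - unfold w, dot, cross, mkvec, px, py, pz; simpl; ring.
  - rewrite Ha, Hb, Hab; ring. }
assert (Hwa : dot w a = 0) by apply dot_cross_l.
assert (Hwb : dot w b = 0) by apply dot_cross_r.
pose (d := mkvec (px v - px rhs) (py v - py rhs) (pz v - pz rhs)).
assert (E : forall z, dot d z =
  dot v z - (dot v a * dot a z + dot v b * dot b z + dot v w * dot w z)).
{ intros z; unfold d, rhs, dot, mkvec, px, py, pz, plus, scal; simpl.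
  unfold plus, scal, mult; simpl; unfold plus, scal, mult; simpl.
  unfold plus, mult; simpl; ring. }
assert (da : dot d a = 0) by (rewrite E, Ha, (dot_sym b a), Hab, Hwa; ring).
assert (db : dot d b = 0) by (rewrite E, Hb, Hab, Hwb; ring).
assert (dw : dot d w = 0)
  by (rewrite E, (dot_sym a w), (dot_sym b w), Hwa, Hwb, Hw; ring).
assert (X : forall f : vec -> R,
  f d * dot w w = dot d a * f (cross b w) + dot d b * f (cross w a) + dot d w * f w ->
  f d = 0).
{ intros f H; rewrite da, db, dw, Hw in H; lra. }
assert (Zx : px d = 0)
  by (apply X; unfold w, dot, cross, mkvec, px, py, pz; simpl; ring).
assert (Zy : py d = 0)
  by (apply X; unfold w, dot, cross, mkvec, px, py, pz; simpl; ring).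
assert (Zz : pz d = 0)
  by (apply X; unfold w, dot, cross, mkvec, px, py, pz; simpl; ring).
apply vec_eq; assumption.
Qed.

Lemma vec_comb (x y z x' y' : R) (a b c : vec) :
  x = x' -> y = y' -> z = 0 ->
  plus (plus (scal x a) (scal y b)) (scal z c) = plus (scal x' a) (scal y' b).
Proof.
intros -> -> ->; rewrite (scal_zero_l c : scal 0 c = zero); apply plus_zero_r.
Qed.

Lemma strain_equations (L : R) (r : rod) (s : R) :
  closed_rod L r ->
  vDerive (tangent r) s =
    plus (scal (- u2 r s) (mat1 r s)) (scal (u1 r s) (mat2 r s)) /\
  vDerive (mat1 r) s =
    plus (scal (u2 r s) (tangent r s)) (scal (- u3 r s) (mat2 r s)) /\
  vDerive (mat2 r) s =
    plus (scal (- u1 r s) (tangent r s)) (scal (u3 r s) (mat1 r s)).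
Proof.
intros [Sc [S1 [S2 [_ [HT [H1 [H2 [H12 HX]]]]]]]].
assert (ST : vsmooth (tangent r)) by (apply vsmooth_vDerive; assumption).
assert (T1 : forall t, dot (tangent r t) (mat1 r t) = 0)
  by (intros t; rewrite <- HX; apply dot_cross_l).
assert (T2 : forall t, dot (tangent r t) (mat2 r t) = 0)
  by (intros t; rewrite <- HX; apply dot_cross_r).
assert (DTT := dot_vDerive _ _ _ s ST ST HT).
assert (D11 := dot_vDerive _ _ _ s S1 S1 H1).
assert (D22 := dot_vDerive _ _ _ s S2 S2 H2).
assert (D12 := dot_vDerive _ _ _ s S1 S2 H12).
assert (DT1 := dot_vDerive _ _ _ s ST S1 T1).
assert (DT2 := dot_vDerive _ _ _ s ST S2 T2).
assert (C : forall x y z : R, forall a b c : vec,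
  plus (plus (scal x a) (scal y b)) (scal z c) =
  plus (plus (scal z c) (scal x a)) (scal y b)).
{ intros; rewrite plus_comm, plus_assoc; reflexivity. }
assert (C' : forall x y z : R, forall a b c : vec,
  plus (plus (scal x a) (scal y b)) (scal z c) =
  plus (plus (scal z c) (scal y b)) (scal x a)).
{ intros; rewrite C, <- plus_assoc, (plus_comm (scal x a)), plus_assoc; reflexivity. }
assert (F : forall v, v = plus (plus (scal (dot v (mat1 r s)) (mat1 r s))
    (scal (dot v (mat2 r s)) (mat2 r s))) (scal (dot v (tangent r s)) (tangent r s))).
{ intros v; rewrite <- HX; apply frame_expand; trivial. }
rewrite (dot_sym (tangent r s)) in DTT, DT1, DT2.
rewrite (dot_sym (mat1 r s)) in D11, D12.
rewrite (dot_sym (mat2 r s)) in D22.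
unfold u1, u2, u3; split; [|split].
- etransitivity; [apply F|]; apply vec_comb; lra.
- etransitivity; [apply F|]; rewrite C'.
  apply vec_comb; lra.
- etransitivity; [apply F|]; rewrite C.
  apply vec_comb; lra.
Qed.

(* Main.v *)
Require Import Defs.
From Stdlib Require Import Reals Lra Lia ZArith ClassicalEpsilon FunctionalExtensionality.
From Coquelicot Require Import Coquelicot.

(* Along the figure eight the angle [th] of the tangent solves th'' = - Lam sin th;
   with ka = th', the tangent T0 satisfies T0'' = Lam e_x - P T0, where
   P = ka^2 + Lam cos th.  Hence for every closed unit field T = T0 + V the change
   of the bending energy is exactly the integral of |V'|^2 - P |V|^2.

   Let z be the component of T normal to the plane.  The angle that M1, M2 make with
   this normal direction turns at the rate u3 + z (T x T').e / (1 - z^2), so closedness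
   of the frame determines the mean of u3; to leading order it is - <ka, z> / l, where l
   is the length.  By Cauchy-Schwarz the twist contributes at least (B / l) <ka, z>^2
   with B = beta / alpha.

   With X' = cos th, the field yA = X sin th + ka cos th / Lam satisfies
   yA'' + P yA = 2 ka and <ka, yA> = l, so its second variation is - 2 l + B l.
   This is the threshold B = 2: removing multiples of yA and of the rotation field cos th
   (for which (cos th)'' + P cos th = Lam is constant) turns the form into that of a field
   vanishing at the points 0, 2 q, 4 q (q = l / 4), plus 2 / l times a square and
   (B - 2) / l times a square.  The in-plane component is
   treated in the same way with X ka - 2 sin th.  The rotations and the shift of
   arclength, along which the energy is flat, are removed by pinning the tangent at
   0, q, 2 q.

   For B < 2 the tangent is moved to latitude e yA, and the longitude th is stretched
   by a factor which closes the curve and is found by the intermediate value theorem. *)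

Open Scope R_scope.

(** * Integrals of continuous functions *)

(** Nonnegativity of the second variation would not be enough: the energies are compared on a C^2
    neighbourhood, and the remainders of the expansion are a small constant times the squared H^1
    norm of the perturbation. So coercivity in H^1 is proved. It fails along the symmetries, which
    generate the normal fields cos th, sin th and the in-plane fields 1, ka; the four pinning
    conditions z(0) = z(q) = 0 and b(0) = b(2 q) = 0 exclude exactly these. Coercivity rests on
    explicit Jacobi fields, sin th for the normal part and ka for the in-plane part. On each quarter
    period such a field vanishes at one end, has zero derivative at the other and keeps its sign in
    between. This makes the form a perfect square there, which bounds a field pointwise up to a
    multiple of the Jacobi field; the H^1 bound follows. Closure of the curve gives the normal part
    mean zero exactly, but the in-plane moments vanish only to second order, whence a penalty term
    in the in-plane estimate. The prescription modulo PI fixes the final position of the material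
    frame only up to sign; closeness decides the sign. *)

Definition cts (f : R -> R) : Prop := forall x : R, continuous f x.

Lemma cts_const (k : R) : cts (fun _ => k).
Proof. intros x; apply continuous_const. Qed.

Lemma cts_id : cts (fun x => x).
Proof. intros x; apply continuous_id. Qed.

Lemma cts_plus (f g : R -> R) : cts f -> cts g -> cts (fun x => f x + g x).
Proof. intros Hf Hg x; apply (continuous_plus f g); auto. Qed.

Lemma cts_minus (f g : R -> R) : cts f -> cts g -> cts (fun x => f x - g x).
Proof. intros Hf Hg x; apply (continuous_minus f g); auto. Qed.

Lemma cts_opp (f : R -> R) : cts f -> cts (fun x => - f x).
Proof. intros Hf x; apply (continuous_opp f); auto. Qed.

Lemma cts_mult (f g : R -> R) : cts f -> cts g -> cts (fun x => f x * g x).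
Proof. intros Hf Hg x; apply (continuous_mult f g); auto. Qed.

Lemma cts_comp (f g : R -> R) : cts f -> cts g -> cts (fun x => g (f x)).
Proof. intros Hf Hg x; apply (continuous_comp f g); auto. Qed.

Lemma cts_pow (f : R -> R) (n : nat) : cts f -> cts (fun x => f x ^ n).
Proof.
intros Hf; induction n as [|n IH]; simpl; [apply cts_const|].
apply cts_mult; assumption.
Qed.

Lemma cts_sin (f : R -> R) : cts f -> cts (fun x => sin (f x)).
Proof. intros Hf; apply (cts_comp f sin Hf); intros x; apply continuous_sin. Qed.

Lemma cts_cos (f : R -> R) : cts f -> cts (fun x => cos (f x)).
Proof. intros Hf; apply (cts_comp f cos Hf); intros x; apply continuous_cos. Qed.

Lemma cts_abs (f : R -> R) : cts f -> cts (fun x => Rabs (f x)).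
Proof. intros Hf; apply (cts_comp f Rabs Hf); intros x; apply continuous_Rabs. Qed.

Lemma is_derive_cts (f f' : R -> R) : (forall x, is_derive f x (f' x)) -> cts f.
Proof. intros H x; apply (@ex_derive_continuous R_AbsRing R_NormedModule); eexists; apply H. Qed.

Lemma cts_inv (g : R -> R) : cts g -> (forall x, g x <> 0) -> cts (fun x => / g x).
Proof.
intros Hg H x; apply (continuous_comp g Rinv); [apply Hg|].
apply (@ex_derive_continuous R_AbsRing R_NormedModule).
auto_derive; auto.
Qed.

Lemma cts_div (f g : R -> R) :
  cts f -> cts g -> (forall x, g x <> 0) -> cts (fun x => f x / g x).
Proof. intros; apply cts_mult, cts_inv; assumption. Qed.

Create HintDb ct.
#[export] Hint Resolve cts_const cts_id cts_plus cts_minus cts_opp cts_mult cts_pow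
  cts_sin cts_cos cts_abs : ct.

(* Rewriting leaves [RInt] at the type [R_CompleteNormedModule], which [ring] rejects. *)
Ltac as_real := match goal with |- @eq _ ?a ?b => change (@eq R a b) end.
Ltac rring := as_real; ring.

Ltac ct := auto 20 with ct.

Lemma cts_ex_RInt (f : R -> R) (a b : R) : cts f -> ex_RInt f a b.
Proof. intros H; apply (@ex_RInt_continuous R_CompleteNormedModule); auto. Qed.

Lemma int_plus (f g : R -> R) (a b : R) : cts f -> cts g ->
  RInt (fun s => f s + g s) a b = RInt f a b + RInt g a b.
Proof. intros; apply (@RInt_plus R_CompleteNormedModule); apply cts_ex_RInt; assumption. Qed.

Lemma int_minus (f g : R -> R) (a b : R) : cts f -> cts g ->
  RInt (fun s => f s - g s) a b = RInt f a b - RInt g a b.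
Proof. intros; apply (@RInt_minus R_CompleteNormedModule); apply cts_ex_RInt; assumption. Qed.

Lemma int_opp (f : R -> R) (a b : R) : cts f ->
  RInt (fun s => - f s) a b = - RInt f a b.
Proof. intros; apply (@RInt_opp R_CompleteNormedModule); apply cts_ex_RInt; assumption. Qed.

Lemma int_scal (k : R) (f : R -> R) (a b : R) : cts f ->
  RInt (fun s => k * f s) a b = k * RInt f a b.
Proof. intros; apply (@RInt_scal R_CompleteNormedModule); apply cts_ex_RInt; assumption. Qed.

Lemma int_const (k a b : R) : RInt (fun _ => k) a b = k * (b - a).
Proof. rewrite RInt_const; apply Rmult_comm. Qed.

Lemma int_ext (f g : R -> R) (a b : R) : (forall s, f s = g s) -> RInt f a b = RInt g a b.
Proof. intros H; apply RInt_ext; auto. Qed.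

Lemma int_chasles (f : R -> R) (a b c : R) : cts f ->
  RInt f a b + RInt f b c = RInt f a c.
Proof. intros; apply (@RInt_Chasles R_CompleteNormedModule); apply cts_ex_RInt; assumption. Qed.

Lemma int_le (f g : R -> R) (a b : R) : a <= b -> cts f -> cts g ->
  (forall s, a <= s <= b -> f s <= g s) -> RInt f a b <= RInt g a b.
Proof. intros; apply RInt_le; auto using cts_ex_RInt; intros; apply H2; lra. Qed.

Lemma int_ge0 (f : R -> R) (a b : R) : a <= b -> cts f ->
  (forall s, a <= s <= b -> 0 <= f s) -> 0 <= RInt f a b.
Proof.
intros; assert (E := int_const 0 a b); rewrite Rmult_0_l in E; rewrite <- E.
apply int_le; ct.
Qed.

Lemma int_deriv (F f : R -> R) (a b : R) : (forall s, is_derive F s (f s)) -> cts f ->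
  RInt f a b = F b - F a.
Proof. intros; apply is_RInt_unique, (is_RInt_derive F f); auto. Qed.

Lemma int_abs (f : R -> R) (a b : R) : a <= b -> cts f ->
  Rabs (RInt f a b) <= RInt (fun s => Rabs (f s)) a b.
Proof. intros; apply abs_RInt_le; auto using cts_ex_RInt. Qed.

Lemma int_comp_lin (f : R -> R) (u v a b : R) : cts f ->
  u * RInt (fun s => f (u * s + v)) a b = RInt f (u * a + v) (u * b + v).
Proof.
intros H; rewrite <- (RInt_comp_lin f u v a b) by (apply cts_ex_RInt, H).
symmetry; apply (@RInt_scal R_CompleteNormedModule), cts_ex_RInt.
apply (cts_comp (fun s => u * s + v) f); ct.
Qed.

Lemma int_swap (f : R -> R) (a b : R) : cts f -> RInt f b a = - RInt f a b.
Proof.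
intros H; assert (E := int_chasles f a b a H); rewrite RInt_point in E.
change (@zero R_CompleteNormedModule) with 0 in E; lra.
Qed.

Lemma int_reflect (f : R -> R) (c a b : R) : cts f ->
  RInt (fun s => f (c - s)) a b = RInt f (c - b) (c - a).
Proof.
intros H; assert (E := int_comp_lin f (-1) c a b H).
replace (-1 * b + c) with (c - b) in E by ring.
replace (-1 * a + c) with (c - a) in E by ring.
rewrite (int_swap f (c - b) (c - a) H) in E.
rewrite (int_ext (fun s => f (c - s)) (fun s => f (-1 * s + c))).
- lra.
- intros s; f_equal; ring.
Qed.

Lemma int_translate (f : R -> R) (c a b : R) : cts f ->
  RInt (fun s => f (c + s)) a b = RInt f (c + a) (c + b).
Proof.
intros H; assert (E := int_comp_lin f 1 c a b H).
replace (1 * b + c) with (c + b) in E by ring.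
replace (1 * a + c) with (c + a) in E by ring.
rewrite (int_ext (fun s => f (c + s)) (fun s => f (1 * s + c))).
- lra.
- intros s; f_equal; ring.
Qed.

Lemma int_period (f : R -> R) (l c : R) : cts f -> (forall s, f (s + l) = f s) ->
  RInt f c (c + l) = RInt f 0 l.
Proof.
intros H P.
rewrite <- (int_chasles f c 0 (c + l)), <- (int_chasles f 0 l (c + l)) by assumption.
assert (E : RInt f l (c + l) = RInt f 0 c).
{ replace (RInt f l (c + l)) with (RInt f (l + 0) (l + c)) by (f_equal; ring).
  rewrite <- int_translate by assumption; apply int_ext; intros s.
  rewrite Rplus_comm; apply P. }
rewrite E, (int_swap f 0 c H); rring.
Qed.

Lemma int_shift (f : R -> R) (l c : R) : cts f -> (forall s, f (s + l) = f s) ->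
  RInt (fun s => f (s + c)) 0 l = RInt f 0 l.
Proof.
intros H P; rewrite (int_ext _ (fun s => f (c + s))) by (intros; f_equal; ring).
rewrite int_translate, Rplus_0_r by assumption; apply int_period; assumption.
Qed.

Lemma int_antiperiodic (f : R -> R) (l : R) : cts f -> (forall s, f (s + l) = - f s) ->
  RInt f 0 (2 * l) = 0.
Proof.
intros H P; rewrite <- (int_chasles f 0 l (2 * l)) by assumption.
replace (RInt f l (2 * l)) with (RInt f (l + 0) (l + l)) by (f_equal; ring).
rewrite <- int_translate by assumption.
rewrite (int_ext (fun s => f (l + s)) (fun s => - f s)).
- rewrite int_opp by assumption; rring.
- intros s; rewrite <- P; f_equal; ring.
Qed.

(** Kept at the level of numbers, so that it yields Cauchy-Schwarz both for the L^2 product and for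
    the semidefinite form [jform]. *)
Lemma discriminant_le (A B C : R) :
  0 <= A -> (forall t : R, 0 <= C - 2 * t * B + t ^ 2 * A) -> B ^ 2 <= A * C.
Proof.
intros HA H.
destruct (Req_dec A 0) as [->|HA0].
- destruct (Req_dec B 0) as [->|HB]; [lra|].
  (* With A = 0 the expression is affine in t, and this t gives it the value -1. *)
  specialize (H ((C + 1) / (2 * B))); exfalso.
  replace (C - 2 * ((C + 1) / (2 * B)) * B + ((C + 1) / (2 * B)) ^ 2 * 0) with (-1) in H
    by (field; assumption).
  lra.
- specialize (H (B / A)).
  replace (C - 2 * (B / A) * B + (B / A) ^ 2 * A) with (C - B ^ 2 / A) in H by (field; assumption).
  apply Rmult_le_reg_r with (/ A); [apply Rinv_0_lt_compat; lra|].
  replace (A * C * / A) with C by (field; assumption).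
  unfold Rdiv in H; lra.
Qed.

Lemma int_cauchy_schwarz (f g : R -> R) (a b : R) : a <= b -> cts f -> cts g ->
  RInt (fun s => f s * g s) a b ^ 2 <=
  RInt (fun s => f s ^ 2) a b * RInt (fun s => g s ^ 2) a b.
Proof.
intros Hab Hf Hg; apply discriminant_le.
- apply int_ge0; ct; intros; apply pow2_ge_0.
- intros t.
  replace (_ - _ + _) with (RInt (fun s => (g s - t * f s) ^ 2) a b).
  + apply int_ge0; ct; intros; apply pow2_ge_0.
  + rewrite (int_ext _ (fun s => g s ^ 2 - 2 * t * (f s * g s) + t ^ 2 * f s ^ 2))
      by (intros; ring).
    rewrite int_plus, int_minus, !int_scal by ct; rring.
Qed.

(** [auto_derive] treats an unknown function as opaque and leaves [ex_derive] and [Derive] terms.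
    Both are settled from hypotheses of the form [forall s, is_derive g s _], which is why such
    facts are put into the context before [ader] is called. *)
Ltac ex_der := repeat match goal with
  | |- _ /\ _ => split
  | |- True => exact I
  | H : forall s, is_derive ?g s _ |- ex_derive ?f ?a => solve [eexists; exact (H a)]
  end.
Ltac der_rw := repeat match goal with
  | H : forall s, is_derive ?g s _ |- context [Derive ?f ?a] =>
      let E := constr:(is_derive_unique f a _ (H a)) in rewrite E
  end.
Ltac ader := auto_derive; [ex_der | der_rw; try first [ring | unfold Rminus; ring]].

(* A syntactic match: plain [apply] would also split a numeral such as [4]. *)
Ltac mpos := repeat match goal with
  | |- 0 < _ * _ => apply Rmult_lt_0_compat
  | |- 0 <= _ * _ => apply Rmult_le_pos
  end; try lra.

(** * The Jacobi transformation on a quarter period *)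

(** Meant for derivatives of quotients by a Jacobi field, which are continuous only away from its
    zero. Freezing [f] outside [a, b] at its end values gives a function continuous on all of R, to
    which Cauchy-Schwarz against 1 applies. *)
Lemma int_sqr_le_local (f : R -> R) (a b : R) : a <= b ->
  (forall x, a <= x <= b -> continuous f x) ->
  RInt f a b ^ 2 <= (b - a) * RInt (fun s => f s ^ 2) a b.
Proof.
intros Hab Hf.
pose (clamp := fun x => Rmax a (Rmin b x)).
assert (Hc : cts clamp).
{ unfold clamp; intros x.
  apply continuous_ext with (fun x => (a + ((b + x - Rabs (b - x)) / 2)
    + Rabs (a - (b + x - Rabs (b - x)) / 2)) / 2).
  - intros y; unfold Rmax, Rmin, Rabs.
    destruct (Rle_dec b y); destruct (Rle_dec a _); destruct (Rcase_abs (b - y));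
      destruct (Rcase_abs _); lra.
  - revert x; change (cts (fun x => (a + ((b + x - Rabs (b - x)) / 2)
      + Rabs (a - (b + x - Rabs (b - x)) / 2)) / 2)); unfold Rdiv; ct. }
assert (Hr : forall x, a <= clamp x <= b).
{ intros x; unfold clamp, Rmax, Rmin; destruct (Rle_dec b x), (Rle_dec a _); lra. }
assert (He : forall x, a <= x <= b -> clamp x = x).
{ intros x Hx; unfold clamp, Rmax, Rmin; destruct (Rle_dec b x), (Rle_dec a _); lra. }
pose (g := fun x => f (clamp x)).
assert (Hg : cts g) by (intros x; apply (continuous_comp clamp f); [apply Hc|apply Hf, Hr]).
rewrite (RInt_ext f g), (RInt_ext (fun s => f s ^ 2) (fun s => g s ^ 2)).
- assert (E := int_cauchy_schwarz (fun _ => 1) g a b Hab (cts_const 1) Hg).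
  rewrite (int_ext (fun s => 1 * g s) g) in E by (intros; ring).
  rewrite (int_ext (fun s => 1 ^ 2) (fun _ => 1)) in E by (intros; ring).
  rewrite int_const in E; lra.
- rewrite Rmin_left, Rmax_right by assumption; intros x Hx; unfold g; rewrite He; lra.
- rewrite Rmin_left, Rmax_right by assumption; intros x Hx; unfold g; rewrite He; lra.
Qed.

(** [phi] solves phi'' + P phi = 0 with a Dirichlet condition at 0, a Neumann condition at [q] and
    no zero in between: it is the ground state, at eigenvalue 0, of the form on fields that vanish
    at 0 and are free at [q]. That form is therefore nonnegative, with kernel spanned by [phi]. *)
Record jacobi_data (q : R) (P phi phi' : R -> R) : Prop := {
  jd_q : 0 < q;
  jd_P : cts P;
  jd_phi : forall s, is_derive phi s (phi' s);
  jd_phi' : forall s, is_derive phi' s (- P s * phi s);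
  jd_0 : phi 0 = 0;
  jd_0' : 0 < phi' 0;
  jd_q' : phi' q = 0;
  jd_pos : forall s, 0 < s <= q -> 0 < phi s }.

Definition jform (P y y' : R -> R) (q : R) : R :=
  RInt (fun s => y' s ^ 2 - P s * y s ^ 2) 0 q.

Lemma derivable_bound (f : R -> R) (l e : R) : 0 < e -> is_derive f 0 l ->
  exists d, 0 < d /\ forall h, 0 < h < d -> Rabs (f h - f 0 - l * h) <= e * h.
Proof.
intros He Hf; apply is_derive_Reals in Hf; destruct (Hf e He) as [d Hd].
exists d; split; [apply cond_pos|]; intros h Hh.
assert (Hh0 : h <> 0) by lra.
specialize (Hd h Hh0); rewrite Rabs_pos_eq, Rplus_0_l in Hd by lra.
specialize (Hd (proj2 Hh)).
replace (f h - f 0 - l * h) with (((f h - f 0) / h - l) * h) by (field; assumption).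
rewrite Rabs_mult, (Rabs_pos_eq h) by lra.
apply Rmult_le_compat_r; lra.
Qed.

Section Quarter.
Context (q : R) (P phi phi' : R -> R) (J : jacobi_data q P phi phi').

(* [y'^2 - P y^2 = (y' - y phi'/phi)^2 + (y^2 phi'/phi)'] *)
Lemma jacobi_local (y y' : R -> R) (a b : R) : 0 < a <= b -> b <= q ->
  (forall s, is_derive y s (y' s)) -> cts y' ->
  RInt (fun s => ((y' s - phi' s / phi s * y s) / phi s * phi s) ^ 2) a b =
  RInt (fun s => y' s ^ 2 - P s * y s ^ 2) a b
    - y b ^ 2 * phi' b / phi b + y a ^ 2 * phi' a / phi a.
Proof.
intros Hab Hb Hy Hy'.
assert (Cy := is_derive_cts y y' Hy).
assert (Dp := jd_phi _ _ _ _ J); assert (Dp' := jd_phi' _ _ _ _ J).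
assert (Cp := is_derive_cts _ _ Dp); assert (Cp' := is_derive_cts _ _ Dp').
assert (CP := jd_P _ _ _ _ J).
assert (Hnz : forall s, a <= s <= b -> phi s <> 0).
{ intros s Hs; apply Rgt_not_eq, (jd_pos _ _ _ _ J); lra. }
pose (F := fun s => y s ^ 2 * phi' s / phi s).
pose (F' := fun s => 2 * y s * y' s * phi' s / phi s - P s * y s ^ 2
                     - y s ^ 2 * phi' s ^ 2 * (/ phi s) ^ 2).
assert (I : is_RInt F' a b (F b - F a)).
{ apply (is_RInt_derive F F').
  - rewrite Rmin_left, Rmax_right by lra; intros s Hs; unfold F, F'.
    ader; [apply Hnz; assumption|field; apply Hnz; assumption].
  - rewrite Rmin_left, Rmax_right by lra; intros s Hs; unfold F', Rdiv.
    assert (Ci : continuous (fun s => / phi s) s).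
    { apply (continuous_comp phi Rinv); [apply Cp|].
      apply (@ex_derive_continuous R_AbsRing R_NormedModule); auto_derive; auto. }
    apply (continuous_minus (fun s => 2 * y s * y' s * phi' s * / phi s - P s * y s ^ 2)
      (fun s => y s ^ 2 * phi' s ^ 2 * (/ phi s) ^ 2)).
    + apply (continuous_minus (fun s => 2 * y s * y' s * phi' s * / phi s)
        (fun s => P s * y s ^ 2)).
      * apply (continuous_mult (fun s => 2 * y s * y' s * phi' s) (fun s => / phi s)); auto.
        revert s Hs Ci; intros s _ _; revert s.
        change (cts (fun s => 2 * y s * y' s * phi' s)); ct.
      * revert s Hs Ci; intros s _ _; revert s.
        change (cts (fun s => P s * y s ^ 2)); ct.
    + apply (continuous_mult (fun s => y s ^ 2 * phi' s ^ 2) (fun s => (/ phi s) ^ 2)).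
      * revert s Hs Ci; intros s _ _; revert s.
        change (cts (fun s => y s ^ 2 * phi' s ^ 2)); ct.
      * apply continuous_ext with (fun s => / phi s * / phi s); [intros; simpl; ring|].
        apply (continuous_mult (fun s => / phi s) (fun s => / phi s)); auto. }
assert (E : is_RInt (fun s => (y' s ^ 2 - P s * y s ^ 2) - F' s) a b
  (RInt (fun s => y' s ^ 2 - P s * y s ^ 2) a b - (F b - F a))).
{ apply (@is_RInt_minus R_NormedModule); [|assumption].
  apply (@RInt_correct R_CompleteNormedModule), cts_ex_RInt; ct. }
apply (@is_RInt_unique R_CompleteNormedModule) in E.
rewrite (RInt_ext _ (fun s => (y' s ^ 2 - P s * y s ^ 2) - F' s)).
- rewrite E; unfold F; as_real; ring.
- rewrite Rmin_left, Rmax_right by lra; intros s Hs; unfold F'.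
  as_real; field; apply Hnz; lra.
Qed.

Lemma jform_split (y y' : R -> R) (s : R) : (forall s, is_derive y s (y' s)) -> cts y' ->
  jform P y y' q = RInt (fun s => y' s ^ 2 - P s * y s ^ 2) 0 s
     + RInt (fun s => y' s ^ 2 - P s * y s ^ 2) s q.
Proof.
intros Hy Hy'; assert (Cy := is_derive_cts y y' Hy); assert (CP := jd_P _ _ _ _ J).
unfold jform; symmetry; apply int_chasles; ct.
Qed.

(** The limit a -> 0 of [jacobi_local], with the square dropped. The boundary term y^2 phi' / phi
    tends to 0 although [phi] vanishes at 0, because y = O(a) while phi is close to phi'(0) a. The
    limit is made quantitative: a positive [gap] is contradicted at a single small point [d]. *)
Lemma jacobi_left (y y' : R -> R) (s : R) : 0 < s <= q ->
  (forall s, is_derive y s (y' s)) -> cts y' -> y 0 = 0 ->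
  y s ^ 2 * phi' s / phi s <= RInt (fun s => y' s ^ 2 - P s * y s ^ 2) 0 s.
Proof.
intros Hs Hy Hy' Hy0.
assert (Cy := is_derive_cts y y' Hy); assert (CP := jd_P _ _ _ _ J).
set (h := fun s => y' s ^ 2 - P s * y s ^ 2).
assert (Ch : cts h) by (unfold h; ct).
pose (p0 := phi' 0); assert (Hp0 : 0 < p0) by apply (jd_0' _ _ _ _ J).
destruct (derivable_bound y (y' 0) 1 Rlt_0_1 (Hy 0)) as [d1 [Hd1 B1]].
destruct (derivable_bound phi p0 (p0 / 2) ltac:(lra) (jd_phi _ _ _ _ J 0)) as [d2 [Hd2 B2]].
assert (D3 := jd_phi' _ _ _ _ J 0); rewrite (jd_0 _ _ _ _ J), Rmult_0_r in D3.
destruct (derivable_bound phi' 0 1 Rlt_0_1 D3) as [d3 [Hd3 B3]].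
destruct (derivable_bound (fun s => RInt h 0 s) (h 0) 1 Rlt_0_1) as [d4 [Hd4 B4]].
{ apply (@is_derive_RInt R_NormedModule h (fun s => RInt h 0 s) 0 0); [|apply Ch].
  apply filter_forall; intros x; apply (@RInt_correct R_CompleteNormedModule), cts_ex_RInt, Ch. }
set (M := Rabs (y' 0) + 1); set (N := Rabs (h 0) + 1).
assert (HM : 0 < M) by (unfold M; assert (A := Rabs_pos (y' 0)); lra).
assert (HN : 0 < N) by (unfold N; assert (A := Rabs_pos (h 0)); lra).
(* [K * d] bounds the two terms lost by starting at [d] instead of 0: the boundary term, where |y|
   <= M d, phi >= p0 d / 2 and |phi'| <= p0 + 1, and the integral over [0, d], which is at most N
   d. *)
set (K := M ^ 2 * (p0 + 1) / (p0 / 2) + N).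
assert (HK : 0 < K).
{ unfold K; apply Rplus_lt_0_compat; [|assumption].
  apply Rdiv_lt_0_compat; [apply Rmult_lt_0_compat; [apply pow_lt|]; lra|lra]. }
apply Rnot_lt_le; intros Hlt; set (gap := y s ^ 2 * phi' s / phi s - RInt h 0 s).
assert (Hgap : 0 < gap) by (unfold gap; lra).
set (m := Rmin (Rmin (Rmin d1 d2) (Rmin d3 d4)) (Rmin (Rmin 1 s) (gap / K))).
assert (Hm : 0 < m /\ m <= d1 /\ m <= d2 /\ m <= d3 /\ m <= d4 /\ m <= 1 /\ m <= s /\ m <= gap / K).
{ assert (0 < gap / K) by (apply Rdiv_lt_0_compat; assumption).
  unfold m; repeat split; unfold Rmin;
  repeat match goal with |- context [Rle_dec ?a ?b] =>
    lazymatch a with context [Rle_dec] => fail | _ =>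
    lazymatch b with context [Rle_dec] => fail | _ => destruct (Rle_dec a b) end end end; lra. }
set (d := m / 2); assert (Hd : 0 < d < m) by (unfold d; lra).
specialize (B1 d ltac:(lra)); specialize (B2 d ltac:(lra)).
specialize (B3 d ltac:(lra)); specialize (B4 d ltac:(lra)).
rewrite Hy0 in B1; rewrite (jd_0 _ _ _ _ J) in B2; rewrite RInt_point in B4.
change (@zero R_CompleteNormedModule) with 0 in B4.
assert (Y : Rabs (y d) <= M * d).
{ replace (y d) with ((y d - 0 - y' 0 * d) + y' 0 * d) by ring.
  eapply Rle_trans; [apply Rabs_triang|]; rewrite Rabs_mult, (Rabs_pos_eq d) by lra.
  unfold M; lra. }
assert (F1 : p0 / 2 * d <= phi d).
{ apply Rabs_le_between in B2; lra. }
assert (F2 : Rabs (phi' d) <= p0 + 1).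
{ apply Rabs_le; apply Rabs_le_between in B3; unfold p0 in *; lra. }
assert (F3 : Rabs (RInt h 0 d) <= N * d).
{ replace (RInt h 0 d) with ((RInt h 0 d - 0 - h 0 * d) + h 0 * d) by (as_real; ring).
  eapply Rle_trans; [apply Rabs_triang|]; rewrite Rabs_mult, (Rabs_pos_eq d) by lra.
  unfold N; lra. }
assert (F4 : Rabs (y d ^ 2 * phi' d / phi d) <= M ^ 2 * (p0 + 1) / (p0 / 2) * d).
{ assert (Hpd : 0 < p0 / 2 * d) by (apply Rmult_lt_0_compat; lra).
  unfold Rdiv at 1; rewrite !Rabs_mult, <- RPow_abs, Rabs_inv, (Rabs_pos_eq (phi d)) by lra.
  apply Rle_trans with ((M * d) ^ 2 * (p0 + 1) * / (p0 / 2 * d)).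
  - apply Rmult_le_compat.
    + apply Rmult_le_pos; [apply pow2_ge_0|apply Rabs_pos].
    + apply Rlt_le, Rinv_0_lt_compat; lra.
    + apply Rmult_le_compat; [apply pow2_ge_0|apply Rabs_pos| |assumption].
      apply pow_incr; split; [apply Rabs_pos|assumption].
    + apply Rinv_le_contravar; assumption.
  - right; field; lra. }
assert (L := jacobi_local y y' d s ltac:(lra) (proj2 Hs) Hy Hy').
assert (G : 0 <= RInt (fun s => ((y' s - phi' s / phi s * y s) / phi s * phi s) ^ 2) d s).
{ rewrite (RInt_ext _ (fun s => (y' s - phi' s / phi s * y s) ^ 2)).
  - apply Rle_trans with (RInt (fun _ => 0) d s); [rewrite int_const; lra|].
    apply RInt_le; [lra|apply cts_ex_RInt; ct| |intros; apply pow2_ge_0].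
    apply (@ex_RInt_continuous R_CompleteNormedModule).
    rewrite Rmin_left, Rmax_right by lra; intros u Hu.
    assert (Hpu : phi u <> 0) by (apply Rgt_not_eq, (jd_pos _ _ _ _ J); lra).
    assert (Dp := jd_phi _ _ _ _ J); assert (Dp' := jd_phi' _ _ _ _ J).
    apply continuous_ext with (fun s => (y' s - phi' s / phi s * y s) * (y' s - phi' s / phi s * y s));
      [intros; simpl; ring|].
    assert (C1 : continuous (fun s => y' s - phi' s / phi s * y s) u).
    { apply (continuous_minus y' (fun s => phi' s / phi s * y s)); [apply Hy'|].
      apply (continuous_mult (fun s => phi' s / phi s) y); [|apply Cy].
      apply (@ex_derive_continuous R_AbsRing R_NormedModule); auto_derive; ex_der; assumption. }
    apply (continuous_mult (fun s => y' s - phi' s / phi s * y s)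
      (fun s => y' s - phi' s / phi s * y s)); assumption.
  - rewrite Rmin_left, Rmax_right by lra; intros u Hu.
    assert (Hpu : phi u <> 0) by (apply Rgt_not_eq, (jd_pos _ _ _ _ J); lra).
    as_real; field; assumption. }
assert (Ch2 := int_chasles h 0 d s Ch).
fold h in L, G.
assert (Hfin : K * d < gap).
{ apply Rlt_le_trans with (K * m); [apply Rmult_lt_compat_l; lra|].
  apply Rle_trans with (K * (gap / K)); [apply Rmult_le_compat_l; lra|].
  right; field; lra. }
apply Rabs_le_between in F3; apply Rabs_le_between in F4.
unfold K, gap in Hfin; unfold h in *; lra.
Qed.

(** At [q] the boundary term is killed by the Neumann condition on [phi]. *)
Lemma jform_pos (y y' : R -> R) :
  (forall s, is_derive y s (y' s)) -> cts y' -> y 0 = 0 -> 0 <= jform P y y' q.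
Proof.
intros Hy Hy' Hy0; assert (Hq := jd_q _ _ _ _ J).
assert (E := jacobi_left y y' q ltac:(lra) Hy Hy' Hy0).
rewrite (jd_q' _ _ _ _ J) in E; unfold jform.
unfold Rdiv in E; rewrite Rmult_0_r, Rmult_0_l in E; exact E.
Qed.

(** The left-hand side is phi(s)^2 times the squared increment of y / phi from s to q.
    Cauchy-Schwarz bounds that increment by the integral of g'^2 with g' = (y / phi)', whereas the
    form controls the integral of g'^2 phi^2. The comparison c phi(s) <= phi(t) for t >= s moves the
    factor phi(s)^2 under the integral, and so absorbs the singularity at 0. *)
Lemma jform_pointwise (c : R) : 0 < c ->
  (forall s t, 0 < s -> s <= t <= q -> c * phi s <= phi t) ->
  forall y y' : R -> R,
  (forall s, is_derive y s (y' s)) -> cts y' -> y 0 = 0 ->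
  forall s, 0 <= s <= q ->
  (y s - y q * (phi s / phi q)) ^ 2 <= q / c ^ 2 * jform P y y' q.
Proof.
intros Hc Hcmp y y' Hy Hy' Hy0 s Hs; assert (Hq := jd_q _ _ _ _ J).
assert (Hpos := jform_pos y y' Hy Hy' Hy0).
assert (Hqc : 0 < q / c ^ 2) by (apply Rdiv_lt_0_compat; [|apply pow_lt]; assumption).
destruct (Req_dec s 0) as [->|Hs0].
{ rewrite Hy0, (jd_0 _ _ _ _ J); unfold Rdiv at 1; rewrite Rmult_0_l, Rmult_0_r, Rminus_0_r.
  rewrite pow_ne_zero by discriminate; apply Rmult_le_pos; lra. }
assert (Hs' : 0 < s <= q) by lra.
assert (Hnz : forall u, s <= u <= q -> 0 < phi u) by (intros u Hu; apply (jd_pos _ _ _ _ J); lra).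
assert (Cy := is_derive_cts y y' Hy).
pose (g' := fun s => (y' s - phi' s / phi s * y s) / phi s).
assert (Cg : forall u, s <= u <= q -> continuous g' u).
{ intros u Hu; assert (Hpu := Hnz u Hu).
  assert (Dp := jd_phi _ _ _ _ J); assert (Dp' := jd_phi' _ _ _ _ J).
  apply (continuous_mult (fun s => y' s - phi' s / phi s * y s) (fun s => / phi s)).
  - apply (continuous_minus y' (fun s => phi' s / phi s * y s)); [apply Hy'|].
    apply (continuous_mult (fun s => phi' s / phi s) y); [|apply Cy].
    apply (@ex_derive_continuous R_AbsRing R_NormedModule); auto_derive; ex_der; lra.
  - apply (@ex_derive_continuous R_AbsRing R_NormedModule); auto_derive; ex_der; lra. }
assert (I : RInt g' s q = y q / phi q - y s / phi s).
{ apply is_RInt_unique, (is_RInt_derive (fun u => y u / phi u) g');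
    rewrite Rmin_left, Rmax_right by lra; [|apply Cg].
  intros u Hu; assert (Hpu := Hnz u Hu).
  assert (Dp := jd_phi _ _ _ _ J).
  unfold g'; ader; [lra|field; lra]. }
assert (CS := int_sqr_le_local g' s q (proj2 Hs') Cg); rewrite I in CS.
assert (L := jacobi_local y y' s q ltac:(lra) (Rle_refl q) Hy Hy').
assert (L0 := jacobi_left y y' s Hs' Hy Hy' Hy0).
assert (Sp := jform_split y y' s Hy Hy').
rewrite (jd_q' _ _ _ _ J) in L; unfold Rdiv in L at 3; rewrite Rmult_0_r, Rmult_0_l in L.
assert (Hps := Hnz s ltac:(lra)); assert (Hpq := Hnz q ltac:(lra)).
assert (CMP : c ^ 2 * phi s ^ 2 * RInt (fun u => g' u ^ 2) s q <=
  RInt (fun s => ((y' s - phi' s / phi s * y s) / phi s * phi s) ^ 2) s q).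
{ assert (Cg2 : forall u, s <= u <= q -> continuous (fun u => g' u ^ 2) u).
  { intros u Hu; apply continuous_ext with (fun u => g' u * g' u); [intros; simpl; ring|].
    apply (continuous_mult g' g'); apply Cg; assumption. }
  rewrite <- (@RInt_scal R_CompleteNormedModule).
  2: { apply (@ex_RInt_continuous R_CompleteNormedModule).
       rewrite Rmin_left, Rmax_right by lra; assumption. }
  apply RInt_le; [lra| | |].
  - apply (@ex_RInt_continuous R_CompleteNormedModule).
    rewrite Rmin_left, Rmax_right by lra; intros u Hu.
    apply (continuous_mult (fun _ => c ^ 2 * phi s ^ 2) (fun u => g' u ^ 2)).
    + apply continuous_const.
    + apply Cg2; assumption.
  - apply (@ex_RInt_continuous R_CompleteNormedModule).
    rewrite Rmin_left, Rmax_right by lra; intros u Hu.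
    apply continuous_ext with (fun u => g' u ^ 2 * (phi u * phi u));
      [intros; unfold g'; simpl; ring|].
    apply (continuous_mult (fun u => g' u ^ 2) (fun u => phi u * phi u)).
    + apply Cg2; assumption.
    + assert (Cp := is_derive_cts _ _ (jd_phi _ _ _ _ J)).
      apply (cts_mult phi phi Cp Cp).
  - intros u Hu; change (c ^ 2 * phi s ^ 2 * g' u ^ 2 <= (g' u * phi u) ^ 2).
    assert (H := Hcmp s u (proj1 Hs') ltac:(lra)).
    rewrite Rpow_mult_distr, Rmult_comm; apply Rmult_le_compat_l; [apply pow2_ge_0|].
    rewrite <- Rpow_mult_distr; apply pow_incr; split; [|assumption].
    apply Rmult_le_pos; lra. }
replace ((y s - y q * (phi s / phi q)) ^ 2)
  with (phi s ^ 2 * (y q / phi q - y s / phi s) ^ 2) by (field; lra).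
apply Rle_trans with (phi s ^ 2 * ((q - s) * RInt (fun u => g' u ^ 2) s q)).
{ apply Rmult_le_compat_l; [apply pow2_ge_0|assumption]. }
assert (Hc2 : 0 < c ^ 2) by (apply pow_lt; assumption).
apply Rmult_le_reg_l with (c ^ 2); [assumption|].
replace (c ^ 2 * (q / c ^ 2 * jform P y y' q)) with (q * jform P y y' q) by (field; lra).
(* The integrand is a square, but continuous only on [s, q]; that its integral is nonnegative is
   read off from [CS], except at s = q, where the integral is 0. *)
assert (G0 : 0 <= c ^ 2 * phi s ^ 2 * RInt (fun u => g' u ^ 2) s q).
{ apply Rmult_le_pos; [apply Rmult_le_pos; apply pow2_ge_0|].
  apply Rmult_le_reg_l with (q - s + 1); [lra|].
  assert (T := pow2_ge_0 (y q / phi q - y s / phi s)).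
  rewrite Rmult_0_r.
  destruct (Req_dec s q) as [->|Hsq]; [rewrite RInt_point; change (@zero R_CompleteNormedModule) with 0; lra|].
  assert (0 <= RInt (fun u => g' u ^ 2) s q).
  { apply Rmult_le_reg_l with (q - s); [lra|]. rewrite Rmult_0_r; eapply Rle_trans; eassumption. }
  apply Rmult_le_pos; lra. }
set (X := c ^ 2 * phi s ^ 2 * RInt (fun u => g' u ^ 2) s q) in *.
replace (c ^ 2 * (phi s ^ 2 * ((q - s) * RInt (fun u : R => g' u ^ 2) s q)))
  with ((q - s) * X) by (unfold X; as_real; ring).
apply Rle_trans with (q * X); [apply Rmult_le_compat_r; lra|].
apply Rmult_le_compat_l; [lra|].
eapply Rle_trans; [apply CMP|]; rewrite L; lra.
Qed.

(** Cauchy-Schwarz for the form between [y] and the test field s phi(s), which also vanishes at 0.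
    Since (s phi)'' + P s phi = 2 phi', the pairing is phi(q) y(q) minus twice the integral of phi'
    y, and the form of s phi itself is the integral of phi^2. With phi taken from [ka], phi' is a
    multiple of the sine of the tangent angle, so this bounds a sine moment of [y]. *)
Lemma jform_cauchy_schwarz (y y' : R -> R) :
  (forall s, is_derive y s (y' s)) -> cts y' -> y 0 = 0 ->
  (phi q * y q - 2 * RInt (fun s => phi' s * y s) 0 q) ^ 2
    <= RInt (fun s => phi s ^ 2) 0 q * jform P y y' q.
Proof.
intros Hy Hy' Hy0; assert (Hq := jd_q _ _ _ _ J).
assert (Cy := is_derive_cts y y' Hy); assert (CP := jd_P _ _ _ _ J).
assert (Dp := jd_phi _ _ _ _ J); assert (Dp' := jd_phi' _ _ _ _ J).
assert (Cp := is_derive_cts _ _ Dp); assert (Cp' := is_derive_cts _ _ Dp').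
apply discriminant_le.
{ apply int_ge0; ct; [lra|]; intros; apply pow2_ge_0. }
intros t.
assert (H := jform_pos (fun s => y s - t * (s * phi s)) (fun s => y' s - t * (phi s + s * phi' s))).
assert (E1 : RInt (fun s => y' s * (phi s + s * phi' s) - P s * y s * (s * phi s)
      + 2 * (phi' s * y s)) 0 q = y q * (phi q + q * phi' q) - y 0 * (phi 0 + 0 * phi' 0)).
{ apply (int_deriv (fun s => y s * (phi s + s * phi' s))); [|ct].
  intros s; ader. }
assert (E2 : RInt (fun s => (phi s + s * phi' s) ^ 2 - P s * (s * phi s) ^ 2 - phi s ^ 2) 0 q
  = q ^ 2 * phi q * phi' q - 0 ^ 2 * phi 0 * phi' 0).
{ apply (int_deriv (fun s => s ^ 2 * phi s * phi' s)); [|ct].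
  intros s; ader. }
rewrite (jd_q' _ _ _ _ J), Hy0 in E1; rewrite (jd_q' _ _ _ _ J) in E2.
rewrite int_plus, int_minus, int_scal in E1 by ct.
rewrite !int_minus in E2 by ct.
replace (jform P y y' q - _ + _) with
  (jform P (fun s => y s - t * (s * phi s)) (fun s => y' s - t * (phi s + s * phi' s)) q).
- apply H; [|ct|rewrite Hy0; ring].
  intros s; ader.
- unfold jform.
  rewrite (int_ext (fun s => (y' s - t * (phi s + s * phi' s)) ^ 2 - P s * (y s - t * (s * phi s)) ^ 2)
   (fun s => y' s ^ 2 - P s * y s ^ 2
     - 2 * t * (y' s * (phi s + s * phi' s) - P s * y s * (s * phi s))
     + t ^ 2 * ((phi s + s * phi' s) ^ 2 - P s * (s * phi s) ^ 2))) by (intros; ring).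
  rewrite int_plus, int_minus, !int_scal by ct.
  rewrite !int_minus by ct.
  as_real. set (A1 := RInt _ 0 q) in *. 
  nra.
Qed.

End Quarter.

(** * Second variation of the figure eight *)

Lemma cts_bounded (f : R -> R) (a b : R) : a <= b -> cts f ->
  exists M : R, 0 < M /\ forall s, a <= s <= b -> Rabs (f s) <= M.
Proof.
intros Hab Hf.
destruct (continuity_ab_maj (fun s => Rabs (f s)) a b Hab) as [x [Hx _]].
{ intros c _; apply continuity_pt_filterlim, (cts_abs f Hf c). }
exists (Rabs (f x) + 1); split; [assert (H := Rabs_pos (f x)); lra|].
intros s Hs; specialize (Hx s Hs); simpl in Hx; lra.
Qed.

(** Each quarter is parametrized by the distance to the nearest of 0, 2 q, 4 q, where sin th
    vanishes; [int_fold_nodes] does the same with q and 3 q, the zeros of ka. Symmetry then reduces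
    all four quarters to one set of Jacobi data. *)
Lemma int_fold_ends (F : R -> R) (q : R) : cts F ->
  RInt F 0 (4 * q) = RInt F 0 q + RInt (fun u => F (2 * q - u)) 0 q
    + RInt (fun u => F (2 * q + u)) 0 q + RInt (fun u => F (4 * q - u)) 0 q.
Proof.
intros HF; rewrite !int_reflect, int_translate by assumption.
rewrite <- (int_chasles F 0 q (4 * q)), <- (int_chasles F q (2 * q) (4 * q)),
  <- (int_chasles F (2 * q) (3 * q) (4 * q)) by assumption.
replace (2 * q - q) with q by ring; replace (2 * q - 0) with (2 * q) by ring.
replace (2 * q + 0) with (2 * q) by ring; replace (2 * q + q) with (3 * q) by ring.
replace (4 * q - q) with (3 * q) by ring; replace (4 * q - 0) with (4 * q) by ring.
rring.
Qed.

Lemma int_fold_nodes (F : R -> R) (q : R) : cts F ->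
  RInt F 0 (4 * q) = RInt (fun u => F (q - u)) 0 q + RInt (fun u => F (q + u)) 0 q
    + RInt (fun u => F (3 * q - u)) 0 q + RInt (fun u => F (3 * q + u)) 0 q.
Proof.
intros HF; rewrite !int_reflect, !int_translate by assumption.
rewrite <- (int_chasles F 0 q (4 * q)), <- (int_chasles F q (2 * q) (4 * q)),
  <- (int_chasles F (2 * q) (3 * q) (4 * q)) by assumption.
replace (q - q) with 0 by ring; replace (q - 0) with q by ring.
replace (q + 0) with q by ring; replace (q + q) with (2 * q) by ring.
replace (3 * q - q) with (2 * q) by ring; replace (3 * q - 0) with (3 * q) by ring.
replace (3 * q + 0) with (3 * q) by ring; replace (3 * q + q) with (4 * q) by ring.
rring.
Qed.

Lemma is_derive_reflect (y y' : R -> R) (c : R) : (forall s, is_derive y s (y' s)) ->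
  forall s, is_derive (fun u => y (c - u)) s (- y' (c - s)).
Proof. intros Hy s; ader. Qed.

Lemma is_derive_translate (y y' : R -> R) (c : R) : (forall s, is_derive y s (y' s)) ->
  forall s, is_derive (fun u => y (c + u)) s (y' (c + s)).
Proof. intros Hy s; ader. Qed.

Lemma cts_reflect (f : R -> R) (c : R) : cts f -> cts (fun u => f (c - u)).
Proof. intros Hf; apply (cts_comp (fun u => c - u) f); ct. Qed.

Lemma cts_translate (f : R -> R) (c : R) : cts f -> cts (fun u => f (c + u)).
Proof. intros Hf; apply (cts_comp (fun u => c + u) f); ct. Qed.

#[export] Hint Resolve cts_reflect cts_translate : ct.

(* [X] is the coordinate along which the figure eight is elongated. *)
Record pendulum (q Lam C : R) (th ka X : R -> R) : Prop := {
  pd_q : 0 < q;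
  pd_Lam : 0 < Lam;
  pd_th : forall s, is_derive th s (ka s);
  pd_ka : forall s, is_derive ka s (- Lam * sin (th s));
  pd_X : forall s, is_derive X s (cos (th s));
  pd_energy : forall s, ka s ^ 2 = 2 * Lam * cos (th s) + 2 * C;
  pd_th_odd : forall s, th (- s) = - th s;
  pd_ka_even : forall s, ka (- s) = ka s;
  pd_X_odd : forall s, X (- s) = - X s;
  pd_th_half : forall s, th (s + 2 * q) = - th s;
  pd_ka_half : forall s, ka (s + 2 * q) = - ka s;
  pd_X_half : forall s, X (s + 2 * q) = X s;
  pd_th_pos : forall s, 0 < s <= q -> 0 < th s < PI;
  pd_ka_pos : forall s, 0 <= s < q -> 0 < ka s }.

Section Pendulum.
Context (q Lam C : R) (th ka X : R -> R) (H : pendulum q Lam C th ka X).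

Let q_pos := pd_q _ _ _ _ _ _ H.
Let Lam_pos := pd_Lam _ _ _ _ _ _ H.
Let D_th := pd_th _ _ _ _ _ _ H.
Let D_ka := pd_ka _ _ _ _ _ _ H.
Let D_X := pd_X _ _ _ _ _ _ H.

Lemma pd_cts_th : cts th. Proof. exact (is_derive_cts _ _ D_th). Qed.
Lemma pd_cts_ka : cts ka. Proof. exact (is_derive_cts _ _ D_ka). Qed.
Lemma pd_cts_X : cts X. Proof. exact (is_derive_cts _ _ D_X). Qed.
#[local] Hint Resolve pd_cts_th pd_cts_ka pd_cts_X : ct.

Lemma pd_th0 : th 0 = 0.
Proof. assert (E := pd_th_odd _ _ _ _ _ _ H 0); rewrite Ropp_0 in E; lra. Qed.

Lemma pd_X0 : X 0 = 0.
Proof. assert (E := pd_X_odd _ _ _ _ _ _ H 0); rewrite Ropp_0 in E; lra. Qed.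

(** In these names the suffix encodes the argument: [2m] stands for 2 q - u, [2p] for 2 q + u, [3m]
    for 3 q - v, and so on. *)
Lemma pd_th_2m (u : R) : th (2 * q - u) = th u.
Proof.
replace (2 * q - u) with (- u + 2 * q) by ring.
rewrite (pd_th_half _ _ _ _ _ _ H), (pd_th_odd _ _ _ _ _ _ H); ring.
Qed.
Lemma pd_th_2p (u : R) : th (2 * q + u) = - th u.
Proof. rewrite Rplus_comm; apply (pd_th_half _ _ _ _ _ _ H). Qed.
Lemma pd_th_4m (u : R) : th (4 * q - u) = - th u.
Proof. replace (4 * q - u) with (2 * q + (2 * q - u)) by ring; rewrite pd_th_2p, pd_th_2m; ring. Qed.
Lemma pd_ka_2m (u : R) : ka (2 * q - u) = - ka u.
Proof.
replace (2 * q - u) with (- u + 2 * q) by ring.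
rewrite (pd_ka_half _ _ _ _ _ _ H), (pd_ka_even _ _ _ _ _ _ H); ring.
Qed.
Lemma pd_ka_2p (u : R) : ka (2 * q + u) = - ka u.
Proof. rewrite Rplus_comm; apply (pd_ka_half _ _ _ _ _ _ H). Qed.
Lemma pd_ka_4m (u : R) : ka (4 * q - u) = ka u.
Proof. replace (4 * q - u) with (2 * q + (2 * q - u)) by ring; rewrite pd_ka_2p, pd_ka_2m; ring. Qed.
Lemma pd_th_1p (v : R) : th (q + v) = th (q - v).
Proof. replace (q + v) with (2 * q - (q - v)) by ring; apply pd_th_2m. Qed.
Lemma pd_th_3m (v : R) : th (3 * q - v) = - th (q - v).
Proof. replace (3 * q - v) with (2 * q + (q - v)) by ring; apply pd_th_2p. Qed.
Lemma pd_th_3p (v : R) : th (3 * q + v) = - th (q - v).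
Proof. replace (3 * q + v) with (4 * q - (q - v)) by ring; apply pd_th_4m. Qed.
Lemma pd_ka_1p (v : R) : ka (q + v) = - ka (q - v).
Proof. replace (q + v) with (2 * q - (q - v)) by ring; apply pd_ka_2m. Qed.
Lemma pd_ka_3m (v : R) : ka (3 * q - v) = - ka (q - v).
Proof. replace (3 * q - v) with (2 * q + (q - v)) by ring; apply pd_ka_2p. Qed.
Lemma pd_ka_3p (v : R) : ka (3 * q + v) = ka (q - v).
Proof. replace (3 * q + v) with (4 * q - (q - v)) by ring; apply pd_ka_4m. Qed.

Lemma pd_kaq : ka q = 0.
Proof. assert (E := pd_ka_2m q); replace (2 * q - q) with q in E by ring; lra. Qed.
Lemma pd_th_3q : th (3 * q) = - th q.
Proof. replace (3 * q) with (2 * q + q) by ring; apply pd_th_2p. Qed.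
Lemma pd_ka_3q : ka (3 * q) = 0.
Proof. replace (3 * q) with (2 * q + q) by ring; rewrite pd_ka_2p, pd_kaq; ring. Qed.
Lemma pd_th_2q : th (2 * q) = 0.
Proof. replace (2 * q) with (2 * q + 0) by ring; rewrite pd_th_2p, pd_th0; ring. Qed.
Lemma pd_X_2q : X (2 * q) = 0.
Proof. replace (2 * q) with (0 + 2 * q) by ring; rewrite (pd_X_half _ _ _ _ _ _ H), pd_X0; ring. Qed.

Lemma pd_th_period (s : R) : th (s + 4 * q) = th s.
Proof.
replace (s + 4 * q) with (2 * q + (2 * q + s)) by ring; rewrite !pd_th_2p; ring.
Qed.
Lemma pd_ka_period (s : R) : ka (s + 4 * q) = ka s.
Proof.
replace (s + 4 * q) with (2 * q + (2 * q + s)) by ring; rewrite !pd_ka_2p; ring.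
Qed.
Lemma pd_X_period (s : R) : X (s + 4 * q) = X s.
Proof.
replace (s + 4 * q) with ((s + 2 * q) + 2 * q) by ring; rewrite !(pd_X_half _ _ _ _ _ _ H); ring.
Qed.

Lemma pd_S_pos : 0 < sin (th q).
Proof. destruct (pd_th_pos _ _ _ _ _ _ H q) as [A B]; [lra|]; apply sin_gt_0; assumption. Qed.

Lemma pd_C_eq : C = - Lam * cos (th q).
Proof. assert (E := pd_energy _ _ _ _ _ _ H q); rewrite pd_kaq in E; lra. Qed.

Lemma pd_C_lt : C ^ 2 < Lam ^ 2.
Proof.
rewrite pd_C_eq; assert (E := sin2_cos2 (th q)); assert (S := pd_S_pos).
unfold Rsqr in E; assert (0 < Lam ^ 2) by (apply pow_lt; assumption).
assert (0 < sin (th q) * sin (th q)) by (apply Rmult_lt_0_compat; assumption).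
replace ((- Lam * cos (th q)) ^ 2) with (Lam ^ 2 * (1 - sin (th q) * sin (th q)))
  by (replace (1 - sin (th q) * sin (th q)) with (cos (th q) * cos (th q)) by lra; ring).
nra.
Qed.

Lemma pd_th_incr (s t : R) : 0 <= s -> s <= t <= q -> th s <= th t.
Proof.
intros Hs Ht.
assert (E : RInt ka s t = th t - th s) by (apply int_deriv; ct).
assert (0 <= RInt ka s t).
{ apply int_ge0; ct; [lra|]; intros u Hu.
  destruct (Req_dec u q) as [->|Hu']; [rewrite pd_kaq; lra|].
  apply Rlt_le, (pd_ka_pos _ _ _ _ _ _ H); lra. }
lra.
Qed.

(** Comparison constant for [jform_pointwise]. The angle th q may exceed PI / 2, so sin th can rise
    and then fall, but on [s, q] it never drops below the smaller of its two end values; the product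
    of two numbers in (0, 1] is below both. *)
Lemma pd_sin_compare (s t : R) : 0 < s -> s <= t <= q -> sin (th q) * sin (th s) <= sin (th t).
Proof.
intros Hs Ht.
assert (A := pd_th_incr s t ltac:(lra) Ht); assert (B := pd_th_incr t q ltac:(lra) ltac:(lra)).
assert (P1 := pd_th_pos _ _ _ _ _ _ H s ltac:(lra)).
assert (P2 := pd_th_pos _ _ _ _ _ _ H q ltac:(lra)).
assert (S1 := pd_S_pos); assert (S2 : 0 < sin (th s)) by (apply sin_gt_0; lra).
assert (B1 := SIN_bound (th s)); assert (B2 := SIN_bound (th q)).
destruct (Rle_dec (th t) (PI / 2)) as [L|L].
- apply Rle_trans with (sin (th s)); [nra|].
  apply sin_incr_1; lra.
- apply Rle_trans with (sin (th q)); [nra|].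
  apply sin_decr_1; lra.
Qed.

(** [ka] decreases on [0, q], so read backwards from [q] the comparison constant is 1. *)
Lemma pd_ka_compare (s t : R) : 0 < s -> s <= t <= q -> 1 * ka (q - s) <= ka (q - t).
Proof.
intros Hs Ht.
assert (E : RInt (fun u => - Lam * sin (th u)) (q - t) (q - s) = ka (q - s) - ka (q - t))
  by (apply int_deriv; ct).
assert (0 <= RInt (fun u => - (- Lam * sin (th u))) (q - t) (q - s)).
{ apply int_ge0; ct; [lra|]; intros u Hu.
  destruct (Req_dec u 0) as [->|Hu']; [rewrite pd_th0, sin_0; lra|].
  assert (P1 := pd_th_pos _ _ _ _ _ _ H u ltac:(lra)).
  assert (0 < sin (th u)) by (apply sin_gt_0; lra); nra. }
rewrite int_opp in H0 by ct; lra.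
Qed.

Definition pot (s : R) : R := ka s ^ 2 + Lam * cos (th s).
(** The pendulum equation linearized at [th] is b'' + [pot_planar] b = 0, and [ka] solves it. In the
    normal direction the potential [pot] carries an additional ka^2, and there [sin th] is a
    solution. *)
Definition pot_planar (s : R) : R := Lam * cos (th s).

Lemma cts_pot : cts pot. Proof. unfold pot; ct. Qed.
Lemma cts_pot_planar : cts pot_planar. Proof. unfold pot_planar; ct. Qed.
#[local] Hint Resolve cts_pot cts_pot_planar : ct.

Lemma jacobi_data_sin : jacobi_data q pot (fun s => sin (th s)) (fun s => cos (th s) * ka s).
Proof.
split; ct.
- intros s; ader.
- intros s; unfold pot; ader.
- rewrite pd_th0; apply sin_0.
- rewrite pd_th0, cos_0, Rmult_1_l; apply (pd_ka_pos _ _ _ _ _ _ H); lra.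
- rewrite pd_kaq; ring.
- intros s Hs; destruct (pd_th_pos _ _ _ _ _ _ H s Hs); apply sin_gt_0; assumption.
Qed.

(** The interval is read backwards, from [q], where [ka] vanishes, to 0, where its derivative
    does. *)
Lemma jacobi_data_ka :
  jacobi_data q (fun v => pot_planar (q - v)) (fun v => ka (q - v)) (fun v => Lam * sin (th (q - v))).
Proof.
split; ct.
- intros s; ader.
- intros s; unfold pot_planar; ader.
- rewrite Rminus_0_r; apply pd_kaq.
- rewrite Rminus_0_r; apply Rmult_lt_0_compat; [assumption|apply pd_S_pos].
- unfold Rminus; rewrite Rplus_opp_r, pd_th0, sin_0; ring.
- intros s Hs; apply (pd_ka_pos _ _ _ _ _ _ H); lra.
Qed.

Let l := 4 * q.

Lemma int_cos_th : RInt (fun s => cos (th s)) 0 l = 0.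
Proof.
rewrite (int_deriv X); ct; unfold l.
replace (4 * q) with (0 + 4 * q) by ring; rewrite pd_X_period; rring.
Qed.

Lemma int_ka_sqr : RInt (fun s => ka s ^ 2) 0 l = 2 * C * l.
Proof.
rewrite (int_ext _ (fun s => 2 * Lam * cos (th s) + 2 * C)) by (apply (pd_energy _ _ _ _ _ _ H)).
rewrite int_plus, int_scal, int_const, int_cos_th by ct; rring.
Qed.

Lemma pd_C_ge0 : 0 <= C.
Proof.
assert (E := int_ka_sqr); assert (0 <= RInt (fun s => ka s ^ 2) 0 l).
{ apply int_ge0; ct; [unfold l; lra|]; intros; apply pow2_ge_0. }
unfold l in *; nra.
Qed.

(** A virial identity: the derivative of ka sin th has mean zero, and as cos th has mean zero too,
    the integral of sin^2 is twice that of cos^2, while the two add up to [l]. *)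
Lemma int_sin_sqr_th : RInt (fun s => sin (th s) ^ 2) 0 l = 2 * l / 3.
Proof.
assert (E1 : RInt (fun s => sin (th s) ^ 2 + cos (th s) ^ 2) 0 l = l).
{ rewrite (int_ext _ (fun _ => 1)), int_const; [rring|].
  intros s; assert (E := sin2_cos2 (th s)); unfold Rsqr in E; as_real; simpl; lra. }
assert (E2 : RInt (fun s => (2 * Lam * cos (th s) + 2 * C) * cos (th s) - Lam * sin (th s) ^ 2) 0 l
   = ka l * sin (th l) - ka 0 * sin (th 0)).
{ apply (int_deriv (fun s => ka s * sin (th s))); [|ct].
  intros s; ader.
  replace (1 * ka s * cos (th s)) with (ka s * cos (th s)) by ring.
  replace (2 * Lam * cos (th s) + 2 * C) with (ka s * ka s)
    by (assert (E := pd_energy _ _ _ _ _ _ H s); simpl in E; lra).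
  ring. }
unfold l in E2 at 2 3; replace (4 * q) with (0 + 4 * q) in E2 by ring.
rewrite pd_th_period, pd_ka_period, Rminus_diag in E2.
rewrite (int_ext _ (fun s => 2 * Lam * cos (th s) ^ 2 + 2 * C * cos (th s) - Lam * sin (th s) ^ 2)) in E2
  by (intros; ring).
rewrite int_minus, int_plus, !int_scal, int_cos_th in E2 by ct.
rewrite int_plus in E1 by ct.
set (A := RInt (fun s => sin (th s) ^ 2) 0 l) in *; set (B := RInt (fun s => cos (th s) ^ 2) 0 l) in *.
assert (Lam * (2 * B - A) = 0) by lra.
apply Rmult_integral in H0; as_real; destruct H0; lra.
Qed.

(* Along these two fields the second variation is not positive; both solve
   the Jacobi equation up to the right-hand sides found below. *)
Definition normal_field (s : R) : R := X s * sin (th s) + ka s * cos (th s) / Lam.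
Definition normal_field' (s : R) : R := ka s * (X s * cos (th s) - ka s * sin (th s) / Lam).
Definition plane_field (s : R) : R := X s * ka s - 2 * sin (th s).
Definition plane_field' (s : R) : R := - cos (th s) * ka s - X s * Lam * sin (th s).

Lemma is_derive_normal_field (s : R) : is_derive normal_field s (normal_field' s).
Proof. unfold normal_field, normal_field'; ader; field; lra. Qed.

Lemma is_derive_normal_field' (s : R) : is_derive normal_field' s (2 * ka s - pot s * normal_field s).
Proof.
unfold normal_field, normal_field', pot; ader.
assert (E := sin2_cos2 (th s)); unfold Rsqr in E.
transitivity (2 * ka s * (sin (th s) * sin (th s) + cos (th s) * cos (th s))
  - (ka s ^ 2 + Lam * cos (th s)) * (X s * sin (th s) + ka s * cos (th s) / Lam)).
- field; lra.
- rewrite E; ring.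
Qed.

Lemma is_derive_plane_field (s : R) : is_derive plane_field s (plane_field' s).
Proof. unfold plane_field, plane_field'; ader. Qed.

Lemma is_derive_plane_field' (s : R) : is_derive plane_field' s (2 * C * sin (th s) - pot_planar s * plane_field s).
Proof.
unfold plane_field, plane_field', pot_planar; ader.
replace C with (ka s * ka s / 2 - Lam * cos (th s))
  by (assert (E := pd_energy _ _ _ _ _ _ H s); simpl in E; lra).
field.
Qed.

Lemma cts_normal_field : cts normal_field. Proof. exact (is_derive_cts _ _ is_derive_normal_field). Qed.
Lemma cts_normal_field' : cts normal_field'. Proof. exact (is_derive_cts _ _ is_derive_normal_field'). Qed.
Lemma cts_plane_field : cts plane_field. Proof. exact (is_derive_cts _ _ is_derive_plane_field). Qed.
Lemma cts_plane_field' : cts plane_field'. Proof. exact (is_derive_cts _ _ is_derive_plane_field'). Qed.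
#[local] Hint Resolve cts_normal_field cts_normal_field' cts_plane_field cts_plane_field' : ct.

Lemma normal_field_half (s : R) : normal_field (s + 2 * q) = - normal_field s.
Proof.
unfold normal_field; rewrite (pd_X_half _ _ _ _ _ _ H), (pd_th_half _ _ _ _ _ _ H), (pd_ka_half _ _ _ _ _ _ H),
  sin_neg, cos_neg; field; lra.
Qed.

Lemma normal_field'_half (s : R) : normal_field' (s + 2 * q) = - normal_field' s.
Proof.
unfold normal_field'; rewrite (pd_X_half _ _ _ _ _ _ H), (pd_th_half _ _ _ _ _ _ H), (pd_ka_half _ _ _ _ _ _ H),
  sin_neg, cos_neg; field; lra.
Qed.

Lemma plane_field_half (s : R) : plane_field (s + 2 * q) = - plane_field s.
Proof.
unfold plane_field; rewrite (pd_X_half _ _ _ _ _ _ H), (pd_th_half _ _ _ _ _ _ H), (pd_ka_half _ _ _ _ _ _ H),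
  sin_neg; ring.
Qed.

Lemma plane_field'_half (s : R) : plane_field' (s + 2 * q) = - plane_field' s.
Proof.
unfold plane_field'; rewrite (pd_X_half _ _ _ _ _ _ H), (pd_th_half _ _ _ _ _ _ H), (pd_ka_half _ _ _ _ _ _ H),
  sin_neg, cos_neg; ring.
Qed.

Lemma half_period (f : R -> R) : (forall s, f (s + 2 * q) = - f s) -> f l = f 0.
Proof.
intros E; unfold l; replace (4 * q) with (0 + 2 * q + 2 * q) by ring; rewrite !E; ring.
Qed.

Lemma int_half (f : R -> R) : cts f -> (forall s, f (s + 2 * q) = - f s) -> RInt f 0 l = 0.
Proof.
intros Cf E; unfold l; replace (4 * q) with (2 * (2 * q)) by ring.
apply int_antiperiodic; assumption.
Qed.

Lemma int_ka_normal_field : RInt (fun s => ka s * normal_field s) 0 l = l.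
Proof.
assert (E : RInt (fun s => ka s * normal_field s - 1) 0 l
  = (- X l * cos (th l) + sin (th l) * ka l / Lam) - (- X 0 * cos (th 0) + sin (th 0) * ka 0 / Lam)).
{ apply (int_deriv (fun s => - X s * cos (th s) + sin (th s) * ka s / Lam)); [|ct].
  intros s; unfold normal_field; ader.
  assert (E := sin2_cos2 (th s)); unfold Rsqr in E.
  transitivity (ka s * (X s * sin (th s) + ka s * cos (th s) / Lam)
    - (sin (th s) * sin (th s) + cos (th s) * cos (th s))).
  - field; lra.
  - rewrite E; ring. }
rewrite int_minus, int_const in E by ct.
replace l with (0 + 4 * q) in E at 3 4 5 6 by (unfold l; ring).
rewrite pd_X_period, pd_th_period, pd_ka_period in E. lra.
Qed.

Lemma int_sin_plane_field : RInt (fun s => sin (th s) * plane_field s) 0 l = - l.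
Proof.
assert (E : RInt (fun s => sin (th s) * plane_field s + 3 * sin (th s) ^ 2 - 1) 0 l
  = - X l * cos (th l) - (- X 0 * cos (th 0))).
{ apply (int_deriv (fun s => - X s * cos (th s))); [|ct].
  intros s; unfold plane_field; ader.
  assert (E := sin2_cos2 (th s)); unfold Rsqr in E.
  transitivity (sin (th s) * (X s * ka s - 2 * sin (th s)) + 3 * sin (th s) ^ 2
    - (sin (th s) * sin (th s) + cos (th s) * cos (th s))); [ring|].
  rewrite E; ring. }
rewrite int_minus, int_plus, int_scal, int_const, int_sin_sqr_th in E by ct.
replace l with (0 + 4 * q) in E at 4 5 by (unfold l; ring).
rewrite pd_X_period, pd_th_period in E. lra.
Qed.

Lemma pot_2m (u : R) : pot (2 * q - u) = pot u.
Proof. unfold pot; rewrite pd_ka_2m, pd_th_2m; ring. Qed.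
Lemma pot_2p (u : R) : pot (2 * q + u) = pot u.
Proof. unfold pot; rewrite pd_ka_2p, pd_th_2p, cos_neg; ring. Qed.
Lemma pot_4m (u : R) : pot (4 * q - u) = pot u.
Proof. unfold pot; rewrite pd_ka_4m, pd_th_4m, cos_neg; ring. Qed.
Lemma pot_planar_1p (v : R) : pot_planar (q + v) = pot_planar (q - v).
Proof. unfold pot_planar; rewrite pd_th_1p; ring. Qed.
Lemma pot_planar_3m (v : R) : pot_planar (3 * q - v) = pot_planar (q - v).
Proof. unfold pot_planar; rewrite pd_th_3m, cos_neg; ring. Qed.
Lemma pot_planar_3p (v : R) : pot_planar (3 * q + v) = pot_planar (q - v).
Proof. unfold pot_planar; rewrite pd_th_3p, cos_neg; ring. Qed.

Lemma pot_bound (s : R) : Rabs (pot s) <= 5 * Lam.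
Proof.
unfold pot; rewrite (pd_energy _ _ _ _ _ _ H).
assert (B := COS_bound (th s)); assert (C0 := pd_C_ge0); assert (C1 := pd_C_lt).
assert (C < Lam) by nra.
apply Rabs_le; nra.
Qed.

Lemma pot_planar_bound (s : R) : Rabs (pot_planar s) <= 5 * Lam.
Proof.
unfold pot_planar; assert (B := COS_bound (th s)); apply Rabs_le; nra.
Qed.

Lemma jform_fold_ends (y y' : R -> R) : cts y -> cts y' ->
  jform pot y y' l = jform pot y y' q
    + jform pot (fun u => y (2 * q - u)) (fun u => - y' (2 * q - u)) q
    + jform pot (fun u => y (2 * q + u)) (fun u => y' (2 * q + u)) q
    + jform pot (fun u => y (4 * q - u)) (fun u => - y' (4 * q - u)) q.
Proof.
intros Cy Cy'; unfold jform, l; rewrite int_fold_ends by ct.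
repeat f_equal; apply functional_extensionality; intros u;
  rewrite ?pot_2m, ?pot_2p, ?pot_4m; rring.
Qed.

Lemma jform_fold_nodes (y y' : R -> R) : cts y -> cts y' ->
  jform pot_planar y y' l = jform (fun v => pot_planar (q - v)) (fun u => y (q - u)) (fun u => - y' (q - u)) q
    + jform (fun v => pot_planar (q - v)) (fun u => y (q + u)) (fun u => y' (q + u)) q
    + jform (fun v => pot_planar (q - v)) (fun u => y (3 * q - u)) (fun u => - y' (3 * q - u)) q
    + jform (fun v => pot_planar (q - v)) (fun u => y (3 * q + u)) (fun u => y' (3 * q + u)) q.
Proof.
intros Cy Cy'; unfold jform, l; rewrite int_fold_nodes by ct.
repeat f_equal; apply functional_extensionality; intros u;
  rewrite ?pot_planar_1p, ?pot_planar_3m, ?pot_planar_3p; rring.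
Qed.

(** Pairing the form with an explicit field leaves, after integration by parts, only the right-hand
    side of the Jacobi equation of that field: here Lam, for [normal_field] 2 ka, for [plane_field]
    2 C sin th. Taking [w] among these fields evaluates the form on their span. *)
Lemma int_by_parts_cos (w w' : R -> R) : (forall s, is_derive w s (w' s)) -> cts w' -> w l = w 0 ->
  RInt (fun s => (- sin (th s) * ka s) * w' s - pot s * cos (th s) * w s) 0 l = - Lam * RInt w 0 l.
Proof.
intros Dw Cw' Hw; assert (Cw := is_derive_cts _ _ Dw).
assert (E : RInt (fun s => ((- sin (th s) * ka s) * w' s - pot s * cos (th s) * w s) + Lam * w s) 0 l
  = (- sin (th l) * ka l) * w l - (- sin (th 0) * ka 0) * w 0).
{ apply (int_deriv (fun s => - sin (th s) * ka s * w s)); [|ct].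
  intros s; unfold pot; ader.
  assert (E := sin2_cos2 (th s)); unfold Rsqr in E.
  transitivity (- sin (th s) * ka s * w' s - (ka s ^ 2 + Lam * cos (th s)) * cos (th s) * w s
    + Lam * (sin (th s) * sin (th s) + cos (th s) * cos (th s)) * w s); [ring|].
  rewrite E; ring. }
rewrite int_plus, int_scal in E by ct; rewrite Hw in E.
replace l with (0 + 4 * q) in E at 3 4 by (unfold l; ring).
rewrite pd_th_period, pd_ka_period in E; lra.
Qed.

Lemma int_by_parts_normal_field (w w' : R -> R) : (forall s, is_derive w s (w' s)) -> cts w' -> w l = w 0 ->
  RInt (fun s => normal_field' s * w' s - pot s * normal_field s * w s) 0 l = - 2 * RInt (fun s => ka s * w s) 0 l.
Proof.
intros Dw Cw' Hw; assert (Cw := is_derive_cts _ _ Dw); assert (D := is_derive_normal_field').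
assert (E : RInt (fun s => (normal_field' s * w' s - pot s * normal_field s * w s) + 2 * (ka s * w s)) 0 l
  = normal_field' l * w l - normal_field' 0 * w 0).
{ apply (int_deriv (fun s => normal_field' s * w s)); [|ct].
  intros s; ader. }
rewrite int_plus, int_scal in E by ct; rewrite Hw, (half_period normal_field') in E by apply normal_field'_half; lra.
Qed.

Lemma int_by_parts_plane_field (w w' : R -> R) : (forall s, is_derive w s (w' s)) -> cts w' -> w l = w 0 ->
  RInt (fun s => plane_field' s * w' s - pot_planar s * plane_field s * w s) 0 l
    = - 2 * C * RInt (fun s => sin (th s) * w s) 0 l.
Proof.
intros Dw Cw' Hw; assert (Cw := is_derive_cts _ _ Dw); assert (D := is_derive_plane_field').
assert (E : RInt (fun s => (plane_field' s * w' s - pot_planar s * plane_field s * w s) + 2 * C * (sin (th s) * w s)) 0 l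
  = plane_field' l * w l - plane_field' 0 * w 0).
{ apply (int_deriv (fun s => plane_field' s * w s)); [|ct].
  intros s; ader. }
rewrite int_plus, int_scal in E by ct; rewrite Hw, (half_period plane_field') in E by apply plane_field'_half; lra.
Qed.

Lemma is_derive_cos_th (s : R) : is_derive (fun s : R => cos (th s)) s (- sin (th s) * ka s).
Proof. ader. Qed.

Lemma cos_th_l : cos (th l) = cos (th 0).
Proof. unfold l; replace (4 * q) with (0 + 4 * q) by ring; rewrite pd_th_period; reflexivity. Qed.

Lemma int_ka_cos : RInt (fun s => ka s * cos (th s)) 0 l = 0.
Proof.
apply int_half; [ct|]; intros s.
rewrite (pd_th_half _ _ _ _ _ _ H), (pd_ka_half _ _ _ _ _ _ H), cos_neg; ring.
Qed.

Lemma int_normal_field : RInt normal_field 0 l = 0.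
Proof. apply int_half; [ct|apply normal_field_half]. Qed.

(** Polarization along the two explicit fields. All terms in [t1] disappear, since pairing with
    [cos th] gives a multiple of the mean of the other field, and [y], [cos th] and [normal_field]
    all have mean zero. *)
Lemma zform_split (z z' : R -> R) (t1 t2 : R) :
  (forall s, is_derive z s (z' s)) -> cts z' -> z l = z 0 -> RInt z 0 l = 0 ->
  let y := fun s => z s - t1 * cos (th s) - t2 * normal_field s in
  let y' := fun s => z' s - t1 * (- sin (th s) * ka s) - t2 * normal_field' s in
  RInt y 0 l = 0 /\
  RInt (fun s => ka s * z s) 0 l = RInt (fun s => ka s * y s) 0 l + t2 * l /\
  jform pot z z' l = jform pot y y' l - 4 * t2 * RInt (fun s => ka s * y s) 0 l - 2 * l * t2 ^ 2.
Proof.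
intros Dz Cz' Hz Iz y y'.
assert (Cz := is_derive_cts _ _ Dz).
assert (Dy : forall s, is_derive y s (y' s)).
{ intros s; unfold y, y'; assert (D := is_derive_normal_field); ader. }
assert (Cy := is_derive_cts _ _ Dy).
assert (Cy' : cts y') by (unfold y'; ct).
assert (Hy : y l = y 0) by (unfold y; rewrite Hz, cos_th_l, (half_period normal_field) by apply normal_field_half; reflexivity).
assert (Iy : RInt y 0 l = 0).
{ unfold y; rewrite !int_minus, !int_scal, Iz, int_cos_th, int_normal_field by ct; rring. }
split; [exact Iy|split].
- rewrite (int_ext (fun s => ka s * z s) (fun s => ka s * y s + t1 * (ka s * cos (th s)) + t2 * (ka s * normal_field s)))
    by (intros; unfold y; rring).
  rewrite !int_plus, !int_scal, int_ka_cos, int_ka_normal_field by ct; rring.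
- unfold jform.
  rewrite (int_ext (fun s => z' s ^ 2 - pot s * z s ^ 2) (fun s => (y' s ^ 2 - pot s * y s ^ 2)
    + 2 * t1 * ((- sin (th s) * ka s) * y' s - pot s * cos (th s) * y s)
    + t1 ^ 2 * ((- sin (th s) * ka s) * (- sin (th s) * ka s) - pot s * cos (th s) * cos (th s))
    + 2 * t1 * t2 * ((- sin (th s) * ka s) * normal_field' s - pot s * cos (th s) * normal_field s)
    + 2 * t2 * (normal_field' s * y' s - pot s * normal_field s * y s)
    + t2 ^ 2 * (normal_field' s * normal_field' s - pot s * normal_field s * normal_field s))) by (intros; unfold y, y'; rring).
  rewrite !int_plus, !int_scal by ct.
  rewrite (int_by_parts_cos y y'), (int_by_parts_cos (fun s : R => cos (th s)) _ is_derive_cos_th), (int_by_parts_cos normal_field normal_field'),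
    (int_by_parts_normal_field y y'), (int_by_parts_normal_field normal_field normal_field'), int_ka_normal_field, Iy, int_cos_th, int_normal_field; ct.
  + rring.
  + apply is_derive_normal_field.
  + apply half_period, normal_field_half.
  + apply is_derive_normal_field.
  + apply half_period, normal_field_half.
  + exact cos_th_l.
Qed.

(** Since z'^2 = (z'^2 - P z^2) + P z^2, a sup bound by a multiple of sqrt D and a bound of the form
    by D together control the H^1 norm. *)
Lemma H1_of_pointwise (P z z' : R -> R) (p k D : R) : cts P ->
  (forall s, is_derive z s (z' s)) -> cts z' -> 0 <= D -> 0 <= p ->
  (forall s, Rabs (P s) <= p) -> (forall s, 0 <= s <= l -> Rabs (z s) <= k * sqrt D) ->
  jform P z z' l <= D ->
  RInt (fun s => z s ^ 2 + z' s ^ 2) 0 l <= (1 + l * (1 + p) * k ^ 2) * D.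
Proof.
intros CP Dz Cz' HD Hp HP Hz HJ; assert (Cz := is_derive_cts _ _ Dz).
rewrite (int_ext _ (fun s => (z' s ^ 2 - P s * z s ^ 2) + (1 + P s) * z s ^ 2)) by (intros; ring).
rewrite int_plus by ct.
assert (RInt (fun s => (1 + P s) * z s ^ 2) 0 l <= RInt (fun _ => (1 + p) * (k ^ 2 * D)) 0 l).
{ apply int_le; ct; [unfold l; lra|]; intros s Hs.
  specialize (HP s); specialize (Hz s Hs); apply Rabs_le_between in HP.
  assert (z s ^ 2 <= k ^ 2 * D).
  { rewrite <- (sqrt_sqrt D HD), <- pow2_abs.
    replace (k ^ 2 * (sqrt D * sqrt D)) with ((k * sqrt D) ^ 2) by ring.
    apply pow_incr; split; [apply Rabs_pos|assumption]. }
  assert (P2 := pow2_ge_0 (z s)); nra. }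
rewrite int_const in H0; unfold jform in HJ; lra.
Qed.

Lemma fold_ends_cases (s : R) : 0 <= s <= l ->
  exists u, 0 <= u <= q /\ (s = u \/ s = 2 * q - u \/ s = 2 * q + u \/ s = 4 * q - u).
Proof.
unfold l; intros Hs; destruct (Rle_dec s q) as [A|A]; [exists s; split; [lra|tauto]|].
destruct (Rle_dec s (2 * q)) as [B|B]; [exists (2 * q - s); split; [lra|right; left; ring]|].
destruct (Rle_dec s (3 * q)) as [D|D]; [exists (s - 2 * q); split; [lra|right; right; left; ring]|].
exists (4 * q - s); split; [lra|right; right; right; ring].
Qed.

Lemma fold_nodes_cases (s : R) : 0 <= s <= l ->
  exists u, 0 <= u <= q /\ (s = q - u \/ s = q + u \/ s = 3 * q - u \/ s = 3 * q + u).
Proof.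
unfold l; intros Hs; destruct (Rle_dec s q) as [A|A]; [exists (q - s); split; [lra|left; ring]|].
destruct (Rle_dec s (2 * q)) as [B|B]; [exists (s - q); split; [lra|right; left; ring]|].
destruct (Rle_dec s (3 * q)) as [D|D]; [exists (3 * q - s); split; [lra|right; right; left; ring]|].
exists (s - 3 * q); split; [lra|right; right; right; ring].
Qed.

Lemma abs_le_of_sqr (x k D : R) : 0 <= k -> 0 <= D -> x ^ 2 <= k * D -> Rabs x <= sqrt k * sqrt D.
Proof.
intros Hk HD Hx; rewrite <- sqrt_mult by assumption.
rewrite <- (sqrt_Rsqr_abs x); apply sqrt_le_1_alt; unfold Rsqr; simpl in Hx; lra.
Qed.

(* On each half period [y] is controlled up to a multiple of the Jacobi field [sin th]. *)
Lemma zform_pointwise : exists k : R, 0 < k /\ forall (y y' : R -> R) (D : R),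
  (forall s, is_derive y s (y' s)) -> cts y' -> y 0 = 0 -> y (2 * q) = 0 -> y (4 * q) = 0 ->
  jform pot y y' l <= D ->
  0 <= jform pot y y' l /\
  forall u, 0 <= u <= q ->
    Rabs (y u - y q * (sin (th u) / sin (th q))) <= k * sqrt D /\
    Rabs (y (2 * q - u) - y q * (sin (th u) / sin (th q))) <= k * sqrt D /\
    Rabs (y (2 * q + u) - y (3 * q) * (sin (th u) / sin (th q))) <= k * sqrt D /\
    Rabs (y (4 * q - u) - y (3 * q) * (sin (th u) / sin (th q))) <= k * sqrt D.
Proof.
assert (S := pd_S_pos); assert (J := jacobi_data_sin).
set (k2 := q / sin (th q) ^ 2).
assert (Hk2 : 0 < k2) by (apply Rdiv_lt_0_compat; [|apply pow_lt]; assumption).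
exists (sqrt k2); split; [apply sqrt_lt_R0; assumption|].
intros y y' D Dy Cy' Y0 Y2 Y4 HD; assert (Cy := is_derive_cts _ _ Dy).
rewrite jform_fold_ends in HD |- * by assumption.
assert (D2 := is_derive_reflect y y' (2 * q) Dy); assert (D3 := is_derive_translate y y' (2 * q) Dy).
assert (D4 := is_derive_reflect y y' (4 * q) Dy).
assert (C2 : cts (fun u => - y' (2 * q - u))) by ct.
assert (C3 : cts (fun u => y' (2 * q + u))) by ct.
assert (C4 : cts (fun u => - y' (4 * q - u))) by ct.
assert (Z2 : y (2 * q - 0) = 0) by (rewrite Rminus_0_r; assumption).
assert (Z3 : y (2 * q + 0) = 0) by (rewrite Rplus_0_r; assumption).
assert (Z4 : y (4 * q - 0) = 0) by (rewrite Rminus_0_r; assumption).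
assert (P1 := jform_pos _ _ _ _ J _ _ Dy Cy' Y0).
assert (P2 := jform_pos _ _ _ _ J (fun u => y (2 * q - u)) (fun u => - y' (2 * q - u)) D2 C2 Z2).
assert (P3 := jform_pos _ _ _ _ J (fun u => y (2 * q + u)) (fun u => y' (2 * q + u)) D3 C3 Z3).
assert (P4 := jform_pos _ _ _ _ J (fun u => y (4 * q - u)) (fun u => - y' (4 * q - u)) D4 C4 Z4).
split; [lra|]; intros u Hu.
assert (B1 := jform_pointwise _ _ _ _ J _ S pd_sin_compare _ _ Dy Cy' Y0 u Hu).
assert (B2 := jform_pointwise _ _ _ _ J _ S pd_sin_compare (fun u => y (2 * q - u))
  (fun u => - y' (2 * q - u)) D2 C2 Z2 u Hu).
assert (B3 := jform_pointwise _ _ _ _ J _ S pd_sin_compare (fun u => y (2 * q + u))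
  (fun u => y' (2 * q + u)) D3 C3 Z3 u Hu).
assert (B4 := jform_pointwise _ _ _ _ J _ S pd_sin_compare (fun u => y (4 * q - u))
  (fun u => - y' (4 * q - u)) D4 C4 Z4 u Hu).
cbv beta in B1, B2, B3, B4.
replace (2 * q - q) with q in B2 by ring; replace (2 * q + q) with (3 * q) in B3 by ring.
replace (4 * q - q) with (3 * q) in B4 by ring.
fold k2 in B1, B2, B3, B4.
repeat split; apply abs_le_of_sqr; try lra;
  (eapply Rle_trans; [eassumption|]; apply Rmult_le_compat_l; lra).
Qed.

Lemma int_sin_quarter : 0 < RInt (fun u => sin (th u)) 0 q.
Proof.
apply RInt_gt_0; [assumption| |].
- intros x Hx; destruct (pd_th_pos _ _ _ _ _ _ H x); [lra|]; apply sin_gt_0; assumption.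
- intros x _; apply (cts_sin th pd_cts_th).
Qed.

Lemma int_sin_th : RInt (fun s => sin (th s)) 0 l = 0.
Proof.
apply int_half; [ct|]; intros s; rewrite (pd_th_half _ _ _ _ _ _ H); apply sin_neg.
Qed.

Lemma Rabs_sum3 (a b c x y z : R) : Rabs a <= x -> Rabs b <= y -> Rabs c <= z ->
  Rabs (a + b + c) <= x + y + z.
Proof.
intros; eapply Rle_trans; [apply Rabs_triang|]; apply Rplus_le_compat; [|assumption].
eapply Rle_trans; [apply Rabs_triang|]; lra.
Qed.

Lemma Rabs_mult_le (a b x y : R) : Rabs a <= x -> Rabs b <= y -> Rabs (a * b) <= x * y.
Proof.
intros; rewrite Rabs_mult; apply Rmult_le_compat; auto using Rabs_pos.
Qed.

(** Once the squares are completed, everything is bounded by the square root of the total [D], one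
    quantity after another: the two products with [ka] and hence the coefficient [t2], then [t1]
    from the condition at 0, [y q] from the condition at q, [y (3 * q)] from the zero mean, then all
    of [y], and finally [z]. *)
Lemma zform_coercive (B : R) : 2 < B -> exists c : R, 0 < c /\
  forall z z' : R -> R, (forall s, is_derive z s (z' s)) -> cts z' -> z l = z 0 ->
  RInt z 0 l = 0 -> z 0 = 0 -> z q = 0 ->
  c * RInt (fun s => z s ^ 2 + z' s ^ 2) 0 l
    <= jform pot z z' l + B / l * RInt (fun s => ka s * z s) 0 l ^ 2.
Proof.
intros HB; destruct zform_pointwise as [k [Hk HP]].
assert (S := pd_S_pos); assert (I := int_sin_quarter); set (I0 := RInt _ 0 q) in I.
assert (Hl : 0 < l) by (unfold l; lra).
destruct (cts_bounded normal_field 0 l ltac:(lra) cts_normal_field) as [MA [HMA BA]].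
(* Bounds in units of sqrt D: [a1] for K2, [a2] for K1, [a3] for t2, [a4] for y at q, [a5] for y at
   3 q, and [a6] for z on the whole period. *)
set (a1 := sqrt (l / 2)); set (a2 := sqrt (l / (B - 2))).
set (a3 := (a1 + a2) / l).
set (a4 := 2 * MA * a3).
set (a5 := a4 + 2 * q * k * sin (th q) / I0).
set (a6 := a3 * MA + a3 * MA + (k + a5 / sin (th q))).
assert (H1 : 0 <= a1) by apply sqrt_pos; assert (H2 : 0 <= a2) by apply sqrt_pos.
assert (H3 : 0 <= a3) by (apply Rmult_le_pos; [lra|apply Rlt_le, Rinv_0_lt_compat; lra]).
assert (H4 : 0 <= a4) by (unfold a4; nra).
assert (Hpos : 0 < 1 + l * (1 + 5 * Lam) * a6 ^ 2).
{ assert (0 <= a6 ^ 2) by apply pow2_ge_0. assert (0 <= l * (1 + 5 * Lam)) by nra. nra. }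
exists (/ (1 + l * (1 + 5 * Lam) * a6 ^ 2)); split; [apply Rinv_0_lt_compat; exact Hpos|].
intros z z' Dz Cz' Hz Iz Z0 Zq; assert (Cz := is_derive_cts _ _ Dz).
(* At 0 and 2 q the field [cos th] takes equal values and [normal_field] opposite ones, so these
   coefficients make [y] vanish at both points. *)
set (t2 := (z 0 - z (2 * q)) / (2 * normal_field 0)).
set (t1 := (z 0 + z (2 * q)) / 2).
assert (EA0 : normal_field 0 = ka 0 / Lam) by (unfold normal_field; rewrite pd_X0, pd_th0, cos_0; field; lra).
assert (HA0 : 0 < normal_field 0).
{ rewrite EA0; apply Rdiv_lt_0_compat; [apply (pd_ka_pos _ _ _ _ _ _ H)|]; lra. }
pose (y := fun s => z s - t1 * cos (th s) - t2 * normal_field s).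
pose (y' := fun s => z' s - t1 * (- sin (th s) * ka s) - t2 * normal_field' s).
set (K1 := RInt (fun s => ka s * z s) 0 l); set (K2 := RInt (fun s => ka s * y s) 0 l).
assert (ZS : RInt y 0 l = 0 /\ K1 = K2 + t2 * l /\
  jform pot z z' l = jform pot y y' l - 4 * t2 * K2 - 2 * l * t2 ^ 2)
  by exact (zform_split z z' t1 t2 Dz Cz' Hz Iz).
destruct ZS as [Iy [Ez EJ]].
assert (Dy : forall s, is_derive y s (y' s)).
{ intros s; unfold y, y'; assert (D := is_derive_normal_field); ader. }
assert (Cy := is_derive_cts _ _ Dy).
assert (Cy' : cts y') by (unfold y'; ct).
assert (EA2 : normal_field (2 * q) = - normal_field 0) by (replace (2 * q) with (0 + 2 * q) by ring; apply normal_field_half).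
assert (Y0 : y 0 = 0).
{ unfold y, t1, t2; rewrite pd_th0, cos_0; field; lra. }
assert (Y2 : y (2 * q) = 0).
{ unfold y; rewrite EA2, pd_th_2q, cos_0; unfold t1, t2; field; lra. }
assert (Y4 : y (4 * q) = 0).
{ fold l; unfold y; rewrite Hz, cos_th_l, (half_period normal_field) by apply normal_field_half; exact Y0. }
set (D := jform pot z z' l + B / l * K1 ^ 2).
(* This identity is where the threshold [2] comes from. *)
assert (ED : D = jform pot y y' l + 2 / l * K2 ^ 2 + (B - 2) / l * K1 ^ 2).
{ unfold D; rewrite EJ; replace K1 with (K2 + t2 * l) by (symmetry; exact Ez); field; lra. }
assert (P1 := pow2_ge_0 K1); assert (P2 := pow2_ge_0 K2).
assert (Hl2 : 0 < 2 / l) by (apply Rdiv_lt_0_compat; lra).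
assert (Hl3 : 0 < (B - 2) / l) by (apply Rdiv_lt_0_compat; lra).
assert (Hl4 : 0 < B / l) by (apply Rdiv_lt_0_compat; lra).
assert (Q1 : 0 <= 2 / l * K2 ^ 2) by (apply Rmult_le_pos; lra).
assert (Q2 : 0 <= (B - 2) / l * K1 ^ 2) by (apply Rmult_le_pos; lra).
assert (Q3 : 0 <= B / l * K1 ^ 2) by (apply Rmult_le_pos; lra).
destruct (HP y y' D Dy Cy' Y0 Y2 Y4 ltac:(lra)) as [JP PW].
assert (HD : 0 <= D) by lra; set (r := sqrt D) in *; assert (Hr : 0 <= r) by apply sqrt_pos.
assert (B2 : Rabs K2 <= a1 * r).
{ apply abs_le_of_sqr; [apply Rlt_le, Rdiv_lt_0_compat; lra|assumption|].
  replace (K2 ^ 2) with (l / 2 * (2 / l * K2 ^ 2)) by (field; lra).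
  apply Rmult_le_compat_l; lra. }
assert (B1 : Rabs K1 <= a2 * r).
{ apply abs_le_of_sqr; [apply Rlt_le, Rdiv_lt_0_compat; lra|assumption|].
  replace (K1 ^ 2) with (l / (B - 2) * ((B - 2) / l * K1 ^ 2)) by (field; lra).
  apply Rmult_le_compat_l; [|lra]. apply Rlt_le, Rdiv_lt_0_compat; lra. }
assert (T2 : Rabs t2 <= a3 * r).
{ replace t2 with ((K1 + - K2) * / l) by (rewrite Ez; field; lra).
  replace (a3 * r) with ((a2 * r + a1 * r) * / l) by (unfold a3; field; lra).
  rewrite Rabs_mult, (Rabs_pos_eq (/ l)) by (apply Rlt_le, Rinv_0_lt_compat; lra).
  apply Rmult_le_compat_r; [apply Rlt_le, Rinv_0_lt_compat; lra|].
  eapply Rle_trans; [apply Rabs_triang|]; rewrite Rabs_Ropp; lra. }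
assert (T1 : Rabs t1 <= a3 * MA * r).
{ replace t1 with (- t2 * normal_field 0).
  - replace (a3 * MA * r) with ((a3 * r) * MA) by ring.
    apply Rabs_mult_le; [rewrite Rabs_Ropp; assumption|apply BA; lra].
  - unfold y in Y0; rewrite pd_th0, cos_0 in Y0; lra. }
assert (Yq : Rabs (y q) <= a4 * r).
{ replace (y q) with (0 + - t1 * cos (th q) + - t2 * normal_field q) by (unfold y; rewrite Zq; ring).
  replace (a4 * r) with (0 + (a3 * MA * r) * 1 + (a3 * r) * MA) by (unfold a4; ring).
  apply Rabs_sum3.
  - rewrite Rabs_R0; lra.
  - apply Rabs_mult_le; [rewrite Rabs_Ropp; assumption|].
    assert (E := COS_bound (th q)); apply Rabs_le; lra.
  - apply Rabs_mult_le; [rewrite Rabs_Ropp; assumption|].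
    apply BA; unfold l; lra. }
(* The value at 3 q is not pinned; it comes from the zero mean of [y]. Up to small errors the four
   quarters of [y] add up to c sin th, whose integral over a quarter is c I0 with I0 > 0. *)
assert (Y3 : Rabs (y (3 * q)) <= a5 * r).
{ unfold l in Iy; rewrite int_fold_ends in Iy by ct.
  set (c := 2 * (y q + y (3 * q)) / sin (th q)).
  pose (e := fun u => (y u + y (2 * q - u) + y (2 * q + u) + y (4 * q - u)) - c * sin (th u)).
  assert (E1 : RInt e 0 q = - c * I0).
  { unfold e, I0; rewrite int_minus, !int_plus, int_scal by ct; as_real; lra. }
  assert (E2 : Rabs (RInt e 0 q) <= 4 * k * r * q).
  { eapply Rle_trans; [apply int_abs; [lra|unfold e; ct]|].
    replace (4 * k * r * q) with (RInt (fun _ => 4 * k * r) 0 q) by (rewrite int_const; rring).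
    apply int_le; [lra|unfold e; ct|ct|]; intros u Hu.
    destruct (PW u Hu) as [A1 [A2 [A3 A4]]].
    replace (e u) with ((y u - y q * (sin (th u) / sin (th q)))
      + (y (2 * q - u) - y q * (sin (th u) / sin (th q)))
      + (y (2 * q + u) - y (3 * q) * (sin (th u) / sin (th q)))
      + (y (4 * q - u) - y (3 * q) * (sin (th u) / sin (th q)))) by (unfold e, c; field; lra).
    eapply Rle_trans; [apply Rabs_triang|].
    assert (A5 := Rabs_sum3 _ _ _ _ _ _ A1 A2 A3); lra. }
  rewrite E1, Rabs_mult, Rabs_Ropp, (Rabs_pos_eq I0) in E2 by lra.
  assert (E3 : Rabs (y q + y (3 * q)) <= 2 * q * k * sin (th q) / I0 * r).
  { replace (y q + y (3 * q)) with (c * (sin (th q) / 2)) by (unfold c; field; lra).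
    rewrite Rabs_mult, (Rabs_pos_eq (sin (th q) / 2)) by lra.
    apply Rmult_le_reg_r with I0; [assumption|].
    replace (2 * q * k * sin (th q) / I0 * r * I0) with (4 * k * r * q * (sin (th q) / 2)) by (field; lra).
    replace (Rabs c * (sin (th q) / 2) * I0) with (Rabs c * I0 * (sin (th q) / 2)) by ring.
    apply Rmult_le_compat_r; lra. }
  replace (y (3 * q)) with ((y q + y (3 * q)) + - y q) by ring.
  eapply Rle_trans; [apply Rabs_triang|]; rewrite Rabs_Ropp; unfold a5; lra. }
assert (H45 : a4 <= a5).
{ unfold a5; assert (0 <= 2 * q * k * sin (th q) / I0); [|lra].
  apply Rlt_le, Rdiv_lt_0_compat; [|assumption]; mpos. }
assert (Yall : forall s, 0 <= s <= l -> Rabs (y s) <= (k + a5 / sin (th q)) * r).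
{ intros s Hs; destruct (fold_ends_cases s Hs) as [u [Hu Hc]].
  destruct (PW u Hu) as [A1 [A2 [A3 A4]]].
  assert (R : forall v c, Rabs (v - c * (sin (th u) / sin (th q))) <= k * r -> Rabs c <= a5 * r ->
    Rabs v <= (k + a5 / sin (th q)) * r).
  { intros v c V1 V2.
    replace v with ((v - c * (sin (th u) / sin (th q))) + c * / sin (th q) * sin (th u)) by (field; lra).
    eapply Rle_trans; [apply Rabs_triang|].
    assert (Rabs (c * / sin (th q) * sin (th u)) <= a5 * r * / sin (th q) * 1).
    { apply Rabs_mult_le; [apply Rabs_mult_le; [assumption|]|].
      - rewrite Rabs_pos_eq; [lra|]; apply Rlt_le, Rinv_0_lt_compat; assumption.
      - assert (E := SIN_bound (th u)); apply Rabs_le; lra. }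
    unfold Rdiv; lra. }
  destruct Hc as [E|[E|[E|E]]]; rewrite E; eapply R; try eassumption; nra. }
assert (Zall : forall s, 0 <= s <= l -> Rabs (z s) <= a6 * r).
{ intros s Hs.
  replace (z s) with (t1 * cos (th s) + t2 * normal_field s + y s) by (unfold y; ring).
  replace (a6 * r) with (a3 * MA * r * 1 + a3 * r * MA + (k + a5 / sin (th q)) * r) by (unfold a6; ring).
  apply Rabs_sum3; [| |apply Yall; assumption].
  - apply Rabs_mult_le; [assumption|]; assert (E := COS_bound (th s)); apply Rabs_le; lra.
  - apply Rabs_mult_le; [assumption|apply BA; assumption]. }
assert (Fin := H1_of_pointwise pot z z' (5 * Lam) a6 D cts_pot Dz Cz' HD ltac:(lra) pot_bound Zall
  ltac:(unfold D; lra)).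
apply Rmult_le_reg_l with (1 + l * (1 + 5 * Lam) * a6 ^ 2); [assumption|].
rewrite <- Rmult_assoc, Rinv_r, Rmult_1_l by lra; exact Fin.
Qed.

(** The in-plane counterpart of [zform_split]. The moments of [b] against sin th and cos th stay in
    the formulas because closure makes them of second order only, not zero. The constant field,
    generated by rotations in the plane, pairs with [y] through the cosine moment. *)
Lemma planar_split (b b' : R -> R) (t1 t2 : R) :
  (forall s, is_derive b s (b' s)) -> cts b' -> b l = b 0 ->
  let y := fun s => b s - t1 - t2 * plane_field s in
  let y' := fun s => b' s - t2 * plane_field' s in
  RInt (fun s => sin (th s) * b s) 0 l = RInt (fun s => sin (th s) * y s) 0 l - t2 * l /\
  RInt (fun s => cos (th s) * b s) 0 l = RInt (fun s => cos (th s) * y s) 0 l /\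
  jform pot_planar b b' l = jform pot_planar y y' l
    - 4 * C * t2 * RInt (fun s => sin (th s) * y s) 0 l + 2 * C * l * t2 ^ 2
    - 2 * t1 * Lam * RInt (fun s => cos (th s) * y s) 0 l.
Proof.
intros Db Cb' Hb y y'.
assert (Cb := is_derive_cts _ _ Db).
assert (Dy : forall s, is_derive y s (y' s)).
{ intros s; unfold y, y'; assert (D := is_derive_plane_field); ader. }
assert (Cy := is_derive_cts _ _ Dy).
assert (Cy' : cts y') by (unfold y'; ct).
assert (Hy : y l = y 0) by (unfold y; rewrite Hb, (half_period plane_field) by apply plane_field_half; reflexivity).
assert (If : RInt (fun s => cos (th s) * plane_field s) 0 l = 0).
{ apply int_half; [ct|]; intros s; rewrite plane_field_half, (pd_th_half _ _ _ _ _ _ H), cos_neg; ring. }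
split; [|split].
- rewrite (int_ext (fun s => sin (th s) * b s)
    (fun s => sin (th s) * y s + t1 * sin (th s) + t2 * (sin (th s) * plane_field s)))
    by (intros; unfold y; rring).
  rewrite !int_plus, !int_scal, int_sin_plane_field, int_sin_th by ct; rring.
- rewrite (int_ext (fun s => cos (th s) * b s)
    (fun s => cos (th s) * y s + t1 * cos (th s) + t2 * (cos (th s) * plane_field s)))
    by (intros; unfold y; rring).
  rewrite !int_plus, !int_scal, int_cos_th, If by ct; rring.
- unfold jform.
  rewrite (int_ext (fun s => b' s ^ 2 - pot_planar s * b s ^ 2) (fun s => (y' s ^ 2 - pot_planar s * y s ^ 2)
    + 2 * t2 * (plane_field' s * y' s - pot_planar s * plane_field s * y s)
    + t2 ^ 2 * (plane_field' s * plane_field' s - pot_planar s * plane_field s * plane_field s)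
    - 2 * t1 * Lam * (cos (th s) * y s)
    - 2 * t1 * t2 * Lam * (cos (th s) * plane_field s)
    - t1 ^ 2 * Lam * cos (th s))) by (intros; unfold y, y', pot_planar; rring).
  rewrite !int_minus, !int_plus, !int_scal by ct.
  rewrite (int_by_parts_plane_field y y'), (int_by_parts_plane_field plane_field plane_field'), int_sin_plane_field, If, int_cos_th; ct.
  + rewrite int_minus by ct; rring.
  + apply is_derive_plane_field.
  + apply half_period, plane_field_half.
Qed.

Lemma int_ka_sqr_quarter : RInt (fun v => ka (q - v) ^ 2) 0 q = C * l / 2.
Proof.
assert (E := int_ka_sqr); unfold l in E; rewrite int_fold_nodes in E by ct.
rewrite (int_ext (fun u => ka (q + u) ^ 2) (fun v => ka (q - v) ^ 2)) in E
  by (intros; rewrite pd_ka_1p; rring).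
rewrite (int_ext (fun u => ka (3 * q - u) ^ 2) (fun v => ka (q - v) ^ 2)) in E
  by (intros; rewrite pd_ka_3m; rring).
rewrite (int_ext (fun u => ka (3 * q + u) ^ 2) (fun v => ka (q - v) ^ 2)) in E
  by (intros; rewrite pd_ka_3p; rring).
unfold l; lra.
Qed.

(** On the quarters adjacent to the nodes q and 3 q the form is nonnegative, and it controls [y] up
    to a multiple of [ka]. The middle estimate bounds the sine moment with the sharp constant needed
    to absorb a negative square later; it adds up one Cauchy-Schwarz inequality per quarter. *)
Lemma planar_pointwise : exists k : R, 0 < k /\ forall (y y' : R -> R),
  (forall s, is_derive y s (y' s)) -> cts y' -> y q = 0 -> y (3 * q) = 0 -> y (4 * q) = y 0 ->
  0 <= jform pot_planar y y' l /\
  (Lam * RInt (fun s => sin (th s) * y s) 0 l) ^ 2 <= C * l / 2 * jform pot_planar y y' l /\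
  forall u, 0 <= u <= q ->
    Rabs (y (q - u) - y 0 * (ka (q - u) / ka 0)) <= k * sqrt (jform pot_planar y y' l) /\
    Rabs (y (q + u) - y (2 * q) * (ka (q - u) / ka 0)) <= k * sqrt (jform pot_planar y y' l) /\
    Rabs (y (3 * q - u) - y (2 * q) * (ka (q - u) / ka 0)) <= k * sqrt (jform pot_planar y y' l) /\
    Rabs (y (3 * q + u) - y 0 * (ka (q - u) / ka 0)) <= k * sqrt (jform pot_planar y y' l).
Proof.
assert (J := jacobi_data_ka).
set (k2 := q / 1 ^ 2).
assert (Hk2 : 0 < k2) by (unfold k2; apply Rdiv_lt_0_compat; [assumption|lra]).
exists (sqrt k2); split; [apply sqrt_lt_R0; assumption|].
intros y y' Dy Cy' Y1 Y3 Y4; assert (Cy := is_derive_cts _ _ Dy).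
rewrite jform_fold_nodes by assumption.
assert (D1 := is_derive_reflect y y' q Dy); assert (D2 := is_derive_translate y y' q Dy).
assert (D3 := is_derive_reflect y y' (3 * q) Dy); assert (D4 := is_derive_translate y y' (3 * q) Dy).
assert (C1 : cts (fun u => - y' (q - u))) by ct.
assert (C2 : cts (fun u => y' (q + u))) by ct.
assert (C3 : cts (fun u => - y' (3 * q - u))) by ct.
assert (C4 : cts (fun u => y' (3 * q + u))) by ct.
assert (Z1 : y (q - 0) = 0) by (rewrite Rminus_0_r; assumption).
assert (Z2 : y (q + 0) = 0) by (rewrite Rplus_0_r; assumption).
assert (Z3 : y (3 * q - 0) = 0) by (rewrite Rminus_0_r; assumption).
assert (Z4 : y (3 * q + 0) = 0) by (rewrite Rplus_0_r; assumption).
assert (P1 := jform_pos _ _ _ _ J (fun u => y (q - u)) (fun u => - y' (q - u)) D1 C1 Z1).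
assert (P2 := jform_pos _ _ _ _ J (fun u => y (q + u)) (fun u => y' (q + u)) D2 C2 Z2).
assert (P3 := jform_pos _ _ _ _ J (fun u => y (3 * q - u)) (fun u => - y' (3 * q - u)) D3 C3 Z3).
assert (P4 := jform_pos _ _ _ _ J (fun u => y (3 * q + u)) (fun u => y' (3 * q + u)) D4 C4 Z4).
assert (S1 := jform_cauchy_schwarz _ _ _ _ J (fun u => y (q - u)) (fun u => - y' (q - u)) D1 C1 Z1).
assert (S2 := jform_cauchy_schwarz _ _ _ _ J (fun u => y (q + u)) (fun u => y' (q + u)) D2 C2 Z2).
assert (S3 := jform_cauchy_schwarz _ _ _ _ J (fun u => y (3 * q - u)) (fun u => - y' (3 * q - u)) D3 C3 Z3).
assert (S4 := jform_cauchy_schwarz _ _ _ _ J (fun u => y (3 * q + u)) (fun u => y' (3 * q + u)) D4 C4 Z4).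
cbv beta in S1, S2, S3, S4.
set (j1 := jform _ (fun u => y (q - u)) _ _) in *.
set (j2 := jform _ (fun u => y (q + u)) _ _) in *.
set (j3 := jform _ (fun u => y (3 * q - u)) _ _) in *.
set (j4 := jform _ (fun u => y (3 * q + u)) _ _) in *.
rewrite int_ka_sqr_quarter in S1, S2, S3, S4.
rewrite Rminus_diag in S1, S2, S3, S4.
replace (q + q) with (2 * q) in S2 by ring.
replace (3 * q - q) with (2 * q) in S3 by ring.
replace (3 * q + q) with (4 * q) in S4 by ring; rewrite Y4 in S4.
split; [lra|split].
- unfold l at 1; rewrite int_fold_nodes by ct.
  rewrite (int_ext (fun u => sin (th (q + u)) * y (q + u)) (fun u => sin (th (q - u)) * y (q + u)))
    by (intros; rewrite pd_th_1p; rring).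
  rewrite (int_ext (fun u => sin (th (3 * q - u)) * y (3 * q - u))
    (fun u => - (sin (th (q - u)) * y (3 * q - u))))
    by (intros; rewrite pd_th_3m, sin_neg; rring).
  rewrite (int_ext (fun u => sin (th (3 * q + u)) * y (3 * q + u))
    (fun u => - (sin (th (q - u)) * y (3 * q + u))))
    by (intros; rewrite pd_th_3p, sin_neg; rring).
  rewrite !int_opp by ct.
  assert (A : forall w : R -> R, cts w -> RInt (fun s => Lam * sin (th (q - s)) * w s) 0 q
    = Lam * RInt (fun s => sin (th (q - s)) * w s) 0 q).
  { intros w Cw; rewrite <- int_scal by ct; apply int_ext; intros; rring. }
  rewrite (A (fun u => y (q - u))) in S1 by ct; rewrite (A (fun u => y (q + u))) in S2 by ct.
  rewrite (A (fun u => y (3 * q - u))) in S3 by ct; rewrite (A (fun u => y (3 * q + u))) in S4 by ct.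
  set (i1 := RInt (fun s => sin (th (q - s)) * y (q - s)) 0 q) in *.
  set (i2 := RInt (fun s => sin (th (q - s)) * y (q + s)) 0 q) in *.
  set (i3 := RInt (fun s => sin (th (q - s)) * y (3 * q - s)) 0 q) in *.
  set (i4 := RInt (fun s => sin (th (q - s)) * y (3 * q + s)) 0 q) in *.
  set (w1 := ka 0 * y 0 - 2 * (Lam * i1)) in *; set (w2 := ka 0 * y (2 * q) - 2 * (Lam * i2)) in *.
  set (w3 := ka 0 * y (2 * q) - 2 * (Lam * i3)) in *; set (w4 := ka 0 * y 0 - 2 * (Lam * i4)) in *.
  (* With these signs the boundary values at 0 and at 2 q each occur twice and cancel, so the moment
     is a combination of the four controlled quantities alone. *)
  replace (Lam * (i1 + i2 + - i3 + - i4)) with (- (w1 + w2 - w3 - w4) / 2)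
    by (unfold w1, w2, w3, w4; field).
  assert (G1 := pow2_ge_0 (w1 - w2)); assert (G2 := pow2_ge_0 (w1 + w3)).
  assert (G3 := pow2_ge_0 (w1 + w4)); assert (G4 := pow2_ge_0 (w2 + w3)).
  assert (G5 := pow2_ge_0 (w2 + w4)); assert (G6 := pow2_ge_0 (w3 - w4)).
  nra.
- intros u Hu.
  assert (B1 := jform_pointwise _ _ _ _ J 1 Rlt_0_1 pd_ka_compare (fun u => y (q - u))
    (fun u => - y' (q - u)) D1 C1 Z1 u Hu).
  assert (B2 := jform_pointwise _ _ _ _ J 1 Rlt_0_1 pd_ka_compare (fun u => y (q + u))
    (fun u => y' (q + u)) D2 C2 Z2 u Hu).
  assert (B3 := jform_pointwise _ _ _ _ J 1 Rlt_0_1 pd_ka_compare (fun u => y (3 * q - u))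
    (fun u => - y' (3 * q - u)) D3 C3 Z3 u Hu).
  assert (B4 := jform_pointwise _ _ _ _ J 1 Rlt_0_1 pd_ka_compare (fun u => y (3 * q + u))
    (fun u => y' (3 * q + u)) D4 C4 Z4 u Hu).
  cbv beta in B1, B2, B3, B4; fold j1 in B1; fold j2 in B2; fold j3 in B3; fold j4 in B4.
  rewrite Rminus_diag in B1, B2, B3, B4.
  replace (q + q) with (2 * q) in B2 by ring.
  replace (3 * q - q) with (2 * q) in B3 by ring.
  replace (3 * q + q) with (4 * q) in B4 by ring; rewrite Y4 in B4.
  fold k2 in B1, B2, B3, B4.
  repeat split; apply abs_le_of_sqr; try lra;
    (eapply Rle_trans; [eassumption|]; apply Rmult_le_compat_l; lra).
Qed.

Lemma int_cos_ka_quarter : RInt (fun v => cos (th (q - v)) * ka (q - v)) 0 q = sin (th q).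
Proof.
rewrite (int_deriv (fun v => - sin (th (q - v)))); [| |ct].
- rewrite Rminus_diag, Rminus_0_r, pd_th0, sin_0; rring.
- intros s; ader.
Qed.

(** Subtracting a constant and a multiple of [plane_field] makes [y] vanish at the zeros q and 3 q
    of [ka]. This leaves the square - (2 C / l) sy^2 of the wrong sign; by [planar_pointwise] it
    costs only the fraction C^2 / Lam^2 < 1 of the form. The cross term with the cosine moment is
    paid for by the penalty N. *)
Lemma planar_coercive : exists c N : R, 0 < c /\ 0 < N /\
  forall b b' : R -> R, (forall s, is_derive b s (b' s)) -> cts b' -> b l = b 0 ->
  b 0 = 0 -> b (2 * q) = 0 ->
  c * RInt (fun s => b s ^ 2 + b' s ^ 2) 0 l
    <= jform pot_planar b b' l + N * (RInt (fun s => sin (th s) * b s) 0 l ^ 2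
        + RInt (fun s => cos (th s) * b s) 0 l ^ 2).
Proof.
destruct planar_pointwise as [k [Hk HP]].
assert (S := pd_S_pos).
assert (Hl : 0 < l) by (unfold l; lra).
assert (K0 : 0 < ka 0) by (apply (pd_ka_pos _ _ _ _ _ _ H); lra).
destruct (cts_bounded plane_field 0 l ltac:(lra) cts_plane_field) as [MA [HMA BA]].
assert (HC := pd_C_lt); assert (HC0 := pd_C_ge0).
(* The fraction of the form that survives. It is positive because C = - Lam cos (th q) with 0 < th q
   < PI. *)
set (eta := 1 - C ^ 2 / Lam ^ 2).
assert (HL2 : 0 < Lam ^ 2) by (apply pow_lt; assumption).
assert (Heta : 0 < eta <= 1).
{ unfold eta; assert (C ^ 2 / Lam ^ 2 < 1).
  { apply Rmult_lt_reg_r with (Lam ^ 2); [assumption|].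
    replace (C ^ 2 / Lam ^ 2 * Lam ^ 2) with (C ^ 2) by (field; lra); lra. }
  assert (0 <= C ^ 2 / Lam ^ 2); [|lra].
  apply Rmult_le_pos; [apply pow2_ge_0|apply Rlt_le, Rinv_0_lt_compat; assumption]. }
set (g := ka 0 / (4 * sin (th q))).
assert (Hg : 0 < g) by (apply Rdiv_lt_0_compat; lra).
set (m1 := 2 * Lam * g); set (m2 := 2 * Lam * g * (4 * q * k)).
assert (Hm1 : 0 < m1) by (unfold m1; apply Rmult_lt_0_compat; lra).
assert (Hm2 : 0 < m2) by (unfold m2; mpos).
(* Chosen so that N r2^2 covers the term m1 r2^2 and the remainder of Young's inequality for m2 |r2|
   r, and still leaves r2^2. *)
set (N := 1 + m1 + m2 ^ 2 / (2 * eta)).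
assert (HN : 1 + m1 <= N).
{ unfold N; assert (0 < m2 ^ 2 / (2 * eta)); [|lra].
  apply Rdiv_lt_0_compat; [apply pow_lt; assumption|lra]. }
set (e0 := sqrt (2 / eta)).
assert (He0 : 0 < e0) by (apply sqrt_lt_R0, Rdiv_lt_0_compat; lra).
set (k1 := g * (1 + 4 * q * k * e0)).
assert (Hk1 : 0 < k1).
{ unfold k1; apply Rmult_lt_0_compat; [assumption|].
  assert (0 < 4 * q * k * e0) by (mpos); lra. }
set (k2 := (sqrt (C * l / 2) * e0 / Lam + 1) / l).
assert (Hk2 : 0 < k2).
{ unfold k2; apply Rdiv_lt_0_compat; [|assumption].
  assert (0 <= sqrt (C * l / 2) * e0 / Lam); [|lra].
  apply Rmult_le_pos; [apply Rmult_le_pos; [apply sqrt_pos|lra]|apply Rlt_le, Rinv_0_lt_compat; lra]. }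
set (a := k1 + k2 * MA + (k * e0 + k1)).
assert (Hpos : 0 < 1 + l * (1 + 5 * Lam) * a ^ 2).
{ assert (0 <= a ^ 2) by apply pow2_ge_0. assert (0 <= l * (1 + 5 * Lam)) by nra. nra. }
exists (/ (1 + l * (1 + 5 * Lam) * a ^ 2)), N; split; [apply Rinv_0_lt_compat; exact Hpos|].
split; [lra|].
intros b b' Db Cb' Hb B0 B2; assert (Cb := is_derive_cts _ _ Db).
set (t1 := (b q + b (3 * q)) / 2); set (t2 := (b (3 * q) - b q) / (4 * sin (th q))).
pose (y := fun s => b s - t1 - t2 * plane_field s).
pose (y' := fun s => b' s - t2 * plane_field' s).
set (r1 := RInt (fun s => sin (th s) * b s) 0 l); set (r2 := RInt (fun s => cos (th s) * b s) 0 l).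
set (sy := RInt (fun s => sin (th s) * y s) 0 l).
assert (ZS : r1 = sy - t2 * l /\ r2 = RInt (fun s => cos (th s) * y s) 0 l /\
  jform pot_planar b b' l = jform pot_planar y y' l - 4 * C * t2 * sy + 2 * C * l * t2 ^ 2
   - 2 * t1 * Lam * RInt (fun s => cos (th s) * y s) 0 l)
  by exact (planar_split b b' t1 t2 Db Cb' Hb).
destruct ZS as [E1 [E2 EJ]]; rewrite <- E2 in EJ.
assert (Dy : forall s, is_derive y s (y' s)).
{ intros s; unfold y, y'; assert (D := is_derive_plane_field); ader. }
assert (Cy := is_derive_cts _ _ Dy).
assert (Cy' : cts y') by (unfold y'; ct).
assert (F0 : plane_field 0 = 0) by (unfold plane_field; rewrite pd_X0, pd_th0, sin_0; ring).
assert (F2 : plane_field (2 * q) = 0) by (unfold plane_field; rewrite pd_X_2q, pd_th_2q, sin_0; ring).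
assert (Y1 : y q = 0).
{ unfold y, plane_field; rewrite pd_kaq; unfold t1, t2; field; lra. }
assert (Y3 : y (3 * q) = 0).
{ unfold y, plane_field; rewrite pd_ka_3q, pd_th_3q, sin_neg; unfold t1, t2; field; lra. }
assert (Y0 : y 0 = - t1) by (unfold y; rewrite B0, F0; ring).
assert (Y2 : y (2 * q) = - t1) by (unfold y; rewrite B2, F2; ring).
assert (Y4 : y (4 * q) = y 0).
{ fold l; unfold y; rewrite Hb, (half_period plane_field) by apply plane_field_half; reflexivity. }
destruct (HP y y' Dy Cy' Y1 Y3 Y4) as [JP [CS PW]].
set (j := jform pot_planar y y' l) in *; fold sy in CS.
set (r := sqrt j) in *; assert (Hr : 0 <= r) by apply sqrt_pos.
assert (Hrr : r * r = j) by (apply sqrt_sqrt; assumption).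
rewrite Y0, Y2 in PW.
(* The pinned values make y = - t1 at 0 and at 2 q, so on each quarter [y] is close to - t1 ka / ka
   0. Testing against cos th, where the integral of cos th ka over a quarter is sin (th q), recovers
   [t1] from the cosine moment [r2]. *)
assert (T1 : Rabs t1 <= g * (Rabs r2 + 4 * q * k * r)).
{ unfold l in E2; rewrite int_fold_nodes in E2 by ct.
  pose (e := fun u => cos (th (q - u)) * (y (q - u) + y (q + u) + y (3 * q - u) + y (3 * q + u))
    - (- 4 * t1 / ka 0) * (cos (th (q - u)) * ka (q - u))).
  assert (X1 : RInt e 0 q = r2 + 4 * t1 * sin (th q) / ka 0).
  { rewrite E2; unfold e.
    rewrite (int_ext (fun u => cos (th (q + u)) * y (q + u)) (fun u => cos (th (q - u)) * y (q + u)))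
      by (intros; rewrite pd_th_1p; rring).
    rewrite (int_ext (fun u => cos (th (3 * q - u)) * y (3 * q - u)) (fun u => cos (th (q - u)) * y (3 * q - u)))
      by (intros; rewrite pd_th_3m, cos_neg; rring).
    rewrite (int_ext (fun u => cos (th (3 * q + u)) * y (3 * q + u)) (fun u => cos (th (q - u)) * y (3 * q + u)))
      by (intros; rewrite pd_th_3p, cos_neg; rring).
    rewrite int_minus, int_scal, int_cos_ka_quarter by ct.
    rewrite (int_ext _ (fun u => cos (th (q - u)) * y (q - u) + cos (th (q - u)) * y (q + u)
      + cos (th (q - u)) * y (3 * q - u) + cos (th (q - u)) * y (3 * q + u))) by (intros; rring).
    rewrite !int_plus by ct; as_real; field; lra. }
  assert (X2 : Rabs (RInt e 0 q) <= 4 * k * r * q).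
  { eapply Rle_trans; [apply int_abs; [lra|unfold e; ct]|].
    replace (4 * k * r * q) with (RInt (fun _ => 4 * k * r) 0 q) by (rewrite int_const; rring).
    apply int_le; [lra|unfold e; ct|ct|]; intros u Hu.
    destruct (PW u Hu) as [A1 [A2 [A3 A4]]].
    replace (e u) with (cos (th (q - u)) * (((y (q - u) - - t1 * (ka (q - u) / ka 0))
      + (y (q + u) - - t1 * (ka (q - u) / ka 0))
      + (y (3 * q - u) - - t1 * (ka (q - u) / ka 0)))
      + (y (3 * q + u) - - t1 * (ka (q - u) / ka 0)))) by (unfold e; field; lra).
    replace (4 * k * r) with (1 * (k * r + k * r + k * r + k * r)) by ring.
    apply Rabs_mult_le; [assert (E := COS_bound (th (q - u))); apply Rabs_le; lra|].
    eapply Rle_trans; [apply Rabs_triang|].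
    assert (A5 := Rabs_sum3 _ _ _ _ _ _ A1 A2 A3); lra. }
  replace t1 with (g * (RInt e 0 q + - r2)) by (rewrite X1; unfold g; field; lra).
  rewrite Rabs_mult, (Rabs_pos_eq g) by lra; apply Rmult_le_compat_l; [lra|].
  eapply Rle_trans; [apply Rabs_triang|]; rewrite Rabs_Ropp; lra. }
set (G := jform pot_planar b b' l + N * (r1 ^ 2 + r2 ^ 2)).
assert (CS2 : 2 * C / l * sy ^ 2 <= (1 - eta) * j).
{ replace (1 - eta) with (C ^ 2 / Lam ^ 2) by (unfold eta; ring).
  apply Rmult_le_reg_l with (l * Lam ^ 2); [apply Rmult_lt_0_compat; assumption|].
  replace (l * Lam ^ 2 * (2 * C / l * sy ^ 2)) with (2 * C * (Lam * sy) ^ 2) by (field; lra).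
  replace (l * Lam ^ 2 * (C ^ 2 / Lam ^ 2 * j)) with (2 * C * (C * l / 2 * j)) by (field; lra).
  apply Rmult_le_compat_l; lra. }
assert (EG : jform pot_planar b b' l = j - 2 * C / l * sy ^ 2 + 2 * C / l * r1 ^ 2 - 2 * t1 * Lam * r2).
{ rewrite EJ, E1; field; lra. }
assert (Q1 : 0 <= 2 * C / l * r1 ^ 2).
{ apply Rmult_le_pos; [|apply pow2_ge_0]; apply Rmult_le_pos; [lra|apply Rlt_le, Rinv_0_lt_compat; lra]. }
assert (Q2 : 2 * t1 * Lam * r2 <= m1 * r2 ^ 2 + m2 * (Rabs r2 * r)).
{ eapply Rle_trans; [apply Rle_abs|].
  replace (2 * t1 * Lam * r2) with (2 * Lam * (t1 * r2)) by ring.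
  rewrite Rabs_mult, (Rabs_pos_eq (2 * Lam)), Rabs_mult by lra.
  rewrite <- (pow2_abs r2).
  replace (m1 * Rabs r2 ^ 2 + m2 * (Rabs r2 * r)) with (2 * Lam * (g * (Rabs r2 + 4 * q * k * r) * Rabs r2))
    by (unfold m1, m2; ring).
  apply Rmult_le_compat_l; [lra|]; apply Rmult_le_compat_r; [apply Rabs_pos|assumption]. }
assert (Q3 : m2 * (Rabs r2 * r) <= eta / 2 * j + m2 ^ 2 / (2 * eta) * r2 ^ 2).
{ rewrite <- Hrr, <- (pow2_abs r2).
  replace (eta / 2 * (r * r) + m2 ^ 2 / (2 * eta) * Rabs r2 ^ 2) with
    (m2 * (Rabs r2 * r) + / (2 * eta) * (eta * r - m2 * Rabs r2) ^ 2) by (field; lra).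
  assert (0 <= / (2 * eta) * (eta * r - m2 * Rabs r2) ^ 2); [|lra].
  apply Rmult_le_pos; [apply Rlt_le, Rinv_0_lt_compat; lra|apply pow2_ge_0]. }
assert (P1 := pow2_ge_0 r1); assert (P2 := pow2_ge_0 r2).
assert (HG : eta / 2 * j + r1 ^ 2 + r2 ^ 2 <= G).
{ unfold G; rewrite EG.
  assert (N * r1 ^ 2 >= r1 ^ 2) by nra.
  assert (N * r2 ^ 2 = r2 ^ 2 + m1 * r2 ^ 2 + m2 ^ 2 / (2 * eta) * r2 ^ 2) by (unfold N; ring).
  lra. }
assert (Hej : 0 <= eta / 2 * j) by (apply Rmult_le_pos; lra).
assert (HG0 : 0 <= G) by lra.
set (rG := sqrt G); assert (HrG : 0 <= rG) by apply sqrt_pos.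
assert (R1 : Rabs r1 <= rG).
{ replace rG with (sqrt 1 * sqrt G) by (rewrite sqrt_1; unfold rG; ring).
  apply abs_le_of_sqr; lra. }
assert (R2 : Rabs r2 <= rG).
{ replace rG with (sqrt 1 * sqrt G) by (rewrite sqrt_1; unfold rG; ring).
  apply abs_le_of_sqr; lra. }
assert (Rr : r <= e0 * rG).
{ apply Rle_trans with (Rabs r); [apply Rle_abs|]; unfold e0, rG; apply abs_le_of_sqr;
    [apply Rlt_le, Rdiv_lt_0_compat; lra|assumption|].
  replace (r ^ 2) with (2 / eta * (eta / 2 * (r * r))) by (field; lra).
  apply Rmult_le_compat_l; [apply Rlt_le, Rdiv_lt_0_compat; lra|rewrite Hrr; lra]. }
assert (T1' : Rabs t1 <= k1 * rG).
{ eapply Rle_trans; [exact T1|]; unfold k1.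
  replace (g * (1 + 4 * q * k * e0) * rG) with (g * ((1 + 4 * q * k * e0) * rG)) by ring.
  apply Rmult_le_compat_l; [lra|].
  assert (4 * q * k * r <= 4 * q * k * (e0 * rG)); [|lra].
  apply Rmult_le_compat_l; [|assumption]; mpos. }
assert (Sy : Rabs sy <= sqrt (C * l / 2) * e0 / Lam * rG).
{ assert (A : Rabs (Lam * sy) <= sqrt (C * l / 2) * r).
  { unfold r; apply abs_le_of_sqr; [|assumption|exact CS].
    unfold Rdiv; mpos. }
  rewrite Rabs_mult, (Rabs_pos_eq Lam) in A by lra.
  apply Rmult_le_reg_l with Lam; [assumption|].
  replace (Lam * (sqrt (C * l / 2) * e0 / Lam * rG)) with (sqrt (C * l / 2) * (e0 * rG)) by (field; lra).
  eapply Rle_trans; [exact A|]; apply Rmult_le_compat_l; [apply sqrt_pos|assumption]. }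
assert (T2 : Rabs t2 <= k2 * rG).
{ replace t2 with ((sy + - r1) * / l) by (rewrite E1; field; lra).
  replace (k2 * rG) with ((sqrt (C * l / 2) * e0 / Lam * rG + rG) * / l) by (unfold k2; field; lra).
  rewrite Rabs_mult, (Rabs_pos_eq (/ l)) by (apply Rlt_le, Rinv_0_lt_compat; lra).
  apply Rmult_le_compat_r; [apply Rlt_le, Rinv_0_lt_compat; lra|].
  eapply Rle_trans; [apply Rabs_triang|]; rewrite Rabs_Ropp; lra. }
assert (KA : forall u, 0 <= u <= q -> Rabs (ka (q - u) / ka 0) <= 1).
{ intros u Hu; destruct (Req_dec u 0) as [->|Hu0].
  - rewrite Rminus_0_r, pd_kaq; unfold Rdiv; rewrite Rmult_0_l, Rabs_R0; lra.
  - assert (A := pd_ka_compare u q ltac:(lra) ltac:(lra)); rewrite Rminus_diag in A.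
    assert (0 < ka (q - u)) by (apply (pd_ka_pos _ _ _ _ _ _ H); lra).
    rewrite Rabs_pos_eq by (apply Rlt_le, Rdiv_lt_0_compat; assumption).
    apply Rmult_le_reg_r with (ka 0); [assumption|].
    replace (ka (q - u) / ka 0 * ka 0) with (ka (q - u)) by (field; lra); lra. }
assert (Yall : forall s, 0 <= s <= l -> Rabs (y s) <= (k * e0 + k1) * rG).
{ intros s Hs; destruct (fold_nodes_cases s Hs) as [u [Hu Hc]].
  destruct (PW u Hu) as [A1 [A2 [A3 A4]]].
  assert (W : forall v, Rabs (v - - t1 * (ka (q - u) / ka 0)) <= k * r -> Rabs v <= (k * e0 + k1) * rG).
  { intros v V1.
    replace v with ((v - - t1 * (ka (q - u) / ka 0)) + - t1 * (ka (q - u) / ka 0)) by ring.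
    eapply Rle_trans; [apply Rabs_triang|].
    assert (Rabs (- t1 * (ka (q - u) / ka 0)) <= k1 * rG * 1).
    { apply Rabs_mult_le; [rewrite Rabs_Ropp; assumption|apply KA; assumption]. }
    assert (k * r <= k * (e0 * rG)) by (apply Rmult_le_compat_l; lra).
    lra. }
  destruct Hc as [E|[E|[E|E]]]; rewrite E; apply W; assumption. }
assert (Ball : forall s, 0 <= s <= l -> Rabs (b s) <= a * rG).
{ intros s Hs.
  replace (b s) with (t1 + t2 * plane_field s + y s) by (unfold y; ring).
  replace (a * rG) with (k1 * rG + k2 * rG * MA + (k * e0 + k1) * rG) by (unfold a; ring).
  apply Rabs_sum3; [assumption| |apply Yall; assumption].
  apply Rabs_mult_le; [assumption|apply BA; assumption]. }
assert (HJG : jform pot_planar b b' l <= G).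
{ unfold G; assert (0 <= N * (r1 ^ 2 + r2 ^ 2)) by (apply Rmult_le_pos; lra); lra. }
assert (Fin := H1_of_pointwise pot_planar b b' (5 * Lam) a G cts_pot_planar Db Cb' HG0 ltac:(lra)
  pot_planar_bound Ball HJG).
apply Rmult_le_reg_l with (1 + l * (1 + 5 * Lam) * a ^ 2); [assumption|].
rewrite <- Rmult_assoc, Rinv_r, Rmult_1_l by lra; exact Fin.
Qed.

End Pendulum.

(* A unit field close to the tangent of the figure eight is [(1 + a) T + b N + z e]. *)
Record unit_field (l mu : R) (th : R -> R) (a a' b b' z z' : R -> R) : Prop := {
  uf_a : forall s, is_derive a s (a' s);
  uf_b : forall s, is_derive b s (b' s);
  uf_z : forall s, is_derive z s (z' s);
  uf_a' : cts a';
  uf_b' : cts b';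
  uf_z' : cts z';
  uf_bl : b l = b 0;
  uf_zl : z l = z 0;
  uf_unit : forall s, (1 + a s) ^ 2 + b s ^ 2 + z s ^ 2 = 1;
  uf_close : forall s, 0 <= s <= l -> Rabs (a s) <= mu /\ Rabs (b s) <= mu /\ Rabs (z s) <= mu /\
    Rabs (a' s) <= mu /\ Rabs (b' s) <= mu /\ Rabs (z' s) <= mu;
  uf_int1 : RInt (fun s => a s * cos (th s) - b s * sin (th s)) 0 l = 0;
  uf_int2 : RInt (fun s => a s * sin (th s) + b s * cos (th s)) 0 l = 0;
  uf_int3 : RInt z 0 l = 0 }.

(** The unit length reads a (2 + a) = - (b^2 + z^2), so the tangential component is of second order;
    the next lemma says the same of its derivative. *)
Lemma unit_field_a_bound (a b z mu : R) : mu <= 1 / 2 -> Rabs a <= mu ->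
  (1 + a) ^ 2 + b ^ 2 + z ^ 2 = 1 -> Rabs a <= b ^ 2 + z ^ 2.
Proof.
intros Hmu Ha E; apply Rabs_le_between in Ha.
assert (Hb := pow2_ge_0 b); assert (Hz := pow2_ge_0 z).
apply Rabs_le; nra.
Qed.

Lemma unit_field_a'_bound (a a' b b' z z' mu : R) : mu <= 1 / 2 -> Rabs a <= mu ->
  (1 + a) * a' + b * b' + z * z' = 0 -> Rabs a' <= b ^ 2 + b' ^ 2 + (z ^ 2 + z' ^ 2).
Proof.
intros Hmu Ha E; apply Rabs_le_between in Ha.
assert (A1 := pow2_ge_0 (b - b')); assert (A2 := pow2_ge_0 (b + b')).
assert (A3 := pow2_ge_0 (z - z')); assert (A4 := pow2_ge_0 (z + z')).
set (h := b ^ 2 + b' ^ 2 + (z ^ 2 + z' ^ 2)).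
assert (E2 : -h <= 2 * ((1 + a) * a') <= h) by (unfold h; lra).
assert (0 <= h) by (unfold h; nra).
apply Rabs_le; split; apply Rnot_lt_le; intros Hl; nra.
Qed.

Lemma sqr_abs_le (x y : R) : Rabs x <= y -> x ^ 2 <= y ^ 2.
Proof. intros; rewrite <- pow2_abs; apply pow_incr; split; [apply Rabs_pos|assumption]. Qed.

(** * The energy inequality for unit fields near the figure eight *)

Section Core.
Context (q Lam C : R) (th ka X : R -> R) (H : pendulum q Lam C th ka X).
Let l := 4 * q.

(** The bending energy is expanded exactly into the two quadratic forms and an integral of [e].
    Since [a] is quadratic in b and z, every error is of third order or higher, hence at most mu
    times a constant times the squared H^1 norm Hb + Hz, and coercivity wins for small mu. *)
Lemma stable_core (B : R) : 2 < B -> exists mu : R, 0 < mu <= 1 / 2 /\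
  forall a a' b b' z z' : R -> R, unit_field l mu th a a' b b' z z' ->
  b 0 = 0 -> b (2 * q) = 0 -> z 0 = 0 -> z q = 0 ->
  RInt (fun s => ka s ^ 2) 0 l <=
  RInt (fun s => (a' s - ka s * b s) ^ 2 + (b' s + ka s * (1 + a s)) ^ 2 + z' s ^ 2) 0 l
  + B / l * RInt (fun s => z s * (((1 + a s) * (b' s + ka s * (1 + a s))
      - b s * (a' s - ka s * b s)) / (1 - z s ^ 2))) 0 l ^ 2.
Proof.
intros HB.
assert (Cth := pd_cts_th _ _ _ _ _ _ H); assert (Cka := pd_cts_ka _ _ _ _ _ _ H).
assert (Cpt := cts_pot _ _ _ _ _ _ H); assert (Cpp := cts_pot_planar _ _ _ _ _ _ H).
destruct (zform_coercive _ _ _ _ _ _ H B HB) as [c1 [Hc1 CZ]].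
destruct (planar_coercive _ _ _ _ _ _ H) as [c2 [N [Hc2 [HN CB]]]].
assert (Hq := pd_q _ _ _ _ _ _ H); assert (HLam := pd_Lam _ _ _ _ _ _ H).
assert (Hl : 0 < l) by (unfold l; lra).
destruct (cts_bounded ka 0 l ltac:(lra) (pd_cts_ka _ _ _ _ _ _ H)) as [M [HM BM]].
set (c := Rmin c1 c2).
assert (Hc : 0 < c /\ c <= c1 /\ c <= c2).
{ unfold c; repeat split; [apply Rmin_glb_lt; assumption|apply Rmin_l|apply Rmin_r]. }
(* The three summands bound the errors coming from the closure moments, from [e] and from the twist
   integral. *)
set (W := 4 * N * l + (Lam + 4 * M) + 6 * M * B).
assert (HW : 0 < W) by (unfold W; nra).
set (mu := Rmin (1 / 2) (c / W)).
assert (Hmu : 0 < mu <= 1 / 2 /\ mu * W <= c).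
{ assert (0 < c / W) by (apply Rdiv_lt_0_compat; lra).
  unfold mu; repeat split; [apply Rmin_glb_lt; lra|apply Rmin_l|].
  apply Rle_trans with (c / W * W); [apply Rmult_le_compat_r; [lra|apply Rmin_r]|].
  right; field; lra. }
clearbody mu; exists mu; split; [apply Hmu|].
intros a a' b b' z z' [Da Db Dz Ca' Cb' Cz' Bl Zl U Cl I1 I2 I3] B0 B2 Z0 Zq.
assert (Ca := is_derive_cts _ _ Da); assert (Cb := is_derive_cts _ _ Db).
assert (Cz := is_derive_cts _ _ Dz).
assert (CZ' := CZ z z' Dz Cz' Zl I3 Z0 Zq); assert (CB' := CB b b' Db Cb' Bl B0 B2).
fold l in CZ', CB'; clear CZ CB.
assert (U' : forall s, (1 + a s) * a' s + b s * b' s + z s * z' s = 0).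
{ intros s.
  assert (E : is_derive (fun s => (1 + a s) ^ 2 + b s ^ 2 + z s ^ 2) s
    (2 * ((1 + a s) * a' s + b s * b' s + z s * z' s))) by ader.
  apply is_derive_unique in E; rewrite (Derive_ext _ (fun _ => 1)) in E by assumption.
  rewrite Derive_const in E; lra. }
set (Hz := RInt (fun s => z s ^ 2 + z' s ^ 2) 0 l) in *.
set (Hb := RInt (fun s => b s ^ 2 + b' s ^ 2) 0 l) in *.
assert (Hz0 : 0 <= Hz).
{ apply int_ge0; ct; [lra|]; intros; assert (A := pow2_ge_0 (z s)); assert (A' := pow2_ge_0 (z' s)); lra. }
assert (Hb0 : 0 <= Hb).
{ apply int_ge0; ct; [lra|]; intros; assert (A := pow2_ge_0 (b s)); assert (A' := pow2_ge_0 (b' s)); lra. }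
pose (h := fun s => (b s ^ 2 + b' s ^ 2) + (z s ^ 2 + z' s ^ 2)).
assert (Ch : cts h) by (unfold h; ct).
assert (Ih : RInt h 0 l = Hb + Hz) by (unfold h; rewrite int_plus by ct; reflexivity).
assert (Aq : forall s, 0 <= s <= l -> Rabs (a s) <= h s /\ Rabs (a s) <= 2 * mu ^ 2 /\ Rabs (a' s) <= h s).
{ intros s Hs; destruct (Cl s Hs) as [L1 [L2 [L3 [L4 [L5 L6]]]]].
  assert (A := unit_field_a_bound _ _ _ mu ltac:(lra) L1 (U s)).
  assert (A' := unit_field_a'_bound _ _ _ _ _ _ mu ltac:(lra) L1 (U' s)).
  assert (P1 := pow2_ge_0 (b' s)); assert (P2 := pow2_ge_0 (z' s)).
  apply sqr_abs_le in L2; apply sqr_abs_le in L3.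
  unfold h; repeat split; lra. }
assert (Ia : RInt (fun s => Rabs (a s)) 0 l <= Hb + Hz).
{ rewrite <- Ih; apply int_le; ct; [lra|]; intros; apply Aq; assumption. }
assert (Ia' : RInt (fun s => Rabs (a s)) 0 l <= 2 * mu ^ 2 * l).
{ replace (2 * mu ^ 2 * l) with (RInt (fun _ => 2 * mu ^ 2) 0 l) by (rewrite int_const; rring).
  apply int_le; ct; [lra|]; intros; apply Aq; assumption. }
assert (Ia0 : 0 <= RInt (fun s => Rabs (a s)) 0 l).
{ apply int_ge0; ct; [lra|]; intros; apply Rabs_pos. }
set (ia := RInt (fun s => Rabs (a s)) 0 l) in *.
(* One factor [ia] is bounded by the squared H^1 norm, the other by a multiple of mu^2. *)
assert (Ia2 : ia ^ 2 <= 2 * mu * l * (Hb + Hz)).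
{ apply Rle_trans with (ia * (2 * mu ^ 2 * l)); [simpl; rewrite Rmult_1_r; apply Rmult_le_compat_l; assumption|].
  apply Rle_trans with ((Hb + Hz) * (2 * mu ^ 2 * l)); [apply Rmult_le_compat_r; [|assumption]|].
  - assert (0 <= mu ^ 2) by apply pow2_ge_0; nra.
  - replace (2 * mu * l * (Hb + Hz)) with ((Hb + Hz) * (2 * mu * l)) by ring.
    apply Rmult_le_compat_l; [lra|]. assert (mu ^ 2 <= mu) by nra. nra. }
set (r1 := RInt (fun s => sin (th s) * b s) 0 l) in *.
set (r2 := RInt (fun s => cos (th s) * b s) 0 l) in *.
(* Closure exchanges the moments of [b], of first order, for moments of [a], of second order. *)
assert (E1 : r1 = RInt (fun s => a s * cos (th s)) 0 l).
{ unfold r1; rewrite (int_ext _ (fun s => b s * sin (th s))) by (intros; rring).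
  rewrite int_minus in I1 by ct; lra. }
assert (E2 : r2 = - RInt (fun s => a s * sin (th s)) 0 l).
{ unfold r2; rewrite (int_ext _ (fun s => b s * cos (th s))) by (intros; rring).
  rewrite int_plus in I2 by ct; lra. }
assert (R1 : Rabs r1 <= ia).
{ rewrite E1; eapply Rle_trans; [apply int_abs; ct; lra|].
  apply int_le; ct; [lra|]; intros s _; rewrite <- (Rmult_1_r (Rabs (a s))).
  apply Rabs_mult_le; [lra|]; assert (E := COS_bound (th s)); apply Rabs_le; lra. }
assert (R2 : Rabs r2 <= ia).
{ rewrite E2, Rabs_Ropp; eapply Rle_trans; [apply int_abs; ct; lra|].
  apply int_le; ct; [lra|]; intros s _; rewrite <- (Rmult_1_r (Rabs (a s))).
  apply Rabs_mult_le; [lra|]; assert (E := SIN_bound (th s)); apply Rabs_le; lra. }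
apply sqr_abs_le in R1; apply sqr_abs_le in R2.
assert (RR : N * (r1 ^ 2 + r2 ^ 2) <= 4 * N * l * mu * (Hb + Hz)).
{ apply Rle_trans with (N * (2 * (2 * mu * l * (Hb + Hz)))); [apply Rmult_le_compat_l; lra|right; ring]. }
(* The excess over [ka] of the rate at which the longitude of T changes; it is O(mu). *)
pose (w := fun s => ((1 + a s) * b' s - b s * a' s) / (1 - z s ^ 2)).
assert (Z1 : forall s, 0 <= s <= l -> 3 / 4 <= 1 - z s ^ 2).
{ intros s Hs; destruct (Cl s Hs) as [_ [_ [L3 _]]]; apply sqr_abs_le in L3; nra. }
assert (Om : forall s, 0 <= s <= l -> ((1 + a s) * (b' s + ka s * (1 + a s))
      - b s * (a' s - ka s * b s)) / (1 - z s ^ 2) = ka s + w s).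
{ intros s Hs; specialize (Z1 s Hs); unfold w; specialize (U s).
  replace ((1 + a s) * (b' s + ka s * (1 + a s)) - b s * (a' s - ka s * b s))
    with (ka s * ((1 + a s) ^ 2 + b s ^ 2) + ((1 + a s) * b' s - b s * a' s)) by ring.
  replace ((1 + a s) ^ 2 + b s ^ 2) with (1 - z s ^ 2) by lra; field; lra. }
assert (Wb : forall s, 0 <= s <= l -> Rabs (w s) <= 3 * mu).
{ intros s Hs; specialize (Z1 s Hs); destruct (Cl s Hs) as [L1 [L2 [L3 [L4 [L5 L6]]]]].
  unfold w, Rdiv; rewrite Rabs_mult, Rabs_inv, (Rabs_pos_eq (1 - z s ^ 2)) by lra.
  apply Rmult_le_reg_r with (1 - z s ^ 2); [lra|].
  rewrite Rmult_assoc, Rinv_l, Rmult_1_r by lra.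
  assert (T1 : Rabs ((1 + a s) * b' s) <= 3 / 2 * mu).
  { apply Rabs_mult_le; [|assumption]; apply Rabs_le_between in L1; apply Rabs_le; lra. }
  assert (T2 : Rabs (- (b s * a' s)) <= 1 / 2 * mu).
  { rewrite Rabs_Ropp; apply Rabs_mult_le; lra. }
  eapply Rle_trans; [apply Rabs_triang|]; nra. }
set (A := RInt (fun s => z s * (_ / _)) 0 l).
set (iz := RInt (fun s => Rabs (z s)) 0 l).
assert (Iz0 : 0 <= iz) by (apply int_ge0; ct; [lra|]; intros; apply Rabs_pos).
set (Kz := RInt (fun s => ka s * z s) 0 l) in *.
assert (KzB : Rabs Kz <= M * iz).
{ unfold Kz, iz; rewrite <- int_scal by ct; eapply Rle_trans; [apply int_abs; ct; lra|].
  apply int_le; ct; [lra|]; intros s Hs; apply Rabs_mult_le; [apply BM; assumption|lra]. }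
assert (Iz2 : iz ^ 2 <= l * (Hb + Hz)).
{ assert (CS := int_cauchy_schwarz (fun _ => 1) (fun s => Rabs (z s)) 0 l ltac:(lra)
    (cts_const 1) ltac:(ct)).
  rewrite (int_ext (fun s => 1 * Rabs (z s)) (fun s => Rabs (z s))) in CS by (intros; rring).
  rewrite (int_ext (fun _ => 1 ^ 2) (fun _ => 1)) in CS by (intros; rring).
  fold iz in CS; rewrite int_const in CS.
  eapply Rle_trans; [exact CS|]; rewrite Rmult_1_l, Rminus_0_r.
  apply Rmult_le_compat_l; [lra|].
  apply Rle_trans with Hz; [|lra].
  apply int_le; ct; [lra|]; intros s _; rewrite pow2_abs; assert (P := pow2_ge_0 (z' s)); lra. }
(* [z w] is continuous only where [z^2 < 1]: extend by its limit values *)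
assert (AB : Rabs (A - Kz) <= 3 * mu * iz).
{ assert (Cw : forall s, 0 <= s <= l -> continuous w s).
  { intros s Hs; apply (continuous_mult (fun s => (1 + a s) * b' s - b s * a' s) (fun s => / (1 - z s ^ 2))).
    - revert s Hs; intros s _; revert s; change (cts (fun s => (1 + a s) * b' s - b s * a' s)); ct.
    - apply (continuous_comp (fun s => 1 - z s ^ 2) Rinv).
      + revert s Hs; intros s _; revert s; change (cts (fun s => 1 - z s ^ 2)); ct.
      + apply (@ex_derive_continuous R_AbsRing R_NormedModule); specialize (Z1 s Hs); auto_derive; lra. }
  assert (Ezw : ex_RInt (fun s => z s * w s) 0 l).
  { apply (@ex_RInt_continuous R_CompleteNormedModule); rewrite Rmin_left, Rmax_right by lra.
    intros s Hs; apply (continuous_mult z w); [apply Cz|apply Cw; assumption]. }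
  assert (EA : A = Kz + RInt (fun s => z s * w s) 0 l).
  { unfold A, Kz; rewrite <- (@RInt_plus R_CompleteNormedModule) by (try assumption; apply cts_ex_RInt; ct).
    apply RInt_ext; rewrite Rmin_left, Rmax_right by lra; intros s Hs; rewrite Om by lra.
    change (@eq R (z s * (ka s + w s)) (ka s * z s + z s * w s)); ring. }
  assert (EA' : A - Kz = RInt (fun s => z s * w s) 0 l) by lra; rewrite EA'.
  eapply Rle_trans; [apply abs_RInt_le; [lra|exact Ezw]|].
  unfold iz; rewrite <- int_scal by ct; apply RInt_le; [lra| |apply cts_ex_RInt; ct|].
  - apply (@ex_RInt_continuous R_CompleteNormedModule); rewrite Rmin_left, Rmax_right by lra.
    intros s Hs; apply (continuous_comp (fun s => z s * w s) Rabs); [|apply continuous_Rabs].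
    apply (continuous_mult z w); [apply Cz|apply Cw; assumption].
  - intros s Hs; rewrite Rmult_comm; rewrite (Rmult_comm (3 * mu)).
    rewrite Rmult_comm; apply Rabs_mult_le; [lra|apply Wb; lra]. }
(* The square of A - Kz is dropped; only the cross term costs something. *)
assert (AQ : Kz ^ 2 - 6 * M * mu * l * (Hb + Hz) <= A ^ 2).
{ replace (A ^ 2) with (Kz ^ 2 + 2 * (Kz * (A - Kz)) + (A - Kz) ^ 2) by ring.
  assert (P := pow2_ge_0 (A - Kz)).
  assert (Q := Rabs_mult_le _ _ _ _ KzB AB); apply Rabs_le_between in Q.
  replace (M * iz * (3 * mu * iz)) with (3 * M * mu * iz ^ 2) in Q by ring.
  assert (3 * M * mu * iz ^ 2 <= 3 * M * mu * (l * (Hb + Hz))); [|lra].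
  apply Rmult_le_compat_l; [mpos|assumption]. }
pose (e := fun s => a' s ^ 2 - Lam * cos (th s) * a s ^ 2 + 2 * ka s * (a s * b' s - a' s * b s)).
assert (Ce : cts e) by (unfold e; ct).
assert (Ie : - (Lam + 4 * M) * mu * (Hb + Hz) <= RInt e 0 l).
{ rewrite <- Ih, <- int_scal by ct; apply int_le; ct; [lra|]; intros s Hs.
  destruct (Cl s Hs) as [L1 [L2 [L3 [L4 [L5 L6]]]]]; destruct (Aq s Hs) as [A1 [_ A2]].
  assert (T1 : Rabs (cos (th s) * (a s * a s)) <= 1 * (mu * h s)).
  { apply Rabs_mult_le; [assert (E := COS_bound (th s)); apply Rabs_le; lra|].
    apply Rabs_mult_le; assumption. }
  assert (T2 : Rabs (ka s * (a s * b' s)) <= M * (h s * mu)).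
  { apply Rabs_mult_le; [apply BM; assumption|apply Rabs_mult_le; assumption]. }
  assert (T3 : Rabs (ka s * (a' s * b s)) <= M * (h s * mu)).
  { apply Rabs_mult_le; [apply BM; assumption|apply Rabs_mult_le; assumption]. }
  apply Rabs_le_between in T1; apply Rabs_le_between in T2; apply Rabs_le_between in T3.
  assert (P := pow2_ge_0 (a' s)); unfold e.
  assert (T4 : Lam * (cos (th s) * (a s * a s)) <= Lam * (1 * (mu * h s)))
    by (apply Rmult_le_compat_l; lra).
  lra. }
assert (EE : RInt (fun s => (a' s - ka s * b s) ^ 2 + (b' s + ka s * (1 + a s)) ^ 2 + z' s ^ 2) 0 l
  = RInt (fun s => ka s ^ 2) 0 l + jform (pot_planar Lam th) b b' l + jform (pot Lam th ka) z z' l + RInt e 0 l).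
(* Criticality of the figure eight: by the pendulum equation the integral of ka b' is Lam times the
   sine moment of [b], which closure turns into the cosine moment of [a]. So the terms 2 ka b' and -
   2 Lam a cos th of the expansion cancel after integration. *)
{ assert (K : RInt (fun s => ka s * b' s - Lam * (sin (th s) * b s)) 0 l = ka l * b l - ka 0 * b 0).
  { apply (int_deriv (fun s => ka s * b s)); [|ct].
    assert (Dk := pd_ka _ _ _ _ _ _ H); intros s; ader. }
  rewrite Bl, B0, int_minus, int_scal in K by ct; fold r1 in K; rewrite E1 in K.
  unfold jform.
  rewrite (int_ext (fun s => (a' s - ka s * b s) ^ 2 + (b' s + ka s * (1 + a s)) ^ 2 + z' s ^ 2)
   (fun s => ka s ^ 2 + (b' s ^ 2 - pot_planar Lam th s * b s ^ 2)
    + (z' s ^ 2 - pot Lam th ka s * z s ^ 2) + e s + 2 * (ka s * b' s) - 2 * Lam * (a s * cos (th s)))).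
  - rewrite int_minus, !int_plus, !int_scal by ct; as_real; lra.
  - intros s; specialize (U s); unfold e, pot, pot_planar.
    replace (2 * Lam * (a s * cos (th s))) with
      (Lam * cos (th s) * ((1 + a s) ^ 2 + b s ^ 2 + z s ^ 2 - 1 - (a s ^ 2 + b s ^ 2 + z s ^ 2))) by ring.
    transitivity (a' s ^ 2 + b' s ^ 2 + z' s ^ 2 + ka s ^ 2 * ((1 + a s) ^ 2 + b s ^ 2 + z s ^ 2 - z s ^ 2)
      + 2 * ka s * b' s + 2 * ka s * (a s * b' s - a' s * b s)); [as_real; ring|].
    rewrite U; as_real; ring. }
rewrite EE.
assert (BA : B / l * Kz ^ 2 - 6 * M * B * mu * (Hb + Hz) <= B / l * A ^ 2).
{ replace (B / l * Kz ^ 2 - 6 * M * B * mu * (Hb + Hz))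
    with (B / l * (Kz ^ 2 - 6 * M * mu * l * (Hb + Hz))) by (field; lra).
  apply Rmult_le_compat_l; [|assumption]; apply Rlt_le, Rdiv_lt_0_compat; lra. }
assert (F1 : c * Hz <= c1 * Hz) by (apply Rmult_le_compat_r; lra).
assert (F2 : c * Hb <= c2 * Hb) by (apply Rmult_le_compat_r; lra).
assert (F3 : mu * W * (Hb + Hz) <= c * (Hb + Hz)) by (apply Rmult_le_compat_r; lra).
unfold W in F3; lra.
Qed.

End Core.

(** * Vectors *)

Lemma px_plus (u v : vec) : px (plus u v) = px u + px v. Proof. reflexivity. Qed.
Lemma py_plus (u v : vec) : py (plus u v) = py u + py v. Proof. reflexivity. Qed.
Lemma pz_plus (u v : vec) : pz (plus u v) = pz u + pz v. Proof. reflexivity. Qed.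
Lemma px_scal (k : R) (v : vec) : px (scal k v) = k * px v. Proof. reflexivity. Qed.
Lemma py_scal (k : R) (v : vec) : py (scal k v) = k * py v. Proof. reflexivity. Qed.
Lemma pz_scal (k : R) (v : vec) : pz (scal k v) = k * pz v. Proof. reflexivity. Qed.
Lemma px_minus (u v : vec) : px (minus u v) = px u - px v. Proof. reflexivity. Qed.
Lemma py_minus (u v : vec) : py (minus u v) = py u - py v. Proof. reflexivity. Qed.
Lemma pz_minus (u v : vec) : pz (minus u v) = pz u - pz v. Proof. reflexivity. Qed.
Lemma px_opp (u : vec) : px (opp u) = - px u. Proof. reflexivity. Qed.
Lemma py_opp (u : vec) : py (opp u) = - py u. Proof. reflexivity. Qed.
Lemma pz_opp (u : vec) : pz (opp u) = - pz u. Proof. reflexivity. Qed.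
Lemma px_mk (x y z : R) : px (mkvec x y z) = x. Proof. reflexivity. Qed.
Lemma py_mk (x y z : R) : py (mkvec x y z) = y. Proof. reflexivity. Qed.
Lemma pz_mk (x y z : R) : pz (mkvec x y z) = z. Proof. reflexivity. Qed.
Lemma px_zero : px zero = 0. Proof. reflexivity. Qed.
Lemma py_zero : py zero = 0. Proof. reflexivity. Qed.
Lemma pz_zero : pz zero = 0. Proof. reflexivity. Qed.

Ltac vnorm := unfold dot, cross in *; repeat rewrite ?px_plus, ?py_plus, ?pz_plus, ?px_scal, ?py_scal,
  ?pz_scal, ?px_minus, ?py_minus, ?pz_minus, ?px_opp, ?py_opp, ?pz_opp, ?px_mk, ?py_mk, ?pz_mk,
  ?px_zero, ?py_zero, ?pz_zero.
Ltac vring := vnorm; ring.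
Ltac veq := apply vec_eq; vnorm; ring.

Lemma dot_plus_l (u v w : vec) : dot (plus u v) w = dot u w + dot v w. Proof. vring. Qed.
Lemma dot_plus_r (u v w : vec) : dot w (plus u v) = dot w u + dot w v. Proof. vring. Qed.
Lemma dot_minus_l (u v w : vec) : dot (minus u v) w = dot u w - dot v w. Proof. vring. Qed.
Lemma dot_minus_r (u v w : vec) : dot w (minus u v) = dot w u - dot w v. Proof. vring. Qed.
Lemma dot_scal_l (k : R) (u w : vec) : dot (scal k u) w = k * dot u w. Proof. vring. Qed.
Lemma dot_scal_r (k : R) (u w : vec) : dot w (scal k u) = k * dot w u. Proof. vring. Qed.
Lemma dot_ge0 (v : vec) : 0 <= dot v v.
Proof. unfold dot; nra. Qed.

(** The norm on a product of normed modules is the Euclidean combination of the two norms; a vector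
    is a pair nested twice. *)
Lemma norm_dot (v : vec) : norm v = sqrt (dot v v).
Proof.
destruct v as [[x y] z].
change (norm ((x, y, z) : vec)) with (sqrt (sqrt (Rabs x ^ 2 + Rabs y ^ 2) ^ 2 + Rabs z ^ 2)).
rewrite !pow2_abs, pow2_sqrt by nra; unfold dot, px, py, pz; simpl; f_equal; ring.
Qed.

Lemma norm_sqr (v : vec) : norm v ^ 2 = dot v v.
Proof. rewrite norm_dot; apply pow2_sqrt, dot_ge0. Qed.

Lemma norm_unit (v : vec) : dot v v = 1 -> norm v = 1.
Proof. intros E; rewrite norm_dot, E; apply sqrt_1. Qed.

Lemma norm_pos (v : vec) : 0 <= norm v.
Proof. rewrite norm_dot; apply sqrt_pos. Qed.

Lemma dot_le_norm (u v : vec) : Rabs (dot u v) <= norm u * norm v.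
Proof.
rewrite !norm_dot, <- sqrt_mult by apply dot_ge0.
rewrite <- sqrt_Rsqr_abs; apply sqrt_le_1_alt.
assert (P : 0 <= dot (cross u v) (cross u v)) by apply dot_ge0.
replace (dot u u * dot v v) with (Rsqr (dot u v) + dot (cross u v) (cross u v)); [lra|].
unfold Rsqr; vring.
Qed.

Lemma norm_cross_le (u v : vec) : norm (cross u v) <= norm u * norm v.
Proof.
rewrite !norm_dot, <- sqrt_mult by apply dot_ge0; apply sqrt_le_1_alt.
replace (dot u u * dot v v) with (Rsqr (dot u v) + dot (cross u v) (cross u v)).
- assert (P := Rle_0_sqr (dot u v)); lra.
- unfold Rsqr; vring.
Qed.

Lemma norm_scal_vec (k : R) (v : vec) : norm (scal k v) = Rabs k * norm v.
Proof.
rewrite !norm_dot, dot_scal_l, dot_scal_r, <- sqrt_Rsqr_abs, <- sqrt_mult.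
- f_equal; unfold Rsqr; ring.
- apply Rle_0_sqr.
- apply dot_ge0.
Qed.

Lemma norm_minus_sym (u v : vec) : norm (minus u v) = norm (minus v u).
Proof. rewrite !norm_dot; f_equal; vring. Qed.

Lemma norm_plus_le (u v : vec) : norm (plus u v) <= norm u + norm v.
Proof. apply (@norm_triangle R_AbsRing). Qed.

Lemma norm_minus_triangle (u v w : vec) : norm (minus u w) <= norm (minus u v) + norm (minus v w).
Proof.
replace (minus u w) with (plus (minus u v) (minus v w)) by veq; apply norm_plus_le.
Qed.

Lemma norm_eq_0_vec (v : vec) : norm v = 0 -> v = zero.
Proof.
intros E; assert (F := norm_sqr v); rewrite E in F; unfold dot in F.
apply vec_eq; rewrite ?px_zero, ?py_zero, ?pz_zero; nra.
Qed.

Lemma dot_diff_le (u v u' v' : vec) :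
  Rabs (dot u v - dot u' v') <= norm (minus u u') * norm v + norm u' * norm (minus v v').
Proof.
replace (dot u v - dot u' v') with (dot (minus u u') v + dot u' (minus v v')) by vring.
eapply Rle_trans; [apply Rabs_triang|]; apply Rplus_le_compat; apply dot_le_norm.
Qed.

Lemma cross_diff_le (u v u' v' : vec) :
  norm (minus (cross u v) (cross u' v')) <= norm (minus u u') * norm v + norm u' * norm (minus v v').
Proof.
replace (minus (cross u v) (cross u' v')) with (plus (cross (minus u u') v) (cross u' (minus v v'))) by veq.
eapply Rle_trans; [apply norm_plus_le|]; apply Rplus_le_compat; apply norm_cross_le.
Qed.

Lemma cross_dot_cross (u v a b : vec) :
  dot (cross u v) (cross a b) = dot u a * dot v b - dot u b * dot v a.
Proof. vring. Qed.

Lemma cross_cross (a b c : vec) : cross a (cross b c) = minus (scal (dot a c) b) (scal (dot a b) c).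
Proof. veq. Qed.

Lemma cross_anti (a b : vec) : cross a b = opp (cross b a).
Proof. veq. Qed.

Lemma cross_plus_r (a b c : vec) : cross a (plus b c) = plus (cross a b) (cross a c).
Proof. veq. Qed.
Lemma cross_scal_r (a b : vec) (k : R) : cross a (scal k b) = scal k (cross a b).
Proof. veq. Qed.

Definition orthonormal (a b : vec) : Prop := dot a a = 1 /\ dot b b = 1 /\ dot a b = 0.

Lemma parseval (a b u v : vec) : orthonormal a b ->
  dot u v = dot u a * dot v a + dot u b * dot v b + dot u (cross a b) * dot v (cross a b).
Proof.
intros [Ha [Hb Hab]]; rewrite (frame_expand a b u Ha Hb Hab) at 1.
rewrite !dot_plus_l, !dot_scal_l, !(dot_sym v); reflexivity.
Qed.

Lemma vec_ext_frame (a b u v : vec) : orthonormal a b ->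
  dot u a = dot v a -> dot u b = dot v b -> dot u (cross a b) = dot v (cross a b) -> u = v.
Proof.
intros [Ha [Hb Hab]] E1 E2 E3; rewrite (frame_expand a b u Ha Hb Hab), (frame_expand a b v Ha Hb Hab).
rewrite E1, E2, E3; reflexivity.
Qed.

(** * Smooth curves *)

Lemma smooth_is_derive (f : R -> R) (s : R) : smooth f -> is_derive f s (Derive f s).
Proof. intros Hf; apply Derive_correct, smooth_ex_derive, Hf. Qed.

Lemma smooth_cts (f : R -> R) : smooth f -> cts f.
Proof. intros Hf; apply (is_derive_cts f (Derive f)); intros s; apply smooth_is_derive, Hf. Qed.

Lemma is_derive_dot (c d : R -> vec) (s : R) : vsmooth c -> vsmooth d ->
  is_derive (fun t : R => dot (c t) (d t)) s (dot (vDerive c s) (d s) + dot (c s) (vDerive d s)).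
Proof.
intros [Cx [Cy Cz]] [Dx [Dy Dz]].
assert (P : forall f g : R -> R, smooth f -> smooth g ->
  is_derive (fun t => f t * g t) s (Derive f s * g s + f s * Derive g s)).
{ intros f g Hf Hg.
  assert (Df := smooth_is_derive f s Hf); assert (Dg := smooth_is_derive g s Hg).
  apply (is_derive_mult f g s _ _ Df Dg); intros; apply Rmult_comm. }
unfold dot; evar_last.
- apply @is_derive_plus; [apply @is_derive_plus|].
  + exact (P _ _ Cx Dx).
  + exact (P _ _ Cy Dy).
  + exact (P _ _ Cz Dz).
- unfold vDerive; rewrite !px_mk, !py_mk, !pz_mk; unfold plus; simpl; ring.
Qed.

Lemma is_derive_dot_const (c : R -> vec) (w : vec) (s : R) : vsmooth c ->
  is_derive (fun t : R => dot (c t) w) s (dot (vDerive c s) w).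
Proof.
intros [Cx [Cy Cz]].
assert (Dx := smooth_is_derive _ s Cx); assert (Dy := smooth_is_derive _ s Cy).
assert (Dz := smooth_is_derive _ s Cz).
unfold dot, vDerive; rewrite !px_mk, !py_mk, !pz_mk.
apply @is_derive_plus; [apply @is_derive_plus|]; apply @is_derive_scal_l; assumption.
Qed.

Lemma cts_dot (c d : R -> vec) : vsmooth c -> vsmooth d -> cts (fun s => dot (c s) (d s)).
Proof.
intros Hc Hd; apply (is_derive_cts _ (fun s => dot (vDerive c s) (d s) + dot (c s) (vDerive d s))).
intros s; apply is_derive_dot; assumption.
Qed.

Lemma cts_dot_const (c : R -> vec) (w : vec) : vsmooth c -> cts (fun s => dot (c s) w).
Proof.
intros Hc; apply (is_derive_cts _ (fun s => dot (vDerive c s) w)).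
intros s; apply is_derive_dot_const; assumption.
Qed.

#[export] Hint Resolve cts_dot cts_dot_const vsmooth_vDerive smooth_cts : ct.

Lemma vDerive_period (c : R -> vec) (l : R) : (forall s, c (s + l) = c s) ->
  forall s, vDerive c (s + l) = vDerive c s.
Proof.
intros Hc s.
assert (P : forall f : R -> R, (forall s, f (s + l) = f s) -> Derive f (s + l) = Derive f s).
{ intros f Hf; unfold Derive; f_equal; apply Lim_ext; intros h.
  replace (s + l + h) with ((s + h) + l) by ring; rewrite !Hf; reflexivity. }
unfold vDerive; rewrite !P; [reflexivity| | |]; intros t; rewrite Hc; reflexivity.
Qed.

(* If [z = T . e], the projections of [M1] and [M2] on [e] have squared length
   [1 - z^2], and their polar angle has derivative [u3 + z (T x T') . e / (1 - z^2)]. *)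
Section Twist.
Context (l : R) (r : rod) (F : vec) (Hr : closed_rod l r) (HF : dot F F = 1).
Context (Hz : forall s, Rabs (dot (tangent r s) F) <= 1 / 2).

Let z (s : R) : R := dot (tangent r s) F.
Definition spin (s : R) : R :=
  dot (tangent r s) F * (dot (cross (tangent r s) (vDerive (tangent r) s)) F
    / (1 - dot (tangent r s) F ^ 2)).

Lemma closed_rod_vsmooth : vsmooth (tangent r) /\ vsmooth (mat1 r) /\ vsmooth (mat2 r).
Proof.
destruct Hr as [Sc [S1 [S2 _]]]; repeat split; try apply S1; try apply S2;
  apply (vsmooth_vDerive _ Sc).
Qed.

Lemma tangent_period (s : R) : tangent r (s + l) = tangent r s.
Proof. destruct Hr as [_ [_ [_ [P _]]]]; apply vDerive_period, P. Qed.

Lemma z_sqr_lt (s : R) : 3 / 4 <= 1 - z s ^ 2.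
Proof. specialize (Hz s); apply sqr_abs_le in Hz; unfold z; lra. Qed.

Lemma cts_spin : cts spin.
Proof.
destruct closed_rod_vsmooth as [ST _].
unfold spin; apply cts_mult; [ct|]; apply cts_div; [| |].
(* The triple product is written through scalar products with the standard basis, so that its
   continuity is found by the hint database. *)
- assert (E : (fun s => dot (cross (tangent r s) (vDerive (tangent r) s)) F)
    = (fun s => dot (tangent r s) (mkvec 1 0 0) * (dot (vDerive (tangent r) s) (mkvec 0 1 0) * pz F)
      - dot (tangent r s) (mkvec 0 1 0) * (dot (vDerive (tangent r) s) (mkvec 1 0 0) * pz F)
      + (dot (tangent r s) (mkvec 0 1 0) * (dot (vDerive (tangent r) s) (mkvec 0 0 1) * px F)
      - dot (tangent r s) (mkvec 0 0 1) * (dot (vDerive (tangent r) s) (mkvec 0 1 0) * px F))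
      + (dot (tangent r s) (mkvec 0 0 1) * (dot (vDerive (tangent r) s) (mkvec 1 0 0) * py F)
      - dot (tangent r s) (mkvec 1 0 0) * (dot (vDerive (tangent r) s) (mkvec 0 0 1) * py F)))).
  { apply functional_extensionality; intros s; vring. }
  rewrite E; ct.
- ct.
- intros s; assert (A := z_sqr_lt s); unfold z in A; lra.
Qed.

(** Only a squared cosine is obtained because [J] compares lines rather than directions; being a
    quotient, it requires neither a polar angle nor a square root. [twist_eq] then removes the
    ambiguity by a multiple of PI through smallness of the angle. *)
Lemma twist_rotation : mat1 r l = mat1 r 0 -> mat2 r l = mat2 r 0 ->
  cos (RInt (fun s => u3 r s + spin s) 0 l) ^ 2 = 1.
Proof.
intros E1 E2; destruct closed_rod_vsmooth as [ST [S1 S2]].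
assert (SE := fun s => strain_equations l r s Hr).
assert (Cu3 : cts (u3 r)) by (unfold u3; ct).
assert (Cs := cts_spin).
pose (Phi := fun s => RInt (fun t => u3 r t + spin t) 0 s).
assert (DPhi : forall s, is_derive Phi s (u3 r s + spin s)).
{ intros s; apply (@is_derive_RInt R_NormedModule (fun t => u3 r t + spin t) Phi 0 s);
    [|revert s; change (cts (fun t => u3 r t + spin t)); ct].
  apply filter_forall; intros x; apply (@RInt_correct R_CompleteNormedModule), cts_ex_RInt; ct. }
pose (d := fun s => dot (mat1 r s) F); pose (c := fun s => dot (mat2 r s) F).
assert (Dd : forall s, is_derive d s (u2 r s * z s - u3 r s * c s)).
{ intros s; destruct (SE s) as [_ [A _]]; evar_last; [apply is_derive_dot_const, S1|].
  rewrite A, dot_plus_l, !dot_scal_l; unfold c, z; ring. }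
assert (Dc : forall s, is_derive c s (- u1 r s * z s + u3 r s * d s)).
{ intros s; destruct (SE s) as [_ [_ A]]; evar_last; [apply is_derive_dot_const, S2|].
  rewrite A, dot_plus_l, !dot_scal_l; unfold d, z; ring. }
assert (Dz : forall s, is_derive z s (- u2 r s * d s + u1 r s * c s)).
{ intros s; destruct (SE s) as [A _]; evar_last; [apply is_derive_dot_const, ST|].
  rewrite A, dot_plus_l, !dot_scal_l; unfold c, d; ring. }
assert (O : forall s, orthonormal (mat1 r s) (mat2 r s)).
{ intros s; destruct Hr as [_ [_ [_ [_ [_ [H1 [H2 [H3 _]]]]]]]]; repeat split; auto. }
assert (HX : forall s, cross (mat1 r s) (mat2 r s) = tangent r s) by apply Hr.
assert (Uz : forall s, d s ^ 2 + c s ^ 2 = 1 - z s ^ 2).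
{ intros s; assert (P := parseval _ _ F F (O s)); rewrite HX, HF, !(dot_sym F) in P.
  unfold d, c, z; lra. }
assert (Sp : forall s, spin s = z s * (- u1 r s * d s - u2 r s * c s) / (1 - z s ^ 2)).
{ intros s; unfold spin; fold (z s); destruct (SE s) as [A _].
  rewrite A, cross_plus_r, !cross_scal_r, <- HX.
  replace (cross (cross (mat1 r s) (mat2 r s)) (mat1 r s)) with (mat2 r s).
  - replace (cross (cross (mat1 r s) (mat2 r s)) (mat2 r s)) with (opp (mat1 r s)).
    + rewrite dot_plus_l, !dot_scal_l; unfold d, c, Rdiv.
      replace (dot (opp (mat1 r s)) F) with (- dot (mat1 r s) F) by vring; ring.
    + rewrite cross_anti, cross_cross; destruct (O s) as [_ [O2 O3]].
      rewrite O2, (dot_sym _ (mat1 r s)), O3; veq.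
  - rewrite cross_anti, cross_cross; destruct (O s) as [O1 [_ O3]]; rewrite O1, O3; veq. }
assert (Mz : forall s, d s ^ 2 + c s ^ 2 <> 0).
{ intros s; rewrite Uz; assert (A := z_sqr_lt s); lra. }
set (d0 := d 0); set (c0 := c 0).
(* the direction of (d, c), turned back by [Phi], is constant *)
pose (J := fun s => ((d s * cos (Phi s) + c s * sin (Phi s)) * d0
  + (- d s * sin (Phi s) + c s * cos (Phi s)) * c0) ^ 2 / (d s ^ 2 + c s ^ 2)).
assert (K : forall s, is_derive J s 0).
{ intros s; specialize (Mz s).
  assert (Sp' : spin s = z s * (- u1 r s * d s - u2 r s * c s) / (d s ^ 2 + c s ^ 2))
    by (rewrite Uz; apply Sp).
  unfold J; ader; [simpl in Mz; intros E; apply Mz; rewrite <- E; ring|].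
  rewrite Sp'; field; intros E; apply Mz; rewrite <- E; ring. }
assert (EJ : RInt (fun _ => 0) 0 l = J l - J 0) by (apply int_deriv; ct).
rewrite int_const in EJ.
assert (P0 : Phi 0 = 0) by (unfold Phi; rewrite RInt_point; reflexivity).
assert (dl : d l = d0) by (unfold d, d0; rewrite E1; reflexivity).
assert (cl : c l = c0) by (unfold c, c0; rewrite E2; reflexivity).
unfold J in EJ; rewrite P0, cos_0, sin_0, dl, cl in EJ; fold d0 c0 in EJ.
assert (M0 : d0 ^ 2 + c0 ^ 2 <> 0) by apply Mz.
change (cos (Phi l) ^ 2 = 1).
apply Rmult_eq_reg_l with (d0 ^ 2 + c0 ^ 2); [|assumption].
transitivity (((d0 * cos (Phi l) + c0 * sin (Phi l)) * d0
  + (- d0 * sin (Phi l) + c0 * cos (Phi l)) * c0) ^ 2 / (d0 ^ 2 + c0 ^ 2)); [field; assumption|].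
transitivity (((d0 * 1 + c0 * 0) * d0 + (- d0 * 0 + c0 * 1) * c0) ^ 2 / (d0 ^ 2 + c0 ^ 2)); [lra|].
field; assumption.
Qed.

Lemma twist_eq : mat1 r l = mat1 r 0 -> mat2 r l = mat2 r 0 ->
  Rabs (RInt (fun s => u3 r s + spin s) 0 l) < PI ->
  RInt (u3 r) 0 l = - RInt spin 0 l.
Proof.
intros E1 E2 B; assert (K := twist_rotation E1 E2).
destruct closed_rod_vsmooth as [ST [S1 S2]]; assert (Cs := cts_spin).
assert (Cu3 : cts (u3 r)) by (unfold u3; ct).
assert (E : RInt (fun s => u3 r s + spin s) 0 l = 0).
{ apply Rabs_lt_between in B; set (x := RInt _ 0 l) in *.
  assert (S0 : sin x = 0).
  { assert (T := sin2_cos2 x); unfold Rsqr in T; simpl in K; nra. }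
  destruct (Rtotal_order x 0) as [L|[L|L]]; [exfalso|assumption|exfalso].
  - assert (0 < sin (- x)) by (apply sin_gt_0; lra); rewrite sin_neg in *; lra.
  - assert (0 < sin x) by (apply sin_gt_0; lra); lra. }
rewrite int_plus in E by ct; lra.
Qed.

End Twist.

Lemma mat2_cross (l : R) (r : rod) (s : R) : closed_rod l r ->
  mat2 r s = cross (tangent r s) (mat1 r s).
Proof.
intros [_ [_ [_ [_ [_ [H1 [_ [H12 HX]]]]]]]].
rewrite <- HX, cross_anti, cross_cross, H1, H12; veq.
Qed.

Lemma closed_rod_frame (l : R) (r : rod) (s : R) : closed_rod l r ->
  orthonormal (mat1 r s) (mat2 r s) /\ cross (mat1 r s) (mat2 r s) = tangent r s /\
  dot (tangent r s) (mat1 r s) = 0 /\ dot (tangent r s) (mat2 r s) = 0.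
Proof.
intros [_ [_ [_ [_ [_ [H1 [H2 [H12 HX]]]]]]]].
repeat split; auto; rewrite <- HX; [apply dot_cross_l|apply dot_cross_r].
Qed.

(* A half-turn of the frame [N, B] only changes signs, so the square sees [d] modulo [PI]. *)
Lemma delta_psi_sin (l : R) (r : rod) (d : R) : closed_rod l r -> has_delta_psi l r d ->
  vDerive (tangent r) 0 <> zero -> dot (mat1 r l) (mat2 r 0) ^ 2 = sin d ^ 2.
Proof.
intros Hr [N [B [kap [tau [psi [[_ [_ [_ [_ [HN [HTN [HB [HT _]]]]]]]] [_ [HM ->]]]]]]]] HT0.
assert (TL := tangent_period l r Hr 0); rewrite Rplus_0_l in TL.
assert (TL' := vDerive_period _ _ (tangent_period l r Hr) 0); rewrite Rplus_0_l in TL'.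
rewrite !HT in TL'.
assert (K0 : kap 0 <> 0).
{ intros E; apply HT0; rewrite HT, E; veq. }
assert (E1 : kap l * dot (N l) (N 0) = kap 0).
{ rewrite <- dot_scal_l, TL', dot_scal_l, HN; ring. }
assert (E2 : kap l ^ 2 = kap 0 ^ 2).
{ assert (A : dot (scal (kap l) (N l)) (scal (kap l) (N l)) = dot (scal (kap 0) (N 0)) (scal (kap 0) (N 0)))
    by (rewrite TL'; reflexivity).
  rewrite !dot_scal_l, !dot_scal_r, !HN in A; lra. }
assert (KL : kap l <> 0) by (intros E; rewrite E in E2; nra).
(* [N] may fail to be periodic: where the curvature vector is nonzero it determines [N] up to sign,
   and [ep] is the sign acquired over one length. *)
set (ep := kap 0 / kap l).
assert (Hep : ep ^ 2 = 1) by (unfold ep; replace ((kap 0 / kap l) ^ 2) with (kap 0 ^ 2 / kap l ^ 2)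
  by (field; assumption); rewrite <- E2; field; assumption).
assert (NL : N l = scal ep (N 0)).
{ transitivity (scal (/ kap l) (scal (kap l) (N l))).
  - apply vec_eq; vnorm; field; assumption.
  - rewrite TL'; unfold ep; apply vec_eq; vnorm; field; assumption. }
rewrite (mat2_cross l r 0 Hr), !HM, !HB, NL, TL.
set (t := tangent r 0) in *; set (n := N 0) in *.
assert (Ht : dot t t = 1) by apply Hr.
assert (Hn : dot n n = 1) by apply HN.
assert (Htn : dot t n = 0) by apply HTN.
assert (A1 : dot n (cross t n) = 0) by (rewrite dot_sym; apply dot_cross_r).
assert (A2 : dot (cross t n) (cross t n) = 1) by (rewrite cross_dot_cross, Ht, Hn, Htn; ring).
assert (A3 : dot n t = 0) by (rewrite dot_sym; exact Htn).
rewrite !cross_plus_r, !cross_scal_r, cross_cross, Ht, Htn.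
rewrite !dot_plus_l, !dot_plus_r, !dot_scal_l, !dot_scal_r, !dot_minus_r, !dot_scal_r.
rewrite A1, A2, A3, dot_cross_l, dot_cross_r, Hn.
replace (psi l - psi 0) with (psi l + - psi 0) by ring; rewrite sin_plus, sin_neg, cos_neg.
transitivity (ep ^ 2 * (sin (psi l) * cos (psi 0) + cos (psi l) * - sin (psi 0)) ^ 2).
- ring.
- rewrite Hep; ring.
Qed.

Lemma bending_strains (l : R) (r : rod) (s : R) : closed_rod l r ->
  u1 r s ^ 2 + u2 r s ^ 2 = dot (vDerive (tangent r) s) (vDerive (tangent r) s).
Proof.
intros Hr; destruct (strain_equations l r s Hr) as [E _].
destruct (closed_rod_frame l r s Hr) as [[O1 [O2 O3]] _].
rewrite E, !dot_plus_l, !dot_plus_r, !dot_scal_l, !dot_scal_r, O1, O2, (dot_sym _ (mat1 r s)), O3; ring.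
Qed.

Lemma closed_rod_cts (l : R) (r : rod) : closed_rod l r ->
  cts (u1 r) /\ cts (u2 r) /\ cts (u3 r).
Proof.
intros Hr; destruct (closed_rod_vsmooth l r Hr) as [ST [S1 S2]].
unfold u1, u2, u3; repeat split; ct.
Qed.

(* Cauchy-Schwarz replaces the twist rate by its mean. *)
Lemma energy_ge (alpha beta l : R) (r : rod) : 0 <= beta -> 0 < l -> closed_rod l r ->
  alpha * RInt (fun s => dot (vDerive (tangent r) s) (vDerive (tangent r) s)) 0 l
    + beta / l * RInt (u3 r) 0 l ^ 2 <= energy alpha beta l r.
Proof.
intros Hb Hl Hr; destruct (closed_rod_cts l r Hr) as [C1 [C2 C3]].
destruct (closed_rod_vsmooth l r Hr) as [ST _].
unfold energy; rewrite int_plus, !int_scal by ct.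
rewrite (int_ext _ _ _ _ (fun s => bending_strains l r s Hr)).
apply Rplus_le_compat_l; unfold Rdiv; rewrite Rmult_assoc; apply Rmult_le_compat_l; [assumption|].
assert (CS := int_cauchy_schwarz (fun _ => 1) (u3 r) 0 l ltac:(lra) (cts_const 1) C3).
rewrite (int_ext (fun s => 1 * u3 r s) (u3 r)) in CS by (intros; rring).
rewrite (int_ext (fun _ => 1 ^ 2) (fun _ => 1)) in CS by (intros; rring).
rewrite int_const in CS.
apply Rmult_le_reg_l with l; [assumption|].
rewrite <- Rmult_assoc, Rinv_r, Rmult_1_l by lra; lra.
Qed.

Lemma lipschitz_of_derive (f f' : R -> R) (M : R) : (forall s, is_derive f s (f' s)) -> cts f' ->
  (forall s, Rabs (f' s) <= M) -> forall s t, Rabs (f s - f t) <= M * Rabs (s - t).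
Proof.
intros Df Cf' B.
assert (A : forall s t, s <= t -> Rabs (f t - f s) <= M * (t - s)).
{ intros s t Hst; rewrite <- (int_deriv f f' s t Df Cf').
  eapply Rle_trans; [apply int_abs; assumption|].
  rewrite <- int_const; apply int_le; ct. }
intros s t; destruct (Rle_dec s t) as [L|L].
- rewrite (Rabs_minus_sym s t), (Rabs_pos_eq (t - s)), Rabs_minus_sym by lra; apply A, L.
- rewrite (Rabs_pos_eq (s - t)) by lra; apply A; lra.
Qed.

Lemma is_derive_comb (f g : R -> R) (f' g' : R) (A B : vec) (s : R) :
  is_derive f s f' -> is_derive g s g' ->
  vDerive (fun t => plus (scal (f t) A) (scal (g t) B)) s = plus (scal f' A) (scal g' B).
Proof.
intros Hf Hg.
assert (P : forall x y : R, Derive (fun t => f t * x + g t * y) s = f' * x + g' * y).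
{ intros x y; apply is_derive_unique; apply @is_derive_plus; apply @is_derive_scal_l; assumption. }
apply vec_eq; unfold vDerive; rewrite ?px_mk, ?py_mk, ?pz_mk.
- rewrite (Derive_ext _ (fun t => f t * px A + g t * px B)), P by reflexivity; vring.
- rewrite (Derive_ext _ (fun t => f t * py A + g t * py B)), P by reflexivity; vring.
- rewrite (Derive_ext _ (fun t => f t * pz A + g t * pz B)), P by reflexivity; vring.
Qed.

(** * The planar tangent field, and the normalization of a nearby field by rotations and a shift *)

Section Figure.
Context (q Lam C : R) (th ka X : R -> R) (H : pendulum q Lam C th ka X).
Context (E1 E2 : vec) (O : orthonormal E1 E2).

Let q_pos := pd_q _ _ _ _ _ _ H.
Let Lam_pos := pd_Lam _ _ _ _ _ _ H.
Let D_th := pd_th _ _ _ _ _ _ H.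
Let D_ka := pd_ka _ _ _ _ _ _ H.
Let C_th := pd_cts_th _ _ _ _ _ _ H.
Let C_ka := pd_cts_ka _ _ _ _ _ _ H.
Let l := 4 * q.
Let e := cross E1 E2.

Definition fig_T (s : R) : vec := plus (scal (cos (th s)) E1) (scal (sin (th s)) E2).
Definition fig_N (s : R) : vec := plus (scal (- sin (th s)) E1) (scal (cos (th s)) E2).

Lemma fig_T_unit (s : R) : dot (fig_T s) (fig_T s) = 1.
Proof.
destruct O as [O1 [O2 O3]]; unfold fig_T.
rewrite !dot_plus_l, !dot_plus_r, !dot_scal_l, !dot_scal_r, O1, O2, (dot_sym E2), O3.
assert (E := sin2_cos2 (th s)); unfold Rsqr in E; lra.
Qed.

Lemma fig_N_unit (s : R) : dot (fig_N s) (fig_N s) = 1.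
Proof.
destruct O as [O1 [O2 O3]]; unfold fig_N.
rewrite !dot_plus_l, !dot_plus_r, !dot_scal_l, !dot_scal_r, O1, O2, (dot_sym E2), O3.
assert (E := sin2_cos2 (th s)); unfold Rsqr in E; lra.
Qed.

Lemma fig_dot_TT (s t : R) : dot (fig_T s) (fig_T t) = cos (th s - th t).
Proof.
destruct O as [O1 [O2 O3]]; unfold fig_T.
rewrite !dot_plus_l, !dot_plus_r, !dot_scal_l, !dot_scal_r, O1, O2, (dot_sym E2), O3, cos_minus; ring.
Qed.

Lemma fig_dot_TN (s : R) : dot (fig_T s) (fig_N s) = 0.
Proof.
destruct O as [O1 [O2 O3]]; unfold fig_T, fig_N.
rewrite !dot_plus_l, !dot_plus_r, !dot_scal_l, !dot_scal_r, O1, O2, (dot_sym E2), O3; ring.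
Qed.

Lemma fig_dot_Te (s : R) : dot (fig_T s) e = 0.
Proof.
unfold fig_T, e; rewrite dot_plus_l, !dot_scal_l, !(dot_sym _ (cross E1 E2)), dot_cross_l, dot_cross_r; ring.
Qed.

Lemma fig_dot_Ne (s : R) : dot (fig_N s) e = 0.
Proof.
unfold fig_N, e; rewrite dot_plus_l, !dot_scal_l, !(dot_sym _ (cross E1 E2)), dot_cross_l, dot_cross_r; ring.
Qed.

Lemma fig_e_unit : dot e e = 1.
Proof.
destruct O as [O1 [O2 O3]]; unfold e; rewrite cross_dot_cross, O1, O2, O3, (dot_sym E2), O3; ring.
Qed.

Lemma fig_period (s : R) : fig_T (s + l) = fig_T s /\ fig_N (s + l) = fig_N s.
Proof.
unfold fig_T, fig_N, l; rewrite (pd_th_period _ _ _ _ _ _ H); split; reflexivity.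
Qed.

Lemma vDerive_fig_T (s : R) : vDerive fig_T s = scal (ka s) (fig_N s).
Proof.
unfold fig_T; rewrite (is_derive_comb _ _ (- sin (th s) * ka s) (cos (th s) * ka s)); [|ader|ader].
unfold fig_N; veq.
Qed.

Lemma fig_ka_bound (s : R) : Rabs (ka s) <= 2 * sqrt Lam.
Proof.
assert (E := pd_energy _ _ _ _ _ _ H s); assert (B := COS_bound (th s)).
assert (C0 := pd_C_ge0 _ _ _ _ _ _ H); assert (C1 := pd_C_lt _ _ _ _ _ _ H).
assert (C < Lam) by nra.
replace (2 * sqrt Lam) with (sqrt 4 * sqrt Lam)
  by (replace 4 with (2 ^ 2) by ring; rewrite sqrt_pow2 by lra; ring).
apply abs_le_of_sqr; nra.
Qed.

Lemma fig_lipschitz : exists K : R, 0 < K /\ forall s t : R,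
  Rabs (th s - th t) <= K * Rabs (s - t) /\
  norm (minus (fig_T s) (fig_T t)) <= K * Rabs (s - t) /\
  norm (minus (scal (ka s) (fig_N s)) (scal (ka t) (fig_N t))) <= K * Rabs (s - t).
Proof.
set (k0 := 2 * sqrt Lam).
assert (Hk0 : 0 < k0) by (assert (P := sqrt_lt_R0 Lam Lam_pos); unfold k0; lra).
exists (2 * k0 + 10 * Lam); split; [lra|]; intros s t.
assert (BK := fig_ka_bound); fold k0 in BK.
assert (BK2 : forall s, Rabs (ka s * ka s) <= 4 * Lam).
{ intros u; replace (4 * Lam) with (k0 * k0) by (unfold k0; assert (Q := sqrt_sqrt Lam ltac:(lra)); nra).
  apply Rabs_mult_le; apply BK. }
assert (Ns : forall x, Rabs (sin x) <= 1) by (intros x; assert (A := SIN_bound x); apply Rabs_le; lra).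
assert (Nc : forall x, Rabs (cos x) <= 1) by (intros x; assert (A := COS_bound x); apply Rabs_le; lra).
assert (L0 := lipschitz_of_derive th ka k0 D_th C_ka BK s t).
assert (L1 : Rabs (cos (th s) - cos (th t)) <= k0 * Rabs (s - t)).
{ apply (lipschitz_of_derive (fun s => cos (th s)) (fun s => - sin (th s) * ka s)); [intros u; ader|ct|].
  intros u; rewrite <- (Rmult_1_l k0); apply Rabs_mult_le; [rewrite Rabs_Ropp; apply Ns|apply BK]. }
assert (L2 : Rabs (sin (th s) - sin (th t)) <= k0 * Rabs (s - t)).
{ apply (lipschitz_of_derive (fun s => sin (th s)) (fun s => cos (th s) * ka s)); [intros u; ader|ct|].
  intros u; rewrite <- (Rmult_1_l k0); apply Rabs_mult_le; [apply Nc|apply BK]. }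
assert (L3 : Rabs (ka s * - sin (th s) - ka t * - sin (th t)) <= 5 * Lam * Rabs (s - t)).
{ apply (lipschitz_of_derive (fun s => ka s * - sin (th s))
    (fun s => Lam * (sin (th s) * sin (th s)) + - ((ka s * ka s) * cos (th s)))); [intros u; ader|ct|].
  intros u; eapply Rle_trans; [apply Rabs_triang|]; rewrite Rabs_Ropp.
  assert (A1 : Rabs (Lam * (sin (th u) * sin (th u))) <= Lam * (1 * 1)).
  { apply Rabs_mult_le; [rewrite Rabs_pos_eq; lra|apply Rabs_mult_le; apply Ns]. }
  assert (A2 : Rabs (ka u * ka u * cos (th u)) <= 4 * Lam * 1) by (apply Rabs_mult_le; [apply BK2|apply Nc]).
  lra. }
assert (L4 : Rabs (ka s * cos (th s) - ka t * cos (th t)) <= 5 * Lam * Rabs (s - t)).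
{ apply (lipschitz_of_derive (fun s => ka s * cos (th s))
    (fun s => - (Lam * (sin (th s) * cos (th s))) + - ((ka s * ka s) * sin (th s)))); [intros u; ader|ct|].
  intros u; eapply Rle_trans; [apply Rabs_triang|]; rewrite !Rabs_Ropp.
  assert (A1 : Rabs (Lam * (sin (th u) * cos (th u))) <= Lam * (1 * 1)).
  { apply Rabs_mult_le; [rewrite Rabs_pos_eq; lra|apply Rabs_mult_le; [apply Ns|apply Nc]]. }
  assert (A2 : Rabs (ka u * ka u * sin (th u)) <= 4 * Lam * 1) by (apply Rabs_mult_le; [apply BK2|apply Ns]).
  lra. }
destruct O as [O1 [O2 _]]; assert (N1 := norm_unit _ O1); assert (N2 := norm_unit _ O2).
assert (A := Rabs_pos (s - t)).
split; [nra|split].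
- replace (minus (fig_T s) (fig_T t)) with
    (plus (scal (cos (th s) - cos (th t)) E1) (scal (sin (th s) - sin (th t)) E2)) by (unfold fig_T; veq).
  eapply Rle_trans; [apply norm_plus_le|]; rewrite !norm_scal_vec, N1, N2; nra.
- replace (minus (scal (ka s) (fig_N s)) (scal (ka t) (fig_N t))) with
    (plus (scal (ka s * - sin (th s) - ka t * - sin (th t)) E1)
      (scal (ka s * cos (th s) - ka t * cos (th t)) E2)) by (unfold fig_N; veq).
  eapply Rle_trans; [apply norm_plus_le|]; rewrite !norm_scal_vec, N1, N2; nra.
Qed.

Lemma fig_cross_0q : cross (fig_T 0) (fig_T q) = scal (sin (th q)) e.
Proof.
unfold fig_T; rewrite (pd_th0 _ _ _ _ _ _ H), cos_0, sin_0; unfold e; veq.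
Qed.

Lemma fig_T0 : fig_T 0 = E1.
Proof. unfold fig_T; rewrite (pd_th0 _ _ _ _ _ _ H), cos_0, sin_0; veq. Qed.

Lemma fig_E2 : cross e E1 = E2.
Proof.
destruct O as [O1 [O2 O3]]; unfold e.
rewrite cross_anti, cross_cross, O1, O3; veq.
Qed.

(* The three unknowns of a rotation and the translation of the parameter are
   fixed by pinning values of the tangent at the points 0, q, 2q. *)
Definition pin (T : R -> vec) (s : R) : R :=
  dot (T (2 * q + s)) (T (q + s)) - dot (T s) (T (q + s)) * dot (T s) (T (2 * q + s)).

(** The factor sin (2 th d) makes [pin] change sign at 0, so every nearby field has a zero of its
    own [pin] close to 0. *)
Lemma fig_pin (d : R) : pin fig_T d = - (sin (th (q - d) - th d) * sin (2 * th d)).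
Proof.
unfold pin; rewrite !fig_dot_TT, (pd_th_2p _ _ _ _ _ _ H), (pd_th_1p _ _ _ _ _ _ H).
replace (- th d - th (q - d)) with (- ((th (q - d) - th d) + 2 * th d)) by ring.
replace (th d - th (q - d)) with (- (th (q - d) - th d)) by ring.
replace (th d - - th d) with (2 * th d) by ring.
rewrite !cos_neg, cos_plus; ring.
Qed.

Lemma pin_close (T : R -> vec) (eta s : R) : (forall s, dot (T s) (T s) = 1) ->
  (forall s, norm (minus (T s) (fig_T s)) <= eta) -> Rabs (pin T s - pin fig_T s) <= 6 * eta.
Proof.
intros U Cl; assert (He : 0 <= eta) by (eapply Rle_trans; [apply norm_pos|apply (Cl 0)]).
assert (D : forall s t, Rabs (dot (T s) (T t) - dot (fig_T s) (fig_T t)) <= 2 * eta).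
{ intros u t; eapply Rle_trans; [apply dot_diff_le|].
  rewrite (norm_unit (T t)), (norm_unit (fig_T u)) by (auto using fig_T_unit).
  assert (A1 := Cl u); assert (A2 := Cl t); lra. }
assert (B1 : forall s t, Rabs (dot (T s) (T t)) <= 1).
{ intros u t; eapply Rle_trans; [apply dot_le_norm|]; rewrite !norm_unit by auto; lra. }
assert (B2 : forall s t, Rabs (dot (fig_T s) (fig_T t)) <= 1).
{ intros u t; eapply Rle_trans; [apply dot_le_norm|]; rewrite !norm_unit by auto using fig_T_unit; lra. }
unfold pin.
replace (_ - _) with ((dot (T (2 * q + s)) (T (q + s)) - dot (fig_T (2 * q + s)) (fig_T (q + s)))
  + - ((dot (T s) (T (q + s)) - dot (fig_T s) (fig_T (q + s))) * dot (T s) (T (2 * q + s)))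
  + - (dot (fig_T s) (fig_T (q + s)) * (dot (T s) (T (2 * q + s)) - dot (fig_T s) (fig_T (2 * q + s)))))
  by ring.
replace (6 * eta) with (2 * eta + 2 * eta * 1 + 1 * (2 * eta)) by ring.
apply Rabs_sum3; rewrite ?Rabs_Ropp; [apply D| |]; apply Rabs_mult_le; auto.
Qed.

Lemma cts_pin (T : R -> vec) : vsmooth T -> cts (pin T).
Proof.
intros [Sx [Sy Sz]]; apply smooth_cts in Sx; apply smooth_cts in Sy; apply smooth_cts in Sz.
unfold pin, dot.
assert (Tx : forall c, cts (fun s => px (T (c + s)))) by (intros c; apply (cts_translate _ c Sx)).
assert (Ty : forall c, cts (fun s => py (T (c + s)))) by (intros c; apply (cts_translate _ c Sy)).
assert (Tz : forall c, cts (fun s => pz (T (c + s)))) by (intros c; apply (cts_translate _ c Sz)).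
ct.
Qed.

(** Taking F1 along T (sg) and the normal F1 x F2 along T (sg) x T (sg + q) settles all conditions
    but one. That one is [pin T sg = 0], since for a unit field [pin] is the scalar product of T (s)
    x T (q + s) with T (s) x T (2 q + s). The root is found by the intermediate value theorem, with
    [eta] uniform over all fields T. *)
Lemma gauge (mu : R) : 0 < mu -> exists eta : R, 0 < eta /\
  forall T : R -> vec, vsmooth T -> (forall s, dot (T s) (T s) = 1) ->
  (forall s, norm (minus (T s) (fig_T s)) <= eta) ->
  (forall s, norm (minus (vDerive T s) (scal (ka s) (fig_N s))) <= eta) ->
  exists (sg : R) (F1 F2 : vec), orthonormal F1 F2 /\
    T sg = F1 /\ dot (T (sg + 2 * q)) F2 = 0 /\ dot (T (sg + q)) (cross F1 F2) = 0 /\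
    norm (minus F1 E1) <= mu /\ norm (minus F2 E2) <= mu /\ norm (minus (cross F1 F2) e) <= mu /\
    forall s, norm (minus (T (sg + s)) (fig_T s)) <= mu /\
      norm (minus (vDerive T (sg + s)) (scal (ka s) (fig_N s))) <= mu.
Proof.
intros Hmu; destruct fig_lipschitz as [K [HK LK]].
assert (S := pd_S_pos _ _ _ _ _ _ H); set (S0 := sin (th q)) in *.
assert (HPI := PI_RGT_0).
destruct (pd_th_pos _ _ _ _ _ _ H q ltac:(lra)) as [Tq1 Tq2].
(* The bound S0 / 4 keeps the cross product that defines the normal at length at least S0 / 2; the
   factor 2 + 8 / S0 covers the largest error, that of F2, namely (8 / S0 + 1) rho. *)
set (rho := Rmin (S0 / 4) (mu / (2 + 8 / S0))).
assert (H8 : 0 < 8 / S0) by (apply Rdiv_lt_0_compat; lra).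
assert (Hrho : 0 < rho /\ rho <= S0 / 4 /\ rho * (2 + 8 / S0) <= mu).
{ assert (0 < mu / (2 + 8 / S0)) by (apply Rdiv_lt_0_compat; lra).
  unfold rho; repeat split; [apply Rmin_glb_lt; lra|apply Rmin_l|].
  apply Rle_trans with (mu / (2 + 8 / S0) * (2 + 8 / S0)); [apply Rmult_le_compat_r; [lra|apply Rmin_r]|].
  right; field; lra. }
(* The first two bounds keep the arguments 2 th d and th q + th d of the sines in [fig_pin] below
   PI; the third keeps the effect of the shift below rho / 2. *)
set (m := Rmin (Rmin (PI / 4) ((PI - th q) / 2)) (rho / 2)).
assert (Hm : 0 < m /\ m <= PI / 4 /\ m <= (PI - th q) / 2 /\ m <= rho / 2).
{ unfold m; repeat split; [repeat apply Rmin_glb_lt; lra| | |].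
  - eapply Rle_trans; [apply Rmin_l|apply Rmin_l].
  - eapply Rle_trans; [apply Rmin_l|apply Rmin_r].
  - apply Rmin_r. }
set (d := Rmin (q / 4) (m / K)).
assert (Hd : 0 < d /\ d <= q / 4 /\ K * d <= m).
{ assert (0 < m / K) by (apply Rdiv_lt_0_compat; lra).
  unfold d; repeat split; [apply Rmin_glb_lt; lra|apply Rmin_l|].
  apply Rle_trans with (K * (m / K)); [apply Rmult_le_compat_l; [lra|apply Rmin_r]|].
  right; field; lra. }
assert (Td : 0 < th d <= m).
{ split; [apply (pd_th_pos _ _ _ _ _ _ H); lra|].
  destruct (LK d 0) as [A _]; rewrite (pd_th0 _ _ _ _ _ _ H), !Rminus_0_r, (Rabs_pos_eq d) in A by lra.
  eapply Rle_trans; [apply Rle_abs|]; lra. }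
assert (Tqd : th d < th (q - d) <= th q).
{ split; [|apply (pd_th_incr _ _ _ _ _ _ H); lra].
  assert (E : RInt ka d (q - d) = th (q - d) - th d) by (apply int_deriv; ct).
  assert (0 < RInt ka d (q - d)); [|lra].
  apply RInt_gt_0; [lra| |intros; apply C_ka].
  intros x Hx; apply (pd_ka_pos _ _ _ _ _ _ H); lra. }
assert (P1 : pin fig_T d < 0).
{ rewrite fig_pin; assert (0 < sin (th (q - d) - th d)) by (apply sin_gt_0; lra).
  assert (0 < sin (2 * th d)) by (apply sin_gt_0; lra). nra. }
assert (P2 : 0 < pin fig_T (- d)).
{ rewrite fig_pin, (pd_th_odd _ _ _ _ _ _ H).
  replace (q - - d) with (q + d) by ring; rewrite (pd_th_1p _ _ _ _ _ _ H).
  replace (2 * - th d) with (- (2 * th d)) by ring; rewrite sin_neg.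
  assert (0 < sin (th (q - d) - - th d)) by (apply sin_gt_0; lra).
  assert (0 < sin (2 * th d)) by (apply sin_gt_0; lra). nra. }
set (g := Rmin (- pin fig_T d) (pin fig_T (- d))).
assert (Hg : 0 < g /\ g <= - pin fig_T d /\ g <= pin fig_T (- d)).
{ unfold g; repeat split; [apply Rmin_glb_lt; lra|apply Rmin_l|apply Rmin_r]. }
(* By [pin_close] the error of [pin] is at most 6 eta <= g / 2, too little to spoil the signs at d
   and - d. *)
set (eta := Rmin (g / 12) (rho / 2)).
assert (Heta : 0 < eta /\ eta <= g / 12 /\ eta <= rho / 2).
{ unfold eta; repeat split; [apply Rmin_glb_lt; lra|apply Rmin_l|apply Rmin_r]. }
exists eta; split; [lra|]; intros T ST U Cl Cl'.
assert (Q1 := pin_close T eta d U Cl); assert (Q2 := pin_close T eta (- d) U Cl).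
apply Rabs_le_between in Q1; apply Rabs_le_between in Q2.
destruct (IVT_gen (pin T) (- d) d 0) as [sg [Hsg Zsg]].
{ intros x; apply continuity_pt_filterlim, (cts_pin T ST). }
{ rewrite Rmin_right, Rmax_left by lra; lra. }
rewrite Rmin_left, Rmax_right in Hsg by lra.
assert (Hsg2 : Rabs sg <= d) by (apply Rabs_le; lra).
assert (W : forall s, norm (minus (T (sg + s)) (fig_T s)) <= rho /\
      norm (minus (vDerive T (sg + s)) (scal (ka s) (fig_N s))) <= rho).
{ intros s; destruct (LK (sg + s) s) as [_ [A1 A2]].
  replace (sg + s - s) with sg in A1, A2 by ring.
  assert (K * Rabs sg <= K * d) by (apply Rmult_le_compat_l; lra).
  assert (B1 := Cl (sg + s)); assert (B2 := Cl' (sg + s)).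
  split.
  - eapply Rle_trans; [apply (norm_minus_triangle _ (fig_T (sg + s)))|]; lra.
  - eapply Rle_trans; [apply (norm_minus_triangle _ (scal (ka (sg + s)) (fig_N (sg + s))))|].
    apply Rle_trans with (eta + K * Rabs sg); [apply Rplus_le_compat; [exact B2|exact A2]|lra]. }
set (F1 := T sg); set (Tq := T (sg + q)); set (v := cross F1 Tq); set (n := norm v).
assert (U1 : dot F1 F1 = 1) by apply U.
assert (Uq : dot Tq Tq = 1) by apply U.
assert (N1 : norm (minus F1 E1) <= rho).
{ destruct (W 0) as [A _]; rewrite Rplus_0_r, fig_T0 in A; exact A. }
assert (Nv : norm (minus v (scal S0 e)) <= 2 * rho).
{ unfold v, S0; rewrite <- fig_cross_0q; eapply Rle_trans; [apply cross_diff_le|].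
  rewrite (norm_unit Tq), (norm_unit (fig_T 0)) by (auto using fig_T_unit); rewrite fig_T0.
  destruct (W q) as [A _]; fold Tq in A; lra. }
assert (Ne : norm e = 1) by apply norm_unit, fig_e_unit.
assert (NSe : norm (scal S0 e) = S0) by (rewrite norm_scal_vec, Ne, Rabs_pos_eq; lra).
assert (Nn : Rabs (n - S0) <= 2 * rho).
{ apply Rabs_le; split.
  - assert (A : norm (scal S0 e) <= norm (minus (scal S0 e) v) + norm v).
    { replace (scal S0 e) with (plus (minus (scal S0 e) v) v) at 1 by veq; apply norm_plus_le. }
    rewrite norm_minus_sym, NSe in A; fold n in A; lra.
  - assert (A : norm v <= norm (minus v (scal S0 e)) + norm (scal S0 e)).
    { replace v with (plus (minus v (scal S0 e)) (scal S0 e)) at 1 by veq; apply norm_plus_le. }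
    rewrite NSe in A; fold n in A; lra. }
assert (Hn : S0 / 2 <= n) by (apply Rabs_le_between in Nn; lra).
(* F2 is the normalized part of T (sg + q) orthogonal to F1, so the zero of [pin] says precisely
   that T (sg + 2 q) is orthogonal to F2. *)
pose (F3 := (scal (/ n) v) : vec); pose (F2 := cross F3 F1).
assert (O33 : dot F3 F3 = 1).
{ unfold F3; rewrite dot_scal_l, dot_scal_r, <- norm_sqr; fold n; field; lra. }
assert (O13 : dot F1 F3 = 0).
{ unfold F3; rewrite dot_scal_r, (dot_sym F1); unfold v; rewrite dot_cross_l; ring. }
assert (O12 : dot F1 F2 = 0) by (unfold F2; rewrite dot_sym; apply dot_cross_r).
assert (O22 : dot F2 F2 = 1).
{ unfold F2; rewrite cross_dot_cross, O33, U1, (dot_sym F3), O13; ring. }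
assert (X12 : cross F1 F2 = F3).
{ unfold F2; rewrite cross_cross, U1, O13; veq. }
assert (N3 : norm (minus F3 e) <= 8 / S0 * rho).
{ replace (minus F3 e) with (scal (/ n) (plus (minus v (scal S0 e)) (scal (S0 - n) e)))
    by (unfold F3; apply vec_eq; vnorm; field; lra).
  rewrite norm_scal_vec, Rabs_inv, (Rabs_pos_eq n) by lra.
  assert (A : norm (plus (minus v (scal S0 e)) (scal (S0 - n) e)) <= 4 * rho).
  { eapply Rle_trans; [apply norm_plus_le|]; rewrite norm_scal_vec, Ne, Rabs_minus_sym; lra. }
  apply Rmult_le_reg_l with n; [lra|]; rewrite <- Rmult_assoc, Rinv_r, Rmult_1_l by lra.
  eapply Rle_trans; [exact A|].
  replace (4 * rho) with (S0 / 2 * (8 / S0 * rho)) by (field; lra).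
  apply Rmult_le_compat_r; [apply Rmult_le_pos; lra|assumption]. }
assert (N2 : norm (minus F2 E2) <= 8 / S0 * rho + rho).
{ rewrite <- fig_E2; unfold F2; eapply Rle_trans; [apply cross_diff_le|].
  rewrite (norm_unit F1), Ne by assumption; lra. }
exists sg, F1, F2; rewrite X12.
assert (0 < 8 / S0 * rho) by (apply Rmult_lt_0_compat; lra).
split; [repeat split; assumption|].
split; [reflexivity|].
split.
{ unfold F2, F3, v.
  replace (cross (scal (/ n) (cross F1 Tq)) F1) with (scal (/ n) (minus (scal (dot F1 F1) Tq) (scal (dot F1 Tq) F1)))
    by veq.
  rewrite dot_scal_r, dot_minus_r, !dot_scal_r, U1.
  unfold pin in Zsg; rewrite (Rplus_comm (2 * q) sg), (Rplus_comm q sg) in Zsg; fold F1 Tq in Zsg.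
  rewrite (dot_sym (T (sg + 2 * q)) F1).
  replace (1 * dot (T (sg + 2 * q)) Tq - dot F1 Tq * dot F1 (T (sg + 2 * q))) with 0 by lra; ring. }
split.
{ fold Tq; unfold F3, v; rewrite dot_scal_r, dot_sym, dot_cross_r; ring. }
split; [lra|split; [lra|split; [lra|]]].
intros s; destruct (W s) as [A1 A2]; split; lra.
Qed.

End Figure.

Lemma period_reduce (l : R) (P : R -> Prop) : 0 < l -> (forall s, P (s + l) <-> P s) ->
  (forall s, 0 <= s <= l -> P s) -> forall s, P s.
Proof.
intros Hl HP H0 s.
assert (N : forall n t, P (t + INR n * l) <-> P t).
{ induction n as [|n IH]; intros t; [simpl; rewrite Rmult_0_l, Rplus_0_r; tauto|].
  rewrite S_INR; replace (t + (INR n + 1) * l) with ((t + INR n * l) + l) by ring.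
  rewrite HP; apply IH. }
assert (Z : forall (k : Z) t, P (t + IZR k * l) <-> P t).
{ intros k t; destruct (Z_le_gt_dec 0 k) as [L|L].
  - rewrite <- (Z2Nat.id k L), <- INR_IZR_INZ; apply N.
  - rewrite <- (N (Z.to_nat (- k)) (t + IZR k * l)), INR_IZR_INZ, Z2Nat.id, opp_IZR by lia.
    replace (t + IZR k * l + - IZR k * l) with t by ring; tauto. }
rewrite <- (Z (- Int_part (s / l))%Z s), opp_IZR; apply H0.
destruct (base_Int_part (s / l)) as [B1 B2].
replace s with (s / l * l) at 1 3 by (field; lra).
set (x := s / l) in *; set (n := IZR (Int_part x)) in *; nra.
Qed.

(** The change of psi for [r] is a multiple of PI because its frame closes; hence so is that for
    [r'], whose vector [mat1] then returns up to sign. The opposite vector lies at distance 2 and is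
    excluded, since the two rods differ by less than 1 / 2 at both ends. *)
Lemma mat1_fixed_of_delta (l eps : R) (r r' : rod) : 0 <= l -> eps <= 1 / 2 ->
  closed_rod l r -> closed_rod l r' -> has_inflection r -> mat1 r l = mat1 r 0 ->
  vDerive (tangent r) 0 <> zero -> vDerive (tangent r') 0 <> zero ->
  same_boundary_conditions l r r' -> close_rods l eps r r' ->
  mat1 r' l = mat1 r' 0.
Proof.
intros Hl He Hr Hr' Hi HM HT HT' [_ [d [d' [Hd [Hd' [HPI _]]]]]] Cl.
destruct (HPI Hi) as [k Hk].
assert (A := delta_psi_sin l r d Hr Hd HT); assert (A' := delta_psi_sin l r' d' Hr' Hd' HT').
destruct (closed_rod_frame l r 0 Hr) as [[_ [_ O3]] _]; rewrite HM, O3 in A.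
assert (Sd : sin d = 0) by (simpl in A; nra).
destruct (sin_eq_0_0 d Sd) as [m Em].
assert (Sd' : sin d' = 0).
{ apply sin_eq_0_1; exists (m + k)%Z; rewrite plus_IZR; lra. }
rewrite Sd' in A'.
destruct (closed_rod_frame l r' 0 Hr') as [O0 [X0 [_ _]]].
destruct (closed_rod_frame l r' l Hr') as [[Ol _] [_ [Tl _]]].
assert (TL := tangent_period l r' Hr' 0); rewrite Rplus_0_l in TL; rewrite TL in Tl.
assert (B0 : dot (mat1 r' l) (mat2 r' 0) = 0) by (simpl in A'; nra).
set (x := dot (mat1 r' l) (mat1 r' 0)).
assert (Hx : x ^ 2 = 1).
{ assert (P := parseval _ _ (mat1 r' l) (mat1 r' l) O0).
  rewrite Ol, B0, X0, (dot_sym (mat1 r' l) (tangent r' 0)), Tl in P; fold x in P; lra. }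
assert (D : norm (minus (mat1 r' l) (mat1 r' 0)) < 1).
{ assert (C1 : norm (minus (mat1 r' l) (mat1 r l)) < eps) by (apply (Cl l); lra).
  assert (C2 : norm (minus (mat1 r' 0) (mat1 r 0)) < eps) by (apply (Cl 0); lra).
  eapply Rle_lt_trans; [apply (norm_minus_triangle _ (mat1 r l))|].
  apply Rlt_le_trans with (eps + eps); [apply Rplus_lt_compat; [exact C1|]|lra].
  rewrite HM, norm_minus_sym; exact C2. }
assert (N := norm_sqr (minus (mat1 r' l) (mat1 r' 0))).
assert (N0 := norm_pos (minus (mat1 r' l) (mat1 r' 0))).
rewrite dot_minus_l, !dot_minus_r, Ol, (dot_sym (mat1 r' 0) (mat1 r' l)) in N; fold x in N.
destruct O0 as [O01 [O02 O03]]; rewrite O01 in N.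
assert (Ex : x = 1).
{ assert (A2 : (x - 1) * (x + 1) = 0) by lra.
  apply Rmult_integral in A2; destruct A2; [lra|exfalso; nra]. }
apply (vec_ext_frame (mat1 r' 0) (mat2 r' 0)); [repeat split; assumption| | |].
- fold x; lra.
- lra.
- rewrite X0, (dot_sym _ (tangent r' 0)), Tl, dot_sym.
  symmetry; apply (closed_rod_frame l r' 0 Hr').
Qed.

(** * Stability above the threshold *)

Section Stable.
Context (q Lam C : R) (th ka X : R -> R) (H : pendulum q Lam C th ka X).
Context (E1 E2 : vec) (O : orthonormal E1 E2).
Context (r : rod) (Hr : closed_rod (4 * q) r) (HT : forall s, tangent r s = fig_T th E1 E2 s).
Context (Hu : forall s, 0 <= s <= 4 * q -> u3 r s = 0).

Let q_pos := pd_q _ _ _ _ _ _ H.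
Let Lam_pos := pd_Lam _ _ _ _ _ _ H.
Let D_th := pd_th _ _ _ _ _ _ H.
Let C_th := pd_cts_th _ _ _ _ _ _ H.
Let C_ka := pd_cts_ka _ _ _ _ _ _ H.
Let l := 4 * q.

Lemma fig_vDerive (s : R) : vDerive (tangent r) s = scal (ka s) (fig_N th E1 E2 s).
Proof.
replace (tangent r) with (fig_T th E1 E2) by (apply functional_extensionality; intros; auto).
apply (vDerive_fig_T _ _ _ _ _ _ H).
Qed.

Lemma fig_energy (alpha beta : R) : energy alpha beta l r = alpha * RInt (fun s => ka s ^ 2) 0 l.
Proof.
unfold energy; rewrite <- int_scal by ct; apply RInt_ext.
rewrite Rmin_left, Rmax_right by (unfold l; lra); intros s Hs.
rewrite (Hu s) by (unfold l in Hs; lra); rewrite (bending_strains l r s Hr), fig_vDerive.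
rewrite dot_scal_l, dot_scal_r, (fig_N_unit th E1 E2 O); as_real; ring.
Qed.

Lemma fig_inflection : has_inflection r.
Proof. exists q; rewrite fig_vDerive, (pd_kaq _ _ _ _ _ _ H); veq. Qed.

Lemma fig_curved : ka 0 = norm (vDerive (tangent r) 0) /\ 0 < ka 0.
Proof.
assert (K0 : 0 < ka 0) by (apply (pd_ka_pos _ _ _ _ _ _ H); lra).
split; [|assumption].
rewrite fig_vDerive, norm_scal_vec, (norm_unit (fig_N th E1 E2 0)), Rabs_pos_eq;
  [ring|lra|apply fig_N_unit; assumption].
Qed.

(* Without twist the material frame is parallel, hence constant relative to the plane. *)
Lemma fig_mat1_parallel (s : R) : 0 <= s <= l ->
  dot (mat1 r s) (fig_N th E1 E2 s) = dot (mat1 r 0) (fig_N th E1 E2 0) /\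
  dot (mat1 r s) (cross E1 E2) = dot (mat1 r 0) (cross E1 E2).
Proof.
intros Hs; destruct (closed_rod_vsmooth l r Hr) as [ST [S1 S2]].
destruct (closed_rod_cts l r Hr) as [C1 [C2 C3]].
assert (SE := fun s => strain_equations l r s Hr).
assert (DE : forall w s, is_derive (fun s : R => dot (mat1 r s) w) s
  (u2 r s * dot (tangent r s) w - u3 r s * dot (mat2 r s) w)).
{ intros w u; destruct (SE u) as [_ [A _]]; evar_last; [apply is_derive_dot_const, S1|].
  rewrite A, dot_plus_l, !dot_scal_l; ring. }
assert (D1 := DE E1); assert (D2 := DE E2).
assert (Z : forall f : R -> R, cts f -> RInt (fun t => u3 r t * f t) 0 s = 0).
{ intros f Cf; rewrite (RInt_ext _ (fun _ => 0)); [rewrite int_const; rring|].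
  rewrite Rmin_left, Rmax_right by lra; intros t Ht; rewrite Hu by (unfold l in Hs; lra); rring. }
assert (CN : cts (fun s => dot (mat2 r s) (fig_N th E1 E2 s))).
{ assert (Ec : (fun s => dot (mat2 r s) (fig_N th E1 E2 s)) =
    (fun s => - sin (th s) * dot (mat2 r s) E1 + cos (th s) * dot (mat2 r s) E2)).
  { apply functional_extensionality; intros u; unfold fig_N; rewrite dot_plus_r, !dot_scal_r; reflexivity. }
  rewrite Ec; ct. }
split.
- assert (E : RInt (fun t => u3 r t * (- dot (mat2 r t) (fig_N th E1 E2 t))) 0 s
    = dot (mat1 r s) (fig_N th E1 E2 s) - dot (mat1 r 0) (fig_N th E1 E2 0)).
  { apply (int_deriv (fun s => dot (mat1 r s) (fig_N th E1 E2 s))).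
    - intros t.
      pose (m1 := fun s => dot (mat1 r s) E1); pose (m2 := fun s => dot (mat1 r s) E2).
      change (forall s, is_derive m1 s (u2 r s * dot (tangent r s) E1 - u3 r s * dot (mat2 r s) E1)) in D1.
      change (forall s, is_derive m2 s (u2 r s * dot (tangent r s) E2 - u3 r s * dot (mat2 r s) E2)) in D2.
      apply (is_derive_ext (fun s => - sin (th s) * m1 s + cos (th s) * m2 s)).
      { intros u; unfold fig_N; rewrite dot_plus_r, !dot_scal_r; reflexivity. }
      assert (D3 := pd_ka _ _ _ _ _ _ H); ader; unfold m1, m2.
      assert (T0 : dot (tangent r t) (mat1 r t) = 0) by apply (closed_rod_frame l r t Hr).
      assert (TN : dot (tangent r t) (fig_N th E1 E2 t) = 0) by (rewrite HT; apply fig_dot_TN, O).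
      rewrite HT in T0; unfold fig_T in T0; rewrite dot_plus_l, !dot_scal_l in T0.
      unfold fig_N in *; rewrite dot_plus_r, !dot_scal_r in TN |- *.
      rewrite !(dot_sym (mat1 r t)).
      transitivity (- ka t * (cos (th t) * dot E1 (mat1 r t) + sin (th t) * dot E2 (mat1 r t))
        + u2 r t * (- sin (th t) * dot (tangent r t) E1 + cos (th t) * dot (tangent r t) E2)
        - u3 r t * (- sin (th t) * dot (mat2 r t) E1 + cos (th t) * dot (mat2 r t) E2)); [ring|].
      rewrite T0, TN; ring.
    - apply cts_mult; [assumption|]; apply cts_opp, CN. }
  rewrite Z in E; [lra|apply cts_opp, CN].
- assert (E : RInt (fun t => u3 r t * (- dot (mat2 r t) (cross E1 E2))) 0 s
    = dot (mat1 r s) (cross E1 E2) - dot (mat1 r 0) (cross E1 E2)).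
  { apply (int_deriv (fun s => dot (mat1 r s) (cross E1 E2))); [|ct].
    intros t; evar_last; [apply DE|]; rewrite HT, fig_dot_Te; ring. }
  rewrite Z in E by ct; lra.
Qed.

Lemma fig_mat1_closed : mat1 r l = mat1 r 0.
Proof.
assert (Hl : 0 <= l <= l) by (unfold l; lra).
destruct (fig_mat1_parallel l Hl) as [A1 A2].
assert (P : fig_T th E1 E2 l = fig_T th E1 E2 0 /\ fig_N th E1 E2 l = fig_N th E1 E2 0).
{ destruct (fig_period q Lam C th ka X H E1 E2 0) as [P1 P2]; rewrite Rplus_0_l in P1, P2.
  split; assumption. }
destruct P as [P1 P2]; rewrite P2 in A1.
assert (N0 : fig_N th E1 E2 0 = E2).
{ unfold fig_N; rewrite (pd_th0 _ _ _ _ _ _ H), cos_0, sin_0; veq. }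
assert (T0 : fig_T th E1 E2 0 = E1) by apply (fig_T0 _ _ _ _ _ _ H).
rewrite N0 in A1.
apply (vec_ext_frame E1 E2); [assumption| |assumption|assumption].
assert (B0 : dot (tangent r 0) (mat1 r 0) = 0) by apply (closed_rod_frame l r 0 Hr).
assert (Bl : dot (tangent r l) (mat1 r l) = 0) by apply (closed_rod_frame l r l Hr).
rewrite HT, T0 in B0; rewrite HT, P1, T0 in Bl; rewrite (dot_sym (mat1 r l)), (dot_sym (mat1 r 0)); lra.
Qed.

(** The tangent of the nearby rod becomes a [unit_field] in the frame supplied by [gauge], with
    origin of arclength at [sg]; periodicity makes the integrals insensitive to this shift. The
    twist energy enters through the mean of [u3], which [twist_eq] computes about the axis F3. *)
Lemma stable_figure (alpha beta : R) : 0 < alpha -> 2 < beta / alpha -> stable alpha beta l r.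
Proof.
intros Ha HB.
assert (Hbeta : 0 < beta).
{ replace beta with (beta / alpha * alpha) by (field; lra); apply Rmult_lt_0_compat; lra. }
assert (Hl : 0 < l) by (unfold l; lra).
destruct (stable_core _ _ _ _ _ _ H (beta / alpha) HB) as [mu [Hmu SC]]; fold l in SC.
set (k0 := 2 * sqrt Lam).
assert (Hk0 : 0 < k0) by (assert (P := sqrt_lt_R0 Lam Lam_pos); unfold k0; lra).
assert (BK : forall s, Rabs (ka s) <= k0) by apply (fig_ka_bound _ _ _ _ _ _ H).
(* The factor 3 + 5 k0 covers the bounds of the six functions in [unit_field]; 1 / 4 gives |T . F3|
   <= 1 / 2, as the formula for the frame angle requires; the last term keeps the contribution of
   [spin] to the total angle at most 1. *)
set (m0 := Rmin (mu / (3 + 5 * k0)) (Rmin (1 / 4) (/ (3 * l * (k0 + 1))))).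
assert (Hm0 : 0 < m0 /\ m0 * (3 + 5 * k0) <= mu /\ m0 <= 1 / 4 /\ m0 * (3 * l * (k0 + 1)) <= 1).
{ assert (0 < mu / (3 + 5 * k0)) by (apply Rdiv_lt_0_compat; lra).
  assert (0 < 3 * l * (k0 + 1)) by mpos.
  assert (0 < / (3 * l * (k0 + 1))) by (apply Rinv_0_lt_compat; assumption).
  unfold m0; repeat split.
  - repeat apply Rmin_glb_lt; lra.
  - apply Rle_trans with (mu / (3 + 5 * k0) * (3 + 5 * k0)); [apply Rmult_le_compat_r; [lra|apply Rmin_l]|].
    right; field; lra.
  - eapply Rle_trans; [apply Rmin_r|apply Rmin_l].
  - apply Rle_trans with (/ (3 * l * (k0 + 1)) * (3 * l * (k0 + 1))).
    + apply Rmult_le_compat_r; [lra|]; eapply Rle_trans; [apply Rmin_r|apply Rmin_r].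
    + right; field; split; lra. }
destruct (gauge _ _ _ _ _ _ H E1 E2 O m0 (proj1 Hm0)) as [eta [Heta G]].
destruct fig_curved as [EK0 K0].
(* In order: closeness for [gauge]; the sign in [mat1_fixed_of_delta]; a contribution of [u3] at
   most 1 to the total angle; and nonzero curvature of the nearby curve at 0. *)
set (eps := Rmin (Rmin eta (1 / 2)) (Rmin (/ (l * (1 + k0))) (ka 0))).
assert (Heps : 0 < eps /\ eps <= eta /\ eps <= 1 / 2 /\ eps * (l * (1 + k0)) <= 1 /\ eps <= ka 0).
{ assert (0 < l * (1 + k0)) by mpos.
  assert (0 < / (l * (1 + k0))) by (apply Rinv_0_lt_compat; assumption).
  unfold eps; repeat split.
  - repeat apply Rmin_glb_lt; lra.
  - eapply Rle_trans; [apply Rmin_l|apply Rmin_l].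
  - eapply Rle_trans; [apply Rmin_l|apply Rmin_r].
  - apply Rle_trans with (/ (l * (1 + k0)) * (l * (1 + k0))).
    + apply Rmult_le_compat_r; [lra|]; eapply Rle_trans; [apply Rmin_r|apply Rmin_l].
    + right; field; split; lra.
  - eapply Rle_trans; [apply Rmin_r|apply Rmin_r]. }
exists eps; split; [lra|]; intros r' BC Cl.
assert (Hr' : closed_rod l r') by apply BC.
destruct (closed_rod_vsmooth l r' Hr') as [ST [S1 S2]].
destruct (closed_rod_vsmooth l r Hr) as [STr [S1r S2r]].
set (T := tangent r') in *.
assert (TU : forall s, dot (T s) (T s) = 1) by apply Hr'.
assert (TP : forall s, T (s + l) = T s) by apply (tangent_period l r' Hr').
assert (TP' := vDerive_period T l TP).
assert (Cl1 : forall s, norm (minus (T s) (fig_T th E1 E2 s)) <= eta).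
{ apply (period_reduce l); [assumption| |].
  - intros s; rewrite TP; destruct (fig_period q Lam C th ka X H E1 E2 s) as [P1 _].
    fold l in P1; rewrite P1; tauto.
  - intros s Hs; rewrite <- HT.
    assert (A : norm (minus (T s) (tangent r s)) < eps) by (apply (Cl s Hs)).
    apply Rlt_le, Rlt_le_trans with eps; [exact A|lra]. }
assert (Cl2 : forall s, norm (minus (vDerive T s) (scal (ka s) (fig_N th E1 E2 s))) <= eta).
{ apply (period_reduce l); [assumption| |].
  - intros s; rewrite TP'; destruct (fig_period q Lam C th ka X H E1 E2 s) as [_ P2].
    fold l in P2; rewrite P2; unfold l at 1; rewrite (pd_ka_period _ _ _ _ _ _ H); tauto.
  - intros s Hs; rewrite <- fig_vDerive.
    assert (A : norm (minus (vDerive T s) (vDerive (tangent r) s)) < eps) by (apply (Cl s Hs)).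
    apply Rlt_le, Rlt_le_trans with eps; [exact A|lra]. }
destruct (G T ST TU Cl1 Cl2) as [sg [F1 [F2 [OF [Pin1 [Pin2 [Pin3 [N1 [N2 [N3 NW]]]]]]]]]].
set (F3 := cross F1 F2) in *.
assert (F33 : dot F3 F3 = 1) by apply (fig_e_unit F1 F2 OF).
assert (M1 : mat1 r' l = mat1 r' 0).
{ apply (mat1_fixed_of_delta l eps r r'); auto; try lra.
  - apply fig_inflection.
  - apply fig_mat1_closed.
  - intros E; rewrite E in EK0.
    rewrite norm_dot in EK0; replace (dot zero zero) with 0 in EK0 by vring; rewrite sqrt_0 in EK0; lra.
  - intros E.
    assert (A : norm (minus (vDerive T 0) (vDerive (tangent r) 0)) < eps) by (apply (Cl 0); lra).
    fold T in E.
    assert (Ex : px (vDerive T 0) = 0 /\ py (vDerive T 0) = 0 /\ pz (vDerive T 0) = 0)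
      by (rewrite E; repeat split; reflexivity).
    destruct Ex as [Ex [Ey Ez]].
    replace (minus (vDerive T 0) (vDerive (tangent r) 0)) with (scal (-1) (vDerive (tangent r) 0)) in A
      by (apply vec_eq; vnorm; rewrite ?Ex, ?Ey, ?Ez; ring).
    rewrite norm_scal_vec, <- EK0, Rabs_left in A by lra; lra. }
assert (TL : T l = T 0) by (rewrite <- (TP 0), Rplus_0_l; reflexivity).
assert (M2 : mat2 r' l = mat2 r' 0).
{ rewrite !(mat2_cross l r' _ Hr'), M1; fold T; rewrite TL; reflexivity. }
pose (tF := fun s => fig_T th F1 F2 s); pose (nF := fun s => fig_N th F1 F2 s).
assert (Nc : forall x, Rabs (cos x) <= 1) by (intros x; assert (A := COS_bound x); apply Rabs_le; lra).
assert (Ns : forall x, Rabs (sin x) <= 1) by (intros x; assert (A := SIN_bound x); apply Rabs_le; lra).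
assert (BtF : forall s, norm (minus (fig_T th E1 E2 s) (tF s)) <= 2 * m0).
{ intros s; rewrite norm_minus_sym; unfold tF, fig_T.
  replace (minus _ _) with (plus (scal (cos (th s)) (minus F1 E1)) (scal (sin (th s)) (minus F2 E2))) by veq.
  eapply Rle_trans; [apply norm_plus_le|]; rewrite !norm_scal_vec.
  replace (2 * m0) with (1 * m0 + 1 * m0) by ring.
  apply Rplus_le_compat; (apply Rmult_le_compat; [apply Rabs_pos|apply norm_pos|auto|auto]). }
assert (BnF : forall s, norm (minus (fig_N th E1 E2 s) (nF s)) <= 2 * m0).
{ intros s; rewrite norm_minus_sym; unfold nF, fig_N.
  replace (minus _ _) with (plus (scal (- sin (th s)) (minus F1 E1)) (scal (cos (th s)) (minus F2 E2))) by veq.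
  eapply Rle_trans; [apply norm_plus_le|]; rewrite !norm_scal_vec, Rabs_Ropp.
  replace (2 * m0) with (1 * m0 + 1 * m0) by ring.
  apply Rplus_le_compat; (apply Rmult_le_compat; [apply Rabs_pos|apply norm_pos|auto|auto]). }
assert (UT : forall s, norm (fig_T th E1 E2 s) = 1) by (intros; apply norm_unit, fig_T_unit, O).
assert (UN : forall s, norm (fig_N th E1 E2 s) = 1) by (intros; apply norm_unit, fig_N_unit, O).
assert (UtF : forall s, norm (tF s) = 1) by (intros; apply norm_unit, fig_T_unit, OF).
assert (UnF : forall s, norm (nF s) = 1) by (intros; apply norm_unit, fig_N_unit, OF).
assert (UF3 : norm F3 = 1) by (apply norm_unit; assumption).
assert (KN : forall s, norm (scal (ka s) (fig_N th E1 E2 s)) <= k0).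
{ intros s; rewrite norm_scal_vec, UN, Rmult_1_r; apply BK. }
assert (B1 : forall s, Rabs (dot (T (sg + s)) (tF s) - 1) <= 3 * m0).
{ intros s; rewrite <- (fig_T_unit th E1 E2 O s) at 1; rewrite Rabs_minus_sym.
  eapply Rle_trans; [apply dot_diff_le|]; rewrite norm_minus_sym.
  rewrite UT, (norm_unit (T (sg + s))) by auto.
  destruct (NW s) as [A _]; assert (A2 := BtF s); lra. }
assert (B2 : forall s, Rabs (dot (T (sg + s)) (nF s)) <= 3 * m0).
{ intros s; replace (dot (T (sg + s)) (nF s)) with (dot (T (sg + s)) (nF s) - dot (fig_T th E1 E2 s) (fig_N th E1 E2 s))
    by (rewrite fig_dot_TN by exact O; ring); rewrite Rabs_minus_sym.
  eapply Rle_trans; [apply dot_diff_le|]; rewrite norm_minus_sym.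
  rewrite UN, (norm_unit (T (sg + s))) by auto.
  destruct (NW s) as [A _]; assert (A2 := BnF s); lra. }
assert (B3 : forall s, Rabs (dot (T (sg + s)) F3) <= 2 * m0).
{ intros s; replace (dot (T (sg + s)) F3) with (dot (T (sg + s)) F3 - dot (fig_T th E1 E2 s) (cross E1 E2))
    by (rewrite fig_dot_Te; ring).
  eapply Rle_trans; [apply dot_diff_le|].
  rewrite UT, UF3; destruct (NW s) as [A _]; lra. }
assert (B4 : forall s, Rabs (dot (vDerive T (sg + s)) (tF s)) <= (1 + 2 * k0) * m0).
{ intros s; replace (dot (vDerive T (sg + s)) (tF s)) with
    (dot (vDerive T (sg + s)) (tF s) - dot (scal (ka s) (fig_N th E1 E2 s)) (fig_T th E1 E2 s))
    by (rewrite dot_scal_l, (dot_sym (fig_N th E1 E2 s)), fig_dot_TN by exact O; ring).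
  eapply Rle_trans; [apply dot_diff_le|]; rewrite UtF, (norm_minus_sym (tF s)).
  destruct (NW s) as [_ A]; assert (A2 := BtF s); assert (A3 := KN s).
  assert (A4 := Rmult_le_compat _ _ _ _ (norm_pos _) (norm_pos _) A3 A2); lra. }
assert (B5 : forall s, Rabs (dot (vDerive T (sg + s)) (nF s) - ka s) <= (1 + 2 * k0) * m0).
{ intros s; replace (ka s) with (dot (scal (ka s) (fig_N th E1 E2 s)) (fig_N th E1 E2 s)) at 1
    by (rewrite dot_scal_l, fig_N_unit by exact O; ring).
  eapply Rle_trans; [apply dot_diff_le|]; rewrite UnF, (norm_minus_sym (nF s)).
  destruct (NW s) as [_ A]; assert (A2 := BnF s); assert (A3 := KN s).
  assert (A4 := Rmult_le_compat _ _ _ _ (norm_pos _) (norm_pos _) A3 A2); lra. }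
assert (B6 : forall s, Rabs (dot (vDerive T (sg + s)) F3) <= (1 + k0) * m0).
{ intros s; replace (dot (vDerive T (sg + s)) F3) with
    (dot (vDerive T (sg + s)) F3 - dot (scal (ka s) (fig_N th E1 E2 s)) (cross E1 E2))
    by (rewrite dot_scal_l, fig_dot_Ne; ring).
  eapply Rle_trans; [apply dot_diff_le|]; rewrite UF3.
  destruct (NW s) as [_ A]; assert (A3 := KN s).
  assert (A4 := Rmult_le_compat _ _ _ _ (norm_pos _) (norm_pos _) A3 N3); lra. }
assert (HzF : forall s, Rabs (dot (tangent r' s) F3) <= 1 / 2).
{ intros s; fold T; replace s with (sg + (s - sg)) by ring.
  eapply Rle_trans; [apply B3|]; lra. }
assert (Csp := cts_spin l r' F3 Hr' HzF).
destruct (closed_rod_cts l r' Hr') as [C1 [C2 C3]].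
assert (TW : RInt (u3 r') 0 l = - RInt (spin r' F3) 0 l).
{ apply (twist_eq l r' F3); auto.
  (* The integrals of |u3| and of |spin| are each at most 1, and 2 < PI. *)
  apply Rle_lt_trans with 2; [|assert (A := PI2_3_2); lra].
  eapply Rle_trans; [apply int_abs; [lra|ct]|].
  apply Rle_trans with (RInt (fun _ => eps * (1 + k0) + 3 * m0 * (k0 + 1)) 0 l).
  2: { rewrite int_const; lra. }
  apply int_le; [lra|ct|ct|]; intros s Hs.
  eapply Rle_trans; [apply Rabs_triang|]; apply Rplus_le_compat.
  - replace (u3 r' s) with (u3 r' s - u3 r s) by (rewrite (Hu s Hs); ring).
    unfold u3; eapply Rle_trans; [apply dot_diff_le|].
    assert (A1 : norm (minus (vDerive (mat2 r') s) (vDerive (mat2 r) s)) < eps) by (apply (Cl s Hs)).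
    assert (A2 : norm (minus (mat1 r' s) (mat1 r s)) < eps) by (apply (Cl s Hs)).
    rewrite (norm_unit (mat1 r' s)) by apply Hr'.
    assert (A3 : norm (vDerive (mat2 r) s) <= k0).
    { destruct (strain_equations l r s Hr) as [_ [_ E]]; rewrite (Hu s Hs) in E.
      replace (vDerive (mat2 r) s) with (scal (- u1 r s) (tangent r s)) by (rewrite E; veq).
      rewrite norm_scal_vec, (norm_unit (tangent r s)), Rabs_Ropp, Rmult_1_r by apply Hr.
      eapply Rle_trans; [|apply (BK s)].
      assert (E2' := bending_strains l r s Hr).
      rewrite fig_vDerive, dot_scal_l, dot_scal_r, (fig_N_unit th E1 E2 O) in E2'.
      apply Rsqr_le_abs_0; unfold Rsqr; assert (P := pow2_ge_0 (u2 r s)); nra. }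
    assert (A4 := Rmult_le_compat _ _ _ _ (norm_pos _) (norm_pos _) A3 (Rlt_le _ _ A2)); lra.
  - unfold spin; fold T.
    assert (Z2 := B3 (s - sg)); replace (sg + (s - sg)) with s in Z2 by ring.
    assert (Z3 := HzF s); fold T in Z3; apply sqr_abs_le in Z3.
    replace (3 * m0 * (k0 + 1)) with ((2 * m0) * ((k0 + 1) * (3 / 2))) by field.
    apply Rabs_mult_le; [assumption|].
    unfold Rdiv; apply Rabs_mult_le.
    + eapply Rle_trans; [apply dot_le_norm|]; rewrite UF3, Rmult_1_r.
      eapply Rle_trans; [apply norm_cross_le|]; rewrite (norm_unit (T s)), Rmult_1_l by auto.
      assert (A := proj2 (NW (s - sg))); replace (sg + (s - sg)) with s in A by ring.
      replace (vDerive T s) with (plus (minus (vDerive T s) (scal (ka (s - sg)) (fig_N th E1 E2 (s - sg))))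
        (scal (ka (s - sg)) (fig_N th E1 E2 (s - sg)))) by veq.
      eapply Rle_trans; [apply norm_plus_le|].
      apply Rle_trans with (m0 + k0); [apply Rplus_le_compat; [exact A|apply KN]|lra].
    + rewrite Rabs_inv, Rabs_pos_eq by lra.
      replace (3 * / 2) with (/ (2 / 3)) by field; apply Rinv_le_contravar; lra. }
assert (DW : forall w s, is_derive (fun s : R => dot (T (sg + s)) w) s (dot (vDerive T (sg + s)) w)).
{ intros w; apply (is_derive_translate (fun s => dot (T s) w) (fun s => dot (vDerive T s) w) sg).
  intros s; apply is_derive_dot_const, ST. }
assert (CW : forall w, cts (fun s : R => dot (T (sg + s)) w)).
{ intros w; apply (cts_translate (fun s => dot (T s) w) sg); ct. }
assert (CW' : forall w, cts (fun s : R => dot (vDerive T (sg + s)) w)).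
{ intros w; apply (cts_translate (fun s => dot (vDerive T s) w) sg); ct. }
assert (D1 := DW F1); assert (D2 := DW F2).
assert (CW1 := CW F1); assert (CW2 := CW F2); assert (CW1' := CW' F1); assert (CW2' := CW' F2).
assert (IW : forall w, RInt (fun s => dot (T (sg + s)) w) 0 l = 0).
{ intros w.
  rewrite (int_deriv (fun s => dot (center r' (sg + s)) w)); [|intros s|apply CW].
  - destruct Hr' as [_ [_ [_ [P _]]]]; rewrite P, Rplus_0_r; rring.
  - apply (is_derive_translate (fun s => dot (center r' s) w) (fun s => dot (T s) w) sg).
    intros t; apply is_derive_dot_const, Hr'. }
(* [p], [w], [z] are the coordinates of T in the fixed frame; 1 + a and b are its components along
   the tangent and normal of the figure eight drawn in the plane of F1 and F2. *)
pose (p := fun s => dot (T (sg + s)) F1); pose (p' := fun s => dot (vDerive T (sg + s)) F1).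
pose (w := fun s => dot (T (sg + s)) F2); pose (w' := fun s => dot (vDerive T (sg + s)) F2).
pose (z := fun s => dot (T (sg + s)) F3); pose (z' := fun s => dot (vDerive T (sg + s)) F3).
pose (a := fun s => p s * cos (th s) + w s * sin (th s) - 1).
pose (b := fun s => - p s * sin (th s) + w s * cos (th s)).
pose (a' := fun s => (p' s * cos (th s) + w' s * sin (th s)) + ka s * b s).
pose (b' := fun s => (- p' s * sin (th s) + w' s * cos (th s)) - ka s * (1 + a s)).
assert (Dp : forall s, is_derive p s (p' s)) by apply DW.
assert (Dw : forall s, is_derive w s (w' s)) by apply DW.
assert (Cp : cts p) by apply CW. assert (Cp' : cts p') by apply CW'.
assert (Cw : cts w) by apply CW. assert (Cw' : cts w') by apply CW'.
assert (Ca : cts a) by (unfold a; ct). assert (Cb : cts b) by (unfold b; ct).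
assert (TFE : forall s v, dot v (tF s) = dot v F1 * cos (th s) + dot v F2 * sin (th s)).
{ intros s v; unfold tF, fig_T; rewrite dot_plus_r, !dot_scal_r; ring. }
assert (NFE : forall s v, dot v (nF s) = - dot v F1 * sin (th s) + dot v F2 * cos (th s)).
{ intros s v; unfold nF, fig_N; rewrite dot_plus_r, !dot_scal_r; ring. }
assert (Ba : forall s, Rabs (a s) <= 3 * m0).
{ intros s; assert (A := B1 s); rewrite TFE in A; exact A. }
assert (Bb : forall s, Rabs (b s) <= 3 * m0).
{ intros s; assert (A := B2 s); rewrite NFE in A; exact A. }
assert (Pe : forall s, T (sg + (s + l)) = T (sg + s)).
{ intros s; replace (sg + (s + l)) with ((sg + s) + l) by ring; apply TP. }
assert (PeL : T (sg + l) = T (sg + 0)) by (rewrite <- (Pe 0), Rplus_0_l; reflexivity).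
assert (thl : th l = th 0).
{ unfold l; replace (4 * q) with (0 + 4 * q) by ring; apply (pd_th_period _ _ _ _ _ _ H). }
assert (UF : unit_field l mu th a a' b b' z z').
{ split.
  - intros s; unfold a, a', b; ader.
  - intros s; unfold b, b', a; ader.
  - apply DW.
  - unfold a'; ct.
  - unfold b'; ct.
  - apply CW'.
  - unfold b, p, w; rewrite PeL, thl; reflexivity.
  - unfold z; rewrite PeL; reflexivity.
  - intros s; assert (P := parseval F1 F2 (T (sg + s)) (T (sg + s)) OF).
    rewrite TU in P; fold F3 in P.
    assert (E := sin2_cos2 (th s)); unfold Rsqr in E.
    transitivity ((p s * p s + w s * w s) * (sin (th s) * sin (th s) + cos (th s) * cos (th s)) + z s * z s).
    + unfold a, b; ring.
    + rewrite E; unfold p, w, z; lra.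
  - intros s _.
    assert (Bkb : Rabs (ka s * b s) <= k0 * (3 * m0)) by (apply Rabs_mult_le; [apply BK|apply Bb]).
    assert (Bka : Rabs (- (ka s * a s)) <= k0 * (3 * m0))
      by (rewrite Rabs_Ropp; apply Rabs_mult_le; [apply BK|apply Ba]).
    assert (A1 := Ba s); assert (A2 := Bb s); assert (A3 := B3 s); assert (A4 := B4 s).
    assert (A5 := B5 s); assert (A6 := B6 s).
    rewrite TFE in A4; rewrite NFE in A5.
    assert (0 < k0 * m0) by mpos.
    repeat split; try (unfold z, z'; lra).
    + unfold a'; eapply Rle_trans; [apply Rabs_triang|].
      apply Rle_trans with ((1 + 2 * k0) * m0 + k0 * (3 * m0)); [apply Rplus_le_compat; assumption|lra].
    + replace (b' s) with ((- p' s * sin (th s) + w' s * cos (th s) - ka s) + - (ka s * a s)) by (unfold b'; ring).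
      eapply Rle_trans; [apply Rabs_triang|].
      apply Rle_trans with ((1 + 2 * k0) * m0 + k0 * (3 * m0)); [apply Rplus_le_compat; assumption|lra].
  - rewrite (int_ext _ (fun s => p s - cos (th s))).
    + rewrite int_minus by ct; unfold p; rewrite IW; unfold l; rewrite (int_cos_th _ _ _ _ _ _ H); rring.
    + intros s; assert (E := sin2_cos2 (th s)); unfold Rsqr in E.
      transitivity (p s * (sin (th s) * sin (th s) + cos (th s) * cos (th s)) - cos (th s)).
      * unfold a, b; as_real; ring.
      * rewrite E; as_real; ring.
  - rewrite (int_ext _ (fun s => w s - sin (th s))).
    + rewrite int_minus by ct; unfold w; rewrite IW; unfold l; rewrite (int_sin_th _ _ _ _ _ _ H); rring.
    + intros s; assert (E := sin2_cos2 (th s)); unfold Rsqr in E.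
      transitivity (w s * (sin (th s) * sin (th s) + cos (th s) * cos (th s)) - sin (th s)).
      * unfold a, b; as_real; ring.
      * rewrite E; as_real; ring.
  - apply IW. }
assert (Z0 : z 0 = 0).
{ unfold z; rewrite Rplus_0_r, Pin1; unfold F3; rewrite dot_sym; apply dot_cross_l. }
assert (Zq : z q = 0) by exact Pin3.
assert (B0 : b 0 = 0).
{ unfold b, p, w; rewrite (pd_th0 _ _ _ _ _ _ H), sin_0, cos_0, Rplus_0_r, Pin1.
  destruct OF as [_ [_ O3]]; rewrite O3; ring. }
assert (B2q : b (2 * q) = 0).
{ unfold b, p, w; rewrite (pd_th_2q _ _ _ _ _ _ H), sin_0, cos_0, Pin2; ring. }
assert (Main := SC a a' b b' z z' UF B0 B2q Z0 Zq).
rewrite fig_energy.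
assert (EG := energy_ge alpha beta l r' (Rlt_le _ _ Hbeta) Hl Hr'); fold T in EG.
eapply Rle_trans; [|exact EG]; clear EG.
assert (Ebend : RInt (fun s => (a' s - ka s * b s) ^ 2 + (b' s + ka s * (1 + a s)) ^ 2 + z' s ^ 2) 0 l
  = RInt (fun s => dot (vDerive T s) (vDerive T s)) 0 l).
{ rewrite <- (int_shift (fun s => dot (vDerive T s) (vDerive T s)) l sg);
    [|ct|intros; rewrite TP'; reflexivity].
  apply int_ext; intros s; rewrite (Rplus_comm s sg).
  assert (P := parseval F1 F2 (vDerive T (sg + s)) (vDerive T (sg + s)) OF); fold F3 in P; rewrite P.
  assert (E := sin2_cos2 (th s)); unfold Rsqr in E.
  transitivity ((p' s * p' s + w' s * w' s) * (sin (th s) * sin (th s) + cos (th s) * cos (th s)) + z' s * z' s).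
  - unfold a', b'; as_real; ring.
  - rewrite E; unfold p', w', z'; as_real; ring. }
(* The numerator is p w' - w p', that is (T x T') . F3, expressed in the moving basis. *)
assert (Etw : RInt (fun s => z s * (((1 + a s) * (b' s + ka s * (1 + a s))
      - b s * (a' s - ka s * b s)) / (1 - z s ^ 2))) 0 l = RInt (spin r' F3) 0 l).
{ rewrite <- (int_shift (spin r' F3) l sg); [|assumption|].
  - apply int_ext; intros s; rewrite (Rplus_comm s sg); unfold spin; fold T; fold (z s).
    unfold F3 at 1; rewrite cross_dot_cross.
    assert (E := sin2_cos2 (th s)); unfold Rsqr in E.
    do 2 f_equal.
    transitivity ((p s * w' s - w s * p' s) * (sin (th s) * sin (th s) + cos (th s) * cos (th s))).
    + unfold a', b', a, b; as_real; ring.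
    + rewrite E; unfold p, w, p', w'; as_real; ring.
  - intros s; unfold spin; fold T; rewrite TP, TP'; reflexivity. }
rewrite Ebend, Etw in Main; rewrite TW.
apply (Rmult_le_compat_l alpha) in Main; [|lra].
eapply Rle_trans; [exact Main|]; right; field; split; lra.
Qed.

End Stable.

(** * Smooth functions *)

(** [smooth] speaks of iterated derivatives, whose last derivative is outermost. [Cn] strips the
    first derivative instead, so closure properties go by induction on [n] with the function
    generalized. *)
Fixpoint Cn (n : nat) (f : R -> R) : Prop :=
  match n with
  | O => True
  | S n => (forall x, ex_derive f x) /\ Cn n (Derive f)
  end.

Lemma Cn_of_smooth (n : nat) (f : R -> R) : smooth f -> Cn n f.
Proof.
revert f; induction n as [|n IH]; intros f Hf; simpl; [exact I|].
split; [intros x; apply smooth_ex_derive, Hf|apply IH, smooth_Derive, Hf].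
Qed.

Lemma smooth_of_Cn (f : R -> R) : (forall n, Cn n f) -> smooth f.
Proof.
intros Hf n; specialize (Hf n); revert f Hf; induction n as [|n IH]; intros f Hf x; [exact I|].
destruct n as [|n]; [exact (proj1 Hf x)|].
assert (A := IH (Derive f) (proj2 Hf) x); simpl in A |- *.
apply ex_derive_ext with (2 := A); intros t; clear.
revert t; induction n as [|n IH]; intros t; [reflexivity|].
simpl; apply Derive_ext; intros y; apply IH.
Qed.

Lemma Cn_pred (n : nat) (f : R -> R) : Cn (S n) f -> Cn n f.
Proof.
revert f; induction n as [|n IH]; intros f Hf; [exact I|].
split; [apply Hf|]; apply IH, Hf.
Qed.

Lemma Cn_S (n : nat) (f g : R -> R) : (forall x, is_derive f x (g x)) -> Cn n g -> Cn (S n) f.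
Proof.
intros Hf Hg; split; [intros x; eexists; apply Hf|].
replace (Derive f) with g; [assumption|].
apply functional_extensionality; intros x; symmetry; apply is_derive_unique, Hf.
Qed.

Lemma Cn_derive (n : nat) (f : R -> R) : Cn (S n) f -> forall x, is_derive f x (Derive f x).
Proof. intros [Hf _] x; apply Derive_correct, Hf. Qed.

Lemma Cn_const (n : nat) (k : R) : Cn n (fun _ => k).
Proof.
revert k; induction n as [|n IH]; intros k; [exact I|].
apply (Cn_S n _ (fun _ => 0)); [|apply IH]; intros x; apply @is_derive_const.
Qed.

Lemma Cn_plus (n : nat) (f g : R -> R) : Cn n f -> Cn n g -> Cn n (fun x => f x + g x).
Proof.
revert f g; induction n as [|n IH]; intros f g Hf Hg; [exact I|].
apply (Cn_S n _ (fun x => Derive f x + Derive g x)); [|apply IH; [apply Hf|apply Hg]].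
intros x; apply @is_derive_plus; eapply Cn_derive; eassumption.
Qed.

Lemma Cn_mult (n : nat) (f g : R -> R) : Cn n f -> Cn n g -> Cn n (fun x => f x * g x).
Proof.
revert f g; induction n as [|n IH]; intros f g Hf Hg; [exact I|].
apply (Cn_S n _ (fun x => Derive f x * g x + f x * Derive g x)).
- assert (D1 := Cn_derive n f Hf); assert (D2 := Cn_derive n g Hg); intros x; ader.
- apply Cn_plus; apply IH; solve [apply Hf|apply Hg|apply Cn_pred; assumption].
Qed.

Lemma Cn_opp (n : nat) (f : R -> R) : Cn n f -> Cn n (fun x => - f x).
Proof.
intros Hf; replace (fun x => - f x) with (fun x => -1 * f x)
  by (apply functional_extensionality; intros; ring).
apply Cn_mult; [apply Cn_const|assumption].
Qed.

Lemma Cn_sin_cos (n : nat) (f : R -> R) : Cn n f -> Cn n (fun x => sin (f x)) /\ Cn n (fun x => cos (f x)).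
Proof.
revert f; induction n as [|n IH]; intros f Hf; [split; exact I|].
assert (D1 := Cn_derive n f Hf); destruct (IH f (Cn_pred n f Hf)) as [A B]; split.
- apply (Cn_S n _ (fun x => Derive f x * cos (f x))); [intros x; ader|].
  apply Cn_mult; [apply Hf|assumption].
- apply (Cn_S n _ (fun x => - (Derive f x * sin (f x)))); [intros x; ader|].
  apply Cn_opp, Cn_mult; [apply Hf|assumption].
Qed.

(** The derivative of f^(-1/2) is -1/2 f' times the cube of f^(-1/2), a polynomial in f' and the
    function itself, so the induction closes. *)
Lemma Cn_inv_sqrt (n : nat) (f : R -> R) : (forall x, 0 < f x) -> Cn n f -> Cn n (fun x => / sqrt (f x)).
Proof.
intros Hp; induction n as [|n IH]; intros Hf; [exact I|].
assert (D1 := Cn_derive n f Hf); assert (A := IH (Cn_pred n f Hf)).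
apply (Cn_S n _ (fun x => (-1 / 2 * Derive f x) * (/ sqrt (f x) * (/ sqrt (f x) * / sqrt (f x))))).
- intros x; specialize (Hp x); assert (P := sqrt_lt_R0 _ Hp); ader; [lra|lra|field; lra].
- repeat first [apply Cn_const|assumption|exact (proj2 Hf)|apply Cn_mult].
Qed.

Lemma smooth_of_derive (f g : R -> R) : (forall x, is_derive f x (g x)) -> smooth g -> smooth f.
Proof.
intros Hf Hg; apply smooth_of_Cn; intros [|n]; [exact I|].
apply (Cn_S n f g Hf), Cn_of_smooth, Hg.
Qed.

Lemma smooth_const (k : R) : smooth (fun _ => k).
Proof. apply smooth_of_Cn; intros; apply Cn_const. Qed.

Lemma smooth_plus (f g : R -> R) : smooth f -> smooth g -> smooth (fun x => f x + g x).
Proof. intros Hf Hg; apply smooth_of_Cn; intros; apply Cn_plus; apply Cn_of_smooth; assumption. Qed.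

Lemma smooth_mult (f g : R -> R) : smooth f -> smooth g -> smooth (fun x => f x * g x).
Proof. intros Hf Hg; apply smooth_of_Cn; intros; apply Cn_mult; apply Cn_of_smooth; assumption. Qed.

Lemma smooth_opp (f : R -> R) : smooth f -> smooth (fun x => - f x).
Proof. intros Hf; apply smooth_of_Cn; intros; apply Cn_opp; apply Cn_of_smooth; assumption. Qed.

Lemma smooth_minus (f g : R -> R) : smooth f -> smooth g -> smooth (fun x => f x - g x).
Proof. intros Hf Hg; apply smooth_plus; [|apply smooth_opp]; assumption. Qed.

Lemma smooth_div_const (f : R -> R) (k : R) : smooth f -> smooth (fun x => f x / k).
Proof. intros Hf; apply smooth_mult; [assumption|apply smooth_const]. Qed.

Lemma smooth_sin (f : R -> R) : smooth f -> smooth (fun x => sin (f x)).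
Proof. intros Hf; apply smooth_of_Cn; intros; apply Cn_sin_cos, Cn_of_smooth, Hf. Qed.

Lemma smooth_cos (f : R -> R) : smooth f -> smooth (fun x => cos (f x)).
Proof. intros Hf; apply smooth_of_Cn; intros; apply Cn_sin_cos, Cn_of_smooth, Hf. Qed.

Lemma smooth_inv_sqrt (f : R -> R) : (forall x, 0 < f x) -> smooth f -> smooth (fun x => / sqrt (f x)).
Proof. intros Hp Hf; apply smooth_of_Cn; intros; apply Cn_inv_sqrt; [|apply Cn_of_smooth]; assumption. Qed.

Lemma is_derive_primitive (f : R -> R) (s : R) : cts f -> is_derive (fun s : R => RInt f 0 s) s (f s).
Proof.
intros Hf; apply (@is_derive_RInt R_NormedModule f (fun s => RInt f 0 s) 0 s); [|apply Hf].
apply filter_forall; intros x; apply (@RInt_correct R_CompleteNormedModule), cts_ex_RInt, Hf.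
Qed.

Lemma smooth_primitive (f : R -> R) : smooth f -> smooth (fun s => RInt f 0 s).
Proof.
intros Hf; apply (smooth_of_derive _ f); [|assumption].
intros s; apply is_derive_primitive, smooth_cts, Hf.
Qed.

Create HintDb sm.
#[export] Hint Resolve smooth_const smooth_plus smooth_mult smooth_opp smooth_minus smooth_div_const
  smooth_sin smooth_cos smooth_primitive : sm.
Ltac sm := auto 20 with sm.

Lemma smooth_dot (c d : R -> vec) : vsmooth c -> vsmooth d -> smooth (fun s => dot (c s) (d s)).
Proof. intros [Cx [Cy Cz]] [Dx [Dy Dz]]; unfold dot; sm. Qed.

Lemma vsmooth_cross (c d : R -> vec) : vsmooth c -> vsmooth d -> vsmooth (fun s => cross (c s) (d s)).
Proof.
intros [Cx [Cy Cz]] [Dx [Dy Dz]]; repeat split.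
- change (smooth (fun s => py (c s) * pz (d s) - pz (c s) * py (d s))); sm.
- change (smooth (fun s => pz (c s) * px (d s) - px (c s) * pz (d s))); sm.
- change (smooth (fun s => px (c s) * py (d s) - py (c s) * px (d s))); sm.
Qed.

Lemma vsmooth_comb (f g h : R -> R) (A B D : vec) : smooth f -> smooth g -> smooth h ->
  vsmooth (fun s => plus (plus (scal (f s) A) (scal (g s) B)) (scal (h s) D)).
Proof.
intros Hf Hg Hh; repeat split.
- change (smooth (fun s => (f s * px A + g s * px B) + h s * px D)); sm.
- change (smooth (fun s => (f s * py A + g s * py B) + h s * py D)); sm.
- change (smooth (fun s => (f s * pz A + g s * pz B) + h s * pz D)); sm.
Qed.

Lemma pendulum_smooth (q Lam C : R) (th ka X : R -> R) :
  pendulum q Lam C th ka X -> smooth th /\ smooth ka /\ smooth X.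
Proof.
intros H.
assert (D1 := pd_th _ _ _ _ _ _ H); assert (D2 := pd_ka _ _ _ _ _ _ H); assert (D3 := pd_X _ _ _ _ _ _ H).
assert (A : forall n, Cn n th /\ Cn n ka).
{ induction n as [|n [I1 I2]]; [split; exact I|]; split.
  - apply (Cn_S n _ _ D1 I2).
  - apply (Cn_S n _ _ D2); apply Cn_mult; [apply Cn_const|apply Cn_sin_cos, I1]. }
assert (S1 : smooth th) by (apply smooth_of_Cn; apply A).
split; [assumption|split; [apply smooth_of_Cn; apply A|]].
apply (smooth_of_derive _ _ D3); sm.
Qed.

(** * Frenet frames *)

(** Lifting of a curve on the circle: the angle must turn at the rate c d' - d c', so [psi] is the
    integral of this rate started at an angle of the initial point. The scalar and vector products
    of (c, d) with (cos psi, sin psi) then have zero derivative. *)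
Lemma smooth_angle (c d : R -> R) : smooth c -> smooth d -> (forall s, c s ^ 2 + d s ^ 2 = 1) ->
  exists psi : R -> R, smooth psi /\ forall s, c s = cos (psi s) /\ d s = sin (psi s).
Proof.
intros Hc Hd U.
assert (E0 : exists x, cos x = c 0 /\ sin x = d 0).
{ assert (B : -1 <= c 0 <= 1) by (specialize (U 0); nra).
  destruct (Rle_dec 0 (d 0)) as [L|L].
  - exists (acos (c 0)); split; [apply cos_acos; assumption|].
    rewrite sin_acos by assumption; apply Rsqr_inj; [apply sqrt_pos|assumption|].
    rewrite Rsqr_sqrt; specialize (U 0); unfold Rsqr; nra.
  - exists (- acos (c 0)); rewrite cos_neg, sin_neg; split; [apply cos_acos; assumption|].
    rewrite sin_acos by assumption.
    enough (sqrt (1 - (c 0)²) = - d 0) by lra.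
    apply Rsqr_inj; [apply sqrt_pos|lra|].
    rewrite Rsqr_sqrt; specialize (U 0); unfold Rsqr; nra. }
destruct E0 as [x0 [Cx Sx]].
assert (Dc := fun s => smooth_is_derive c s Hc); assert (Dd := fun s => smooth_is_derive d s Hd).
assert (Sc := smooth_Derive c Hc); assert (Sd := smooth_Derive d Hd).
pose (om := fun s => c s * Derive d s - d s * Derive c s).
assert (Som : smooth om) by (unfold om; sm).
pose (psi := fun s => x0 + RInt om 0 s).
assert (Dpsi : forall s, is_derive psi s (om s)).
{ intros s; unfold psi; evar_last.
  - apply @is_derive_plus; [apply @is_derive_const|apply is_derive_primitive, smooth_cts, Som].
  - unfold plus, zero; simpl; ring. }
assert (U' : forall s, c s * Derive c s + d s * Derive d s = 0).
{ intros s.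
  assert (E : is_derive (fun s => c s ^ 2 + d s ^ 2) s (2 * (c s * Derive c s + d s * Derive d s))).
  { clear - Dc Dd; ader. }
  apply is_derive_unique in E; rewrite (Derive_ext _ (fun _ => 1)), Derive_const in E by assumption; lra. }
exists psi; split; [unfold psi; sm|].
assert (K : forall s, (c s * cos (psi s) + d s * sin (psi s)) = 1 /\ (d s * cos (psi s) - c s * sin (psi s)) = 0).
{ assert (P0 : psi 0 = x0) by (unfold psi; rewrite RInt_point; apply Rplus_0_r).
  assert (Dd' : forall s, Derive d s = om s * c s /\ Derive c s = - om s * d s).
  { intros s; specialize (U s); specialize (U' s); unfold om; split.
    - transitivity (Derive d s * (c s ^ 2 + d s ^ 2)); [rewrite U; ring|].
      transitivity ((c s * Derive d s - d s * Derive c s) * c s + d s * (c s * Derive c s + d s * Derive d s)); [ring|].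
      rewrite U'; ring.
    - transitivity (Derive c s * (c s ^ 2 + d s ^ 2)); [rewrite U; ring|].
      transitivity (- (c s * Derive d s - d s * Derive c s) * d s + c s * (c s * Derive c s + d s * Derive d s)); [ring|].
      rewrite U'; ring. }
  assert (Dc2 : forall s, is_derive c s (- om s * d s)) by (intros s; rewrite <- (proj2 (Dd' s)); apply Dc).
  assert (Dd2 : forall s, is_derive d s (om s * c s)) by (intros s; rewrite <- (proj1 (Dd' s)); apply Dd).
  clear Dc Dd.
  assert (Z : forall f, (forall s, is_derive f s 0) -> forall s, f s = f 0).
  { intros f Df s; assert (E : RInt (fun _ => 0) 0 s = f s - f 0) by (apply int_deriv; ct).
    rewrite int_const in E; lra. }
  specialize (U 0); intros s; split.
  - rewrite (Z (fun s => c s * cos (psi s) + d s * sin (psi s))).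
    + rewrite P0, Cx, Sx; lra.
    + intros t; ader.
  - rewrite (Z (fun s => d s * cos (psi s) - c s * sin (psi s))).
    + rewrite P0, Cx, Sx; ring.
    + intros t; ader. }
intros s; destruct (K s) as [K1 K2].
assert (T := sin2_cos2 (psi s)); unfold Rsqr in T.
split.
- transitivity (c s * (sin (psi s) * sin (psi s) + cos (psi s) * cos (psi s))); [rewrite T; ring|].
  transitivity (cos (psi s) * (c s * cos (psi s) + d s * sin (psi s)) - sin (psi s) * (d s * cos (psi s) - c s * sin (psi s)));
    [ring|rewrite K1, K2; ring].
- transitivity (d s * (sin (psi s) * sin (psi s) + cos (psi s) * cos (psi s))); [rewrite T; ring|].
  transitivity (sin (psi s) * (c s * cos (psi s) + d s * sin (psi s)) + cos (psi s) * (d s * cos (psi s) - c s * sin (psi s)));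
    [ring|rewrite K1, K2; ring].
Qed.

Lemma angle_period (a b : R) : cos a = cos b -> sin a = sin b -> exists m : Z, a - b = IZR m * PI.
Proof.
intros Ec Es; apply sin_eq_0_0.
rewrite sin_minus, Ec, Es; ring.
Qed.

(** The real content of a generalized Frenet frame is a normal that is smooth across inflection
    points. Given one, B and tau are forced, and the Frenet equations follow by differentiating the
    orthonormality relations. *)
Lemma frenet_of_normal (l : R) (r : rod) (N : R -> vec) (kap : R -> R) :
  closed_rod l r -> vsmooth N -> smooth kap -> (forall s, dot (N s) (N s) = 1) ->
  (forall s, dot (tangent r s) (N s) = 0) -> (forall s, vDerive (tangent r) s = scal (kap s) (N s)) ->
  generalized_frenet r N (fun s => cross (tangent r s) (N s)) kap
    (fun s => dot (vDerive N s) (cross (tangent r s) (N s))).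
Proof.
intros Hr SN Sk UN ON DT; destruct (closed_rod_vsmooth l r Hr) as [ST _].
assert (SB := vsmooth_cross _ _ ST SN).
assert (UT : forall s, dot (tangent r s) (tangent r s) = 1) by apply Hr.
set (B := fun s => cross (tangent r s) (N s)) in *.
assert (UB : forall s, dot (B s) (B s) = 1).
{ intros s; unfold B; rewrite cross_dot_cross, UT, UN, ON; ring. }
assert (TB : forall s, dot (tangent r s) (B s) = 0) by (intros s; rewrite dot_sym; apply dot_cross_l).
assert (NB : forall s, dot (N s) (B s) = 0) by (intros s; rewrite dot_sym; apply dot_cross_r).
assert (OF : forall s, orthonormal (tangent r s) (N s)) by (intros s; repeat split; auto).
assert (R1 := fun s => dot_vDerive _ _ _ s ST SN ON).
assert (R2 := fun s => dot_vDerive _ _ _ s SN SN UN).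
assert (R3 := fun s => dot_vDerive _ _ _ s ST SB TB).
assert (R4 := fun s => dot_vDerive _ _ _ s SN SB NB).
assert (R5 := fun s => dot_vDerive _ _ _ s SB SB UB).
unfold generalized_frenet; repeat split; try apply SN; try apply SB; auto.
- apply (smooth_dot _ _ (vsmooth_vDerive _ SN) SB).
- intros s; specialize (R1 s); specialize (R2 s); rewrite DT, dot_scal_l, UN in R1.
  apply (vec_ext_frame (tangent r s) (N s)); [apply OF| | |]; fold (B s);
    rewrite dot_plus_l, !dot_scal_l.
  + rewrite UT, (dot_sym (B s)), TB, dot_sym; lra.
  + rewrite ON, (dot_sym (B s)), NB; rewrite (dot_sym (N s)) in R2; lra.
  + rewrite TB, UB; lra.
- intros s; specialize (R3 s); specialize (R4 s); specialize (R5 s); rewrite DT, dot_scal_l, NB in R3.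
  apply (vec_ext_frame (tangent r s) (N s)); [apply OF| | |]; fold (B s); rewrite dot_scal_l.
  + rewrite (dot_sym (N s)), ON, dot_sym; lra.
  + rewrite UN; rewrite (dot_sym (N s)) in R4; lra.
  + rewrite NB; rewrite (dot_sym (B s)) in R5; lra.
Qed.

(** If the normal and the material vector both return after one length, so does (cos psi, sin psi).
    This is the form in which the boundary condition modulo PI is checked, for the figure eight as
    well as for its perturbations. *)
Lemma has_delta_psi_of_normal (l : R) (r : rod) (N : R -> vec) (kap : R -> R) :
  closed_rod l r -> vsmooth N -> smooth kap -> (forall s, dot (N s) (N s) = 1) ->
  (forall s, dot (tangent r s) (N s) = 0) -> (forall s, vDerive (tangent r) s = scal (kap s) (N s)) ->
  N l = N 0 -> mat1 r l = mat1 r 0 ->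
  exists (d : R) (m : Z), has_delta_psi l r d /\ d = IZR m * PI.
Proof.
intros Hr SN Sk UN ON DT NL ML; destruct (closed_rod_vsmooth l r Hr) as [ST [S1 _]].
assert (SB := vsmooth_cross _ _ ST SN).
assert (UT : forall s, dot (tangent r s) (tangent r s) = 1) by apply Hr.
assert (OF : forall s, orthonormal (tangent r s) (N s)) by (intros s; repeat split; auto).
assert (MT : forall s, dot (mat1 r s) (tangent r s) = 0).
{ intros s; rewrite dot_sym; apply (closed_rod_frame l r s Hr). }
assert (UM : forall s, dot (mat1 r s) (mat1 r s) = 1) by apply Hr.
set (B := fun s => cross (tangent r s) (N s)) in *.
destruct (smooth_angle (fun s => dot (mat1 r s) (N s)) (fun s => dot (mat1 r s) (B s))) as [psi [Sp Hp]].
{ apply smooth_dot; assumption. }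
{ apply smooth_dot; assumption. }
{ intros s; assert (P := parseval _ _ (mat1 r s) (mat1 r s) (OF s)); rewrite UM, MT in P; fold (B s) in P; lra. }
assert (TL := tangent_period l r Hr 0); rewrite Rplus_0_l in TL.
destruct (angle_period (psi l) (psi 0)) as [m Hm].
{ rewrite <- (proj1 (Hp l)), <- (proj1 (Hp 0)), NL, ML; reflexivity. }
{ rewrite <- (proj2 (Hp l)), <- (proj2 (Hp 0)); unfold B; rewrite NL, ML, TL; reflexivity. }
exists (psi l - psi 0), m; split; [|assumption].
exists N, B, kap, (fun s => dot (vDerive N s) (B s)), psi.
split; [apply (frenet_of_normal l); assumption|].
split; [assumption|split; [|reflexivity]].
intros s; destruct (Hp s) as [P1 P2]; rewrite <- P1, <- P2.
apply (vec_ext_frame (tangent r s) (N s)); [apply OF| | |]; rewrite dot_plus_l, !dot_scal_l.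
- rewrite MT, (dot_sym (N s)), ON; unfold B; rewrite dot_cross_l; ring.
- rewrite UN; unfold B; rewrite dot_cross_r; ring.
- fold (B s).
  replace (dot (N s) (B s)) with 0 by (unfold B; rewrite dot_sym, dot_cross_r; reflexivity).
  replace (dot (B s) (B s)) with 1 by (unfold B; rewrite cross_dot_cross, UT, UN, ON; ring); ring.
Qed.

(** * Families depending on a small real *)

Lemma sin_lipschitz (x y : R) : Rabs (sin x - sin y) <= Rabs (x - y).
Proof.
rewrite <- (Rmult_1_l (Rabs (x - y))).
apply (lipschitz_of_derive sin cos); [intros s; ader|ct|].
intros s; assert (A := COS_bound s); apply Rabs_le; lra.
Qed.

Lemma cos_lipschitz (x y : R) : Rabs (cos x - cos y) <= Rabs (x - y).
Proof.
rewrite <- (Rmult_1_l (Rabs (x - y))).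
apply (lipschitz_of_derive cos (fun s => - sin s)); [intros s; ader|ct|].
intros s; assert (A := SIN_bound s); rewrite Rabs_Ropp; apply Rabs_le; lra.
Qed.

Lemma Rabs_sin_le (x : R) : Rabs (sin x) <= Rabs x.
Proof. assert (A := sin_lipschitz x 0); rewrite sin_0, !Rminus_0_r in A; exact A. Qed.

Lemma one_minus_cos_le (x : R) : Rabs (1 - cos x) <= x ^ 2.
Proof.
replace (1 - cos x) with (2 * (sin (x / 2) * sin (x / 2))).
- assert (A := Rabs_sin_le (x / 2)).
  assert (B := Rabs_mult_le _ _ _ _ A A).
  rewrite Rabs_mult, (Rabs_pos_eq 2) by lra.
  rewrite <- Rabs_mult, (Rabs_pos_eq (x / 2 * (x / 2))) in B by nra.
  assert (0 <= x ^ 2) by apply pow2_ge_0. nra.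
- assert (E := cos_2a_sin (x / 2)); replace (2 * (x / 2)) with x in E by field; rewrite E; ring.
Qed.

(** Quadratic rather than cubic, but valid for all x and of the same shape as the bound for 1 - cos
    x; remainders of order e^3 in the energy require no more. *)
Lemma sub_sin_le (x : R) : Rabs (x - sin x) <= x ^ 2.
Proof.
assert (Hp : forall y, 0 <= y -> Rabs (y - sin y) <= y ^ 2).
{ intros y Hy.
  assert (E : RInt (fun t => 1 - cos t) 0 y = (y - sin y) - (0 - sin 0)).
  { apply (int_deriv (fun t => t - sin t)); [intros s; ader|ct]. }
  rewrite sin_0 in E; replace (y - sin y) with (y - sin y - (0 - 0)) by ring; rewrite <- E.
  eapply Rle_trans; [apply int_abs; ct|].
  apply Rle_trans with (RInt (fun _ => y) 0 y); [|rewrite int_const; right; ring].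
  apply int_le; ct; intros t Ht.
  replace (1 - cos t) with (cos 0 - cos t) by (rewrite cos_0; ring).
  eapply Rle_trans; [apply cos_lipschitz|]; rewrite Rabs_minus_sym, Rminus_0_r, Rabs_pos_eq; lra. }
destruct (Rle_dec 0 x) as [L|L]; [apply Hp; assumption|].
assert (A := Hp (- x) ltac:(lra)); rewrite sin_neg in A.
replace (- x - - sin x) with (- (x - sin x)) in A by ring; rewrite Rabs_Ropp in A.
replace ((- x) ^ 2) with (x ^ 2) in A by ring; exact A.
Qed.

(** Uniform in s on [0, l] for 0 < e <= e0; the bound e0 <= 1 lets a higher order imply a lower one.
    Quantities depending on e alone are written as functions that ignore s. *)
Definition bigO (l : R) (n : nat) (f : R -> R -> R) : Prop :=
  exists C e0 : R, 0 <= C /\ 0 < e0 <= 1 /\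
    forall e s, 0 < e <= e0 -> 0 <= s <= l -> Rabs (f e s) <= C * e ^ n.

Section BigO.
Context (l : R) (Hl : 0 < l).

Lemma bigO_ext (n : nat) (f g : R -> R -> R) :
  (forall e s, f e s = g e s) -> bigO l n f -> bigO l n g.
Proof.
intros E [C [e0 [HC [He A]]]]; exists C, e0; split; [assumption|split; [assumption|]].
intros e s H1 H2; rewrite <- E; auto.
Qed.

Lemma bigO_plus (n : nat) (f g : R -> R -> R) :
  bigO l n f -> bigO l n g -> bigO l n (fun e s => f e s + g e s).
Proof.
intros [C [e0 [HC [He A]]]] [D [e1 [HD [He1 B]]]].
exists (C + D), (Rmin e0 e1).
assert (M1 := Rmin_l e0 e1); assert (M2 := Rmin_r e0 e1).
split; [lra|split; [split; [apply Rmin_glb_lt; lra|lra]|]].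
intros e s H1 H2; eapply Rle_trans; [apply Rabs_triang|].
rewrite Rmult_plus_distr_r; apply Rplus_le_compat; [apply A|apply B]; lra.
Qed.

Lemma bigO_opp (n : nat) (f : R -> R -> R) : bigO l n f -> bigO l n (fun e s => - f e s).
Proof.
intros [C [e0 [HC [He A]]]]; exists C, e0; split; [assumption|split; [assumption|]].
intros e s H1 H2; rewrite Rabs_Ropp; auto.
Qed.

Lemma bigO_minus (n : nat) (f g : R -> R -> R) :
  bigO l n f -> bigO l n g -> bigO l n (fun e s => f e s - g e s).
Proof. intros Hf Hg; apply bigO_plus; [assumption|apply bigO_opp; assumption]. Qed.

Lemma bigO_mult (n m : nat) (f g : R -> R -> R) :
  bigO l n f -> bigO l m g -> bigO l (n + m) (fun e s => f e s * g e s).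
Proof.
intros [C [e0 [HC [He A]]]] [D [e1 [HD [He1 B]]]].
exists (C * D), (Rmin e0 e1).
assert (M1 := Rmin_l e0 e1); assert (M2 := Rmin_r e0 e1).
split; [nra|split; [split; [apply Rmin_glb_lt; lra|lra]|]].
intros e s H1 H2; rewrite pow_add.
replace (C * D * (e ^ n * e ^ m)) with (C * e ^ n * (D * e ^ m)) by ring.
apply Rabs_mult_le; [apply A|apply B]; lra.
Qed.

Lemma bigO_weaken (n m : nat) (f : R -> R -> R) : (n <= m)%nat -> bigO l m f -> bigO l n f.
Proof.
intros Hnm [C [e0 [HC [He A]]]]; exists C, e0; split; [assumption|split; [assumption|]].
intros e s H1 H2; eapply Rle_trans; [apply A; assumption|]; apply Rmult_le_compat_l; [assumption|].
replace m with (n + (m - n))%nat by lia; rewrite pow_add.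
assert (0 < e ^ n) by (apply pow_lt; lra).
assert (e ^ (m - n) <= 1).
{ rewrite <- (pow1 (m - n)); apply pow_incr; lra. }
nra.
Qed.

Lemma bigO_cts (g : R -> R) : cts g -> bigO l 0 (fun _ s => g s).
Proof.
intros Cg; destruct (cts_bounded g 0 l ltac:(lra) Cg) as [M [HM BM]].
exists M, 1; split; [lra|split; [lra|]]; intros e s _ Hs; simpl; rewrite Rmult_1_r; auto.
Qed.

Lemma bigO_eps : bigO l 1 (fun e _ => e).
Proof.
exists 1, 1; split; [lra|split; [lra|]]; intros e s He _; rewrite Rabs_pos_eq by lra; simpl; lra.
Qed.

Lemma bigO_sin (n : nat) (f : R -> R -> R) : bigO l n f -> bigO l n (fun e s => sin (f e s)).
Proof.
intros [C [e0 [HC [He A]]]]; exists C, e0; split; [assumption|split; [assumption|]].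
intros e s H1 H2; eapply Rle_trans; [apply Rabs_sin_le|]; auto.
Qed.

Lemma bigO_sin_bounded (f : R -> R -> R) : bigO l 0 (fun e s => sin (f e s)).
Proof.
exists 1, 1; split; [lra|split; [lra|]]; intros e s _ _; simpl.
assert (A := SIN_bound (f e s)); apply Rabs_le; lra.
Qed.

Lemma bigO_cos_bounded (f : R -> R -> R) : bigO l 0 (fun e s => cos (f e s)).
Proof.
exists 1, 1; split; [lra|split; [lra|]]; intros e s _ _; simpl.
assert (A := COS_bound (f e s)); apply Rabs_le; lra.
Qed.

Lemma bigO_sin_diff (n : nat) (f g : R -> R -> R) :
  bigO l n (fun e s => f e s - g e s) -> bigO l n (fun e s => sin (f e s) - sin (g e s)).
Proof.
intros [C [e0 [HC [He A]]]]; exists C, e0; split; [assumption|split; [assumption|]].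
intros e s H1 H2; eapply Rle_trans; [apply sin_lipschitz|]; auto.
Qed.

Lemma bigO_cos_diff (n : nat) (f g : R -> R -> R) :
  bigO l n (fun e s => f e s - g e s) -> bigO l n (fun e s => cos (f e s) - cos (g e s)).
Proof.
intros [C [e0 [HC [He A]]]]; exists C, e0; split; [assumption|split; [assumption|]].
intros e s H1 H2; eapply Rle_trans; [apply cos_lipschitz|]; auto.
Qed.

Lemma bigO_sqr_dominated (h : R -> R) (n : nat) (f : R -> R -> R) :
  (forall x, Rabs (h x) <= x ^ 2) -> bigO l n f -> bigO l (n + n) (fun e s => h (f e s)).
Proof.
intros Hh Hf; destruct (bigO_mult _ _ _ _ Hf Hf) as [C [e0 [HC [He A]]]].
exists C, e0; split; [assumption|split; [assumption|]].
intros e s H1 H2; eapply Rle_trans; [apply Hh|].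
eapply Rle_trans; [|apply (A e s H1 H2)].
eapply Rle_trans; [|apply Rle_abs]; right; ring.
Qed.

Lemma bigO_one_minus_cos (n : nat) (f : R -> R -> R) :
  bigO l n f -> bigO l (n + n) (fun e s => 1 - cos (f e s)).
Proof. apply (bigO_sqr_dominated (fun x => 1 - cos x)), one_minus_cos_le. Qed.

Lemma bigO_sub_sin (n : nat) (f : R -> R -> R) :
  bigO l n f -> bigO l (n + n) (fun e s => f e s - sin (f e s)).
Proof. apply (bigO_sqr_dominated (fun x => x - sin x)), sub_sin_le. Qed.

Lemma bigO_int (n : nat) (f : R -> R -> R) : (forall e, cts (f e)) ->
  bigO l n f -> bigO l n (fun e s => RInt (f e) 0 s).
Proof.
intros Cf [C [e0 [HC [He A]]]]; exists (C * l), e0; split; [nra|split; [assumption|]].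
intros e s H1 H2; eapply Rle_trans; [apply int_abs; [lra|apply Cf]|].
assert (Hp : 0 < e ^ n) by (apply pow_lt; lra).
apply Rle_trans with (RInt (fun _ => C * e ^ n) 0 s).
- assert (Cfe := Cf e); apply int_le; ct; [lra|]; intros t Ht; apply A; lra.
- rewrite int_const.
  replace (C * l * e ^ n) with (C * e ^ n * l) by ring; apply Rmult_le_compat_l; [nra|lra].
Qed.

Lemma bigO_at_end (n : nat) (f : R -> R -> R) : bigO l n f -> bigO l n (fun e _ => f e l).
Proof.
intros [C [e0 [HC [He A]]]]; exists C, e0; split; [assumption|split; [assumption|]].
intros e s H1 _; apply A; lra.
Qed.

Lemma bigO_small (f : R -> R -> R) (eta : R) : 0 < eta -> bigO l 1 f ->
  exists e0, 0 < e0 /\ forall e s, 0 < e <= e0 -> 0 <= s <= l -> Rabs (f e s) < eta.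
Proof.
intros Heta [C [e0 [HC [He A]]]].
assert (0 < eta / (C + 1)) by (apply Rdiv_lt_0_compat; lra).
exists (Rmin e0 (eta / (C + 1))); split; [apply Rmin_glb_lt; lra|].
assert (M1 := Rmin_l e0 (eta / (C + 1))); assert (M2 := Rmin_r e0 (eta / (C + 1))).
intros e s H1 H2; eapply Rle_lt_trans; [apply A; lra|]; rewrite pow_1.
apply Rlt_le_trans with ((C + 1) * e); [lra|].
apply Rle_trans with ((C + 1) * (eta / (C + 1))); [apply Rmult_le_compat_l; lra|right; field; lra].
Qed.

(** First-order closeness to a limit, combined with boundedness of the limit so that the notion is
    stable under products. Convergence of the whole material frame then follows from the shape of
    its formulas. *)
Definition near (F : R -> R -> R) (G : R -> R) : Prop :=
  bigO l 1 (fun e s => F e s - G s) /\ bigO l 0 (fun _ s => G s).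

Lemma near_bounded (F : R -> R -> R) (G : R -> R) : near F G -> bigO l 0 F.
Proof.
intros [A B]; apply (bigO_ext _ (fun e s => (F e s - G s) + G s)); [intros; ring|].
apply bigO_plus; [apply (bigO_weaken 0 1); [lia|assumption]|assumption].
Qed.

Lemma near_refl (G : R -> R) : cts G -> near (fun _ => G) G.
Proof.
intros CG; split; [|apply bigO_cts, CG].
exists 0, 1; split; [lra|split; [lra|]]; intros e s _ _; rewrite Rminus_diag, Rabs_R0; lra.
Qed.

Lemma near_plus (F F' : R -> R -> R) (G G' : R -> R) : near F G -> near F' G' ->
  near (fun e s => F e s + F' e s) (fun s => G s + G' s).
Proof.
intros [A B] [A' B']; split; [|apply bigO_plus; assumption].
apply (bigO_ext _ (fun e s => (F e s - G s) + (F' e s - G' s))); [intros; ring|].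
apply bigO_plus; assumption.
Qed.

Lemma near_opp (F : R -> R -> R) (G : R -> R) : near F G -> near (fun e s => - F e s) (fun s => - G s).
Proof.
intros [A B]; split; [|apply bigO_opp; assumption].
apply (bigO_ext _ (fun e s => - (F e s - G s))); [intros; ring|]; apply bigO_opp; assumption.
Qed.

Lemma near_minus (F F' : R -> R -> R) (G G' : R -> R) : near F G -> near F' G' ->
  near (fun e s => F e s - F' e s) (fun s => G s - G' s).
Proof. intros H H'; apply near_plus; [|apply near_opp]; assumption. Qed.

Lemma near_mult (F F' : R -> R -> R) (G G' : R -> R) : near F G -> near F' G' ->
  near (fun e s => F e s * F' e s) (fun s => G s * G' s).
Proof.
intros H H'; assert (B' := near_bounded _ _ H'); destruct H as [A B]; destruct H' as [A' B2].
split; [|apply (bigO_mult 0 0); assumption].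
apply (bigO_ext _ (fun e s => (F e s - G s) * F' e s + G s * (F' e s - G' s))); [intros; ring|].
apply bigO_plus; [apply (bigO_mult 1 0)|apply (bigO_mult 0 1)]; assumption.
Qed.

Lemma near_sin (F : R -> R -> R) (G : R -> R) : near F G -> near (fun e s => sin (F e s)) (fun s => sin (G s)).
Proof.
intros [A B]; split; [apply (bigO_sin_diff 1 F (fun _ => G)); assumption|].
apply (bigO_sin_bounded (fun _ => G)).
Qed.

Lemma near_cos (F : R -> R -> R) (G : R -> R) : near F G -> near (fun e s => cos (F e s)) (fun s => cos (G s)).
Proof.
intros [A B]; split; [apply (bigO_cos_diff 1 F (fun _ => G)); assumption|].
apply (bigO_cos_bounded (fun _ => G)).
Qed.

Lemma near_zero (F : R -> R -> R) : bigO l 1 F -> near F (fun _ => 0).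
Proof.
intros A; split; [|apply bigO_cts, cts_const].
apply (bigO_ext _ F); [intros; ring|assumption].
Qed.

Lemma near_int (F : R -> R -> R) (G : R -> R) : (forall e, cts (F e)) -> cts G -> near F G ->
  near (fun e s => RInt (F e) 0 s) (fun s => RInt G 0 s).
Proof.
intros CF CG [A B]; split.
- apply (bigO_ext _ (fun e s => RInt (fun t => F e t - G t) 0 s)).
  + intros e s; assert (CFe := CF e); apply int_minus; ct.
  + apply (bigO_int 1 (fun e t => F e t - G t)); [|assumption].
    intros e; assert (CFe := CF e); ct.
- apply (bigO_int 0 (fun _ => G)); [intros; assumption|assumption].
Qed.

Lemma near_small (F : R -> R -> R) (G : R -> R) (eta : R) : 0 < eta -> near F G ->
  exists e0, 0 < e0 /\ forall e s, 0 < e <= e0 -> 0 <= s <= l -> Rabs (F e s - G s) < eta.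
Proof. intros He [A _]; apply (bigO_small (fun e s => F e s - G s)); assumption. Qed.

End BigO.

(** * The amplitude that closes the perturbed curve *)

Section Stretch.
Context (q Lam C : R) (th ka X : R -> R) (H : pendulum q Lam C th ka X).
Let q_pos := pd_q _ _ _ _ _ _ H.
Let C_th := pd_cts_th _ _ _ _ _ _ H.
Let C_yA := cts_normal_field _ _ _ _ _ _ H.
Let l := 4 * q.

(** Up to sign this is the derivative at k = 1 of the integral of cos (k th): the transversality
    that lets a stretched longitude close the curve. *)
Lemma int_th_sin_pos : 0 < RInt (fun s => th s * sin (th s)) 0 l.
Proof.
unfold l; rewrite int_fold_ends by ct.
rewrite (int_ext (fun u => th (2 * q - u) * sin (th (2 * q - u))) (fun s => th s * sin (th s)))
  by (intros; rewrite (pd_th_2m _ _ _ _ _ _ H); reflexivity).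
rewrite (int_ext (fun u => th (2 * q + u) * sin (th (2 * q + u))) (fun s => th s * sin (th s)))
  by (intros; rewrite (pd_th_2p _ _ _ _ _ _ H), sin_neg; rring).
rewrite (int_ext (fun u => th (4 * q - u) * sin (th (4 * q - u))) (fun s => th s * sin (th s)))
  by (intros; rewrite (pd_th_4m _ _ _ _ _ _ H), sin_neg; rring).
assert (0 < RInt (fun s => th s * sin (th s)) 0 q); [|lra].
apply RInt_gt_0; [assumption| |].
- intros x Hx; destruct (pd_th_pos _ _ _ _ _ _ H x); [lra|].
  apply Rmult_lt_0_compat; [assumption|apply sin_gt_0; assumption].
- intros x _; assert (A : cts (fun s => th s * sin (th s))) by ct; apply A.
Qed.

(** The other two components of the tangent close by symmetry, so one equation in one unknown
    remains. Raising the tangent to latitude e [normal_field] disturbs it by O(e^2), and stretching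
    the longitude by 1 + c changes it by - c J0 + O(c^2); hence a root with c = O(e^2). *)
Lemma stretch : exists (kf : R -> R) (M e0 : R), 0 < M /\ 0 < e0 <= 1 /\
  forall e, 0 < e <= e0 -> Rabs (kf e - 1) <= M * e ^ 2 /\
    RInt (fun s => cos (e * normal_field Lam th ka X s) * cos (kf e * th s)) 0 l = 0.
Proof.
set (yA := normal_field Lam th ka X) in *.
assert (J := int_th_sin_pos); set (J0 := RInt _ 0 l) in J.
assert (Hl : 0 < l) by (unfold l; lra).
destruct (cts_bounded th 0 l ltac:(lra) C_th) as [t0 [Ht0 Bt]].
destruct (cts_bounded yA 0 l ltac:(lra) C_yA) as [y0 [Hy0 By]].
set (C1 := y0 ^ 2 * l); assert (HC1 : 0 < C1) by (unfold C1; assert (0 < y0 ^ 2) by (apply pow_lt; lra); nra).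
(* At c = M e^2 the linear term c J0 equals 2 C1 e^2, twice the disturbance due to the latitude. The
   remaining C1 e^2 must dominate C2 c^2, and this fixes [e0]. *)
set (M := 2 * C1 / J0); assert (HM : 0 < M) by (unfold M; apply Rdiv_lt_0_compat; lra).
set (C2 := 2 * t0 ^ 2 * l); assert (HC2 : 0 < C2) by (unfold C2; assert (0 < t0 ^ 2) by (apply pow_lt; lra); nra).
set (e0 := Rmin 1 (C1 / (2 * C2 * M ^ 2))).
assert (HM2 : 0 < M ^ 2) by (apply pow_lt; assumption).
assert (He0 : 0 < e0 <= 1 /\ C2 * M ^ 2 * e0 < C1).
{ assert (0 < C1 / (2 * C2 * M ^ 2)) by (apply Rdiv_lt_0_compat; [lra|mpos]).
  unfold e0; split; [split; [apply Rmin_glb_lt; lra|apply Rmin_l]|].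
  apply Rle_lt_trans with (C2 * M ^ 2 * (C1 / (2 * C2 * M ^ 2))); [apply Rmult_le_compat_l; [nra|apply Rmin_r]|].
  replace (C2 * M ^ 2 * (C1 / (2 * C2 * M ^ 2))) with (C1 / 2) by (field; lra); lra. }
pose (g := fun e k => RInt (fun s => cos (e * yA s) * cos (k * th s)) 0 l).
(* [R1] is the effect of the latitude and [R2] the second-order remainder of cos ((1 + c) th) in c;
   the term of order zero is cos th, which integrates to 0. *)
assert (Est : forall e c, 0 < e -> Rabs (g e (1 + c) + c * J0) <= C1 * e ^ 2 + C2 * c ^ 2).
{ intros e c He.
  pose (R1 := fun s => - ((1 - cos (e * yA s)) * cos ((1 + c) * th s))).
  pose (R2 := fun s => - (cos (th s) * (1 - cos (c * th s))) + sin (th s) * (c * th s - sin (c * th s))).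
  assert (E : g e (1 + c) + c * J0 = RInt R1 0 l + RInt R2 0 l).
  { unfold g, J0; rewrite <- !int_plus, <- int_scal by (unfold R1, R2; ct).
    rewrite (int_ext (fun s => cos (e * yA s) * cos ((1 + c) * th s))
      (fun s => cos (th s) + (R1 s + R2 s) - c * (th s * sin (th s)))).
    - assert (IC : RInt (fun s => cos (th s)) 0 l = 0) by exact (int_cos_th _ _ _ _ _ _ H).
      rewrite int_minus, int_plus, IC by (unfold R1, R2; ct); rring.
    - intros s; unfold R1, R2; replace ((1 + c) * th s) with (th s + c * th s) by ring.
      rewrite cos_plus; rring. }
  rewrite E; eapply Rle_trans; [apply Rabs_triang|]; apply Rplus_le_compat.
  - eapply Rle_trans; [apply int_abs; [lra|unfold R1; ct]|].
    apply Rle_trans with (RInt (fun _ => e ^ 2 * y0 ^ 2 * 1) 0 l);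
      [|rewrite int_const; unfold C1; right; ring].
    apply int_le; [lra|unfold R1; ct|ct|]; intros s Hs; unfold R1; rewrite Rabs_Ropp.
    apply Rabs_mult_le.
    + eapply Rle_trans; [apply one_minus_cos_le|]; rewrite Rpow_mult_distr.
      apply Rmult_le_compat_l; [apply pow2_ge_0|]; apply sqr_abs_le, By; assumption.
    + assert (A := COS_bound ((1 + c) * th s)); apply Rabs_le; lra.
  - eapply Rle_trans; [apply int_abs; [lra|unfold R2; ct]|].
    apply Rle_trans with (RInt (fun _ => 2 * (c ^ 2 * t0 ^ 2)) 0 l);
      [|rewrite int_const; unfold C2; right; ring].
    apply int_le; [lra|unfold R2; ct|ct|]; intros s Hs; unfold R2.
    assert (B : (c * th s) ^ 2 <= c ^ 2 * t0 ^ 2).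
    { rewrite Rpow_mult_distr; apply Rmult_le_compat_l; [apply pow2_ge_0|]; apply sqr_abs_le, Bt; assumption. }
    eapply Rle_trans; [apply Rabs_triang|]; rewrite Rabs_Ropp.
    assert (A1 : Rabs (cos (th s) * (1 - cos (c * th s))) <= 1 * (c ^ 2 * t0 ^ 2)).
    { apply Rabs_mult_le; [assert (A := COS_bound (th s)); apply Rabs_le; lra|].
      eapply Rle_trans; [apply one_minus_cos_le|exact B]. }
    assert (A2 : Rabs (sin (th s) * (c * th s - sin (c * th s))) <= 1 * (c ^ 2 * t0 ^ 2)).
    { apply Rabs_mult_le; [assert (A := SIN_bound (th s)); apply Rabs_le; lra|].
      eapply Rle_trans; [apply sub_sin_le|exact B]. }
    lra. }
assert (Lip : forall e k k', Rabs (g e k - g e k') <= t0 * l * Rabs (k - k')).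
{ intros e k k'; unfold g; rewrite <- int_minus by ct.
  eapply Rle_trans; [apply int_abs; [lra|ct]|].
  apply Rle_trans with (RInt (fun _ => 1 * (Rabs (k - k') * t0)) 0 l); [|rewrite int_const; right; ring].
  apply int_le; [lra|ct|ct|]; intros s Hs.
  replace (_ - _) with (cos (e * yA s) * (cos (k * th s) - cos (k' * th s))) by ring.
  apply Rabs_mult_le; [assert (A := COS_bound (e * yA s)); apply Rabs_le; lra|].
  eapply Rle_trans; [apply cos_lipschitz|].
  replace (k * th s - k' * th s) with ((k - k') * th s) by ring; apply Rabs_mult_le; [lra|auto]. }
assert (Cg : forall e, continuity (g e)).
{ intros e k; apply continuity_pt_filterlim; apply filterlim_locally; intros eps.
  assert (Htl : 0 < t0 * l) by mpos.
  assert (Hd : 0 < eps / (t0 * l)) by (apply Rdiv_lt_0_compat; [apply cond_pos|assumption]).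
  exists (mkposreal _ Hd); intros k' Hk'.
  change (Rabs (g e k' - g e k) < eps); eapply Rle_lt_trans; [apply Lip|].
  change (Rabs (k' - k) < eps / (t0 * l)) in Hk'.
  apply Rlt_le_trans with (t0 * l * (eps / (t0 * l))); [apply Rmult_lt_compat_l; assumption|].
  right; field; split; lra. }
pose (P := fun e k => Rabs (k - 1) <= M * e ^ 2 /\ g e k = 0).
assert (Ex : forall e, 0 < e <= e0 -> exists k, P e k).
{ intros e He; set (c := M * e ^ 2).
  assert (He2 : 0 < e ^ 2) by (apply pow_lt; lra).
  assert (Hc : 0 < c) by (unfold c; mpos).
  assert (K : C1 * e ^ 2 + C2 * c ^ 2 < c * J0).
  { unfold c; replace (M * e ^ 2 * J0) with (2 * C1 * e ^ 2) by (unfold M; field; lra).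
    replace (C2 * (M * e ^ 2) ^ 2) with (e ^ 2 * (C2 * M ^ 2 * e ^ 2)) by ring.
    assert (e ^ 2 <= e0) by (simpl; nra).
    assert (C2 * M ^ 2 * e ^ 2 <= C2 * M ^ 2 * e0) by (apply Rmult_le_compat_l; [nra|assumption]).
    assert (e ^ 2 * (C2 * M ^ 2 * e ^ 2) < e ^ 2 * C1) by (apply Rmult_lt_compat_l; lra). lra. }
  assert (G1 := Est e c ltac:(lra)); assert (G2 := Est e (- c) ltac:(lra)).
  replace ((- c) ^ 2) with (c ^ 2) in G2 by ring.
  apply Rabs_le_between in G1; apply Rabs_le_between in G2.
  destruct (IVT_gen (g e) (1 + - c) (1 + c) 0 (Cg e)) as [k [Hk Zk]].
  { rewrite Rmin_right, Rmax_left by lra; lra. }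
  rewrite Rmin_left, Rmax_right in Hk by lra.
  exists k; split; [apply Rabs_le; fold c; lra|assumption]. }
(* The root is selected separately for each [e]; of its dependence on [e] only the quadratic bound
   is recorded. *)
exists (fun e => epsilon (inhabits 0) (P e)), M, e0; split; [assumption|split; [apply He0|]].
intros e He; exact (epsilon_spec (inhabits 0) (P e) (Ex e He)).
Qed.

End Stretch.

(** * The destabilizing family *)

Section Coordinates.
Context (E1 E2 : vec) (O : orthonormal E1 E2).
Let E3 := cross E1 E2.

Definition vec3 (x y z : R) : vec := plus (plus (scal x E1) (scal y E2)) (scal z E3).

Lemma frame_dots : dot E1 E1 = 1 /\ dot E2 E2 = 1 /\ dot E3 E3 = 1 /\
  dot E1 E2 = 0 /\ dot E2 E1 = 0 /\ dot E1 E3 = 0 /\ dot E3 E1 = 0 /\ dot E2 E3 = 0 /\ dot E3 E2 = 0.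
Proof.
destruct O as [O1 [O2 O3]].
assert (A1 : dot E3 E1 = 0) by apply dot_cross_l; assert (A2 : dot E3 E2 = 0) by apply dot_cross_r.
assert (A3 : dot E3 E3 = 1) by apply (fig_e_unit E1 E2 O).
repeat split; try assumption; rewrite dot_sym; assumption.
Qed.

Lemma dot_vec3 (x y z x' y' z' : R) :
  dot (vec3 x y z) (vec3 x' y' z') = x * x' + y * y' + z * z'.
Proof.
destruct frame_dots as [A1 [A2 [A3 [A4 [A5 [A6 [A7 [A8 A9]]]]]]]].
unfold vec3; rewrite !dot_plus_l, !dot_plus_r, !dot_scal_l, !dot_scal_r.
rewrite A1, A2, A3, A4, A5, A6, A7, A8, A9; ring.
Qed.

Lemma dot_vec3_E (x y z : R) :
  dot (vec3 x y z) E1 = x /\ dot (vec3 x y z) E2 = y /\ dot (vec3 x y z) E3 = z.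
Proof.
destruct frame_dots as [A1 [A2 [A3 [A4 [A5 [A6 [A7 [A8 A9]]]]]]]].
unfold vec3; rewrite !dot_plus_l, !dot_scal_l.
rewrite A1, A2, A3, A4, A5, A6, A7, A8, A9; repeat split; ring.
Qed.

Lemma vec3_of_dots (v : vec) (x y z : R) : dot v E1 = x -> dot v E2 = y -> dot v E3 = z -> v = vec3 x y z.
Proof.
intros H1 H2 H3; destruct (dot_vec3_E x y z) as [A1 [A2 A3]].
apply (vec_ext_frame E1 E2 v _ O); fold E3; lra.
Qed.

Lemma cross_vec3 (x y z x' y' z' : R) :
  cross (vec3 x y z) (vec3 x' y' z') = vec3 (y * z' - z * y') (z * x' - x * z') (x * y' - y * x').
Proof.
destruct frame_dots as [A1 [A2 [A3 [A4 [A5 [A6 [A7 [A8 A9]]]]]]]].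
assert (X2 : cross E3 E1 = E2) by apply (fig_E2 E1 E2 O).
assert (X1 : cross E2 E3 = E1) by (unfold E3; rewrite cross_cross, A2, A5; veq).
destruct (dot_vec3_E x y z) as [B1 [B2 B3]]; destruct (dot_vec3_E x' y' z') as [B1' [B2' B3']].
apply vec3_of_dots.
- rewrite <- X1, cross_dot_cross, B2, B3, B2', B3'; ring.
- rewrite <- X2, cross_dot_cross, B1, B3, B1', B3'; ring.
- unfold E3; rewrite cross_dot_cross, B1, B2, B1', B2'; ring.
Qed.

Lemma scal_vec3 (k x y z : R) : scal k (vec3 x y z) = vec3 (k * x) (k * y) (k * z).
Proof. unfold vec3; veq. Qed.

Lemma vec3_close (x y z x' y' z' eta : R) :
  Rabs (x - x') < eta -> Rabs (y - y') < eta -> Rabs (z - z') < eta ->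
  norm (minus (vec3 x y z) (vec3 x' y' z')) < 3 * eta.
Proof.
intros Hx Hy Hz.
replace (minus (vec3 x y z) (vec3 x' y' z')) with
  (plus (plus (scal (x - x') E1) (scal (y - y') E2)) (scal (z - z') E3)) by (unfold vec3; veq).
destruct frame_dots as [A1 [A2 [A3 _]]].
eapply Rle_lt_trans; [apply norm_plus_le|]; rewrite norm_scal_vec, (norm_unit E3) by assumption.
eapply Rle_lt_trans; [apply Rplus_le_compat_r, norm_plus_le|].
rewrite !norm_scal_vec, (norm_unit E1), (norm_unit E2) by assumption; lra.
Qed.

Lemma vsmooth_vec3 (f g h : R -> R) : smooth f -> smooth g -> smooth h ->
  vsmooth (fun s => vec3 (f s) (g s) (h s)).
Proof. intros; apply vsmooth_comb; assumption. Qed.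

Lemma vDerive_vec3 (f g h f' g' h' : R -> R) :
  (forall s, is_derive f s (f' s)) -> (forall s, is_derive g s (g' s)) -> (forall s, is_derive h s (h' s)) ->
  forall s, vDerive (fun s => vec3 (f s) (g s) (h s)) s = vec3 (f' s) (g' s) (h' s).
Proof.
intros Df Dg Dh s.
assert (P : forall x y z : R, Derive (fun t => f t * x + g t * y + h t * z) s = f' s * x + g' s * y + h' s * z).
{ intros x y z; apply is_derive_unique; ader. }
apply vec_eq; unfold vDerive; rewrite ?px_mk, ?py_mk, ?pz_mk.
- rewrite (Derive_ext _ (fun t => f t * px E1 + g t * px E2 + h t * px E3)), P by reflexivity; unfold vec3; vring.
- rewrite (Derive_ext _ (fun t => f t * py E1 + g t * py E2 + h t * py E3)), P by reflexivity; unfold vec3; vring.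
- rewrite (Derive_ext _ (fun t => f t * pz E1 + g t * pz E2 + h t * pz E3)), P by reflexivity; unfold vec3; vring.
Qed.

Lemma vDerive_shift (c : R -> vec) (v : vec) (s : R) : vDerive (fun s => plus v (c s)) s = vDerive c s.
Proof.
assert (P : forall (f : R -> R) x, Derive (fun t => x + f t) s = Derive f s).
{ intros f x; unfold Derive; f_equal; apply Lim_ext; intros y; f_equal; ring. }
unfold vDerive; f_equal; apply P.
Qed.
End Coordinates.

Section Bending.
Context (q Lam C : R) (th ka X : R -> R) (H : pendulum q Lam C th ka X).
Let q_pos := pd_q _ _ _ _ _ _ H.
Let D_th := pd_th _ _ _ _ _ _ H.
Let D_ka := pd_ka _ _ _ _ _ _ H.
Let C_th := pd_cts_th _ _ _ _ _ _ H.
Let C_ka := pd_cts_ka _ _ _ _ _ _ H.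
Let C_pot := cts_pot _ _ _ _ _ _ H.
Let l := 4 * q.
Let V := pot Lam th ka.

(** [sin th] solves the Jacobi equation with zero right-hand side, being the normal part of a
    rotation of the figure eight. *)
Lemma int_by_parts_sin (w w' : R -> R) : (forall s, is_derive w s (w' s)) -> cts w' -> w l = w 0 ->
  RInt (fun s => (cos (th s) * ka s) * w' s - V s * sin (th s) * w s) 0 l = 0.
Proof.
intros Dw Cw' Hw; assert (Cw := is_derive_cts _ _ Dw).
rewrite (int_deriv (fun s => cos (th s) * ka s * w s)).
- rewrite Hw; unfold l; replace (4 * q) with (0 + 4 * q) by ring.
  rewrite (pd_th_period _ _ _ _ _ _ H), (pd_ka_period _ _ _ _ _ _ H); rring.
- intros s; unfold V, pot; ader.
- unfold V; ct.
Qed.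

(* [V] is the potential of the second variation and also the Lagrange multiplier
   of the constraint [|T| = 1], so the expansion of the bending energy is exact. *)
Lemma bending_expand (p p' w w' z z' : R -> R) :
  (forall s, is_derive p s (p' s)) -> (forall s, is_derive w s (w' s)) -> (forall s, is_derive z s (z' s)) ->
  cts p' -> cts w' -> cts z' -> p l = p 0 -> w l = w 0 -> RInt p 0 l = 0 ->
  (forall s, p s ^ 2 + w s ^ 2 + z s ^ 2 = 1) ->
  RInt (fun s => p' s ^ 2 + w' s ^ 2 + z' s ^ 2) 0 l = RInt (fun s => ka s ^ 2) 0 l
   + jform V (fun s => p s - cos (th s)) (fun s => p' s - - sin (th s) * ka s) l
   + jform V (fun s => w s - sin (th s)) (fun s => w' s - cos (th s) * ka s) l
   + jform V z z' l.
Proof.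
intros Dp Dw Dz Cp' Cw' Cz' Pl Wl Ip U.
assert (Cp := is_derive_cts _ _ Dp); assert (Cw := is_derive_cts _ _ Dw); assert (Cz := is_derive_cts _ _ Dz).
assert (CV : cts V) by exact C_pot.
assert (Ic : RInt (fun s => cos (th s)) 0 l = 0) by exact (int_cos_th _ _ _ _ _ _ H).
assert (Dc := is_derive_cos_th _ _ _ _ _ _ H).
assert (Ds : forall s, is_derive (fun s : R => sin (th s)) s (cos (th s) * ka s)) by (intros s; ader).
assert (A1 : RInt (fun s => (- sin (th s) * ka s) * p' s - V s * cos (th s) * p s) 0 l = 0).
{ transitivity (- Lam * RInt p 0 l); [exact (int_by_parts_cos _ _ _ _ _ _ H p p' Dp Cp' Pl)|rewrite Ip; rring]. }
assert (thl : th l = th 0).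
{ unfold l; replace (4 * q) with (0 + 4 * q) by ring; apply (pd_th_period _ _ _ _ _ _ H). }
assert (A2 : RInt (fun s => (- sin (th s) * ka s) * (- sin (th s) * ka s) - V s * cos (th s) * cos (th s)) 0 l = 0).
{ transitivity (- Lam * RInt (fun s => cos (th s)) 0 l).
  - apply (int_by_parts_cos _ _ _ _ _ _ H (fun s : R => cos (th s)) _ Dc); [ct|].
    fold l; rewrite thl; reflexivity.
  - rewrite Ic; rring. }
assert (A3 := int_by_parts_sin w w' Dw Cw' Wl).
assert (A4 : RInt (fun s => (cos (th s) * ka s) * (cos (th s) * ka s) - V s * sin (th s) * sin (th s)) 0 l = 0).
{ apply (int_by_parts_sin (fun s : R => sin (th s)) _ Ds); [ct|]; rewrite thl; reflexivity. }
assert (IV : RInt V 0 l = RInt (fun s => ka s ^ 2) 0 l).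
{ unfold V, pot; rewrite int_plus, int_scal, Ic by ct; rring. }
unfold jform; rewrite <- IV.
rewrite (int_ext (fun s => p' s ^ 2 + w' s ^ 2 + z' s ^ 2) (fun s => V s
  + ((p' s - - sin (th s) * ka s) ^ 2 - V s * (p s - cos (th s)) ^ 2)
  + ((w' s - cos (th s) * ka s) ^ 2 - V s * (w s - sin (th s)) ^ 2)
  + (z' s ^ 2 - V s * z s ^ 2)
  + 2 * ((- sin (th s) * ka s) * p' s - V s * cos (th s) * p s)
  - ((- sin (th s) * ka s) * (- sin (th s) * ka s) - V s * cos (th s) * cos (th s))
  + 2 * ((cos (th s) * ka s) * w' s - V s * sin (th s) * w s)
  - ((cos (th s) * ka s) * (cos (th s) * ka s) - V s * sin (th s) * sin (th s)))).
- rewrite int_minus, int_plus, int_minus, !int_plus, !int_scal, A1, A2, A3, A4 by ct; rring.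
- intros s; specialize (U s).
  transitivity (V s * (p s ^ 2 + w s ^ 2 + z s ^ 2) - V s * (p s ^ 2 + w s ^ 2 + z s ^ 2)
    + p' s ^ 2 + w' s ^ 2 + z' s ^ 2); [as_real; ring|].
  rewrite U at 1; as_real; ring.
Qed.

Lemma jform_le (v v' : R -> R) (M N : R) : cts v -> cts v' ->
  (forall s, 0 <= s <= l -> Rabs (v s) <= M) -> (forall s, 0 <= s <= l -> Rabs (v' s) <= N) ->
  jform V v v' l <= l * (N ^ 2 + 5 * Lam * M ^ 2).
Proof.
intros Cv Cv' Bv Bv'; unfold jform; assert (CV : cts V) by exact C_pot.
rewrite Rmult_comm; replace l with (l - 0) at 2 by ring; rewrite <- int_const.
apply int_le; ct; [unfold l; lra|]; intros s Hs.
assert (B := pot_bound _ _ _ _ _ _ H s); fold V in B.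
assert (B1 := sqr_abs_le _ _ (Bv s Hs)); assert (B2 := sqr_abs_le _ _ (Bv' s Hs)).
assert (A : Rabs (- (V s * (v s * v s))) <= 5 * Lam * (M * M)).
{ rewrite Rabs_Ropp; repeat apply Rabs_mult_le; auto. }
apply Rabs_le_between in A; simpl; simpl in B2; lra.
Qed.

End Bending.

Section Perturbed.
Context (q Lam C : R) (th ka X : R -> R) (H : pendulum q Lam C th ka X).
Context (E1 E2 : vec) (O : orthonormal E1 E2).
Context (c0 : vec) (phi0 : R) (kf : R -> R).

Let q_pos := pd_q _ _ _ _ _ _ H.
Let Lam_pos := pd_Lam _ _ _ _ _ _ H.
Let D_th := pd_th _ _ _ _ _ _ H.
Let D_ka := pd_ka _ _ _ _ _ _ H.
Let C_th := pd_cts_th _ _ _ _ _ _ H.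
Let C_ka := pd_cts_ka _ _ _ _ _ _ H.
Let l := 4 * q.
Let yA := normal_field Lam th ka X.
Let yA' := normal_field' Lam th ka X.
Let D_yA := is_derive_normal_field _ _ _ _ _ _ H : forall s, is_derive yA s (yA' s).
Let C_yA := cts_normal_field _ _ _ _ _ _ H : cts yA.

Let C_yA' := cts_normal_field' _ _ _ _ _ _ H : cts yA'.

(* latitude [chi], longitude [Th] of the tangent *)
Definition chi (e s : R) : R := e * yA s.
Definition Th (e s : R) : R := kf e * th s.
Definition chi' (e s : R) : R := e * yA' s.
Definition Th' (e s : R) : R := kf e * ka s.
(** Relative to parallel transport the east and north directions turn about T at the rate Th' sin
    chi, and [twist] is the mean of this rate. Turning the material frame by the difference [phi']
    makes its twist rate constant, the cheapest choice for a given mean, and lets the frame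
    close. *)
Definition twist (e : R) : R := RInt (fun s => Th' e s * sin (chi e s)) 0 l / l.
Definition phi' (e s : R) : R := twist e - Th' e s * sin (chi e s).
Definition phi (e s : R) : R := phi0 + RInt (phi' e) 0 s.

Definition tx (e s : R) : R := cos (chi e s) * cos (Th e s).
Definition ty (e s : R) : R := cos (chi e s) * sin (Th e s).
Definition tz (e s : R) : R := sin (chi e s).
Definition tx' (e s : R) : R :=
  - (sin (chi e s) * chi' e s * cos (Th e s)) - cos (chi e s) * (sin (Th e s) * Th' e s).
Definition ty' (e s : R) : R :=
  - (sin (chi e s) * chi' e s * sin (Th e s)) + cos (chi e s) * (cos (Th e s) * Th' e s).
Definition tz' (e s : R) : R := cos (chi e s) * chi' e s.

(* east and north on the sphere of tangents *)
Definition fx (e ph s : R) : R := - (cos ph * sin (Th e s)) - sin ph * (sin (chi e s) * cos (Th e s)).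
Definition fy (e ph s : R) : R := cos ph * cos (Th e s) - sin ph * (sin (chi e s) * sin (Th e s)).
Definition fz (e ph s : R) : R := sin ph * cos (chi e s).
(** Derivative of the rotated frame vector along the rod: a turn inside the normal plane, expressed
    by the vector a quarter turn behind, and the component along T forced by orthogonality to T. *)
Definition fx' (e ph s : R) : R := - (phi' e s + Th' e s * sin (chi e s)) * fx e (ph - PI / 2) s
  - (cos ph * (Th' e s * cos (chi e s)) + sin ph * chi' e s) * tx e s.
Definition fy' (e ph s : R) : R := - (phi' e s + Th' e s * sin (chi e s)) * fy e (ph - PI / 2) s
  - (cos ph * (Th' e s * cos (chi e s)) + sin ph * chi' e s) * ty e s.
Definition fz' (e ph s : R) : R := - (phi' e s + Th' e s * sin (chi e s)) * fz e (ph - PI / 2) s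
  - (cos ph * (Th' e s * cos (chi e s)) + sin ph * chi' e s) * tz e s.

Definition perturbed (e : R) : rod := Rod
  (fun s => plus c0 (vec3 E1 E2 (RInt (tx e) 0 s) (RInt (ty e) 0 s) (RInt (tz e) 0 s)))
  (fun s => vec3 E1 E2 (fx e (phi e s) s) (fy e (phi e s) s) (fz e (phi e s) s))
  (fun s => vec3 E1 E2 (fx e (phi e s + PI / 2) s) (fy e (phi e s + PI / 2) s) (fz e (phi e s + PI / 2) s)).

Lemma trig1 (x : R) : sin x * sin x = 1 - cos x * cos x.
Proof. assert (E := sin2_cos2 x); unfold Rsqr in E; lra. Qed.

Lemma cos_p (x : R) : cos (x + PI / 2) = - sin x.
Proof. rewrite cos_plus, cos_PI2, sin_PI2; ring. Qed.
Lemma sin_p (x : R) : sin (x + PI / 2) = cos x.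
Proof. rewrite sin_plus, cos_PI2, sin_PI2; ring. Qed.
Lemma cos_m (x : R) : cos (x - PI / 2) = sin x.
Proof. rewrite cos_minus, cos_PI2, sin_PI2; ring. Qed.
Lemma sin_m (x : R) : sin (x - PI / 2) = - cos x.
Proof. rewrite sin_minus, cos_PI2, sin_PI2; ring. Qed.

Lemma D_chi (e s : R) : is_derive (chi e) s (chi' e s).
Proof. unfold chi, chi'; ader. Qed.
Lemma D_Th (e s : R) : is_derive (Th e) s (Th' e s).
Proof. unfold Th, Th'; ader. Qed.

Lemma smooth_chi (e : R) : smooth (chi e).
Proof.
destruct (pendulum_smooth _ _ _ _ _ _ H) as [S1 [S2 S3]].
unfold chi, yA, normal_field; sm.
Qed.
Lemma smooth_Th (e : R) : smooth (Th e).
Proof. destruct (pendulum_smooth _ _ _ _ _ _ H) as [S1 _]; unfold Th; sm. Qed.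
Lemma smooth_Th' (e : R) : smooth (Th' e).
Proof. destruct (pendulum_smooth _ _ _ _ _ _ H) as [_ [S1 _]]; unfold Th'; sm. Qed.
#[local] Hint Resolve smooth_chi smooth_Th smooth_Th' : sm.
Lemma smooth_phi' (e : R) : smooth (phi' e).
Proof. unfold phi'; sm. Qed.
#[local] Hint Resolve smooth_phi' : sm.
Lemma smooth_phi (e : R) : smooth (phi e).
Proof. unfold phi; sm. Qed.
#[local] Hint Resolve smooth_phi : sm.
Lemma smooth_t (e : R) : smooth (tx e) /\ smooth (ty e) /\ smooth (tz e).
Proof. unfold tx, ty, tz; repeat split; sm. Qed.

Lemma cts_chi (e : R) : cts (chi e). Proof. apply smooth_cts; sm. Qed.
Lemma cts_Th (e : R) : cts (Th e). Proof. apply smooth_cts; sm. Qed.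
Lemma cts_Th' (e : R) : cts (Th' e). Proof. apply smooth_cts; sm. Qed.
Lemma cts_chi' (e : R) : cts (chi' e). Proof. unfold chi'; ct. Qed.
Lemma cts_phi' (e : R) : cts (phi' e). Proof. apply smooth_cts; sm. Qed.
Lemma cts_tx (e : R) : cts (tx e). Proof. exact (smooth_cts _ (proj1 (smooth_t e))). Qed.
Lemma cts_ty (e : R) : cts (ty e). Proof. exact (smooth_cts _ (proj1 (proj2 (smooth_t e)))). Qed.
Lemma cts_tz (e : R) : cts (tz e). Proof. exact (smooth_cts _ (proj2 (proj2 (smooth_t e)))). Qed.
#[local] Hint Resolve cts_chi cts_Th cts_Th' cts_chi' cts_phi' cts_tx cts_ty cts_tz : ct.

Lemma D_phi (e s : R) : is_derive (phi e) s (phi' e s).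
Proof.
unfold phi; evar_last.
- apply @is_derive_plus; [apply @is_derive_const|apply is_derive_primitive; ct].
- unfold plus, zero; simpl; ring.
Qed.

Lemma D_t (e s : R) : is_derive (tx e) s (tx' e s) /\ is_derive (ty e) s (ty' e s) /\
  is_derive (tz e) s (tz' e s).
Proof.
assert (D1 := D_chi e); assert (D2 := D_Th e).
unfold tx, ty, tz, tx', ty', tz'; revert D1 D2.
generalize (chi e) (chi' e) (Th e) (Th' e); intros c c' t t' D1 D2.
split; [|split]; ader.
Qed.

(* Rotating the frame by [ph] about [T]; [c = 0] gives [M1] and [c = PI / 2] gives [M2]. *)
Lemma D_f (e c s : R) : is_derive (fun s => fx e (phi e s + c) s) s (fx' e (phi e s + c) s) /\
  is_derive (fun s => fy e (phi e s + c) s) s (fy' e (phi e s + c) s) /\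
  is_derive (fun s => fz e (phi e s + c) s) s (fz' e (phi e s + c) s).
Proof.
assert (D1 := D_chi e); assert (D2 := D_Th e); assert (D3 := D_phi e).
assert (T1 := trig1 (chi e s)).
unfold fx, fy, fz, fx', fy', fz', fx, fy, fz, tx, ty, tz; rewrite !cos_m, !sin_m.
revert D1 D2 D3 T1.
generalize (chi e) (chi' e) (Th e) (Th' e) (phi e) (phi' e); intros k k' t t' f f' D1 D2 D3 T1.
split; [|split]; ader; ring [T1].
Qed.

Lemma chi_half (e s : R) : chi e (s + 2 * q) = - chi e s.
Proof. unfold chi, yA; rewrite (normal_field_half _ _ _ _ _ _ H); ring. Qed.
Lemma Th_half (e s : R) : Th e (s + 2 * q) = - Th e s.
Proof. unfold Th; rewrite (pd_th_half _ _ _ _ _ _ H); ring. Qed.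
Lemma chi_l (e s : R) : chi e (s + l) = chi e s.
Proof. unfold l; replace (s + 4 * q) with (s + 2 * q + 2 * q) by ring; rewrite !chi_half; ring. Qed.
Lemma Th_l (e s : R) : Th e (s + l) = Th e s.
Proof. unfold l; replace (s + 4 * q) with (s + 2 * q + 2 * q) by ring; rewrite !Th_half; ring. Qed.

Section Closed.
Context (e : R) (Hk : RInt (tx e) 0 l = 0).

(** Latitude and longitude both change sign after half a period, so this component and the next
    close for every stretching factor. *)
Lemma int_ty : RInt (ty e) 0 l = 0.
Proof.
unfold l; replace (4 * q) with (2 * (2 * q)) by ring; apply int_antiperiodic; [ct|]; intros s.
unfold ty; rewrite chi_half, Th_half, cos_neg, sin_neg; ring.
Qed.

Lemma int_tz : RInt (tz e) 0 l = 0.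
Proof.
unfold l; replace (4 * q) with (2 * (2 * q)) by ring; apply int_antiperiodic; [ct|]; intros s.
unfold tz; rewrite chi_half, sin_neg; ring.
Qed.

Lemma t_l (s : R) : tx e (s + l) = tx e s /\ ty e (s + l) = ty e s /\ tz e (s + l) = tz e s.
Proof. unfold tx, ty, tz; rewrite chi_l, Th_l; repeat split. Qed.

Lemma perturbed_tangent (s : R) : tangent (perturbed e) s = vec3 E1 E2 (tx e s) (ty e s) (tz e s).
Proof.
unfold tangent, perturbed; simpl center; rewrite vDerive_shift.
apply (vDerive_vec3 E1 E2 (fun s => RInt (tx e) 0 s) (fun s => RInt (ty e) 0 s) (fun s => RInt (tz e) 0 s));
  intros u; apply is_derive_primitive; ct.
Qed.

Lemma perturbed_tangent' (s : R) :
  vDerive (tangent (perturbed e)) s = vec3 E1 E2 (tx' e s) (ty' e s) (tz' e s).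
Proof.
replace (tangent (perturbed e)) with (fun s => vec3 E1 E2 (tx e s) (ty e s) (tz e s))
  by (apply functional_extensionality; intros; rewrite perturbed_tangent; reflexivity).
apply vDerive_vec3; intros u; apply D_t.
Qed.

Lemma perturbed_mat1' (s : R) : vDerive (mat1 (perturbed e)) s =
  vec3 E1 E2 (fx' e (phi e s) s) (fy' e (phi e s) s) (fz' e (phi e s) s).
Proof.
assert (A := D_f e 0).
assert (E : forall s, phi e s + 0 = phi e s) by (intros; ring).
unfold perturbed; simpl mat1.
apply (vDerive_vec3 E1 E2 (fun s => fx e (phi e s) s) (fun s => fy e (phi e s) s) (fun s => fz e (phi e s) s)
  (fun s => fx' e (phi e s) s) (fun s => fy' e (phi e s) s) (fun s => fz' e (phi e s) s)); intros u;
  destruct (A u) as [A1 [A2 A3]]; rewrite E in A1, A2, A3;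
  [apply is_derive_ext with (2 := A1)|apply is_derive_ext with (2 := A2)|apply is_derive_ext with (2 := A3)];
  intros t; rewrite E; reflexivity.
Qed.

Lemma perturbed_mat2' (s : R) : vDerive (mat2 (perturbed e)) s =
  vec3 E1 E2 (fx' e (phi e s + PI / 2) s) (fy' e (phi e s + PI / 2) s) (fz' e (phi e s + PI / 2) s).
Proof.
unfold perturbed; simpl mat2.
apply (vDerive_vec3 E1 E2 (fun s => fx e (phi e s + PI / 2) s) (fun s => fy e (phi e s + PI / 2) s)
  (fun s => fz e (phi e s + PI / 2) s)
  (fun s => fx' e (phi e s + PI / 2) s) (fun s => fy' e (phi e s + PI / 2) s)
  (fun s => fz' e (phi e s + PI / 2) s)); intros u; apply D_f.
Qed.

Lemma perturbed_closed : closed_rod l (perturbed e).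
Proof.
destruct (smooth_t e) as [S1 [S2 S3]].
assert (T : forall s, sin (chi e s) * sin (chi e s) = 1 - cos (chi e s) * cos (chi e s)) by (intros; apply trig1).
assert (T' : forall s, sin (Th e s) * sin (Th e s) = 1 - cos (Th e s) * cos (Th e s)) by (intros; apply trig1).
assert (T2 : forall s, sin (phi e s) * sin (phi e s) = 1 - cos (phi e s) * cos (phi e s)) by (intros; apply trig1).
unfold closed_rod; split; [|split; [|split; [|split; [|split; [|split; [|split; [|split]]]]]]].
- assert (A := vsmooth_vec3 E1 E2 (fun s => RInt (tx e) 0 s) (fun s => RInt (ty e) 0 s) (fun s => RInt (tz e) 0 s)
    (smooth_primitive _ S1) (smooth_primitive _ S2) (smooth_primitive _ S3)).
  destruct A as [A1 [A2 A3]]; unfold perturbed; simpl center; repeat split.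
  + apply (smooth_plus _ _ (smooth_const (px c0)) A1).
  + apply (smooth_plus _ _ (smooth_const (py c0)) A2).
  + apply (smooth_plus _ _ (smooth_const (pz c0)) A3).
- unfold perturbed; simpl mat1; apply vsmooth_vec3; unfold fx, fy, fz; sm.
- unfold perturbed; simpl mat2; apply vsmooth_vec3; unfold fx, fy, fz; sm.
- intros s; unfold perturbed; simpl center; f_equal.
  assert (P : forall f, cts f -> (forall s, f (s + l) = f s) -> RInt f 0 l = 0 -> RInt f 0 (s + l) = RInt f 0 s).
  { intros f Cf Pf If; rewrite <- (int_chasles f 0 s (s + l)), (int_period f l s), If by assumption; rring. }
  rewrite (P (tx e) (cts_tx e) (fun u => proj1 (t_l u)) Hk),
    (P (ty e) (cts_ty e) (fun u => proj1 (proj2 (t_l u))) int_ty),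
    (P (tz e) (cts_tz e) (fun u => proj2 (proj2 (t_l u))) int_tz); reflexivity.
- intros s; rewrite perturbed_tangent, (dot_vec3 E1 E2 O); unfold tx, ty, tz; ring [(T s) (T' s)].
- intros s; unfold perturbed; simpl mat1; rewrite (dot_vec3 E1 E2 O); unfold fx, fy, fz.
  ring [(T s) (T' s) (T2 s)].
- intros s; unfold perturbed; simpl mat2; rewrite (dot_vec3 E1 E2 O); unfold fx, fy, fz.
  rewrite cos_p, sin_p; ring [(T s) (T' s) (T2 s)].
- intros s; unfold perturbed; simpl mat1; simpl mat2; rewrite (dot_vec3 E1 E2 O); unfold fx, fy, fz.
  rewrite cos_p, sin_p; ring [(T s) (T' s) (T2 s)].
- intros s; rewrite perturbed_tangent; unfold perturbed; simpl mat1; simpl mat2.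
  rewrite (cross_vec3 E1 E2 O); unfold fx, fy, fz, tx, ty, tz; rewrite cos_p, sin_p.
  f_equal; ring [(T s) (T' s) (T2 s)].
Qed.

Lemma twist_rate (s : R) : u3 (perturbed e) s = - twist e.
Proof.
unfold u3; rewrite perturbed_mat2'; unfold perturbed; simpl mat1; rewrite (dot_vec3 E1 E2 O).
assert (T := trig1 (chi e s)); assert (T' := trig1 (Th e s)); assert (T2 := trig1 (phi e s)).
unfold fx', fy', fz'; replace (phi e s + PI / 2 - PI / 2) with (phi e s) by ring.
replace (phi' e s + Th' e s * sin (chi e s)) with (twist e) by (unfold phi'; ring).
unfold fx, fy, fz, tx, ty, tz; rewrite cos_p, sin_p.
ring [T T' T2].
Qed.

Lemma perturbed_energy (alpha beta : R) : energy alpha beta l (perturbed e) =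
  alpha * RInt (fun s => tx' e s ^ 2 + ty' e s ^ 2 + tz' e s ^ 2) 0 l + beta * twist e ^ 2 * l.
Proof.
assert (C1 : cts (tx' e)) by (unfold tx'; ct); assert (C2 : cts (ty' e)) by (unfold ty'; ct).
assert (C3 : cts (tz' e)) by (unfold tz'; ct).
unfold energy.
rewrite (int_ext _ (fun s => alpha * (tx' e s ^ 2 + ty' e s ^ 2 + tz' e s ^ 2) + beta * twist e ^ 2)).
- rewrite int_plus, int_scal, int_const by ct; rring.
- intros s; rewrite (bending_strains l _ s perturbed_closed), perturbed_tangent', (dot_vec3 E1 E2 O), twist_rate.
  as_real; ring.
Qed.

Lemma int_phi' : RInt (phi' e) 0 l = 0.
Proof.
unfold phi'; rewrite int_minus, int_const by ct; unfold twist; as_real; field.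
unfold l; lra.
Qed.

Lemma perturbed_mat1_closed : mat1 (perturbed e) l = mat1 (perturbed e) 0.
Proof.
unfold perturbed; simpl mat1.
assert (P : phi e l = phi e 0) by (unfold phi; rewrite int_phi', RInt_point; reflexivity).
assert (C0 : chi e l = chi e 0) by (rewrite <- (chi_l e 0), Rplus_0_l; reflexivity).
assert (T0 : Th e l = Th e 0) by (rewrite <- (Th_l e 0), Rplus_0_l; reflexivity).
unfold fx, fy, fz; rewrite P, C0, T0; reflexivity.
Qed.

(* [yA' = ka h], so [T'] is [ka] times a field without zeros and the signed
   normal is smooth across the inflection points. *)
Lemma perturbed_delta_psi : 0 < kf e -> (forall s, 0 < cos (chi e s)) ->
  exists (d : R) (m : Z), has_delta_psi l (perturbed e) d /\ d = IZR m * PI.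
Proof.
intros Hkf Hchi; destruct (pendulum_smooth _ _ _ _ _ _ H) as [S1 [S2 S3]].
pose (h := fun s => X s * cos (th s) - ka s * sin (th s) / Lam).
assert (Sh : smooth h) by (unfold h; sm).
assert (Eh : forall s, chi' e s = ka s * (e * h s)) by (intros s; unfold chi', yA', normal_field', h; ring).
(* [m] is |T'|^2 / ka^2 continued through the zeros of [ka], and it is positive there too. So ka
   sqrt m is a smooth signed curvature; it appears below as ka m nu. *)
pose (m := fun s => (kf e * cos (chi e s)) * (kf e * cos (chi e s)) + (e * h s) * (e * h s)).
assert (Hm : forall s, 0 < m s).
{ intros s; specialize (Hchi s); unfold m; assert (0 < kf e * cos (chi e s)) by (apply Rmult_lt_0_compat; assumption).
  nra. }
assert (Sm : smooth m) by (unfold m; sm).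
pose (nu := fun s => / sqrt (m s)).
assert (Sn : smooth nu) by (apply smooth_inv_sqrt; assumption).
assert (Enu : forall s, nu s * nu s * m s = 1).
{ intros s; unfold nu; specialize (Hm s); assert (P := sqrt_lt_R0 _ Hm).
  assert (Q : sqrt (m s) * sqrt (m s) = m s) by (apply sqrt_sqrt; lra).
  rewrite <- Q at 3; field; lra. }
pose (a := fun s => nu s * (kf e * cos (chi e s))); pose (b := fun s => nu s * (e * h s)).
assert (Eab : forall s, a s * a s + b s * b s = 1).
{ intros s; rewrite <- (Enu s); unfold a, b, m; ring. }
pose (nx := fun s => - (a s * sin (Th e s)) - b s * (sin (chi e s) * cos (Th e s))).
pose (ny := fun s => a s * cos (Th e s) - b s * (sin (chi e s) * sin (Th e s))).
pose (nz := fun s => b s * cos (chi e s)).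
assert (T : forall s, sin (chi e s) * sin (chi e s) = 1 - cos (chi e s) * cos (chi e s)) by (intros; apply trig1).
assert (T' : forall s, sin (Th e s) * sin (Th e s) = 1 - cos (Th e s) * cos (Th e s)) by (intros; apply trig1).
apply (has_delta_psi_of_normal l (perturbed e) (fun s => vec3 E1 E2 (nx s) (ny s) (nz s)) (fun s => ka s * (m s * nu s))).
- apply perturbed_closed.
- apply vsmooth_vec3; unfold nx, ny, nz, a, b; sm.
- sm.
- intros s; rewrite (dot_vec3 E1 E2 O); rewrite <- (Eab s); unfold nx, ny, nz; ring [(T s) (T' s)].
- intros s; rewrite perturbed_tangent, (dot_vec3 E1 E2 O); unfold nx, ny, nz, tx, ty, tz; ring [(T' s)].
- intros s; rewrite perturbed_tangent', scal_vec3.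
  assert (K : ka s * (m s * nu s) * nu s = ka s).
  { transitivity (ka s * (nu s * nu s * m s)); [ring|rewrite Enu; ring]. }
  unfold tx', ty', tz', nx, ny, nz, a, b; rewrite Eh; unfold Th'.
  f_equal; [transitivity ((ka s * (m s * nu s) * nu s) * (- (kf e * cos (chi e s) * sin (Th e s))
        - e * h s * (sin (chi e s) * cos (Th e s))))
    |transitivity ((ka s * (m s * nu s) * nu s) * (kf e * cos (chi e s) * cos (Th e s)
        - e * h s * (sin (chi e s) * sin (Th e s))))
    |transitivity ((ka s * (m s * nu s) * nu s) * (e * h s * cos (chi e s)))];
    try (rewrite K; ring); ring.
- assert (C0 : chi e l = chi e 0) by (rewrite <- (chi_l e 0), Rplus_0_l; reflexivity).
  assert (T0 : Th e l = Th e 0) by (rewrite <- (Th_l e 0), Rplus_0_l; reflexivity).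
  assert (H0 : h l = h 0).
  { unfold h, l; replace (4 * q) with (0 + 4 * q) by ring.
    rewrite (pd_X_period _ _ _ _ _ _ H), (pd_th_period _ _ _ _ _ _ H), (pd_ka_period _ _ _ _ _ _ H); reflexivity. }
  unfold nx, ny, nz, a, b, nu, m; rewrite C0, T0, H0; reflexivity.
- apply perturbed_mat1_closed.
Qed.

End Closed.

Section Asymptotics.
Context (Hkf : bigO l 2 (fun e _ => kf e - 1)).
Let l_pos : 0 < l. Proof. unfold l; lra. Qed.

Lemma near_congr (F : R -> R -> R) (G G' : R -> R) : (forall s, G s = G' s) -> near l F G -> near l F G'.
Proof. intros E; replace G' with G by (apply functional_extensionality, E); trivial. Qed.

Lemma bigO_chi : bigO l 1 chi.
Proof. apply (bigO_mult l 1 0 (fun e _ => e) (fun _ s => yA s)); [apply bigO_eps|apply bigO_cts; ct]. Qed.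
Lemma bigO_chi' : bigO l 1 chi'.
Proof. apply (bigO_mult l 1 0 (fun e _ => e) (fun _ s => yA' s)); [apply bigO_eps|apply bigO_cts; ct]. Qed.
Lemma bigO_Th : bigO l 2 (fun e s => Th e s - th s).
Proof.
apply (bigO_ext l _ (fun e s => (kf e - 1) * th s)); [intros; unfold Th; ring|].
apply (bigO_mult l 2 0 (fun e _ => kf e - 1) (fun _ s => th s)); [assumption|apply bigO_cts; ct].
Qed.
Lemma bigO_Th' : bigO l 2 (fun e s => Th' e s - ka s).
Proof.
apply (bigO_ext l _ (fun e s => (kf e - 1) * ka s)); [intros; unfold Th'; ring|].
apply (bigO_mult l 2 0 (fun e _ => kf e - 1) (fun _ s => ka s)); [assumption|apply bigO_cts; ct].
Qed.
Lemma near_chi : near l chi (fun _ => 0). Proof. apply near_zero; [assumption|apply bigO_chi]. Qed.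
Lemma near_chi' : near l chi' (fun _ => 0). Proof. apply near_zero; [assumption|apply bigO_chi']. Qed.
Lemma near_Th : near l Th th.
Proof. split; [apply (bigO_weaken l 1 2); [lia|apply bigO_Th]|apply bigO_cts; ct]. Qed.
Lemma near_Th' : near l Th' ka.
Proof. split; [apply (bigO_weaken l 1 2); [lia|apply bigO_Th']|apply bigO_cts; ct]. Qed.

(** To first order the mean of Th' sin chi is e times the mean of ka yA, which is 1; the stretching
    and the sine contribute only at second order. *)
Lemma twist_asymptotic : bigO l 2 (fun e _ => twist e - e).
Proof.
assert (Iy : RInt (fun s => ka s * yA s) 0 l = l) by exact (int_ka_normal_field _ _ _ _ _ _ H).
apply (bigO_ext l _ (fun e _ => RInt (fun s => Th' e s * sin (chi e s) - ka s * chi e s) 0 l * / l)).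
{ intros e _; rewrite int_minus by ct.
  replace (RInt (fun s => ka s * chi e s) 0 l) with (e * l).
  - unfold twist; field; lra.
  - rewrite <- Iy at 1; rewrite <- int_scal by ct; apply int_ext; intros; unfold chi; rring. }
apply (bigO_mult l 2 0 (fun e _ => RInt (fun s => Th' e s * sin (chi e s) - ka s * chi e s) 0 l) (fun _ _ => / l));
  [|apply bigO_cts; ct].
apply (bigO_at_end l l_pos 2 (fun e s => RInt (fun s => Th' e s * sin (chi e s) - ka s * chi e s) 0 s)).
apply (bigO_int l l_pos 2 (fun e s => Th' e s * sin (chi e s) - ka s * chi e s)); [intros; ct|].
apply (bigO_ext l _ (fun e s => (Th' e s - ka s) * sin (chi e s) - ka s * (chi e s - sin (chi e s))));
  [intros; ring|].
apply bigO_minus.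
- apply (bigO_mult l 2 0 (fun e s => Th' e s - ka s)); [apply bigO_Th'|apply bigO_sin_bounded].
- apply (bigO_mult l 0 2 (fun _ s => ka s)); [apply bigO_cts; ct|].
  apply (bigO_sub_sin l 1), bigO_chi.
Qed.

Lemma near_twist : near l (fun e _ => twist e) (fun _ => 0).
Proof.
apply near_zero; [assumption|].
apply (bigO_ext l _ (fun e _ => (twist e - e) + e)); [intros; ring|].
apply bigO_plus; [apply (bigO_weaken l 1 2); [lia|apply twist_asymptotic]|apply bigO_eps].
Qed.

Ltac near_tac := repeat first
  [ exact near_chi | exact near_chi' | exact near_Th | exact near_Th' | exact near_twist | eassumption
  | apply near_minus | apply near_opp | apply near_plus | apply near_mult | apply near_sin | apply near_cos ].

Lemma near_phi' : near l phi' (fun _ => 0).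
Proof.
unfold phi'; eapply near_congr; [|near_tac]; intros s; simpl; rewrite sin_0; ring.
Qed.

Lemma near_phi : near l phi (fun _ => phi0).
Proof.
apply (near_congr _ (fun s => phi0 + RInt (fun _ => 0) 0 s)).
{ intros s; rewrite int_const; ring. }
unfold phi; apply near_plus; [apply near_refl; ct|].
apply (near_int l l_pos phi'); [intros; ct|ct|exact near_phi'].
Qed.

Lemma near_t : near l tx (fun s => cos (th s)) /\ near l ty (fun s => sin (th s)) /\ near l tz (fun _ => 0) /\
  near l tx' (fun s => - sin (th s) * ka s) /\ near l ty' (fun s => cos (th s) * ka s) /\ near l tz' (fun _ => 0).
Proof.
unfold tx, ty, tz, tx', ty', tz'.
refine (conj _ (conj _ (conj _ (conj _ (conj _ _))))); (eapply near_congr; [|near_tac]); intros s; simpl; rewrite ?cos_0, ?sin_0; ring.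
Qed.

Lemma near_f (ph : R -> R -> R) (ph0 : R) : near l ph (fun _ => ph0) ->
  near l (fun e s => fx e (ph e s) s) (fun s => - (cos ph0 * sin (th s))) /\
  near l (fun e s => fy e (ph e s) s) (fun s => cos ph0 * cos (th s)) /\
  near l (fun e s => fz e (ph e s) s) (fun s => sin ph0) /\
  near l (fun e s => fx' e (ph e s) s) (fun s => - (cos ph0 * ka s) * cos (th s)) /\
  near l (fun e s => fy' e (ph e s) s) (fun s => - (cos ph0 * ka s) * sin (th s)) /\
  near l (fun e s => fz' e (ph e s) s) (fun s => 0).
Proof.
intros Hph; assert (Hp := near_phi').
assert (Hph2 : near l (fun e s => ph e s - PI / 2) (fun _ => ph0 - PI / 2)).
{ apply near_minus; [assumption|apply near_refl; ct]. }
unfold fx', fy', fz', fx, fy, fz, tx, ty, tz.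
refine (conj _ (conj _ (conj _ (conj _ (conj _ _))))); (eapply near_congr; [|near_tac]); intros s; simpl; rewrite ?cos_0, ?sin_0; ring.
Qed.

(** To first order the tangent is displaced normally to the plane. So the two in-plane differences
    are O(e^2) and contribute O(e^4) through the exact expansion, while the normal part contributes
    e^2 times the value - 2 l of the form on [normal_field], up to O(e^3). *)
Lemma bending_asymptotic : exists D e1 : R, 0 <= D /\ 0 < e1 <= 1 /\
  forall e, 0 < e <= e1 -> RInt (tx e) 0 l = 0 ->
  RInt (fun s => tx' e s ^ 2 + ty' e s ^ 2 + tz' e s ^ 2) 0 l
    <= RInt (fun s => ka s ^ 2) 0 l - 2 * l * e ^ 2 + D * e ^ 3.
Proof.
assert (Bc := bigO_chi); assert (Bc' := bigO_chi'); assert (BT := bigO_Th); assert (BT' := bigO_Th').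
assert (BTb := near_bounded l Th' ka near_Th').
assert (B1c := bigO_one_minus_cos l 1 chi Bc).
assert (Bs := bigO_sin l 1 chi Bc).
assert (Bss := bigO_mult l 1 1 _ _ Bs Bc').
assert (V1 : bigO l 2 (fun e s => tx e s - cos (th s))).
{ apply (bigO_ext l _ (fun e s => - ((1 - cos (chi e s)) * cos (Th e s)) + (cos (Th e s) - cos (th s))));
    [intros; unfold tx; ring|].
  apply bigO_plus; [apply bigO_opp, (bigO_mult l 2 0); [assumption|apply bigO_cos_bounded]|].
  apply (bigO_cos_diff l 2 Th (fun _ => th)); assumption. }
assert (V2 : bigO l 2 (fun e s => ty e s - sin (th s))).
{ apply (bigO_ext l _ (fun e s => - ((1 - cos (chi e s)) * sin (Th e s)) + (sin (Th e s) - sin (th s))));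
    [intros; unfold ty; ring|].
  apply bigO_plus; [apply bigO_opp, (bigO_mult l 2 0); [assumption|apply bigO_sin_bounded]|].
  apply (bigO_sin_diff l 2 Th (fun _ => th)); assumption. }
assert (V1' : bigO l 2 (fun e s => tx' e s - - sin (th s) * ka s)).
{ apply (bigO_ext l _ (fun e s => - (sin (chi e s) * chi' e s * cos (Th e s))
    + (1 - cos (chi e s)) * (sin (Th e s) * Th' e s)
    - ((sin (Th e s) - sin (th s)) * Th' e s + sin (th s) * (Th' e s - ka s)))); [intros; unfold tx'; ring|].
  apply bigO_minus; apply bigO_plus.
  - apply bigO_opp, (bigO_mult l 2 0); [assumption|apply bigO_cos_bounded].
  - apply (bigO_mult l 2 0); [assumption|]; apply (bigO_mult l 0 0); [apply bigO_sin_bounded|assumption].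
  - apply (bigO_mult l 2 0); [|assumption]; apply (bigO_sin_diff l 2 Th (fun _ => th)); assumption.
  - apply (bigO_mult l 0 2); [|assumption]; apply (bigO_sin_bounded l (fun _ => th)). }
assert (V2' : bigO l 2 (fun e s => ty' e s - cos (th s) * ka s)).
{ apply (bigO_ext l _ (fun e s => - (sin (chi e s) * chi' e s * sin (Th e s))
    - (1 - cos (chi e s)) * (cos (Th e s) * Th' e s)
    + ((cos (Th e s) - cos (th s)) * Th' e s + cos (th s) * (Th' e s - ka s)))); [intros; unfold ty'; ring|].
  apply bigO_plus; [apply bigO_minus|apply bigO_plus].
  - apply bigO_opp, (bigO_mult l 2 0); [assumption|apply bigO_sin_bounded].
  - apply (bigO_mult l 2 0); [assumption|]; apply (bigO_mult l 0 0); [apply bigO_cos_bounded|assumption].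
  - apply (bigO_mult l 2 0); [|assumption]; apply (bigO_cos_diff l 2 Th (fun _ => th)); assumption.
  - apply (bigO_mult l 0 2); [|assumption]; apply (bigO_cos_bounded l (fun _ => th)). }
pose (V := pot Lam th ka); assert (CV : cts V) by exact (cts_pot _ _ _ _ _ _ H).
(* The cost V (chi^2 - sin^2 chi) of replacing sin chi by chi in the potential term. In the
   derivative term |cos chi| <= 1 already gives an inequality in the right direction. *)
assert (V3 : bigO l 3 (fun e s => V s * ((chi e s - sin (chi e s)) * (chi e s + sin (chi e s))))).
{ apply (bigO_mult l 0 3 (fun _ s => V s)); [apply bigO_cts; assumption|].
  apply (bigO_mult l 2 1); [apply (bigO_sub_sin l 1); assumption|apply bigO_plus; assumption]. }
destruct V1 as [D1 [e1 [HD1 [He1 V1]]]]; destruct V2 as [D2 [e2 [HD2 [He2 V2]]]].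
destruct V1' as [D3 [e3 [HD3 [He3 V1']]]]; destruct V2' as [D4 [e4 [HD4 [He4 V2']]]].
destruct V3 as [D5 [e5 [HD5 [He5 V3]]]].
set (m := Rmin (Rmin e1 e2) (Rmin (Rmin e3 e4) e5)).
assert (Hm : 0 < m <= 1 /\ m <= e1 /\ m <= e2 /\ m <= e3 /\ m <= e4 /\ m <= e5).
{ assert (A1 := Rmin_l e1 e2); assert (A2 := Rmin_r e1 e2).
  assert (A3 := Rmin_l e3 e4); assert (A4 := Rmin_r e3 e4).
  assert (A5 := Rmin_l (Rmin e3 e4) e5); assert (A6 := Rmin_r (Rmin e3 e4) e5).
  assert (A7 := Rmin_l (Rmin e1 e2) (Rmin (Rmin e3 e4) e5)).
  assert (A8 := Rmin_r (Rmin e1 e2) (Rmin (Rmin e3 e4) e5)).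
  fold m in A7, A8; repeat split; try lra; unfold m; repeat apply Rmin_glb_lt; lra. }
set (Q := l * (D3 ^ 2 + 5 * Lam * D1 ^ 2) + l * (D4 ^ 2 + 5 * Lam * D2 ^ 2)).
assert (HQ : 0 <= Q).
{ assert (P1 := pow2_ge_0 D1); assert (P2 := pow2_ge_0 D2).
  assert (P3 := pow2_ge_0 D3); assert (P4 := pow2_ge_0 D4).
  unfold Q; apply Rplus_le_le_0_compat; apply Rmult_le_pos; nra. }
exists (Q + D5 * l), m; split; [assert (0 <= D5 * l) by mpos; lra|split; [apply Hm|]].
intros e He Hk.
destruct (smooth_t e) as [S1 [S2 S3]].
assert (C1 : cts (tx' e)) by (unfold tx'; ct); assert (C2 : cts (ty' e)) by (unfold ty'; ct).
assert (C3 : cts (tz' e)) by (unfold tz'; ct).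
assert (t0 := t_l e 0); rewrite Rplus_0_l in t0; destruct t0 as [t1 [t2 t3]].
assert (BE := bending_expand _ _ _ _ _ _ H (tx e) (tx' e) (ty e) (ty' e) (tz e) (tz' e)
  (fun s => proj1 (D_t e s)) (fun s => proj1 (proj2 (D_t e s))) (fun s => proj2 (proj2 (D_t e s)))
  C1 C2 C3 t1 t2 Hk).
fold l V in BE; rewrite BE.
2: { intros s; unfold tx, ty, tz; assert (T := trig1 (chi e s)); assert (T' := trig1 (Th e s)); ring [T T']. }
assert (J1 := jform_le _ _ _ _ _ _ H (fun s => tx e s - cos (th s)) (fun s => tx' e s - - sin (th s) * ka s)
  (D1 * e ^ 2) (D3 * e ^ 2) ltac:(ct) ltac:(ct) (fun s Hs => V1 e s ltac:(lra) Hs) (fun s Hs => V1' e s ltac:(lra) Hs)).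
assert (J2 := jform_le _ _ _ _ _ _ H (fun s => ty e s - sin (th s)) (fun s => ty' e s - cos (th s) * ka s)
  (D2 * e ^ 2) (D4 * e ^ 2) ltac:(ct) ltac:(ct) (fun s Hs => V2 e s ltac:(lra) Hs) (fun s Hs => V2' e s ltac:(lra) Hs)).
fold l V in J1, J2.
assert (J3 : jform V (tz e) (tz' e) l <= - 2 * l * e ^ 2 + D5 * e ^ 3 * l).
{ assert (Iy : RInt (fun s => yA' s * yA' s - V s * yA s * yA s) 0 l = - 2 * l).
  { transitivity (- 2 * RInt (fun s => ka s * yA s) 0 l).
    - apply (int_by_parts_normal_field _ _ _ _ _ _ H yA yA'); [exact D_yA|ct|].
      apply (half_period q), (normal_field_half _ _ _ _ _ _ H).
    - assert (E : RInt (fun s => ka s * yA s) 0 l = l) by exact (int_ka_normal_field _ _ _ _ _ _ H); rewrite E; rring. }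
  replace (- 2 * l * e ^ 2) with (e ^ 2 * (- 2 * l)) by ring.
  replace (D5 * e ^ 3 * l) with (RInt (fun _ => D5 * e ^ 3) 0 l) by (rewrite int_const; rring).
  rewrite <- Iy, <- int_scal, <- int_plus by ct; unfold jform; apply int_le; ct; [lra|]; intros s Hs.
  assert (A := V3 e s ltac:(lra) Hs); apply Rabs_le_between in A.
  assert (B : tz' e s ^ 2 <= chi' e s ^ 2).
  { unfold tz'; rewrite Rpow_mult_distr; assert (T := trig1 (chi e s)); assert (P := Rle_0_sqr (sin (chi e s))).
    assert (P' := pow2_ge_0 (chi' e s)); unfold Rsqr in P.
    assert (cos (chi e s) ^ 2 <= 1) by (simpl; lra); nra. }
  replace (e ^ 2 * (yA' s * yA' s - V s * yA s * yA s)) with (chi' e s ^ 2 - V s * chi e s ^ 2)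
    by (unfold chi', chi; ring).
  unfold tz in *; lra. }
assert (He4' : e ^ 4 <= e ^ 3).
{ replace (e ^ 4) with (e ^ 3 * e) by ring; assert (0 < e ^ 3) by (apply pow_lt; lra); nra. }
assert (Q * e ^ 4 <= Q * e ^ 3) by (apply Rmult_le_compat_l; assumption).
assert (EQ : l * ((D3 * e ^ 2) ^ 2 + 5 * Lam * (D1 * e ^ 2) ^ 2) + l * ((D4 * e ^ 2) ^ 2 + 5 * Lam * (D2 * e ^ 2) ^ 2)
  = Q * e ^ 4) by (unfold Q; ring).
lra.
Qed.

(** The constant twist rate costs beta l twist^2 = beta l e^2 + O(e^3), against the gain 2 alpha l
    e^2 from bending. *)
Lemma energy_asymptotic (alpha beta : R) : 0 <= alpha -> 0 <= beta -> exists D e1 : R, 0 <= D /\ 0 < e1 <= 1 /\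
  forall e, 0 < e <= e1 -> RInt (tx e) 0 l = 0 ->
  energy alpha beta l (perturbed e)
    <= alpha * RInt (fun s => ka s ^ 2) 0 l - (2 * alpha - beta) * l * e ^ 2 + D * e ^ 3.
Proof.
intros Ha Hb; destruct bending_asymptotic as [D [e1 [HD [He1 BA]]]].
destruct twist_asymptotic as [D' [e2 [HD' [He2 TA]]]].
set (G := 2 * D' + D' ^ 2).
assert (HG : 0 <= G) by (unfold G; assert (P := pow2_ge_0 D'); lra).
exists (alpha * D + beta * G * l), (Rmin e1 e2).
assert (M1 := Rmin_l e1 e2); assert (M2 := Rmin_r e1 e2).
split; [apply Rplus_le_le_0_compat; mpos|split; [split; [apply Rmin_glb_lt; lra|lra]|]].
intros e He Hk; rewrite (perturbed_energy e Hk).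
assert (A := BA e ltac:(lra) Hk); assert (T := TA e 0 ltac:(lra) ltac:(lra)).
assert (He3 : 0 < e ^ 3) by (apply pow_lt; lra).
assert (Tq : twist e ^ 2 <= e ^ 2 + G * e ^ 3).
{ replace (twist e ^ 2) with (e ^ 2 + 2 * (e * (twist e - e)) + (twist e - e) ^ 2) by ring.
  assert (T2 := sqr_abs_le _ _ T).
  assert (T1 : Rabs (e * (twist e - e)) <= e * (D' * e ^ 2)).
  { apply Rabs_mult_le; [rewrite Rabs_pos_eq; lra|assumption]. }
  apply Rabs_le_between in T1.
  assert ((D' * e ^ 2) ^ 2 <= D' ^ 2 * e ^ 3).
  { replace ((D' * e ^ 2) ^ 2) with (D' ^ 2 * e ^ 3 * e) by ring.
    assert (0 <= D' ^ 2 * e ^ 3) by (apply Rmult_le_pos; [apply pow2_ge_0|lra]); nra. }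
  unfold G; lra. }
apply (Rmult_le_compat_l alpha) in A; [|assumption].
assert (Tb : beta * l * twist e ^ 2 <= beta * l * (e ^ 2 + G * e ^ 3))
  by (apply Rmult_le_compat_l; [mpos|assumption]).
lra.
Qed.

End Asymptotics.
End Perturbed.

Lemma near_vec3 (E1 E2 : vec) (O : orthonormal E1 E2) (l eta : R) (F1 F2 F3 : R -> R -> R) (G1 G2 G3 : R -> R) :
  0 < eta -> near l F1 G1 -> near l F2 G2 -> near l F3 G3 ->
  exists e0, 0 < e0 /\ forall e s, 0 < e <= e0 -> 0 <= s <= l ->
    norm (minus (vec3 E1 E2 (F1 e s) (F2 e s) (F3 e s)) (vec3 E1 E2 (G1 s) (G2 s) (G3 s))) < eta.
Proof.
intros He N1 N2 N3.
destruct (near_small l F1 G1 (eta / 3) ltac:(lra) N1) as [e1 [H1 A1]].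
destruct (near_small l F2 G2 (eta / 3) ltac:(lra) N2) as [e2 [H2 A2]].
destruct (near_small l F3 G3 (eta / 3) ltac:(lra) N3) as [e3 [H3 A3]].
exists (Rmin e1 (Rmin e2 e3)).
assert (M1 := Rmin_l e1 (Rmin e2 e3)); assert (M2 := Rmin_r e1 (Rmin e2 e3)).
assert (M3 := Rmin_l e2 e3); assert (M4 := Rmin_r e2 e3).
split; [repeat apply Rmin_glb_lt; assumption|]; intros e s H4 H5.
replace eta with (3 * (eta / 3)) by field.
apply vec3_close; [assumption|apply A1|apply A2|apply A3]; lra.
Qed.

(** * Instability below the threshold *)

Section Unstable.
Context (q Lam C : R) (th ka X : R -> R) (H : pendulum q Lam C th ka X).
Context (E1 E2 : vec) (O : orthonormal E1 E2).
Context (r : rod) (Hr : closed_rod (4 * q) r) (HT : forall s, tangent r s = fig_T th E1 E2 s).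
Context (Hu : forall s, 0 <= s <= 4 * q -> u3 r s = 0).

Let q_pos := pd_q _ _ _ _ _ _ H.
Let D_th := pd_th _ _ _ _ _ _ H.
Let C_th := pd_cts_th _ _ _ _ _ _ H.
Let C_ka := pd_cts_ka _ _ _ _ _ _ H.
Let l := 4 * q.

Lemma fig_T_vec3 (s : R) : fig_T th E1 E2 s = vec3 E1 E2 (cos (th s)) (sin (th s)) 0.
Proof. unfold fig_T, vec3; veq. Qed.

Lemma fig_N_vec3 (s : R) : fig_N th E1 E2 s = vec3 E1 E2 (- sin (th s)) (cos (th s)) 0.
Proof. unfold fig_N, vec3; veq. Qed.

Lemma fig_center (s : R) : center r s =
  plus (center r 0) (vec3 E1 E2 (RInt (fun t => cos (th t)) 0 s) (RInt (fun t => sin (th t)) 0 s) (RInt (fun _ => 0) 0 s)).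
Proof.
assert (D : forall w, RInt (fun t => dot (tangent r t) w) 0 s = dot (center r s) w - dot (center r 0) w).
{ intros w; apply (int_deriv (fun t => dot (center r t) w)).
  - intros t; apply is_derive_dot_const, Hr.
  - destruct (closed_rod_vsmooth _ r Hr) as [ST _]; ct. }
destruct (dot_vec3_E E1 E2 O (RInt (fun t => cos (th t)) 0 s) (RInt (fun t => sin (th t)) 0 s) (RInt (fun _ => 0) 0 s))
  as [A1 [A2 A3]].
assert (B : forall t, dot (tangent r t) E1 = cos (th t) /\ dot (tangent r t) E2 = sin (th t)
  /\ dot (tangent r t) (cross E1 E2) = 0).
{ intros t; rewrite HT, fig_T_vec3; apply dot_vec3_E, O. }
apply (vec_ext_frame E1 E2 _ _ O); rewrite dot_plus_l, ?A1, ?A2, ?A3.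
- rewrite (int_ext (fun t => cos (th t)) (fun t => dot (tangent r t) E1)) by (intros; symmetry; apply B).
  rewrite D; ring.
- rewrite (int_ext (fun t => sin (th t)) (fun t => dot (tangent r t) E2)) by (intros; symmetry; apply B).
  rewrite D; ring.
- rewrite (int_ext (fun t => 0) (fun t => dot (tangent r t) (cross E1 E2))) by (intros; symmetry; apply B).
  rewrite D; ring.
Qed.

Lemma fig_material_frame : exists phi0 : R, forall s, 0 <= s <= l ->
  mat1 r s = vec3 E1 E2 (- (cos phi0 * sin (th s))) (cos phi0 * cos (th s)) (sin phi0) /\
  mat2 r s = vec3 E1 E2 (- (cos (phi0 + PI / 2) * sin (th s))) (cos (phi0 + PI / 2) * cos (th s)) (sin (phi0 + PI / 2)) /\
  vDerive (mat1 r) s = vec3 E1 E2 (- (cos phi0 * ka s) * cos (th s)) (- (cos phi0 * ka s) * sin (th s)) 0 /\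
  vDerive (mat2 r) s = vec3 E1 E2 (- (cos (phi0 + PI / 2) * ka s) * cos (th s)) (- (cos (phi0 + PI / 2) * ka s) * sin (th s)) 0.
Proof.
set (c := dot (mat1 r 0) (fig_N th E1 E2 0)); set (d := dot (mat1 r 0) (cross E1 E2)).
assert (OF : forall s, orthonormal (fig_T th E1 E2 s) (fig_N th E1 E2 s)).
{ intros s; repeat split; [apply fig_T_unit, O|apply fig_N_unit, O|apply fig_dot_TN, O]. }
assert (XF : forall s, cross (fig_T th E1 E2 s) (fig_N th E1 E2 s) = cross E1 E2).
{ intros s; rewrite fig_T_vec3, fig_N_vec3, (cross_vec3 E1 E2 O).
  transitivity (vec3 E1 E2 0 0 1); [|unfold vec3; veq].
  f_equal; try ring; ring [(trig1 (th s))]. }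
assert (MT : forall s, dot (mat1 r s) (fig_T th E1 E2 s) = 0).
{ intros s; rewrite <- HT, dot_sym; apply (closed_rod_frame _ r s Hr). }
assert (U : c ^ 2 + d ^ 2 = 1).
{ assert (P := parseval _ _ (mat1 r 0) (mat1 r 0) (OF 0)); rewrite MT, XF in P; fold c d in P.
  assert (P2 : dot (mat1 r 0) (mat1 r 0) = 1) by apply Hr; lra. }
destruct (smooth_angle (fun _ => c) (fun _ => d) (smooth_const c) (smooth_const d) (fun _ => U)) as [psi [_ Hpsi]].
destruct (Hpsi 0) as [Ec Ed]; set (phi0 := psi 0) in *; exists phi0; intros s Hs.
destruct (fig_mat1_parallel _ _ _ _ _ _ H E1 E2 O r Hr HT Hu s Hs) as [P1 P2]; fold c in P1; fold d in P2.
assert (M1 : mat1 r s = vec3 E1 E2 (- (cos phi0 * sin (th s))) (cos phi0 * cos (th s)) (sin phi0)).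
{ apply (vec_ext_frame _ _ _ _ (OF s)).
  - rewrite MT, fig_T_vec3, (dot_vec3 E1 E2 O); ring.
  - rewrite P1, fig_N_vec3, (dot_vec3 E1 E2 O), Ec; ring [(trig1 (th s))].
  - rewrite XF, P2, Ed; symmetry; apply (dot_vec3_E E1 E2 O). }
assert (M2 : mat2 r s = vec3 E1 E2 (- (cos (phi0 + PI / 2) * sin (th s))) (cos (phi0 + PI / 2) * cos (th s)) (sin (phi0 + PI / 2))).
{ rewrite (mat2_cross _ r s Hr), HT, M1, fig_T_vec3, (cross_vec3 E1 E2 O), cos_p, sin_p.
  f_equal; ring [(trig1 (th s))]. }
destruct (strain_equations _ r s Hr) as [_ [S1 S2]]; rewrite (Hu s Hs) in S1, S2.
assert (T' := fig_vDerive _ _ _ _ _ _ H E1 E2 r HT s).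
assert (V1 : u1 r s = - (cos (phi0 + PI / 2) * ka s) * -1).
{ unfold u1; rewrite T', M2, fig_N_vec3, dot_scal_l, (dot_vec3 E1 E2 O); ring [(trig1 (th s))]. }
assert (V2 : u2 r s = - (cos phi0 * ka s)).
{ unfold u2; rewrite T', M1, fig_N_vec3, dot_scal_l, (dot_vec3 E1 E2 O); ring [(trig1 (th s))]. }
repeat split; [assumption|assumption| |].
- rewrite S1, V2, HT, fig_T_vec3; unfold vec3; veq.
- rewrite S2, V1, HT, fig_T_vec3; unfold vec3; veq.
Qed.

Lemma fig_delta_psi : exists (d : R) (m : Z), has_delta_psi l r d /\ d = IZR m * PI.
Proof.
destruct (pendulum_smooth _ _ _ _ _ _ H) as [S1 [S2 S3]].
apply (has_delta_psi_of_normal l r (fig_N th E1 E2) ka Hr).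
- assert (A := vsmooth_vec3 E1 E2 (fun s => - sin (th s)) (fun s => cos (th s)) (fun _ => 0)
    ltac:(sm) ltac:(sm) ltac:(sm)).
  replace (fig_N th E1 E2) with (fun s => vec3 E1 E2 (- sin (th s)) (cos (th s)) 0); [assumption|].
  apply functional_extensionality; intros s; rewrite fig_N_vec3; reflexivity.
- assumption.
- apply fig_N_unit, O.
- intros s; rewrite HT; apply fig_dot_TN, O.
- apply (fig_vDerive _ _ _ _ _ _ H E1 E2 r HT).
- destruct (fig_period q Lam C th ka X H E1 E2 0) as [_ P2]; rewrite Rplus_0_l in P2; exact P2.
- apply (fig_mat1_closed _ _ _ _ _ _ H E1 E2 O r Hr HT Hu).
Qed.

Lemma unstable_figure (alpha beta : R) : 0 < alpha -> 0 <= beta -> beta / alpha < 2 -> unstable alpha beta l r.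
Proof.
intros Ha Hb HB [eps [Heps HS]].
assert (Hba : beta < 2 * alpha).
{ replace beta with (beta / alpha * alpha) by (field; lra); apply Rmult_lt_compat_r; assumption. }
assert (Hl : 0 < l) by (unfold l; lra).
destruct (stretch _ _ _ _ _ _ H) as [kf [M [e0 [HM [He0 Kf]]]]]; fold l in Kf.
destruct fig_material_frame as [phi0 MF].
assert (Hkf : bigO (4 * q) 2 (fun e _ => kf e - 1)).
{ exists M, e0; split; [lra|split; [assumption|]]; intros e s He _; apply (Kf e He). }
set (c0 := center r 0).
set (pr := perturbed q Lam th ka X E1 E2 c0 phi0 kf).
destruct (near_t _ _ _ _ _ _ H kf Hkf) as [T1 [T2 [T3 [T4 [T5 T6]]]]].
assert (NP := near_phi _ _ _ _ _ _ H phi0 kf Hkf).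
assert (NP2 := near_plus _ _ _ _ _ NP (near_refl (4 * q) ltac:(lra) (fun _ => PI / 2) (cts_const (PI / 2))) :
  near (4 * q) (fun e s => phi q Lam th ka X phi0 kf e s + PI / 2) (fun _ => phi0 + PI / 2)).
destruct (near_f _ _ _ _ _ _ H kf Hkf _ _ NP) as [F1 [F2 [F3 [F4 [F5 F6]]]]].
destruct (near_f _ _ _ _ _ _ H kf Hkf _ _ NP2) as [G1 [G2 [G3 [G4 [G5 G6]]]]].
assert (S := smooth_t _ _ _ _ _ _ H kf).
assert (I1 := near_int (4 * q) ltac:(lra) _ _ (fun e => smooth_cts _ (proj1 (S e))) (cts_cos _ C_th) T1).
assert (I2 := near_int (4 * q) ltac:(lra) _ _ (fun e => smooth_cts _ (proj1 (proj2 (S e)))) (cts_sin _ C_th) T2).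
assert (I3 := near_int (4 * q) ltac:(lra) _ _ (fun e => smooth_cts _ (proj2 (proj2 (S e)))) (cts_const 0) T3).
destruct (near_vec3 E1 E2 O _ eps _ _ _ _ _ _ Heps I1 I2 I3) as [a1 [Ha1 A1]].
destruct (near_vec3 E1 E2 O _ eps _ _ _ _ _ _ Heps T1 T2 T3) as [a2 [Ha2 A2]].
destruct (near_vec3 E1 E2 O _ eps _ _ _ _ _ _ Heps T4 T5 T6) as [a3 [Ha3 A3]].
destruct (near_vec3 E1 E2 O _ eps _ _ _ _ _ _ Heps F1 F2 F3) as [a4 [Ha4 A4]].
destruct (near_vec3 E1 E2 O _ eps _ _ _ _ _ _ Heps F4 F5 F6) as [a5 [Ha5 A5]].
destruct (near_vec3 E1 E2 O _ eps _ _ _ _ _ _ Heps G1 G2 G3) as [a6 [Ha6 A6]].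
destruct (near_vec3 E1 E2 O _ eps _ _ _ _ _ _ Heps G4 G5 G6) as [a7 [Ha7 A7]].
destruct (energy_asymptotic _ _ _ _ _ _ H E1 E2 O c0 phi0 kf Hkf alpha beta (Rlt_le _ _ Ha) Hb)
  as [D [a8 [HD [Ha8 EA]]]].
destruct (near_small _ _ _ (1 / 2) ltac:(lra) (near_chi _ _ _ _ _ _ H)) as [a9 [Ha9 A9]].
set (gap := (2 * alpha - beta) * l); assert (Hgap : 0 < gap) by (unfold gap; apply Rmult_lt_0_compat; lra).
(* The bounds [a1] to [a7] ensure closeness of the seven quantities in [close_rods], [a8] the energy
   expansion, and [a9] a positive cosine of the latitude; M e^2 <= 1 / 2 keeps the stretching factor
   positive, and D e < gap lets the e^2 gain beat the cubic remainder. *)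
assert (Hm : exists e, 0 < e /\ e <= a1 /\ e <= a2 /\ e <= a3 /\ e <= a4 /\ e <= a5 /\ e <= a6 /\ e <= a7 /\
  e <= a8 /\ e <= a9 /\ e <= e0 /\ M * e ^ 2 <= 1 / 2 /\ D * e < gap).
{ assert (Q1 : 0 < / (2 * (M + 1))) by (apply Rinv_0_lt_compat; lra).
  assert (Q2 : 0 < gap / (D + 1)) by (apply Rdiv_lt_0_compat; lra).
  set (b1 := Rmin (Rmin a1 a2) (Rmin a3 a4)); set (b2 := Rmin (Rmin a5 a6) (Rmin a7 a8)).
  set (b3 := Rmin (Rmin a9 e0) (Rmin (/ (2 * (M + 1))) (gap / (D + 1)))).
  assert (X1 := Rmin_l (Rmin a1 a2) (Rmin a3 a4)); assert (X2 := Rmin_r (Rmin a1 a2) (Rmin a3 a4)).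
  assert (X3 := Rmin_l (Rmin a5 a6) (Rmin a7 a8)); assert (X4 := Rmin_r (Rmin a5 a6) (Rmin a7 a8)).
  assert (X5 := Rmin_l (Rmin a9 e0) (Rmin (/ (2 * (M + 1))) (gap / (D + 1)))).
  assert (X6 := Rmin_r (Rmin a9 e0) (Rmin (/ (2 * (M + 1))) (gap / (D + 1)))).
  fold b1 in X1, X2; fold b2 in X3, X4; fold b3 in X5, X6.
  assert (Y1 := Rmin_l a1 a2); assert (Y2 := Rmin_r a1 a2); assert (Y3 := Rmin_l a3 a4); assert (Y4 := Rmin_r a3 a4).
  assert (Y5 := Rmin_l a5 a6); assert (Y6 := Rmin_r a5 a6); assert (Y7 := Rmin_l a7 a8); assert (Y8 := Rmin_r a7 a8).
  assert (Y9 := Rmin_l a9 e0); assert (Y10 := Rmin_r a9 e0).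
  assert (Y11 := Rmin_l (/ (2 * (M + 1))) (gap / (D + 1))); assert (Y12 := Rmin_r (/ (2 * (M + 1))) (gap / (D + 1))).
  set (e := Rmin b1 (Rmin b2 b3)).
  assert (Z1 := Rmin_l b1 (Rmin b2 b3)); assert (Z2 := Rmin_r b1 (Rmin b2 b3)).
  assert (Z3 := Rmin_l b2 b3); assert (Z4 := Rmin_r b2 b3); fold e in Z1, Z2.
  assert (He : 0 < e) by (unfold e, b1, b2, b3; repeat apply Rmin_glb_lt; lra).
  exists e; repeat split; try lra.
  - assert (e <= / (2 * (M + 1))) by lra.
    assert (e * (M + 1) <= 1 / 2).
    { replace (1 / 2) with (/ (2 * (M + 1)) * (M + 1)) by (field; lra); apply Rmult_le_compat_r; lra. }
    assert (e <= 1) by lra; simpl; nra.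
  - assert (e * (D + 1) <= gap).
    { replace gap with (gap / (D + 1) * (D + 1)) by (field; lra); apply Rmult_le_compat_r; lra. }
    lra. }
destruct Hm as [e [He [L1 [L2 [L3 [L4 [L5 [L6 [L7 [L8 [L9 [L10 [L11 L12]]]]]]]]]]]]].
destruct (Kf e ltac:(lra)) as [Kb Kz].
assert (Hk : RInt (tx Lam th ka X kf e) 0 (4 * q) = 0) by exact Kz.
assert (Kpos : 0 < kf e) by (apply Rabs_le_between in Kb; lra).
assert (Cl : closed_rod l (pr e)) by (apply (perturbed_closed _ _ _ _ _ _ H E1 E2 O c0 phi0 kf e Hk)).
assert (Cchi : forall s, 0 < cos (chi Lam th ka X e s)).
{ apply (period_reduce l); [assumption| |].
  - intros s; assert (A : chi Lam th ka X e (s + l) = chi Lam th ka X e s) by exact (chi_l _ _ _ _ _ _ H e s).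
    rewrite A; tauto.
  - intros s Hs; assert (A := A9 e s ltac:(lra) Hs); rewrite Rminus_0_r in A.
    apply Rabs_lt_between in A; assert (P := PI2_3_2); apply cos_gt_0; lra. }
assert (PT := perturbed_tangent _ _ _ _ _ _ H E1 E2 c0 phi0 kf e).
assert (PT' := perturbed_tangent' _ _ _ _ _ _ H E1 E2 c0 phi0 kf e).
assert (PM1 := perturbed_mat1' _ _ _ _ _ _ H E1 E2 c0 phi0 kf e).
assert (PM2 := perturbed_mat2' _ _ _ _ _ _ H E1 E2 c0 phi0 kf e).
fold pr in PT, PT', PM1, PM2.
assert (BC : same_boundary_conditions l r (pr e)).
{ split; [assumption|].
  destruct fig_delta_psi as [d [m [Hd Ed]]].
  destruct (perturbed_delta_psi _ _ _ _ _ _ H E1 E2 O c0 phi0 kf e Hk Kpos Cchi) as [d' [m' [Hd' Ed']]].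
  exists d, d'; split; [assumption|split; [exact Hd'|split]].
  - intros _; exists (m' - m)%Z; rewrite Ed, Ed', minus_IZR; ring.
  - intros NI; exfalso; apply NI; apply (fig_inflection _ _ _ _ _ _ H E1 E2 r HT). }
assert (CL : close_rods l eps r (pr e)).
{ intros s Hs; destruct (MF s Hs) as [M1 [M2 [M3 M4]]].
  rewrite PT, PT', PM1, PM2, M1, M2, M3, M4, HT, (fig_vDerive _ _ _ _ _ _ H E1 E2 r HT), fig_T_vec3, fig_N_vec3, scal_vec3.
  split; [|split; [|split; [|split; [|split; [|split]]]]].
  - rewrite (fig_center s).
    unfold pr, perturbed; simpl center; fold c0.
    replace (minus _ _) with (minus
      (vec3 E1 E2 (RInt (tx Lam th ka X kf e) 0 s) (RInt (ty Lam th ka X kf e) 0 s) (RInt (tz Lam th ka X e) 0 s))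
      (vec3 E1 E2 (RInt (fun t => cos (th t)) 0 s) (RInt (fun t => sin (th t)) 0 s) (RInt (fun _ => 0) 0 s))) by veq.
    apply A1; [lra|assumption].
  - apply A2; [lra|assumption].
  - replace (ka s * - sin (th s)) with (- sin (th s) * ka s) by ring.
    replace (ka s * cos (th s)) with (cos (th s) * ka s) by ring.
    replace (ka s * 0) with 0 by ring.
    apply A3; [lra|assumption].
  - assert (B := A4 e s ltac:(lra) Hs); cbv beta in B; unfold pr, perturbed; cbn [mat1]; exact B.
  - assert (B := A5 e s ltac:(lra) Hs); cbv beta in B; exact B.
  - assert (B := A6 e s ltac:(lra) Hs); cbv beta in B; unfold pr, perturbed; cbn [mat2]; exact B.
  - assert (B := A7 e s ltac:(lra) Hs); cbv beta in B; exact B. }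
assert (Final := HS (pr e) BC CL).
assert (Er : energy alpha beta l r = alpha * RInt (fun s => ka s ^ 2) 0 l)
  by exact (fig_energy _ _ _ _ _ _ H E1 E2 O r Hr HT Hu alpha beta).
assert (E : energy alpha beta l (pr e) <= alpha * RInt (fun s => ka s ^ 2) 0 l - gap * e ^ 2 + D * e ^ 3)
  by exact (EA e ltac:(lra) Hk).
rewrite Er in Final.
assert (e ^ 2 * (D * e) < e ^ 2 * gap) by (apply Rmult_lt_compat_l; [apply pow_lt|]; assumption).
assert (E3 : e ^ 2 * (D * e) = D * e ^ 3) by ring; lra.
Qed.

End Unstable.

(** * The pendulum in terms of the Jacobi amplitude *)

Section Amplitude.
Context (p : R) (Hp : 0 < p < 1).

(** At t = am u this is the Jacobi function dn u, the derivative of the amplitude. *)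
Definition delta (t : R) : R := sqrt (1 - p ^ 2 * sin t ^ 2).

Lemma delta_arg (t : R) : 0 < 1 - p ^ 2 * sin t ^ 2 <= 1.
Proof.
assert (A := sin2_cos2 t); unfold Rsqr in A.
assert (B := Rle_0_sqr (sin t)); assert (D := Rle_0_sqr (cos t)); unfold Rsqr in B, D; simpl.
split; nra.
Qed.

Lemma delta_bound (t : R) : 0 < delta t <= 1.
Proof.
destruct (delta_arg t) as [A B]; unfold delta; split; [apply sqrt_lt_R0; assumption|].
rewrite <- sqrt_1 at 2; apply sqrt_le_1_alt; assumption.
Qed.

Lemma cts_inv_delta : cts (fun t => / delta t).
Proof.
apply (is_derive_cts _ (fun t => p ^ 2 * sin t * cos t / (delta t * (delta t * delta t)))).
intros t; unfold delta; assert (A := delta_arg t); assert (B := proj1 (delta_bound t)); unfold delta in B.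
auto_derive.
- replace (1 + - (p * (p * 1) * (sin t * (sin t * 1)))) with (1 - p ^ 2 * sin t ^ 2) by ring.
  repeat split; lra.
- replace (1 + - (p * (p * 1) * (sin t * (sin t * 1)))) with (1 - p ^ 2 * sin t ^ 2) by ring.
  field; lra.
Qed.

Let F (phi : R) : R := ellF phi p.

Lemma is_derive_ellF (t : R) : is_derive (fun phi => ellF phi p) t (/ delta t).
Proof. apply (is_derive_primitive (fun t => / delta t)), cts_inv_delta. Qed.

Lemma inv_delta_ge1 (t : R) : 1 <= / delta t.
Proof.
destruct (delta_bound t) as [A B]; rewrite <- Rinv_1; apply Rinv_le_contravar; assumption.
Qed.

(** The integrand of [ellF] is at least 1. This inequality yields injectivity, surjectivity by
    intermediate values, and the Lipschitz constant 1 of the amplitude. *)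
Lemma ellF_expand (a b : R) : a <= b -> b - a <= F b - F a.
Proof.
intros Hab; rewrite <- (int_deriv F (fun t => / delta t) a b is_derive_ellF cts_inv_delta).
replace (b - a) with (RInt (fun _ => 1) a b) by (rewrite int_const; rring).
apply int_le; [assumption|ct|apply cts_inv_delta|]; intros; apply inv_delta_ge1.
Qed.

Lemma ellF_0 : F 0 = 0.
Proof. unfold F, ellF; rewrite RInt_point; reflexivity. Qed.

Lemma ellF_am (u : R) : F (jacobi_am u p) = u.
Proof.
unfold jacobi_am; apply (epsilon_spec (inhabits 0) (fun phi => ellF phi p = u)).
set (a := Rabs u + 1); assert (Ha : 0 < a) by (assert (P := Rabs_pos u); unfold a; lra).
destruct (IVT_gen F (- a) a u) as [x [_ Hx]].
- intros x; apply continuity_pt_filterlim, (is_derive_cts F _ is_derive_ellF x).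
- assert (A := ellF_expand (- a) 0 ltac:(lra)); assert (B := ellF_expand 0 a ltac:(lra)).
  rewrite ellF_0 in A, B; assert (P := Rle_abs u); assert (P' := Rle_abs (- u)); rewrite Rabs_Ropp in P'.
  rewrite Rmin_left, Rmax_right by lra; unfold a in *; lra.
- exists x; exact Hx.
Qed.

Lemma ellF_inj (a b : R) : F a = F b -> a = b.
Proof.
intros E; destruct (Rle_dec a b) as [L|L].
- assert (A := ellF_expand a b L); lra.
- assert (A := ellF_expand b a ltac:(lra)); lra.
Qed.

Lemma am_ellF (a u : R) : F a = u -> jacobi_am u p = a.
Proof. intros E; apply ellF_inj; rewrite ellF_am; symmetry; assumption. Qed.

Lemma am_incr (u v : R) : u < v -> jacobi_am u p < jacobi_am v p.
Proof.
intros L; apply Rnot_le_lt; intros L'; assert (A := ellF_expand _ _ L'); rewrite !ellF_am in A; lra.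
Qed.

Lemma am_lipschitz (u v : R) : Rabs (jacobi_am u p - jacobi_am v p) <= Rabs (u - v).
Proof.
set (a := jacobi_am u p); set (b := jacobi_am v p).
assert (Ea : F a = u) by apply ellF_am; assert (Eb : F b = v) by apply ellF_am.
destruct (Rle_dec a b) as [L|L].
- assert (A := ellF_expand a b L); rewrite Ea, Eb in A.
  rewrite (Rabs_minus_sym a), (Rabs_minus_sym u), !Rabs_pos_eq; lra.
- assert (A := ellF_expand b a ltac:(lra)); rewrite Ea, Eb in A.
  rewrite !Rabs_pos_eq; lra.
Qed.

(** The inverse function rule, done on difference quotients: for an increment h of u with increment
    k of the amplitude, h / k is a difference quotient of [ellF], and [am_lipschitz] turns small h
    into small k. *)
Lemma is_derive_am (u : R) : is_derive (fun u => jacobi_am u p) u (delta (jacobi_am u p)).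
Proof.
set (a := jacobi_am u p).
apply is_derive_Reals; intros eps Heps.
assert (DF := is_derive_ellF a); apply is_derive_Reals in DF.
destruct (DF eps Heps) as [d Hd]; exists d; intros h Hh Hhd.
set (k := jacobi_am (u + h) p - a).
assert (Ek : jacobi_am (u + h) p = a + k) by (unfold k; ring).
assert (EF : F (a + k) - F a = h).
{ rewrite <- Ek, ellF_am; unfold a; rewrite ellF_am; ring. }
assert (Hk : k <> 0).
{ intros E; rewrite E, Rplus_0_r in EF; lra. }
assert (Hkd : Rabs k < d).
{ eapply Rle_lt_trans; [|exact Hhd]; unfold k, a.
  eapply Rle_trans; [apply am_lipschitz|]; replace (u + h - u) with h by ring; lra. }
specialize (Hd k Hk Hkd); change (ellF (a + k) p - ellF a p) with (F (a + k) - F a) in Hd; rewrite EF in Hd.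
(* [ellF_expand] gives D >= 1, so passing to the inverse quotient k / h does not enlarge the
   error. *)
set (D := h / k) in *.
assert (HD : 1 <= D).
{ unfold D; destruct (Rlt_dec k 0) as [L|L].
  - assert (A := ellF_expand (a + k) a ltac:(lra)).
    replace (h / k) with ((- h) / (- k)) by (field; assumption).
    apply Rmult_le_reg_r with (- k); [lra|]; unfold Rdiv; rewrite Rmult_assoc, Rinv_l by lra; lra.
  - assert (A := ellF_expand a (a + k) ltac:(lra)).
    apply Rmult_le_reg_r with k; [lra|]; unfold Rdiv; rewrite Rmult_assoc, Rinv_l by lra; lra. }
destruct (delta_bound a) as [Da1 Da2].
rewrite Ek; fold a; replace ((a + k - a) / h - delta a) with (/ D * (- (D - / delta a) * delta a))
  by (unfold D; field; repeat split; try assumption; lra).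
rewrite !Rabs_mult, Rabs_Ropp, (Rabs_pos_eq (delta a)), (Rabs_pos_eq (/ D))
  by (try (apply Rlt_le, Rinv_0_lt_compat); lra).
assert (I : / D <= 1) by (rewrite <- Rinv_1; apply Rinv_le_contravar; lra).
assert (I0 : 0 < / D) by (apply Rinv_0_lt_compat; lra).
assert (P := Rabs_pos (D - / delta a)).
apply Rle_lt_trans with (1 * (Rabs (D - / delta a) * 1)); [|lra].
apply Rmult_le_compat; [lra|nra|assumption|]; apply Rmult_le_compat_l; assumption.
Qed.

Lemma delta_opp (t : R) : delta (- t) = delta t.
Proof. unfold delta; rewrite sin_neg; do 2 f_equal; ring. Qed.

Lemma delta_PI (t : R) : delta (t + PI) = delta t.
Proof. unfold delta; rewrite neg_sin; do 2 f_equal; ring. Qed.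

Lemma ellF_odd (t : R) : F (- t) = - F t.
Proof.
assert (E := int_reflect (fun t => / delta t) 0 0 t cts_inv_delta).
rewrite (int_ext _ (fun t => / delta t)) in E
  by (intros; rewrite Rminus_0_l, delta_opp; reflexivity).
rewrite Rminus_0_l, Rminus_0_r, (int_swap _ 0 (- t)) in E by apply cts_inv_delta.
change (F t = - F (- t)) in E; lra.
Qed.

Lemma ellF_PI : F PI = 2 * ellK p.
Proof.
change (RInt (fun t => / delta t) 0 PI = 2 * RInt (fun t => / delta t) 0 (PI / 2)).
assert (Cd := cts_inv_delta).
rewrite <- (int_chasles _ 0 (PI / 2) PI Cd).
assert (E := int_reflect (fun t => / delta t) PI 0 (PI / 2) Cd).
rewrite (int_ext _ (fun t => / delta t)) in E.
- rewrite Rminus_0_r in E; replace (PI - PI / 2) with (PI / 2) in E by field.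
  rewrite <- E; rring.
- intros t; rewrite <- (delta_opp (PI - t)), <- (delta_PI (- (PI - t))); do 2 f_equal; ring.
Qed.

Lemma ellF_shift (t : R) : F (t + PI) = F t + 2 * ellK p.
Proof.
rewrite <- ellF_PI; assert (Cd := cts_inv_delta).
change (RInt (fun t => / delta t) 0 (t + PI) = RInt (fun t => / delta t) 0 t + RInt (fun t => / delta t) 0 PI).
rewrite <- (int_chasles _ 0 PI (t + PI) Cd).
assert (E := int_translate (fun t => / delta t) PI 0 t Cd).
rewrite Rplus_0_r, (Rplus_comm PI t) in E; rewrite <- E.
rewrite (int_ext (fun s => / delta (PI + s)) (fun t => / delta t))
  by (intros; rewrite Rplus_comm, delta_PI; reflexivity).
rring.
Qed.

Lemma am_odd (u : R) : jacobi_am (- u) p = - jacobi_am u p.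
Proof. apply am_ellF; rewrite ellF_odd, ellF_am; reflexivity. Qed.

Lemma am_shift (u : R) : jacobi_am (u + 2 * ellK p) p = jacobi_am u p + PI.
Proof. apply am_ellF; rewrite ellF_shift, ellF_am; reflexivity. Qed.

Lemma am_0 : jacobi_am 0 p = 0.
Proof. apply am_ellF, ellF_0. Qed.

Lemma am_K : jacobi_am (ellK p) p = PI / 2.
Proof. apply am_ellF; reflexivity. Qed.

Lemma ellK_pos : 0 < ellK p.
Proof.
assert (P := PI_RGT_0); assert (A := ellF_expand 0 (PI / 2) ltac:(lra)); rewrite ellF_0 in A.
change (ellK p) with (F (PI / 2)); lra.
Qed.

Section Scaled.
Context (kappa0 : R) (Hk : 0 < kappa0).

Let w := kappa0 / (2 * p).
Let q := 2 * p * ellK p / kappa0.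
Let am (s : R) : R := jacobi_am (kappa0 * s / (2 * p)) p.

Definition eight_ka (s : R) : R := kappa0 * jacobi_cn (kappa0 * s / (2 * p)) p.
(** The classical solution sin (th / 2) = p sn of the oscillating pendulum; p < 1 keeps the argument
    away from the ends of the domain of [asin]. *)
Definition eight_th (s : R) : R := 2 * asin (p * sin (jacobi_am (kappa0 * s / (2 * p)) p)).
Definition eight_X (s : R) : R := RInt (fun t => cos (eight_th t)) 0 s.

Lemma w_pos : 0 < w.
Proof. apply Rdiv_lt_0_compat; lra. Qed.

Lemma is_derive_am_scaled (s : R) : is_derive am s (w * delta (am s)).
Proof.
unfold am; assert (D := is_derive_am).
assert (E : is_derive (fun s => kappa0 * s / (2 * p)) s w).
{ auto_derive; [exact I|unfold w; field; lra]. }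
apply (is_derive_comp (fun u => jacobi_am u p) (fun s => kappa0 * s / (2 * p)) s _ w (D _) E).
Qed.

Lemma asin_arg (s : R) : -1 < p * sin (am s) < 1.
Proof. assert (A := SIN_bound (am s)); nra. Qed.

Lemma delta_am (s : R) : sqrt (1 - (p * sin (am s))²) = delta (am s).
Proof. unfold delta, Rsqr; f_equal; ring. Qed.

Lemma sin_eight_th (s : R) : sin (eight_th s) = 2 * (p * sin (am s)) * delta (am s).
Proof.
assert (A := asin_arg s); unfold eight_th; rewrite sin_2a; fold (am s).
rewrite sin_asin, cos_asin, delta_am by lra; reflexivity.
Qed.

Lemma cos_eight_th (s : R) : cos (eight_th s) = 1 - 2 * (p * sin (am s)) ^ 2.
Proof.
assert (A := asin_arg s); unfold eight_th; rewrite cos_2a_sin; fold (am s).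
rewrite sin_asin by lra; ring.
Qed.

Lemma is_derive_eight_th (s : R) : is_derive eight_th s (eight_ka s).
Proof.
assert (A := asin_arg s); assert (D := is_derive_am_scaled s).
assert (Ds : is_derive (fun s => p * sin (am s)) s (p * (cos (am s) * (w * delta (am s))))).
{ assert (D' := is_derive_am_scaled); ader. }
assert (Da : is_derive asin (p * sin (am s)) (/ delta (am s))).
{ apply is_derive_Reals; rewrite <- delta_am, <- Rdiv_1_l.
  apply (derive_pt_eq_1 _ _ _ (derivable_pt_asin _ A)), derive_pt_asin. }
evar_last.
- apply (is_derive_scal (fun s => asin (p * sin (am s))) s 2).
  apply (is_derive_comp asin (fun s => p * sin (am s)) s _ _ Da Ds).
- unfold scal; simpl; unfold mult; simpl; unfold eight_ka, jacobi_cn; fold (am s).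
  assert (B := proj1 (delta_bound (am s))); unfold w; field; lra.
Qed.

Lemma is_derive_eight_ka (s : R) : is_derive eight_ka s (- w ^ 2 * sin (eight_th s)).
Proof.
assert (D := is_derive_am_scaled).
apply (is_derive_ext (fun s => kappa0 * cos (am s))); [reflexivity|].
rewrite sin_eight_th; ader.
unfold w; field; lra.
Qed.

Lemma am_half (s : R) : am (s + 2 * q) = am s + PI.
Proof.
unfold am, q; rewrite <- am_shift; f_equal; field; lra.
Qed.

Lemma am_quarter : am q = PI / 2.
Proof. rewrite <- am_K; unfold am, q; f_equal; field; lra. Qed.

Lemma am_scaled_incr (s t : R) : s < t -> am s < am t.
Proof.
intros L; apply am_incr; unfold Rdiv; rewrite !Rmult_assoc.
apply Rmult_lt_compat_l; [assumption|]; apply Rmult_lt_compat_r; [apply Rinv_0_lt_compat; lra|assumption].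
Qed.

Lemma am_scaled_0 : am 0 = 0.
Proof. unfold am; replace (kappa0 * 0 / (2 * p)) with 0 by (field; lra); apply am_0. Qed.

Lemma eight_th_odd (s : R) : eight_th (- s) = - eight_th s.
Proof.
unfold eight_th; replace (kappa0 * - s / (2 * p)) with (- (kappa0 * s / (2 * p))) by (field; lra).
rewrite am_odd, sin_neg.
replace (p * - sin (jacobi_am (kappa0 * s / (2 * p)) p)) with (- (p * sin (jacobi_am (kappa0 * s / (2 * p)) p))) by ring.
rewrite asin_opp; ring.
Qed.

Lemma eight_th_half (s : R) : eight_th (s + 2 * q) = - eight_th s.
Proof.
unfold eight_th; fold (am (s + 2 * q)) (am s); rewrite am_half, neg_sin.
replace (p * - sin (am s)) with (- (p * sin (am s))) by ring; rewrite asin_opp; ring.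
Qed.

(** The constants Lam = w^2 and C = w^2 (2 p^2 - 1) come from ka^2 = 4 p^2 w^2 cn^2 and cos th = 1 -
    2 p^2 sn^2; the point s = q corresponds to the argument K(p). The vanishing integral is what
    makes X periodic with period 2 q. *)
Lemma eight_pendulum : RInt (fun s => cos (eight_th s)) 0 (4 * q) = 0 ->
  pendulum q (w ^ 2) (w ^ 2 * (2 * p ^ 2 - 1)) eight_th eight_ka eight_X.
Proof.
intros IX.
assert (Cth : cts eight_th) by apply (is_derive_cts _ _ is_derive_eight_th).
assert (Cc : cts (fun s => cos (eight_th s))) by ct.
assert (Hq : 0 < q) by (assert (K := ellK_pos); unfold q; apply Rdiv_lt_0_compat; mpos).
assert (Hw := w_pos); assert (HPI := PI_RGT_0).
assert (Ekw : kappa0 = 2 * p * w) by (unfold w; field; lra).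
assert (Ang : forall s, 0 < s <= q -> 0 < am s <= PI / 2).
{ intros s Hs; split; [rewrite <- am_scaled_0; apply am_scaled_incr; lra|].
  rewrite <- am_quarter; destruct (Req_dec s q) as [->|E]; [lra|].
  apply Rlt_le, am_scaled_incr; lra. }
split.
- assumption.
- apply pow_lt, w_pos.
- exact is_derive_eight_th.
- exact is_derive_eight_ka.
- intros s; exact (is_derive_primitive (fun t => cos (eight_th t)) s Cc).
- intros s; rewrite (cos_eight_th s); unfold eight_ka, jacobi_cn; fold (am s).
  assert (T := sin2_cos2 (am s)); unfold Rsqr in T; rewrite Ekw.
  assert (T' : cos (am s) * cos (am s) = 1 - sin (am s) * sin (am s)) by lra; ring [T'].
- exact eight_th_odd.
- intros s; unfold eight_ka, jacobi_cn; replace (kappa0 * - s / (2 * p)) with (- (kappa0 * s / (2 * p))) by (field; lra).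
  rewrite am_odd, cos_neg; reflexivity.
- intros s; unfold eight_X; assert (E := int_reflect _ 0 0 s Cc).
  rewrite (int_ext _ (fun t => cos (eight_th t))) in E
    by (intros; rewrite Rminus_0_l, eight_th_odd, cos_neg; reflexivity).
  rewrite Rminus_0_l, Rminus_0_r, (int_swap _ 0 (- s)) in E by exact Cc; lra.
- exact eight_th_half.
- intros s; unfold eight_ka, jacobi_cn; fold (am (s + 2 * q)) (am s); rewrite am_half, neg_cos; ring.
- intros s; unfold eight_X.
  assert (P : forall t, cos (eight_th (t + 2 * q)) = cos (eight_th t)).
  { intros t; rewrite eight_th_half, cos_neg; reflexivity. }
  rewrite <- (int_chasles _ 0 s (s + 2 * q) Cc), (int_period _ (2 * q) s Cc P).
  assert (E := int_period _ (2 * q) (2 * q) Cc P).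
  rewrite <- (int_chasles _ 0 (2 * q) (4 * q) Cc) in IX.
  replace (2 * q + 2 * q) with (4 * q) in E by ring; lra.
- intros s Hs; destruct (Ang s Hs) as [A1 A2].
  assert (Sp : 0 < sin (am s)) by (apply sin_gt_0; lra).
  assert (B := asin_bound_lt _ (asin_arg s)).
  assert (Bt : - PI < eight_th s < PI) by (unfold eight_th; fold (am s); lra).
  split; [|lra].
  (* The angle lies in (- PI, PI), so a positive sine forces it to be positive. *)
  apply Rnot_le_lt; intros L.
  assert (Sn : 0 < sin (eight_th s)).
  { rewrite sin_eight_th; assert (B1 := proj1 (delta_bound (am s))); mpos. }
  destruct (Req_dec (eight_th s) 0) as [E|E]; [rewrite E, sin_0 in Sn; lra|].
  assert (0 < sin (- eight_th s)) by (apply sin_gt_0; lra); rewrite sin_neg in *; lra.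
- intros s Hs; unfold eight_ka, jacobi_cn; fold (am s); apply Rmult_lt_0_compat; [assumption|].
  assert (L := am_scaled_incr s q ltac:(lra)); rewrite am_quarter in L.
  apply cos_gt_0; [|assumption].
  destruct (Req_dec s 0) as [->|E]; [rewrite am_scaled_0; lra|].
  destruct (Ang s ltac:(lra)); lra.
Qed.

End Scaled.
End Amplitude.

(** With E1 the initial tangent and E2 = e x E1, the tangent and [fig_T] solve the same linear
    system with the same initial value. Their scalar product is therefore constantly 1, which for
    unit vectors means equality. *)
Lemma figure_eight_tangent (kappa0 p : R) (r : rod) : 0 < p < 1 -> 0 < kappa0 ->
  vsmooth (tangent r) -> (forall s, dot (tangent r s) (tangent r s) = 1) ->
  planar_with_signed_curvature r (eight_ka p kappa0) ->
  exists E1 E2 : vec, orthonormal E1 E2 /\ forall s, tangent r s = fig_T (eight_th p kappa0) E1 E2 s.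
Proof.
intros Hp Hk ST UT [e [He [Te DT]]].
set (th := eight_th p kappa0); set (ka := eight_ka p kappa0) in *.
set (E1 := tangent r 0); set (E2 := cross e E1).
assert (U1 : dot E1 E1 = 1) by apply UT; assert (P1 : dot E1 e = 0) by apply Te.
assert (O : orthonormal E1 E2).
{ repeat split; [assumption| |].
  - unfold E2; rewrite cross_dot_cross, He, U1, (dot_sym e), P1; ring.
  - unfold E2; rewrite dot_sym; apply dot_cross_r. }
exists E1, E2; split; [assumption|].
assert (D_th : forall s, is_derive th s (ka s)) by (intros s; apply is_derive_eight_th; assumption).
pose (a := fun s => dot (tangent r s) E1); pose (b := fun s => dot (tangent r s) E2).
assert (Da : forall s, is_derive a s (- ka s * b s)).
{ intros s; evar_last; [apply is_derive_dot_const, ST|]; rewrite DT, dot_scal_l; unfold b, E2; vring. }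
assert (Db : forall s, is_derive b s (ka s * a s)).
{ intros s; evar_last; [apply is_derive_dot_const, ST|]; rewrite DT, dot_scal_l; unfold a, E2.
  rewrite cross_dot_cross, He, (dot_sym e), P1; ring. }
assert (th0 : th 0 = 0).
{ assert (E : th (- 0) = - th 0) by (apply eight_th_odd; assumption).
  rewrite Ropp_0 in E; lra. }
assert (K : forall s, cos (th s) * a s + sin (th s) * b s = 1).
{ intros s.
  assert (E : RInt (fun _ => 0) 0 s = (cos (th s) * a s + sin (th s) * b s) - (cos (th 0) * a 0 + sin (th 0) * b 0)).
  { apply (int_deriv (fun s => cos (th s) * a s + sin (th s) * b s)); [|ct]; intros t; ader. }
  rewrite int_const, th0, cos_0, sin_0 in E; unfold a at 2 in E; fold E1 in E; rewrite U1 in E; lra. }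
intros s.
assert (E : minus (tangent r s) (fig_T th E1 E2 s) = zero).
{ apply norm_eq_0_vec; rewrite norm_dot, dot_minus_l, !dot_minus_r, UT, (fig_T_unit th E1 E2 O).
  rewrite (dot_sym (fig_T th E1 E2 s)).
  replace (dot (tangent r s) (fig_T th E1 E2 s)) with (cos (th s) * a s + sin (th s) * b s)
    by (unfold fig_T, a, b; rewrite dot_plus_r, !dot_scal_r; reflexivity).
  rewrite K; replace (1 - 1 - (1 - 1)) with 0 by ring; apply sqrt_0. }
apply vec_eq; [rewrite <- px_minus|rewrite <- py_minus|rewrite <- pz_minus]; rewrite E; reflexivity.
Qed.

Theorem theorem6 :
  forall (alpha beta kappa0 p : R) (r : rod),
    0 < alpha -> 0 <= beta ->
    0 < kappa0 ->
    0 < p < 1 -> 2 * ellE p = ellK p ->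
    untwisted_figure_eight kappa0 p r ->
    (beta / alpha > 2 -> stable alpha beta (figure_eight_length kappa0 p) r) /\
    (beta / alpha < 2 -> unstable alpha beta (figure_eight_length kappa0 p) r).
Proof.
intros alpha beta kappa0 p r Ha Hb Hk Hp _ [Hr [Hpl Hu]].
set (q := 2 * p * ellK p / kappa0).
assert (El : figure_eight_length kappa0 p = 4 * q) by (unfold figure_eight_length, q; field; lra).
rewrite El in *.
destruct (closed_rod_vsmooth _ r Hr) as [ST _].
assert (UT : forall s, dot (tangent r s) (tangent r s) = 1) by apply Hr.
destruct (figure_eight_tangent kappa0 p r Hp Hk ST UT Hpl) as [E1 [E2 [O HT]]].
(* The integral of cos th is the increment of the E1 coordinate of the centerline over one length,
   which is 0 because the centerline is closed. *)
assert (IX : RInt (fun s => cos (eight_th p kappa0 s)) 0 (4 * q) = 0).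
{ rewrite (int_ext _ (fun s => dot (tangent r s) E1)).
  - rewrite (int_deriv (fun s => dot (center r s) E1)); [|intros s; apply is_derive_dot_const, Hr|ct].
    destruct Hr as [_ [_ [_ [P _]]]]; rewrite <- (P 0), Rplus_0_l; rring.
  - intros s; rewrite HT, fig_T_vec3; symmetry; apply (dot_vec3_E E1 E2 O). }
assert (H := eight_pendulum p Hp kappa0 Hk IX); fold q in H.
split; intros HB.
- apply (stable_figure _ _ _ _ _ _ H E1 E2 O r Hr HT Hu); lra.
- apply (unstable_figure _ _ _ _ _ _ H E1 E2 O r Hr HT Hu); assumption.
Qed.
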